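(* Let $d_{\ell}\in(d^{(\ell)}_{\min},\gamma_X)$. Then \[ r^{(\ell)}(d_{\ell})=\overline{r}^{(\ell)}(d_{\ell})=\frac{1}{2\ell}\log\frac{(\lambda^{(\ell)}_{S,1}+\lambda^{(\ell)}_Q)(\lambda_{S,2}+\lambda^{(\ell)}_Q)^{\ell-1}}{(\lambda^{(\ell)}_Q)^{\ell}} \] if either of the following conditions is satisfied: \begin{enumerate} \item $\rho_S\geq 0$ and \[ (\ell-1)\lambda^2_{X,2}(\lambda^{(\ell)}_{S,1})^2\mu^{(\ell)}(\mu^{(\ell)}-1)+\ell(\lambda^{(\ell)}_{X,1})^2\lambda^2_{S,2}\geq 0, \] where \[ \mu^{(\ell)}=\frac{\lambda_{S,2}-\lambda_{S,2}(\lambda_{S,2}+\lambda^{(\ell)}_Q)^{-1}\lambda_{S,2}}{\lambda^{(\ell)}_{S,1}-\lambda^{(\ell)}_{S,1}(\lambda^{(\ell)}_{S,1}+\lambda^{(\ell)}_Q)^{-1}\lambda^{(\ell)}_{S,1}}; \] \item $\rho_S\leq 0$ and \[ (\lambda^{(\ell)}_{X,1})^2\lambda^2_{S,2}\nu^{(\ell)}(\nu^{(\ell)}-1)+\ell\lambda^2_{X,2}(\lambda^{(\ell)}_{S,1})^2\geq 0, \] where \[ \nu^{(\ell)}=\frac{\lambda^{(\ell)}_{S,1}-\lambda^{(\ell)}_{S,1}(\lambda^{(\ell)}_{S,1}+\lambda^{(\ell)}_Q)^{-1}\lambda^{(\ell)}_{S,1}}{\lambda_{S,2}-\lambda_{S,2}(\lambda_{S,2}+\lambda^{(\ell)}_Q)^{-1}\lambda_{S,2}}.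 \] \end{enumerate}
   Context: Fix an integer $\ell\geq 2$. Let $X=(X_1,\dots,X_\ell)^T$ (target signals) and $Z=(Z_1,\dots,Z_\ell)^T$ (noises) be mutually independent zero-mean Gaussian random vectors, and $S=X+Z$ (observed sources). $\Gamma_X$ is the $\ell\times\ell$ covariance matrix of $X$ with all diagonal entries $\gamma_X$ and all off-diagonal entries $\rho_X\gamma_X$; $\Gamma_Z$ likewise with $\gamma_Z,\rho_Z$; and $\Gamma_S=\Gamma_X+\Gamma_Z$ has diagonal entries $\gamma_S$ and off-diagonal entries $\rho_S\gamma_S$. These matrices are assumed positive semidefinite, and $\gamma_X>0$. For $j\in\{1,\dots,\ell\}$ set $\lambda^{(j)}_{X,1}=(1+(j-1)\rho_X)\gamma_X$, $\lambda_{X,2}=(1-\rho_X)\gamma_X$, $\lambda^{(j)}_{Z,1}=(1+(j-1)\rho_Z)\gamma_Z$, $\lambda_{Z,2}=(1-\rho_Z)\gamma_Z$, $\lambda^{(j)}_{S,1}=(1+(j-1)\rho_S)\gamma_S$, $\lambda_{S,2}=(1-\rho_S)\gamma_S$. Let $\{(X(t),Z(t),S(t))\}_{t\ge1}$ be i.i.d. with each $(X(t),Z(t),S(t))$ distributed as $(X,Z,S)$; write $S_i^n=(S_i(1),\dots,S_i(n))$. Logarithms are natural. Achievable region: for $k\in\{1,\dots,\ell\}$, a tuple $(r,d_k,\dots,d_\ell)$ is achievable if for every $\epsilon>0$ there exist $n$ and encoding functions $\phi^{(n)}_i:\mathbb{R}^n\to\mathcal{C}^{(n)}_i$ (finite sets),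 $i=1,\dots,\ell$, such that $\frac{1}{kn}\sum_{i\in\mathcal{A}}\log|\mathcal{C}^{(n)}_i|\le r+\epsilon$ for every $\mathcal{A}\subseteq\{1,\dots,\ell\}$ with $|\mathcal{A}|=k$, and $\frac{1}{|\mathcal{A}|n}\sum_{i\in\mathcal{A}}\sum_{t=1}^n\mathbb{E}[(X_i(t)-\hat X_{i,\mathcal{A}}(t))^2]\le d_{|\mathcal{A}|}+\epsilon$ for every $\mathcal{A}\subseteq\{1,\dots,\ell\}$ with $|\mathcal{A}|\ge k$, where $\hat X_{i,\mathcal{A}}(t)=\mathbb{E}[X_i(t)\mid(\phi^{(n)}_{i'}(S^n_{i'}))_{i'\in\mathcal{A}}]$. The set of achievable tuples is $\mathcal{RD}_k$. Define $r^{(\ell)}(d_\ell)=\min\{r:(r,d_\ell)\in\mathcal{RD}_\ell\}$. For $j\in\{1,\dots,\ell\}$: $d^{(j)}_{\min}=\frac1j d^{(j)}_{\min,1}+\frac{j-1}{j}d_{\min,2}$, where $d^{(j)}_{\min,1}=0$ if $\lambda^{(j)}_{S,1}=0$ and $=\lambda^{(j)}_{X,1}\lambda^{(j)}_{Z,1}/\lambda^{(j)}_{S,1}$ otherwise, and $d_{\min,2}=0$ if $\lambda_{S,2}=0$ and $=\lambda_{X,2}\lambda_{Z,2}/\lambda_{S,2}$ otherwise (this equals $\frac1j\sum_{i=1}^j\mathbb{E}[(X_i-\mathbb{E}[X_i|S_1,\dots,S_j])^2]$). For $k\in\{1,\dots,\ell\}$ and $d_k\in(d^{(k)}_{\min},\gamma_X)$,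 $\lambda^{(k)}_Q$ is the unique positive number satisfying \[ \frac{\lambda^{(k)}_{X,1}(\lambda^{(k)}_{Z,1}+\lambda^{(k)}_Q)}{k(\lambda^{(k)}_{S,1}+\lambda^{(k)}_Q)}+\frac{(k-1)\lambda_{X,2}(\lambda_{Z,2}+\lambda^{(k)}_Q)}{k(\lambda_{S,2}+\lambda^{(k)}_Q)}=d_k, \] and $\overline{r}^{(k)}(d_k)=\frac{1}{2k}\log\frac{(\lambda^{(k)}_{S,1}+\lambda^{(k)}_Q)(\lambda_{S,2}+\lambda^{(k)}_Q)^{k-1}}{(\lambda^{(k)}_Q)^k}$. *)

(* Defs.v *)
From HB Require Import structures.
From mathcomp Require Import all_boot all_order all_algebra.
From mathcomp Require Import all_classical all_reals all_analysis.
Set Implicit Arguments. Unset Strict Implicit. Unset Printing Implicit Defensive.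
Import Order.TTheory GRing.Theory Num.Theory.
Local Open Scope ring_scope.
Local Open Scope classical_set_scope.

Section Defs.
Variable R : realType.

Definition eqcov (l : nat) (g rho : R) (i j : 'I_l) : R :=
  if i == j then g else rho * g.

Definition psd_eqcov (l : nat) (g rho : R) : Prop :=
  forall v : 'I_l -> R, 0 <= \sum_(i < l) \sum_(j < l) v i * v j * eqcov g rho i j.

(* Gamma_S = Gamma_X + Gamma_Z : diagonal gammaS, off-diagonal rhoS * gammaS *)
Definition gammaS (gX gZ : R) : R := gX + gZ.
Definition rhoS (gX rX gZ rZ : R) : R := (rX * gX + rZ * gZ) / (gX + gZ).

(* eigenvalues lambda^{(j)}_{.,1} and lambda_{.,2} *)
Definition lam1 (j : nat) (g rho : R) : R := (1 + (j.-1)%:R * rho) * g.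
Definition lam2 (g rho : R) : R := (1 - rho) * g.

Definition dmin_part (lX lZ lS : R) : R := if lS == 0 then 0 else lX * lZ / lS.

Definition dmin (j : nat) (gX rX gZ rZ : R) : R :=
  let gS := gammaS gX gZ in let rS := rhoS gX rX gZ rZ in
  (j%:R)^-1 * dmin_part (lam1 j gX rX) (lam1 j gZ rZ) (lam1 j gS rS)
  + (j.-1)%:R / j%:R * dmin_part (lam2 gX rX) (lam2 gZ rZ) (lam2 gS rS).

(* left-hand side of the equation defining lambda^{(k)}_Q *)
Definition distQ (k : nat) (gX rX gZ rZ q : R) : R :=
  let gS := gammaS gX gZ in let rS := rhoS gX rX gZ rZ in
  lam1 k gX rX * (lam1 k gZ rZ + q) / (k%:R * (lam1 k gS rS + q))
  + (k.-1)%:R * lam2 gX rX * (lam2 gZ rZ + q) / (k%:R * (lam2 gS rS + q)).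

Definition rbar (k : nat) (gX rX gZ rZ q : R) : R :=
  let gS := gammaS gX gZ in let rS := rhoS gX rX gZ rZ in
  ((2 * k)%:R)^-1 *
    ln ((lam1 k gS rS + q) * (lam2 gS rS + q) ^+ k.-1 / q ^+ k).

Definition centered_gaussian d (T : measurableType d) (P : probability T R)
    (Y : T -> R) (v : R) : Prop :=
  measurable_fun setT Y /\
  forall A : set R, measurable A ->
    P (Y @^-1` A) = (if v == 0 then \d_(0 : R) A else normal_prob 0 (Num.sqrt v) A).

(* (X(t), Z(t))_{t} i.i.d., X(t) and Z(t) independent zero-mean Gaussian
   vectors with covariances Gamma_X, Gamma_Z : stated as joint Gaussianity of the
   whole family with the corresponding covariance structure. *)
Definition gauss_source d (T : measurableType d) (P : probability T R) (l : nat)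
    (X Z : nat -> 'I_l -> T -> R) (gX rX gZ rZ : R) : Prop :=
  forall (n : nat) (a b : 'I_n -> 'I_l -> R),
    centered_gaussian P
      (fun w => \sum_(t < n) \sum_(i < l) (a t i * X t i w + b t i * Z t i w))
      (\sum_(t < n) \sum_(i < l) \sum_(j < l)
         (a t i * a t j * eqcov gX rX i j + b t i * b t j * eqcov gZ rZ i j)).

Definition borelRn (n : nat) : set (set ('I_n -> R)) :=
  <<s [set C | exists (j : 'I_n) (B : set R), measurable B /\
                 C = (fun s : 'I_n -> R => s j) @^-1` B] >>.

Definition Sblock (l n : nat) T (X Z : nat -> 'I_l -> T -> R) (i : 'I_l) (w : T)
  : 'I_n -> R := fun t => X t i w + Z t i w.
Arguments Sblock {l} n {T} X Z i w _.

Definition cell d (T : measurableType d) (l n : nat) (M : 'I_l -> nat)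
    (phi : forall i : 'I_l, ('I_n -> R) -> 'I_(M i))
    (X Z : nat -> 'I_l -> T -> R) (A : {set 'I_l}) (w : T) : set T :=
  [set w' | forall i, i \in A ->
     phi i (Sblock n X Z i w') = phi i (Sblock n X Z i w)].

(* hat X_{i,A}(t) = E[X_i(t) | (phi_{i'}(S^n_{i'}))_{i' in A}] : conditional
   expectation given a finite-valued random variable (elementary version) *)
Definition Xhat d (T : measurableType d) (P : probability T R) (l n : nat)
    (M : 'I_l -> nat) (phi : forall i : 'I_l, ('I_n -> R) -> 'I_(M i))
    (X Z : nat -> 'I_l -> T -> R) (A : {set 'I_l}) (t : nat) (i : 'I_l) (w : T) : R :=
  let C := cell phi X Z A w in
  fine (\int[P]_(w' in C) (X t i w')%:E)%E / fine (P C).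

Definition mse d (T : measurableType d) (P : probability T R) (l n : nat)
    (M : 'I_l -> nat) (phi : forall i : 'I_l, ('I_n -> R) -> 'I_(M i))
    (X Z : nat -> 'I_l -> T -> R) (A : {set 'I_l}) (t : nat) (i : 'I_l) : \bar R :=
  (\int[P]_w ((X t i w - Xhat P phi X Z A t i w) ^+ 2)%:E)%E.

(* (r, d_k, ..., d_l) in RD_k ; the distortions are given as dd : nat -> R,
   only dd k, ..., dd l are used *)
Definition achievable d (T : measurableType d) (P : probability T R) (l : nat)
    (X Z : nat -> 'I_l -> T -> R) (k : nat) (r : R) (dd : nat -> R) : Prop :=
  forall eps : R, 0 < eps ->
  exists (n : nat) (M : 'I_l -> nat) (phi : forall i : 'I_l, ('I_n -> R) -> 'I_(M i)),
    [/\ (0 < n)%N,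
        (forall (i : 'I_l) (c : 'I_(M i)), borelRn [set s | phi i s = c]),
        (forall A : {set 'I_l}, #|A| = k ->
            ((k * n)%:R)^-1 * \sum_(i in A) ln ((M i)%:R) <= r + eps)
      & (forall A : {set 'I_l}, (k <= #|A|)%N ->
            ((((#|A| * n)%:R)^-1)%:E *
              \sum_(i in A) \sum_(t < n) mse P phi X Z A t i
             <= (dd #|A| + eps)%:E)%E)].

End Defs.

(* Main.v *)
Require Import Defs.
From HB Require Import structures.
From mathcomp Require Import all_boot all_order all_algebra.
From mathcomp Require Import all_classical all_reals all_analysis.
From mathcomp Require Import measurable_realfun ring lra.
Import Order.TTheory GRing.Theory Num.Theory.
Import numFieldNormedType.Exports.
Local Open Scope ring_scope.
Local Open Scope classical_set_scope.
Set Implicit Arguments.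
Unset Strict Implicit.
Unset Printing Implicit Defensive.

(** Rotating the [l] sources by an orthogonal matrix [H] with constant first row diagonalizes the
    three covariance matrices, with eigenvalues [lam1 l] (once) and [lam2] ([l - 1] times).

    Converse. Let [lam] be the smaller eigenvalue of [Gamma_S].  After rotation
    [S_k = sig_k xi_k + sqrt lam zeta'_k], where [xi] and [zeta] are white and [zeta' = H zeta];
    given [xi], the encoders see independent inputs [zeta_i].  Replacing the standard Gaussian
    density by one of another precision, centred at an estimate that depends on the codeword,
    gives a likelihood ratio of mean 1 for each fixed codeword; summing over the codewords bounds
    the logarithm of their number from below by the quadratic errors made in estimating [xi] and
    the [zeta_i].  As the [zeta_i] are estimated from separate messages, their errors add up in
    every direction [k].  Both kinds of errors are controlled by the error on [S]; the condition
    of the theorem is exactly what makes nonnegative the weights [eta] of the directions for which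
    the resulting bound depends on the total distortion alone.

    Achievability. The test channel is [U_i = S_i + sqrt q G_i] with [G] white, finely quantized.
    Encoders and decoder share exponential clocks indexed by (block, message): encoder [i] sends
    the message of the winner of the race run at the rates [kernel(block | S_i) / M_i], and the
    decoder finds the blocks one encoder after the other, as the winners, among the clocks of the
    received message, of the race run at the rates [Q_i] predicted from the blocks already found.
    The two winners differ with probability at most [E (k / (k + M_i Q_i))], which vanishes as
    soon as the rate exceeds [E (ln (k / Q_i))], that is [ln (v_i / q) / 2] where [v_i] is the
    variance of [U_i] given [U_1, ..., U_(i-1)].  The product of the [v_i] is the determinant of
    [Gamma_S + q], whence the rate [rbar]; averaging over the clocks gives a deterministic code. *)

(** * Expectation *)

(** The source is known only through the laws of its linear combinations. Independence, vanishing
    means and the splitting of [S] are therefore all obtained by exhibiting another Gaussian vector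
    with the same covariance, and uniqueness of the law of a vector comes first. Likelihood ratios
    replace differential entropies: they only involve integrals against explicit Gaussian densities.
    The precisions used in the converse, [(lS k + q) / (lam + q)] for [xi] and [(lam + q) / q] for
    [zeta], are the posterior precisions in the test channel, of [xi] given the output and of [zeta]
    given [xi] and the output. Their product [(lS k + q) / q] is the share of direction [k] in the
    rate, so the bound is tight at the test channel. For achievability, races reduce joint
    typicality to one scalar log-likelihood ratio per encoder, and quantization keeps every alphabet
    finite. The quantizer and the truncation level depend on one-letter laws alone, so they are
    fixed before the block length. The channel noise is manufactured from the source itself and made
    independent of it by working on [P \x P]. *)

Notation mble f := (measurable_fun setT f) (only parsing).

Section Expectation.
Context {d : measure_display} {T : measurableType d} {R : realType}.
Variable P : probability T R.
Implicit Types f g : T -> R.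

(** Real-valued: an infinite integral is read as 0, so linearity and monotonicity go together with
    integrability [ig]. *)
Definition Ex f : R := (\int[P]_w f w)%R.
Definition ig f : Prop := P.-integrable setT (EFin \o f).

Lemma ig_mble f : ig f -> mble f.
Proof. by move=> /integrableP[/measurable_EFinP]. Qed.

Lemma EFin_Ex f : ig f -> (Ex f)%:E = (\int[P]_w (f w)%:E)%E.
Proof. by move=> If; rewrite /Ex /Rintegral fineK//; exact: integrable_fin_num. Qed.

Lemma eq_Ex f g : f =1 g -> Ex f = Ex g.
Proof. by move=> /funext ->. Qed.

Lemma eq_ig f g : f =1 g -> ig f -> ig g.
Proof. by move=> /funext ->. Qed.

Lemma ig_le f g : mble f -> (forall w, `|f w| <= g w) -> ig g -> ig f.
Proof.
move=> mf fg; apply: le_integrable => //; first exact/measurable_EFinP.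
by move=> x _ /=; rewrite lee_fin (le_trans (fg x))// ler_norm.
Qed.

Lemma ig_cst c : ig (fun=> c).
Proof. exact: finite_measure_integrable_cst. Qed.

Lemma ig_bnd f c : mble f -> (forall w, `|f w| <= c) -> ig f.
Proof. by move=> mf fc; apply: (ig_le mf fc); exact: ig_cst. Qed.

Lemma igD f g : ig f -> ig g -> ig (fun w => f w + g w).
Proof. by move=> If Ig; apply: eq_integrable (integrableD _ If Ig). Qed.

Lemma igZ c f : ig f -> ig (fun w => c * f w).
Proof. by move=> If; apply: eq_integrable (integrableZl _ c If). Qed.

Lemma igN f : ig f -> ig (fun w => - f w).
Proof. by move=> If; apply: eq_ig (igZ (-1) If) => w; rewrite mulN1r. Qed.

Lemma igB f g : ig f -> ig g -> ig (fun w => f w - g w).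
Proof. by move=> If Ig; apply: igD => //; exact: igN. Qed.

Lemma ig_sum I (s : seq I) (p : pred I) (F : I -> T -> R) :
  (forall i, p i -> ig (F i)) -> ig (fun w => \sum_(i <- s | p i) F i w).
Proof.
move=> IF; elim: s => [|i s IH].
  by apply: eq_ig (ig_cst 0) => w; rewrite big_nil.
have [pi|npi] := boolP (p i).
  by apply: eq_ig (igD (IF _ pi) IH) => w; rewrite big_cons pi.
by apply: eq_ig IH => w; rewrite big_cons (negbTE npi).
Qed.

Lemma ig_abs f : ig f -> ig (fun w => `|f w|).
Proof. by move=> If; exact: integrable_norm. Qed.

Lemma Ex_cst c : Ex (fun=> c) = c.
Proof. transitivity (c * fine (P setT)); first exact: Rintegral_cst.
by rewrite probability_setT mulr1. Qed.

Lemma ExD f g : ig f -> ig g -> Ex (fun w => f w + g w) = Ex f + Ex g.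
Proof. by move=> If Ig; rewrite /Ex RintegralD. Qed.

Lemma ExZ c f : ig f -> Ex (fun w => c * f w) = c * Ex f.
Proof. by move=> If; rewrite /Ex RintegralZl. Qed.

Lemma ExN f : ig f -> Ex (fun w => - f w) = - Ex f.
Proof. by move=> If; rewrite -mulN1r -ExZ//; apply: eq_Ex => w; rewrite mulN1r. Qed.

Lemma ExB f g : ig f -> ig g -> Ex (fun w => f w - g w) = Ex f - Ex g.
Proof. by move=> If Ig; rewrite ExD ?ExN//; exact: igN. Qed.

Lemma Ex_sum I (s : seq I) (p : pred I) (F : I -> T -> R) :
  (forall i, p i -> ig (F i)) ->
  Ex (fun w => \sum_(i <- s | p i) F i w) = \sum_(i <- s | p i) Ex (F i).
Proof.
move=> IF; elim: s => [|i s IH].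
  by rewrite big_nil -[RHS](Ex_cst 0); apply: eq_Ex => w; rewrite big_nil.
rewrite big_cons; have [pi|npi] := boolP (p i).
  rewrite -IH -ExD; [|exact: IF|exact: ig_sum].
  by apply: eq_Ex => w; rewrite big_cons pi.
by rewrite -IH; apply: eq_Ex => w; rewrite big_cons (negbTE npi).
Qed.

Lemma Ex_ge0 f : (forall w, 0 <= f w) -> 0 <= Ex f.
Proof. by move=> f0; apply: Rintegral_ge0. Qed.

Lemma Ex_le f g : ig f -> ig g -> (forall w, f w <= g w) -> Ex f <= Ex g.
Proof. by move=> If Ig fg; apply: le_Rintegral. Qed.

Lemma Ex_indic A : measurable A -> Ex (\1_A) = fine (P A).
Proof. by move=> mA; rewrite /Ex /Rintegral integral_indic// setIT. Qed.

Lemma ge0_igP f c : mble f -> (forall w, 0 <= f w) ->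
  (\int[P]_w (f w)%:E = c%:E)%E -> ig f /\ Ex f = c.
Proof.
move=> mf f0 fc; split; last by rewrite /Ex /Rintegral fc.
apply/integrableP; split; first exact/measurable_EFinP.
rewrite (eq_integral (fun w => (f w)%:E)) ?fc ?ltry// => w _ /=.
by rewrite ger0_norm.
Qed.

Definition L2 f := mble f /\ ig (fun w => f w ^+ 2).

Lemma L2_mble f : L2 f -> mble f. Proof. by case. Qed.
Lemma L2_sqr f : L2 f -> ig (fun w => f w ^+ 2). Proof. by case. Qed.

Lemma L2_mul f g : L2 f -> L2 g -> ig (fun w => f w * g w).
Proof.
move=> [mf If] [mg Ig]; apply: (ig_le _ _ (igD If Ig)).
  exact: measurable_funM.
move=> w; rewrite ler_norml.
have h1 := sqr_ge0 (f w + g w); have h2 := sqr_ge0 (f w - g w).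
by apply/andP; split; nra.
Qed.

Lemma eq_L2 f g : f =1 g -> L2 f -> L2 g.
Proof. by move=> /funext ->. Qed.

Lemma L2_bnd f c : mble f -> (forall w, `|f w| <= c) -> L2 f.
Proof.
move=> mf fc; split => //; apply: (@ig_bnd _ (c ^+ 2)).
  exact: measurable_funX.
by move=> w; rewrite normrX lerXn2r// nnegrE (le_trans _ (fc w)).
Qed.

Lemma L2_cst c : L2 (fun=> c).
Proof. by apply: (@L2_bnd _ `|c|). Qed.

Lemma L2_ig f : L2 f -> ig f.
Proof.
move=> Lf; apply: eq_ig (L2_mul Lf (L2_cst 1)) => w; by rewrite mulr1.
Qed.

Lemma L2D f g : L2 f -> L2 g -> L2 (fun w => f w + g w).
Proof.
move=> Lf Lg; split; first by apply: measurable_funD; exact: L2_mble.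
apply: eq_ig (igD (igD (L2_sqr Lf) (L2_sqr Lg)) (igZ 2 (L2_mul Lf Lg))) => w.
by ring.
Qed.

Lemma L2Z c f : L2 f -> L2 (fun w => c * f w).
Proof.
move=> Lf; split; first by apply: measurable_funM => //; exact: L2_mble.
by apply: eq_ig (igZ (c ^+ 2) (L2_sqr Lf)) => w; rewrite exprMn.
Qed.

Lemma L2B f g : L2 f -> L2 g -> L2 (fun w => f w - g w).
Proof.
move=> Lf Lg; apply: eq_L2 (L2D Lf (L2Z (-1) Lg)) => w; by rewrite mulN1r.
Qed.

Lemma L2_sum I (s : seq I) (p : pred I) (F : I -> T -> R) :
  (forall i, p i -> L2 (F i)) -> L2 (fun w => \sum_(i <- s | p i) F i w).
Proof.
move=> IF; elim: s => [|i s IH].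
  by apply: eq_L2 (L2_cst 0) => w; rewrite big_nil.
have [pi|npi] := boolP (p i).
  by apply: eq_L2 (L2D (IF _ pi) IH) => w; rewrite big_cons pi.
by apply: eq_L2 IH => w; rewrite big_cons (negbTE npi).
Qed.

Lemma L2_le f g : mble f -> (forall w, `|f w| <= `|g w|) -> L2 g -> L2 f.
Proof.
move=> mf fg Lg; split => //; apply: (ig_le _ _ (L2_sqr Lg)).
  exact: measurable_funX.
by move=> w; rewrite normrX -(real_normK (num_real (g w))) lerXn2r// nnegrE.
Qed.

Lemma L2_bndM f g c : mble f -> (forall w, `|f w| <= c) -> L2 g ->
  L2 (fun w => f w * g w).
Proof.
move=> mf fc Lg; apply: (L2_le _ _ (L2Z c Lg)).
  by apply: measurable_funM => //; exact: L2_mble.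
move=> w; rewrite !normrM ler_wpM2r// (le_trans (fc w))// ler_norm//.
Qed.

Lemma ig_bndM f g c : mble f -> (forall w, `|f w| <= c) -> ig g ->
  ig (fun w => f w * g w).
Proof.
move=> mf fc Ig; apply: (ig_le _ _ (igZ c (ig_abs Ig))).
  by apply: measurable_funM => //; exact: ig_mble.
by move=> w; rewrite normrM ler_wpM2r.
Qed.

End Expectation.

(** * Transfer of expectations between variables of equal law *)

Section SameLaw.
Context {R : realType} {d d' e : measure_display} {T : measurableType d}
  {T' : measurableType d'} {V : measurableType e}.
Variables (P : probability T R) (P' : probability T' R).

Definition same_law (Y : T -> V) (Y' : T' -> V) :=
  forall B, measurable B -> P (Y @^-1` B) = P' (Y' @^-1` B).

Variables (Y : T -> V) (Y' : T' -> V).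
Hypotheses (mY : mble Y) (mY' : mble Y') (YY' : same_law Y Y').

Lemma same_law_integral (f : V -> \bar R) : mble f -> (forall v, 0 <= f v)%E ->
  (\int[P]_w f (Y w) = \int[P']_w f (Y' w))%E.
Proof.
move=> mf f0.
have := @ge0_integral_pushforward _ _ _ _ _ _ mY P _ f measurableT mf (fun v _ => f0 v).
have := @ge0_integral_pushforward _ _ _ _ _ _ mY' P' _ f measurableT mf (fun v _ => f0 v).
rewrite !preimage_setT /comp => <- <-.
by apply: eq_measure_integral => A mA _; exact: YY'.
Qed.

Lemma same_law_ig (f : V -> R) : mble f ->
  ig P (f \o Y) -> ig P' (f \o Y').
Proof.
move=> mf /integrableP[_ fI]; apply/integrableP; split.
  by apply/measurable_EFinP; exact: measurableT_comp.
rewrite -(@same_law_integral (fun v => `|(f v)%:E|)%E)//.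
by apply: measurableT_comp => //; exact/measurable_EFinP.
Qed.

Lemma same_law_Ex (f : V -> R) : mble f -> Ex P (f \o Y) = Ex P' (f \o Y').
Proof.
move=> mf; rewrite /Ex /Rintegral; congr fine; rewrite [LHS]integralE [RHS]integralE.
have mfE : mble (EFin \o f) by exact/measurable_EFinP.
have h1 := @same_law_integral (fun v => (EFin \o f)^\+ v)%E (measurable_funepos mfE)
  (funepos_ge0 _).
have h2 := @same_law_integral (fun v => (EFin \o f)^\- v)%E (measurable_funeneg mfE)
  (funeneg_ge0 _).
transitivity (\int[P]_w (EFin \o f)^\+ (Y w) - \int[P]_w (EFin \o f)^\- (Y w))%E.
  by congr adde; [|congr oppe]; apply: eq_integral => w _; rewrite ?funeposE ?funenegE.
rewrite h1 h2.
by congr adde; [|congr oppe]; apply: eq_integral => w _; rewrite ?funeposE ?funenegE.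
Qed.

End SameLaw.

(** * Expectations on a product space *)

Section Product.
Context {R : realType} {d1 d2 : measure_display} {T1 : measurableType d1}
  {T2 : measurableType d2}.
Variables (P1 : probability T1 R) (P2 : probability T2 R).
Let PP : probability _ R := (P1 \x P2)%E.

(** Every section is asked to be integrable, not almost every one, so that the inner real-valued
    expectation agrees everywhere with the extended integral. *)
Lemma Ex_fubini (F : T1 * T2 -> R) : ig PP F ->
  (forall x, ig P2 (fun y => F (x, y))) ->
  Ex PP F = Ex P1 (fun x => Ex P2 (fun y => F (x, y))).
Proof.
move=> IF I2; rewrite /Ex /Rintegral; congr fine.
rewrite -[LHS](@integral12_prod_meas1 _ _ _ _ _ P1 P2 (EFin \o F))//.
by apply: eq_integral => x _; rewrite /fubini_F/= -EFin_Ex.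
Qed.

Lemma Ex_fubini' (F : T1 * T2 -> R) : ig PP F ->
  (forall y, ig P1 (fun x => F (x, y))) ->
  Ex PP F = Ex P2 (fun y => Ex P1 (fun x => F (x, y))).
Proof.
move=> IF I1; rewrite /Ex /Rintegral; congr fine.
rewrite -[LHS](@integral21_prod_meas1 _ _ _ _ _ P1 P2 (EFin \o F))//.
by apply: eq_integral => x _; rewrite /fubini_G/= -EFin_Ex.
Qed.

Lemma mble_section (F : T1 * T2 -> R) x : mble F -> mble (fun y => F (x, y)).
Proof. by move=> mF; apply: (measurableT_comp mF); exact: pair1_measurable. Qed.

Lemma mble_section' (F : T1 * T2 -> R) y : mble F -> mble (fun x => F (x, y)).
Proof. by move=> mF; apply: (measurableT_comp mF); exact: pair2_measurable. Qed.

Lemma ig_fubini (F : T1 * T2 -> R) : ig PP F ->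
  (forall x, ig P2 (fun y => F (x, y))) -> ig P1 (fun x => Ex P2 (fun y => F (x, y))).
Proof.
move=> IF I2; have := integrable_fubini_F IF.
by apply: eq_integrable => // x _; rewrite /fubini_F/= -EFin_Ex.
Qed.

Lemma ig_tonelli (F : T1 * T2 -> R) : mble F -> (forall w, 0 <= F w) ->
  (forall x, ig P2 (fun y => F (x, y))) ->
  ig P1 (fun x => Ex P2 (fun y => F (x, y))) -> ig PP F.
Proof.
move=> mF F0 I2 I1; apply/(@integrable12ltyP _ _ _ _ _ P1 P2).
  exact/measurable_EFinP.
have := I1 => /integrableP[_]; apply: le_lt_trans.
rewrite le_eqVlt; apply/orP; left; apply/eqP; apply: eq_integral => x _.
rewrite /= ger0_norm ?Ex_ge0// EFin_Ex//.
by apply: eq_integral => y _; rewrite /= ger0_norm.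
Qed.

Lemma mble_tonelli (F : T1 * T2 -> R) : mble F -> (forall w, 0 <= F w) ->
  mble (fun x => Ex P2 (fun y => F (x, y))).
Proof.
move=> mF F0.
have := @measurable_fun_fubini_tonelli_F _ _ _ _ _ P2 (EFin \o F) _ (fun w => F0 w).
rewrite /fubini_F => h; apply: (measurableT_comp (fine_measurable _)) => //.
by apply: h; exact/measurable_EFinP.
Qed.

Lemma ig_fst f : ig P1 f -> ig PP (fun w => f w.1).
Proof.
move=> If; have mf1 : mble (fun w : T1 * T2 => f w.1).
  by apply: (measurableT_comp (ig_mble If)); exact: measurable_fst.
apply: (ig_le mf1 (fun w => lexx _)).
apply: ig_tonelli => //=.
- exact: measurableT_comp.
- by move=> x; exact: ig_cst.
- by under eq_fun do rewrite Ex_cst; exact: ig_abs.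
Qed.

Lemma ig_snd f : ig P2 f -> ig PP (fun w => f w.2).
Proof.
move=> If; have mf1 : mble (fun w : T1 * T2 => f w.2).
  by apply: (measurableT_comp (ig_mble If)); exact: measurable_snd.
apply: (ig_le mf1 (fun w => lexx _)).
apply: ig_tonelli => //=.
- exact: measurableT_comp.
- by move=> x; exact: ig_abs.
- exact: ig_cst.
Qed.

Lemma Ex_fst f : ig P1 f -> Ex PP (fun w => f w.1) = Ex P1 f.
Proof.
move=> If; rewrite (Ex_fubini (ig_fst If) (fun x => ig_cst P2 (f x))).
by apply: eq_Ex => x /=; rewrite Ex_cst.
Qed.

Lemma ig_prod f g : ig P1 f -> ig P2 g -> ig PP (fun w => f w.1 * g w.2).
Proof.
move=> If Ig.
have mf1 : mble (fun w : T1 * T2 => f w.1).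
  by apply: (measurableT_comp (ig_mble If)); exact: measurable_fst.
have mg2 : mble (fun w : T1 * T2 => g w.2).
  by apply: (measurableT_comp (ig_mble Ig)); exact: measurable_snd.
have mfg := measurable_funM mf1 mg2.
apply: (ig_le mfg (fun w => lexx _)).
apply: ig_tonelli => //=.
- exact: (measurableT_comp (@normr_measurable _ _)).
- by move=> x; under eq_fun do rewrite normrM; apply: igZ; exact: ig_abs.
- under eq_fun => x.
    rewrite (_ : (fun y => _) = (fun y => `|f x| * `|g y|)); last first.
      by apply/funext => y; rewrite normrM.
    rewrite ExZ; last exact: ig_abs.
    rewrite mulrC.
    over.
  by apply: igZ; exact: ig_abs.
Qed.

Lemma Ex_prod f g : ig P1 f -> ig P2 g ->
  Ex PP (fun w => f w.1 * g w.2) = Ex P1 f * Ex P2 g.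
Proof.
move=> If Ig; rewrite (Ex_fubini (ig_prod If Ig) (fun x => igZ (f x) Ig)).
rewrite mulrC -ExZ//; apply: eq_Ex => x /=; rewrite ExZ// mulrC//.
Qed.

End Product.

(** * Uniqueness of the law of a vector *)

Section DCT.
Context {d : measure_display} {T : measurableType d} {R : realType}.
Variable P : probability T R.

Lemma Ex_dct (f_ : nat -> T -> R) (f g : T -> R) :
  (forall n, mble (f_ n)) -> mble f -> (forall w, f_ ^~ w @ \oo --> f w) ->
  ig P g -> (forall n w, `|f_ n w| <= g w) ->
  Ex P (f_ n) @[n --> \oo] --> Ex P f.
Proof.
move=> mf_ mf cf Ig fg.
have [||||| If _ h] := @dominated_convergence _ _ _ P setT measurableT
  (fun n => EFin \o f_ n) (EFin \o f) (EFin \o g).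
- by move=> n; exact/measurable_EFinP.
- exact/measurable_EFinP.
- by apply/aeW => w _; apply/fine_cvgP; split; [exact: nearW|exact: cf].
- exact: Ig.
- by apply/aeW => w n _; rewrite /= lee_fin.
apply: fine_cvg.
by rewrite EFin_Ex.
Qed.

(** An equality of expectations valid for each value of a parameter [x] survives averaging over [x].
    This is the step from cosines to the Cauchy kernel, and from the Cauchy kernel to differences of
    [atan]. *)
Lemma Ex_swap {d' d2 : measure_display} {T' : measurableType d'} {X : measurableType d2}
  (P' : probability T' R) (Q : probability X R)
  (h : T -> R) (h' : T' -> R) (y : T -> R) (y' : T' -> R) (g : X * R -> R) (c : R)
  (b : X -> R) :
  mble h -> mble h' -> mble y -> mble y' -> mble g ->
  (forall w, `|h w| <= c) -> (forall w, `|h' w| <= c) ->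
  (forall x z, `|g (x, z)| <= b x) -> ig Q b ->
  (forall x, Ex P (fun w => h w * g (x, y w)) = Ex P' (fun w => h' w * g (x, y' w))) ->
  Ex P (fun w => h w * Ex Q (fun x => g (x, y w))) =
  Ex P' (fun w => h' w * Ex Q (fun x => g (x, y' w))).
Proof.
suff key : forall dd (S : measurableType dd) (PS : probability S R) (k z : S -> R),
    mble k -> mble z -> mble g -> (forall w, `|k w| <= c) ->
    (forall x z, `|g (x, z)| <= b x) -> ig Q b ->
    Ex PS (fun w => k w * Ex Q (fun x => g (x, z w))) =
    Ex Q (fun x => Ex PS (fun w => k w * g (x, z w))).
  move=> mh mh' my my' mg hc h'c gc Ib E.
  rewrite (key _ _ P h y)// (key _ _ P' h' y')//.
  by apply: eq_Ex => x; exact: E.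
move=> dd S PS k z mk mz mg kc gc Ib.
pose F (p : S * X) : R := k p.1 * g (p.2, z p.1).
have mF : mble F.
  apply: measurable_funM; first exact: (measurableT_comp mk measurable_fst).
  apply: measurableT_comp mg _; apply/measurable_fun_pairP; split => /=.
    exact: measurable_snd.
  exact: measurableT_comp mz measurable_fst.
have bF p : `|F p| <= c * b p.2 by rewrite normrM ler_pM.
have I1 : ig (PS \x Q)%E F.
  by apply: ig_le mF bF _; exact: (ig_snd PS (igZ c Ib)).
have mg1 w : mble (fun x => g (x, z w)).
  by apply: measurableT_comp mg _; exact: pair2_measurable.
have I2 w : ig Q (fun x => F (w, x)).
  apply: (ig_le _ _ (igZ c Ib)) => [|x]; first exact: mble_section.
  exact: (bF (w, x)).
have I3 x : ig PS (fun w => F (w, x)).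
  apply: (@ig_bnd _ _ _ _ _ (c * b x)) => [|w]; first exact: mble_section'.
  exact: (bF (w, x)).
transitivity (Ex (PS \x Q)%E F); last by rewrite Ex_fubini'.
rewrite Ex_fubini//; apply: eq_Ex => w; rewrite /F/= ExZ//.
exact: (ig_le _ _ Ib).
Qed.

End DCT.

(** * Explicit integrals over a segment *)

Section OneDim.
Context {R : realType}.

Lemma measurable_cos : mble (@cos R).
Proof. by exact: (continuous_measurable_fun (@continuous_cos R)). Qed.

Lemma measurable_atan : mble (@atan R).
Proof. by exact: (continuous_measurable_fun (@continuous_atan R)). Qed.

Lemma norm_cos_le1 (x : R) : `|cos x| <= 1.
Proof. by rewrite ler_norml cos_geN1 cos_le1. Qed.

Lemma norm_sin_le1 (x : R) : `|sin x| <= 1.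
Proof. by rewrite ler_norml sin_geN1 sin_le1. Qed.

Lemma ig_uniform (a b : R) (ab : a < b) (f : R -> R) :
  continuous f -> ig (uniform_prob ab) f.
Proof.
move=> cf; have mf : mble f by exact: continuous_measurable_fun.
apply/integrableP; split; first exact/measurable_EFinP.
rewrite integral_uniform//; last exact/measurableT_comp/measurable_EFinP.
have : lebesgue_measure.-integrable `[a, b] (EFin \o f).
  apply: continuous_compact_integrable; first exact: segment_compact.
  exact: continuous_subspaceT.
move=> /integrableP[_ h]; rewrite lte_mul_pinfty// lee_fin invr_ge0 subr_ge0.
exact: ltW.
Qed.

(** Integrals over segments are written as uniform expectations so that the product lemmas for
    probabilities apply to them. *)
Lemma Ex_uniform (a b : R) (ab : a < b) (f F : R -> R) :
  continuous f -> (forall x : R, is_derive x 1 F (f x)) ->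
  Ex (uniform_prob ab) f = (b - a)^-1 * (F b - F a).
Proof.
move=> cf dF.
have mf : mble f by exact: continuous_measurable_fun.
have mfE : mble (EFin \o f) by exact/measurable_EFinP.
have If : lebesgue_measure.-integrable `[a, b] (EFin \o f).
  apply: continuous_compact_integrable; first exact: segment_compact.
  exact: continuous_subspaceT.
have cF1 (x : R) : {for x, continuous F}.
  by apply: differentiable_continuous; apply/derivable1_diffP; case: (dF x).
rewrite /Ex /Rintegral integralE integral_uniform//; last exact: measurable_funepos.
rewrite integral_uniform//; last exact: measurable_funeneg.
rewrite -muleBr//; last exact: integrable_add_def.
rewrite -integralE (@continuous_FTC2 _ f F)//.
- exact: continuous_subspaceT.
- split; [by move=> x _; case: (dF x)| |].
    by apply: cvg_at_right_filter; exact: cF1.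
  by apply: cvg_at_left_filter; exact: cF1.
- by move=> x _; rewrite derive1E; case: (dF x).
Qed.

Lemma continuous_expN : continuous (fun t : R => expR (- t)).
Proof.
move=> t; apply: continuous_comp; last exact: continuous_expR.
exact: opp_continuous.
Qed.

Lemma Ex_exp_cos (N z : R) (N0 : 0 < N) :
  Ex (uniform_prob N0) (fun t => N * (expR (- t) * cos (t * z))) =
  (1 + z ^+ 2)^-1 * (1 + expR (- N) * (z * sin (N * z) - cos (N * z))).
Proof.
have z1 : 1 + z ^+ 2 != 0 by rewrite gt_eqF// ltr_pwDl// sqr_ge0.
have cc : continuous (fun t : R => cos (t * z)).
  move=> t; apply: continuous_comp; last exact: continuous_cos.
  by apply: cvgM; [exact: cvg_id|exact: cvg_cst].
pose f := (fun t : R => expR (- t) * cos (t * z)).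
have cf : continuous f by move=> t; apply: cvgM; [exact: continuous_expN|exact: cc].
have If : ig (uniform_prob N0) f.
  exact: ig_uniform.
have dF (t : R) : is_derive t 1 (fun t => expR (- t) * (z * sin (t * z) - cos (t * z)))
   ((1 + z ^+ 2) * f t).
  have d1 : is_derive t 1 (fun t => expR (- t)) (- expR (- t)).
    have := is_derive1_comp (is_derive_expR (- t)) (is_deriveN (is_derive_id t 1)).
    by rewrite mulrN1.
  have dz : is_derive t 1 (fun t : R => t * z) z.
    have := is_deriveM (is_derive_id t 1) (is_derive_cst z t 1).
    by rewrite scaler0 add0r scaler1.
  have d2 : is_derive t 1 (fun t => sin (t * z)) (cos (t * z) * z).
    exact: (@is_derive1_comp _ _ (fun t : R => t * z) t _ _ (is_derive_sin (t * z)) dz).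
  have d3 : is_derive t 1 (fun t => cos (t * z)) (- sin (t * z) * z).
    exact: (@is_derive1_comp _ _ (fun t : R => t * z) t _ _ (is_derive_cos (t * z)) dz).
  have d4 := is_deriveM d1 (is_deriveB (is_deriveZ z d2) d3).
  have e4 : (z \*: (fun t : R => sin (t * z)) - (fun t : R => cos (t * z))) t =
      z * sin (t * z) - cos (t * z) by [].
  by apply: is_derive_eq d4 _; rewrite e4 /f /GRing.scale /=; ring.
have cf1 : continuous (fun t => (1 + z ^+ 2) * f t).
  by move=> t; apply: cvgM; [exact: cvg_cst|exact: cf].
have := @Ex_uniform _ _ N0 _ _ cf1 dF; rewrite !ExZ// => E.
transitivity (N * Ex (uniform_prob N0) f); first by [].
rewrite -[Ex (uniform_prob N0) f](mulKf z1) E.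
by rewrite oppr0 expR0 mul0r sin0 cos0; field; rewrite z1 gt_eqF.
Qed.

Lemma Ex_cauchy (a b tau y : R) (ab : a < b) :
  Ex (uniform_prob ab) (fun x => tau / (1 + (tau * (x - y)) ^+ 2)) =
  (b - a)^-1 * (atan (tau * (b - y)) - atan (tau * (a - y))).
Proof.
apply: (@Ex_uniform _ _ ab _ (fun x => atan (tau * (x - y)))).
  move=> x; apply: cvgM; first exact: cvg_cst.
  apply: cvgV; first by rewrite gt_eqF// ltr_pwDl// sqr_ge0.
  apply: cvgD; first exact: cvg_cst.
  have c1 : {for x, continuous (fun x => tau * (x - y))}.
    apply: cvgM; first exact: cvg_cst.
    by apply: cvgB; [exact: cvg_id|exact: cvg_cst].
  exact: (cvgM c1 c1).
move=> x.
have d1 : is_derive x 1 (fun x => tau * (x - y)) tau.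
  have := is_deriveZ tau (is_deriveB (is_derive_id x 1) (is_derive_cst y x 1)).
  by rewrite subr0 scaler1.
have := @is_derive1_comp _ _ (fun x => tau * (x - y)) x _ _ (is_derive1_atan _) d1.
by rewrite mulrC.
Qed.

End OneDim.

(** * Uniqueness in dimension one, with a bounded weight *)

Section Uniqueness1.
Context {R : realType} {d d' : measure_display} {T : measurableType d}
  {T' : measurableType d'}.
Variables (P : probability T R) (P' : probability T' R).
Variables (h : T -> R) (h' : T' -> R) (y : T -> R) (y' : T' -> R) (c : R).
Hypotheses (mh : mble h) (mh' : mble h') (my : mble y) (my' : mble y').
Hypotheses (hc : forall w, `|h w| <= c) (hc' : forall w, `|h' w| <= c).
Hypothesis E_cos : forall a b, Ex P (fun w => h w * cos (a * y w + b)) =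
  Ex P' (fun w => h' w * cos (a * y' w + b)).

Let mkk (k : R -> R) : continuous k -> mble k.
Proof. exact: continuous_measurable_fun. Qed.

(* [GN N u] is the integral of [exp (- t) * cos (t * u)] over [[0, N]]; it tends to the Cauchy kernel,
   whose primitive [atan], once rescaled, approximates step functions. *)
Let GN (N u : R) := (1 + u ^+ 2)^-1 * (1 + expR (- N) * (u * sin (N * u) - cos (N * u))).

Let E_GN (N tau x : R) : 0 < N -> Ex P (fun w => h w * GN N (tau * (x - y w))) =
  Ex P' (fun w => h' w * GN N (tau * (x - y' w))).
Proof.
move=> N0.
have k1 (z : R) : GN N (tau * (x - z)) = Ex (uniform_prob N0)
   (fun t => N * (expR (- t) * cos (t * (tau * (x - z))))) by rewrite Ex_exp_cos.
transitivity (Ex P (fun w => h w * Ex (uniform_prob N0)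
   (fun t => N * (expR (- t) * cos (t * (tau * (x - y w))))))).
  by apply: eq_Ex => w; rewrite k1.
transitivity (Ex P' (fun w => h' w * Ex (uniform_prob N0)
   (fun t => N * (expR (- t) * cos (t * (tau * (x - y' w))))))); last first.
  by apply: eq_Ex => w; rewrite k1.
have mexp : mble (fun t : R => expR (- t)) by apply: mkk; exact: continuous_expN.
apply: (@Ex_swap _ _ _ P _ _ _ _ P' (uniform_prob N0) h h' y y'
  (fun p => N * (expR (- p.1) * cos (p.1 * (tau * (x - p.2))))) c
  (fun t => N * expR (- t))) => //.
- apply: measurable_funM => //; apply: measurable_funM.
    exact: (measurableT_comp mexp measurable_fst).
  apply: (measurableT_comp measurable_cos).
  apply: measurable_funM; first exact: measurable_fst.
  apply: measurable_funM => //; apply: measurable_funB => //.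
- move=> t z; rewrite !normrM (gtr0_norm N0) ler_pM2l//.
  by rewrite (gtr0_norm (expR_gt0 _)) ler_piMr ?expR_ge0// norm_cos_le1.
- apply: (@ig_uniform _ _ _ N0) => t; apply: cvgM; first exact: cvg_cst.
  exact: continuous_expN.
- move=> t /=.
  transitivity (N * expR (- t) * Ex P (fun w => h w * cos (- (t * tau) * y w + t * tau * x))).
    rewrite -ExZ; last first.
      apply: (@ig_bnd _ _ _ _ _ c).
        apply: measurable_funM => //; apply: (measurableT_comp measurable_cos).
        by apply: measurable_funD => //; apply: measurable_funM.
      by move=> w; rewrite normrM -[leRHS]mulr1 ler_pM// norm_cos_le1.
    apply: eq_Ex => w; rewrite (_ : - (t * tau) * y w + t * tau * x = t * (tau * (x - y w))).
      by ring.
    by ring.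
  rewrite E_cos -ExZ; last first.
    apply: (@ig_bnd _ _ _ _ _ c).
      apply: measurable_funM => //; apply: (measurableT_comp measurable_cos).
      by apply: measurable_funD => //; apply: measurable_funM.
    by move=> w; rewrite normrM -[leRHS]mulr1 ler_pM// norm_cos_le1.
  apply: eq_Ex => w; rewrite (_ : - (t * tau) * y' w + t * tau * x = t * (tau * (x - y' w))).
    by ring.
  by ring.
Qed.

Let inv_bnd (u : R) : `|(1 + u ^+ 2)^-1| <= 1.
Proof.
have u2 := sqr_ge0 u; rewrite ger0_norm ?invr_ge0 ?addr_ge0//.
by rewrite invf_le1 ?ltr_pwDl// lerDl.
Qed.

Let igc {dd} {S : measurableType dd} (PS : probability S R) (k z : S -> R) (g : R -> R) (c' : R) :
  mble k -> mble z -> mble g -> (forall w, `|k w| <= c) -> (forall u, `|g u| <= c') ->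
  ig PS (fun w => k w * g (z w)).
Proof.
move=> mk mz mg kc gc; apply: (@ig_bnd _ _ _ _ _ (c * c')).
  by apply: measurable_funM => //; exact: measurableT_comp.
by move=> w; rewrite normrM ler_pM.
Qed.

(** Uniform in [N] and [u]: the constant that dominates the limit in [N]. *)
Let GN_bnd (N u : R) : 0 < N -> `|GN N u| <= 3.
Proof.
move=> N0; have u1 : 0 < 1 + u ^+ 2 by rewrite ltr_pwDl// sqr_ge0.
rewrite /GN normrM normfV (gtr0_norm u1) ler_pdivrMl//.
have e1 : expR (- N) <= 1 by rewrite -[leRHS]expR0 ler_expR oppr_le0 ltW.
have e0 := expR_ge0 (- N).
have s1 := norm_sin_le1 (N * u); have c1 := norm_cos_le1 (N * u).
apply: (le_trans (ler_normD _ _)); rewrite normr1 normrM (ger0_norm e0).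
have h1 : `|u * sin (N * u) - cos (N * u)| <= `|u| + 1.
  apply: (le_trans (ler_normB _ _)); apply: lerD => //.
  by rewrite normrM ler_piMr.
have h2 : expR (- N) * `|u * sin (N * u) - cos (N * u)| <= `|u| + 1.
  by apply: le_trans h1; rewrite ler_piMl.
have h3 := sqr_ge0 (`|u| - 1).
rewrite -(real_normK (num_real u)); nra.
Qed.

Let GN_cvg u : GN n.+1%:R u @[n --> \oo] --> (1 + u ^+ 2)^-1.
Proof.
have u1 : 0 < 1 + u ^+ 2 by rewrite ltr_pwDl// sqr_ge0.
have cE : expR (- (n.+1%:R : R)) @[n --> \oo] --> (0 : R).
  have := @cvgr_expR R => /cvg_pinftyP/(_ (fun n => n.+1%:R)); apply.
  by have := @cvgr_idn R; rewrite -cvg_shiftS.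
rewrite -[X in _ --> X](addr0 _); apply/cvgrPdist_le => e e0.
have e1 : 0 < e / (`|u| + 1) * (1 + u ^+ 2) by rewrite mulr_gt0// divr_gt0// ltr_wpDl.
move/cvgrPdist_le : cE => /(_ _ e1); apply: filterS => n.
rewrite sub0r normrN addr0 => hn.
rewrite /GN mulrDr mulr1 opprD addrA subrr sub0r normrN normrM.
rewrite normfV (gtr0_norm u1) ler_pdivrMl// [leRHS]mulrC normrM.
have h1 : `|u * sin (n.+1%:R * u) - cos (n.+1%:R * u)| <= `|u| + 1.
  apply: (le_trans (ler_normB _ _)); apply: lerD; last exact: norm_cos_le1.
  by rewrite normrM ler_piMr// norm_sin_le1.
apply: (le_trans (ler_pM _ _ hn h1)) => //.
by rewrite mulrAC divfK// gt_eqF// ltr_wpDl.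
Qed.

Let m_inv : mble (fun u : R => (1 + u ^+ 2)^-1).
Proof.
apply: mkk => u; apply: cvgV; first by rewrite gt_eqF// ltr_pwDl// sqr_ge0.
by apply: cvgD; [exact: cvg_cst|exact: exprn_continuous].
Qed.

Let m_GN N : mble (GN N).
Proof.
apply: measurable_funM => //; apply: measurable_funD => //.
apply: measurable_funM => //; apply: measurable_funB.
  apply: measurable_funM => //; apply: mkk => u.
  apply: (@continuous_comp _ _ _ (fun u => N * u) sin); last exact: continuous_sin.
  by apply: cvgM; [exact: cvg_cst|exact: cvg_id].
apply: mkk => u.
apply: (@continuous_comp _ _ _ (fun u => N * u) cos); last exact: continuous_cos.
by apply: cvgM; [exact: cvg_cst|exact: cvg_id].
Qed.

Let E_cauchy (tau x : R) :
  Ex P (fun w => h w * (1 + (tau * (x - y w)) ^+ 2)^-1) =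
  Ex P' (fun w => h' w * (1 + (tau * (x - y' w)) ^+ 2)^-1).
Proof.
have key dd (S : measurableType dd) (PS : probability S R) (k z : S -> R) :
   mble k -> mble z -> (forall w, `|k w| <= c) ->
   Ex PS (fun w => k w * GN n.+1%:R (tau * (x - z w))) @[n --> \oo] -->
   Ex PS (fun w => k w * (1 + (tau * (x - z w)) ^+ 2)^-1).
  move=> mk mz kc.
  have mz' : mble (fun w => tau * (x - z w)).
    by apply: measurable_funM => //; exact: measurable_funB.
  apply: (@Ex_dct _ _ _ PS _ _ (fun=> c * 3)).
  - by move=> n; apply: measurable_funM => //; exact: (measurableT_comp (m_GN _)).
  - by apply: measurable_funM => //; exact: (measurableT_comp m_inv).
  - by move=> w; apply: cvgM; [exact: cvg_cst|exact: GN_cvg].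
  - exact: ig_cst.
  - by move=> n w; rewrite normrM ler_pM// GN_bnd.
have k1 := key _ _ P h y mh my hc; have k2 := key _ _ P' h' y' mh' my' hc'.
have e : (fun n => Ex P (fun w => h w * GN n.+1%:R (tau * (x - y w)))) =
    (fun n => Ex P' (fun w => h' w * GN n.+1%:R (tau * (x - y' w)))).
  by apply/funext => n; exact: E_GN.
rewrite e in k1; exact: (cvg_unique (@norm_hausdorff _ R^o) k1 k2).
Qed.

Let E_atan (tau a b : R) : a < b -> 0 < tau ->
  Ex P (fun w => h w * (atan (tau * (b - y w)) - atan (tau * (a - y w)))) =
  Ex P' (fun w => h' w * (atan (tau * (b - y' w)) - atan (tau * (a - y' w)))).
Proof.
move=> ab tau0.
have ba : 0 < b - a by rewrite subr_gt0.
have k1 z : atan (tau * (b - z)) - atan (tau * (a - z)) =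
   (b - a) * Ex (uniform_prob ab) (fun x => tau / (1 + (tau * (x - z)) ^+ 2)).
  by rewrite Ex_cauchy mulrA divff ?gt_eqF// mul1r.
under eq_Ex do rewrite k1 mulrCA.
under [RHS]eq_Ex do rewrite k1 mulrCA.
have bG (u : R) : `|tau / (1 + u ^+ 2)| <= tau.
  by rewrite normrM gtr0_norm// ler_piMr ?inv_bnd// ltW.
have mg : mble (fun p : R * R => tau / (1 + (tau * (p.1 - p.2)) ^+ 2)).
  apply: measurable_funM => //; apply: (measurableT_comp m_inv).
  by apply: measurable_funM => //; apply: measurable_funB.
have kk dd (S : measurableType dd) (PS : probability S R) (k z : S -> R) :
   mble k -> mble z -> (forall w, `|k w| <= c) ->
   ig PS (fun w => k w * Ex (uniform_prob ab) (fun x => tau / (1 + (tau * (x - z w)) ^+ 2))).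
  move=> mk mz kc; under eq_fun do rewrite Ex_cauchy.
  apply: (@ig_bnd _ _ _ _ _ (c * ((b - a)^-1 * (pi + pi)))).
    apply: measurable_funM => //; apply: measurable_funM => //.
    by apply: measurable_funB; apply: (measurableT_comp measurable_atan);
      apply: measurable_funM => //; exact: measurable_funB.
  move=> w; rewrite normrM ler_pM// normrM gtr0_norm ?invr_gt0// ler_pM2l ?invr_gt0//.
  have at1 (u : R) : `|atan u| <= pi.
    have := atan_gtNpi2 u; have := atan_ltpi2 u; have := @pi_gt0 R.
    by rewrite ler_norml; lra.
  by apply: (le_trans (ler_normB _ _)); apply: lerD.
rewrite !ExZ//; try exact: kk.
congr (_ * _).
apply: (@Ex_swap _ _ _ P _ _ _ _ P' (uniform_prob ab) h h' y y'
  (fun p => tau / (1 + (tau * (p.1 - p.2)) ^+ 2)) c (fun=> tau)) => //.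
- exact: ig_cst.
- move=> x /=.
  under eq_Ex do rewrite mulrCA; under [RHS]eq_Ex do rewrite mulrCA.
  rewrite !ExZ ?E_cauchy//.
  + apply: (@igc _ _ P' h' (fun w => tau * (x - y' w)) (fun u => (1 + u ^+ 2)^-1) 1) => //.
    by apply: measurable_funM => //; exact: measurable_funB.
  + apply: (@igc _ _ P h (fun w => tau * (x - y w)) (fun u => (1 + u ^+ 2)^-1) 1) => //.
    by apply: measurable_funM => //; exact: measurable_funB.
Qed.

(** A smoothed indicator of the closed ray up to [b]. The edge is moved right by [1 / N] and the
    slope is [N ^ 2], so at [z = b] the first argument is [N], which still tends to infinity and
    includes the endpoint; the left edge [b - N] escapes to minus infinity. *)
Let atan_step (n : nat) (b z : R) : R :=
  let N := n.+1%:R in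
  atan (N ^+ 2 * (b + N^-1 - z)) - atan (N ^+ 2 * (b - N - z)).

Let cvgy_nat : (n.+1%:R : R) @[n --> \oo] --> +oo.
Proof. by have := @cvgr_idn R; rewrite -cvg_shiftS. Qed.

Let atanNy (u : nat -> R) : (fun n => - u n) @ \oo --> +oo -> 
  atan (u n) @[n --> \oo] --> - (pi / 2).
Proof.
move=> uoo; have /cvgN := cvg_comp _ _ uoo (@cvgy_atan R).
by under [X in X @ _ --> _]eq_fun do rewrite /= atanN opprK.
Qed.

Let atan_step_cvg b z : atan_step n b z @[n --> \oo] --> pi * (z <= b)%R%:R.
Proof.
have c2 : atan (n.+1%:R ^+ 2 * (b - n.+1%:R - z)) @[n --> \oo] --> - (pi / 2 : R).
  apply: atanNy; apply/cvgryPge => A.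
  have /cvgryPge/(_ (1 + `|A| + `|b - z|)) := cvgy_nat; apply: filterS => n hn.
  set N := n.+1%:R in hn *.
  have := ler_norm A; have := ler_norm (b - z); have := normr_ge0 A; have := normr_ge0 (b - z).
  nra.
have [zb|bz] := leP z b.
  rewrite mulr1 (_ : pi = pi / 2 - - (pi / 2)); last by rewrite opprK -splitr.
  apply: cvgB c2; apply: cvg_comp (@cvgy_atan R).
  apply/cvgryPge => A.
  have /cvgryPge/(_ (1 + `|A|)) := cvgy_nat; apply: filterS => n hn.
  set N := n.+1%:R in hn *.
  have N0 : 0 < N by rewrite /N ltr0n.
  rewrite (_ : N ^+ 2 * (b + N^-1 - z) = N ^+ 2 * (b - z) + N); last first.
    by field; rewrite gt_eqF.
  have h0 := ler_norm A; have h1 : 0 <= N ^+ 2 * (b - z).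
    by rewrite mulr_ge0 ?sqr_ge0// subr_ge0.
  lra.
rewrite mulr0 (_ : 0 = - (pi / 2) - - (pi / 2)); last by rewrite subrr.
apply: cvgB c2; apply: atanNy; apply/cvgryPge => A.
have zb0 : 0 < z - b by rewrite subr_gt0.
have /cvgryPge/(_ (1 + (1 + `|A|) / (z - b))) := cvgy_nat; apply: filterS => n hn.
set N := n.+1%:R in hn *.
have N0 : 0 < N by rewrite /N ltr0n.
rewrite (_ : - (N ^+ 2 * (b + N^-1 - z)) = N * (N * (z - b) - 1)); last first.
  by field; rewrite gt_eqF.
have h0 := ler_norm A; have A0 := normr_ge0 A.
have h1 : (1 + `|A|) <= (N - 1) * (z - b) by rewrite -ler_pdivrMr// lerBrDl.
have h2 : 0 <= (1 + `|A|) / (z - b) by apply: divr_ge0; lra.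
nra.
Qed.

Let E_ray b : Ex P (fun w => h w * (y w <= b)%R%:R) = Ex P' (fun w => h' w * (y' w <= b)%R%:R).
Proof.
have mst dd (S : measurableType dd) (z : S -> R) n :
    mble z -> mble (fun w => atan_step n b (z w)).
  move=> mz; apply: measurable_funB; apply: (measurableT_comp measurable_atan);
    by apply: measurable_funM => //; exact: measurable_funB.
have mle dd (S : measurableType dd) (z : S -> R) :
    mble z -> mble (fun w => (z w <= b)%R%:R : R).
  move=> mz; rewrite (_ : (fun w => _) = \1_`]-oo, b] \o z).
    by apply: measurableT_comp => //; exact: measurable_indic.
  by apply/funext => w /=; rewrite indicE mem_setE in_itv.
have key dd (S : measurableType dd) (PS : probability S R) (k z : S -> R) :
   mble k -> mble z -> (forall w, `|k w| <= c) ->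
   Ex PS (fun w => k w * atan_step n b (z w)) @[n --> \oo] -->
   Ex PS (fun w => k w * (pi * (z w <= b)%R%:R)).
  move=> mk mz kc.
  apply: (@Ex_dct _ _ _ PS _ _ (fun=> c * (pi + pi))).
  - by move=> n; apply: measurable_funM => //; exact: mst.
  - by apply: measurable_funM => //; apply: measurable_funM => //; exact: mle.
  - by move=> w; apply: cvgM; [exact: cvg_cst|exact: atan_step_cvg].
  - exact: ig_cst.
  - move=> n w; rewrite normrM ler_pM//.
    have at1 (u : R) : `|atan u| <= pi.
      have := atan_gtNpi2 u; have := atan_ltpi2 u; have := @pi_gt0 R.
      by rewrite ler_norml; lra.
    by apply: (le_trans (ler_normB _ _)); apply: lerD.
have k1 := key _ _ P h y mh my hc; have k2 := key _ _ P' h' y' mh' my' hc'.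
have e : (fun n => Ex P (fun w => h w * atan_step n b (y w))) =
    (fun n => Ex P' (fun w => h' w * atan_step n b (y' w))).
  apply/funext => n; apply: E_atan; last by rewrite exprn_gt0.
  by rewrite (@lt_trans _ _ b)// ?ltrBlDr ?ltrDl ?invr_gt0.
rewrite e in k1; have : Ex P (fun w => h w * (pi * (y w <= b)%R%:R)) =
    Ex P' (fun w => h' w * (pi * (y' w <= b)%R%:R)).
  exact: (cvg_unique (@norm_hausdorff _ R^o) k1 k2).
have e2 dd (S : measurableType dd) (PS : probability S R) (k z : S -> R) :
   mble k -> mble z -> (forall w, `|k w| <= c) ->
   Ex PS (fun w => k w * (pi * (z w <= b)%R%:R)) = pi * Ex PS (fun w => k w * (z w <= b)%R%:R).
  move=> mk mz kc; rewrite -ExZ; first by apply: eq_Ex => w; rewrite mulrCA.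
  apply: (@ig_bnd _ _ _ _ _ c); first by apply: measurable_funM => //; exact: mle.
  by move=> w; rewrite normrM -[leRHS]mulr1 ler_pM//; case: (z w <= b)%R; rewrite ?normr1 ?normr0.
rewrite !e2// => /mulfI; apply.
by rewrite gt_eqF// pi_gt0.
Qed.

(** The weight will carry the indicators of the coordinates already treated. Since the weighted set
    function may be signed, the Dynkin argument relies on linearity and dominated convergence
    instead of properties of measures. *)
Lemma weighted_law_eq B : measurable B ->
  Ex P (fun w => h w * \1_B (y w)) = Ex P' (fun w => h' w * \1_B (y' w)).
Proof.
have mB1 dd (S : measurableType dd) (z : S -> R) (A : set R) :
    measurable A -> mble z -> mble (fun w => \1_A (z w) : R).
  move=> mA mz; have m1 : mble (\1_A : R -> R) := measurable_indic mA.
  exact: (measurableT_comp m1 mz).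
have ind1 (A : set R) u : `|\1_A u : R| <= 1.
  by rewrite indicE; case: (_ \in _); rewrite ?normr1 ?normr0.
have igi dd (S : measurableType dd) (PS : probability S R) (k z : S -> R) (A : set R) :
    mble k -> mble z -> (forall w, `|k w| <= c) -> measurable A ->
    ig PS (fun w => k w * \1_A (z w)).
  by move=> mk mz kc mA; apply: (@igc _ _ _ _ _ \1_A 1).
(* The cosine of frequency 0 compares the total weights, which complements require. *)
have h0 : Ex P h = Ex P' h'.
  have := E_cos 0 0; under eq_Ex do rewrite mul0r addr0 cos0 mulr1.
  by under [RHS]eq_Ex do rewrite mul0r addr0 cos0 mulr1.
have igh : ig P h by apply: ig_bnd hc.
have igh' : ig P' h' by apply: ig_bnd hc'.
pose PP := [set B : set R | Ex P (fun w => h w * \1_B (y w)) = Ex P' (fun w => h' w * \1_B (y' w))].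
have e2 dd (S : measurableType dd) (PS : probability S R) (k z : S -> R) (A : set R) :
    measurable A -> mble k -> mble z -> (forall w, `|k w| <= c) -> ig PS k ->
    Ex PS (fun w => k w * \1_(~` A) (z w)) = Ex PS k - Ex PS (fun w => k w * \1_A (z w)).
  move=> mA mk mz kc Ik; rewrite -ExB//; last exact: igi.
  apply: eq_Ex => w; rewrite !indicE in_setC; case: (_ \in _) => /=.
    by rewrite mulr0 mulr1 subrr.
  by rewrite mulr0 mulr1 subr0.
move=> mB; suff : PP B by [].
have GE : @measurable _ R = <<s @RGenOInfty.G R >> := RGenOInfty.measurableE R.
apply: (dynkin_induction GE); last by rewrite -GE.
- move=> _ _ [b1 ->] [b2 ->]; exists (Num.max b1 b2).
  by apply/seteqP; split => x /=; rewrite !in_itv/= !andbT ?gt_max; [move=> [-> ->]|move/andP].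
- rewrite /PP/=; under eq_Ex do rewrite indicT mulr1.
  by under [RHS]eq_Ex do rewrite indicT mulr1.
- move=> _ [b ->]; rewrite /PP/= -setCitvl !e2//.
  congr (_ - _) => //.
  have := E_ray b; congr (_ = _); apply: eq_Ex => w; by rewrite indicE mem_setE in_itv.
- by move=> A mA; rewrite /PP/= => EA; rewrite !e2// EA h0.
- move=> F mF tF EF; rewrite /PP/=.
  have e3 (u : R) (n : nat) : (0 : R) <= \sum_(i < n) (\1_(F i) u : R) <= 1 /\
      \sum_(i < n) (\1_(F i) u : R) @[n --> \oo] --> (\1_(\bigcup_k F k) u : R).
    have [[k _ Fku]|nF] := pselect ((\bigcup_k F k) u); last first.
      have s0 m : \sum_(i < m) \1_(F i) u = 0 :> R.
        apply: big1 => i _; rewrite indicE memNset// => Fiu; apply: nF; by exists i.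
      rewrite s0 lexx ler01; split => //.
      rewrite indicE memNset//; apply: cvg_near_cst; apply: nearW => m; exact: s0.
    have s1 m : \sum_(i < m) \1_(F i) u = (k < m)%N%:R :> R.
      have [km|mk] := ltnP k m.
        rewrite (bigD1 (Ordinal km))//= indicE mem_set// big1 ?addr0// => i ik.
        rewrite indicE memNset// => Fiu; move/negP: ik; apply; apply/eqP/val_inj => /=.
        by apply: (tF i k) => //; exists u.
      rewrite big1// => i _; rewrite indicE memNset// => Fiu.
      have ik : i = k :> nat by apply: (tF i k) => //; exists u.
      by have := ltn_ord i; rewrite ik ltnNge mk.
    split; first by rewrite s1; case: (k < n)%N; rewrite ?lexx ?ler01.
    rewrite indicE mem_set; last by exists k.
    apply: cvg_near_cst; exists k.+1 => // m /= km; by rewrite s1 km.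
  have key dd (S : measurableType dd) (PS : probability S R) (k z : S -> R) :
     mble k -> mble z -> (forall w, `|k w| <= c) ->
     (\sum_(i < n) Ex PS (fun w => k w * \1_(F i) (z w))) @[n --> \oo] -->
     Ex PS (fun w => k w * \1_(\bigcup_k F k) (z w)).
    move=> mk mz kc.
    rewrite (_ : (fun n => _) = (fun n => Ex PS (fun w => k w * \sum_(i < n) \1_(F i) (z w)))).
      apply: (@Ex_dct _ _ _ PS _ _ (fun=> c)).
      + move=> n; apply: measurable_funM => //; apply: measurable_sum => i; exact: mB1.
      + by apply: measurable_funM => //; apply: mB1 => //; exact: bigcup_measurable.
      + by move=> w; apply: cvgM; [exact: cvg_cst|exact: (e3 _ 0%N).2].
      + exact: ig_cst.
      + move=> n w; have /andP[g0 g1] := (e3 (z w) n).1.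
        by rewrite normrM -[leRHS]mulr1 ler_pM// ger0_norm.
    apply/funext => n; rewrite -Ex_sum; last by move=> i _; exact: igi.
    by apply: eq_Ex => w; rewrite mulr_sumr.
  have k1 := key _ _ P h y mh my hc; have k2 := key _ _ P' h' y' mh' my' hc'.
  have e : (fun n => \sum_(i < n) Ex P (fun w => h w * \1_(F i) (y w))) =
    (fun n => \sum_(i < n) Ex P' (fun w => h' w * \1_(F i) (y' w))).
    by apply/funext => n; apply: eq_bigr => i _; exact: EF.
  rewrite e in k1; exact: (cvg_unique (@norm_hausdorff _ R^o) k1 k2).
Qed.

End Uniqueness1.

(** * Vectors with the product sigma-algebra *)

Section Vectors.
Context {R : realType} {J : finType}.

Definition cylinders : set (set (J -> R)) :=
  [set C | exists (j : J) (B : set R), measurable B /\ C = (fun s : J -> R => s j) @^-1` B].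

(** The generators have the shape of those of [borelRn], so for [J = 'I_n] a measurable set of
    vectors is the same thing as a set in [borelRn], and the condition on encoders can be used
    directly. *)
Definition vec := g_sigma_algebraType cylinders.

Lemma measurable_coord (j : J) : mble (fun v : vec => v j).
Proof.
move=> _ B mB; rewrite setTI; apply: sub_sigma_algebra.
by exists j, B.
Qed.

Lemma measurable_vecP {d} {T : measurableType d} (Y : T -> J -> R) :
  (forall j, mble (fun w => Y w j)) <-> mble (Y : T -> vec).
Proof.
split=> [mY|mY j]; last by exact: (measurableT_comp (measurable_coord j) mY).
apply: (@measurability _ _ _ vec setT Y cylinders) => //.
move=> _ [_ [j [B [mB ->]]] <-]; have := mY j measurableT B mB.
by [].
Qed.

End Vectors.
Arguments vec R J : clear implicits.

(** * The law of a vector is determined by its linear forms *)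

Section CramerWold.
Context {R : realType} {d d' : measure_display} {T : measurableType d}
  {T' : measurableType d'} {J : finType}.
Variables (P : probability T R) (P' : probability T' R).
Variables (Y : T -> J -> R) (Y' : T' -> J -> R).
Hypotheses (mY : forall j, mble (fun w => Y w j)) (mY' : forall j, mble (fun w => Y' w j)).
Hypothesis lin_law : forall (a : J -> R) B, measurable B ->
  P [set w | B (\sum_j a j * Y w j)] = P' [set w | B (\sum_j a j * Y' w j)].

Let E_cos0 (a : J -> R) b : Ex P (fun w => cos (\sum_j a j * Y w j + b)) =
  Ex P' (fun w => cos (\sum_j a j * Y' w j + b)).
Proof.
have mcb : mble (fun u : R => cos (u + b)).
  by apply: (measurableT_comp measurable_cos); exact: measurable_funD.
have m1 : mble (fun w => \sum_j a j * Y w j).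
  by apply: measurable_sum => j; exact: measurable_funM.
have m2 : mble (fun w => \sum_j a j * Y' w j).
  by apply: measurable_sum => j; exact: measurable_funM.
exact: (same_law_Ex m1 m2 (lin_law a) mcb).
Qed.

Let box (s : seq J) (B : J -> set R) (v : J -> R) : R := \prod_(j <- s) \1_(B j) (v j).

Let box01 s B v : 0 <= box s B v <= 1.
Proof.
have i01 (A : set R) (u : R) : (0 : R) <= (\1_A u : R) <= 1.
  by rewrite indicE; case: (_ \in _); rewrite ?lexx ?ler01.
apply: (big_ind (fun x : R => 0 <= x <= 1)); last by move=> i _; exact: i01.
  by rewrite ler01 lexx.
move=> x1 x2 /andP[? ?] /andP[? ?]; rewrite mulr_ge0//=.
by rewrite -[leRHS]mulr1 ler_pM.
Qed.

Let mbox dd (S : measurableType dd) (Z : S -> J -> R) s B :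
  (forall j, mble (fun w => Z w j)) -> (forall j, measurable (B j)) ->
  mble (fun w => box s B (Z w)).
Proof.
move=> mZ mB; apply: measurable_prod => j _.
exact: (measurableT_comp (measurable_indic (mB j)) (mZ j)).
Qed.

Let cosM (x y : R) : cos x * cos y = 2^-1 * (cos (x + y) + cos (x - y)).
Proof. by rewrite cosD cosB; field. Qed.

(* Induction on [s]: the weight [box s B * (1 + cos _)] is nonnegative, so the one-dimensional
   uniqueness result with that weight adds the indicator of one more coordinate. *)
Let E_box s (B : J -> set R) (a : J -> R) b : (forall j, measurable (B j)) ->
  Ex P (fun w => box s B (Y w) * cos (\sum_j a j * Y w j + b)) =
  Ex P' (fun w => box s B (Y' w) * cos (\sum_j a j * Y' w j + b)).
Proof.
move=> mB; elim: s a b => [|j s IH] a b.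
  under eq_Ex do rewrite /box big_nil mul1r.
  by under [RHS]eq_Ex do rewrite /box big_nil mul1r; exact: E_cos0.
have mlc dd (S : measurableType dd) (Z : S -> J -> R) (a0 : J -> R) b0 :
    (forall j, mble (fun w => Z w j)) -> mble (fun w => cos (\sum_j a0 j * Z w j + b0)).
  move=> mZ; apply: (measurableT_comp measurable_cos); apply: measurable_funD => //.
  by apply: measurable_sum => i; exact: measurable_funM.
have igbc dd (S : measurableType dd) (PS : probability S R) (Z : S -> J -> R) (a0 : J -> R) b0 :
    (forall j, mble (fun w => Z w j)) ->
    ig PS (fun w => box s B (Z w) * cos (\sum_j a0 j * Z w j + b0)).
  move=> mZ; apply: (@ig_bnd _ _ _ _ _ 1).
    by apply: measurable_funM; [exact: mbox|exact: mlc].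
  move=> w; have /andP[z0 z1] := box01 s B (Z w).
  by rewrite normrM -[leRHS]mulr1 ler_pM ?norm_cos_le1// ger0_norm.
have step (a' : J -> R) (b' : R) :
   Ex P (fun w => box s B (Y w) * (1 + cos (\sum_j a' j * Y w j + b')) * \1_(B j) (Y w j)) =
   Ex P' (fun w => box s B (Y' w) * (1 + cos (\sum_j a' j * Y' w j + b')) * \1_(B j) (Y' w j)).
  have bb dd (S : measurableType dd) (Z : S -> J -> R) w :
     `|box s B (Z w) * (1 + cos (\sum_j a' j * Z w j + b'))| <= 1 * 2.
    have /andP[b0 b1] := box01 s B (Z w); rewrite normrM; apply: ler_pM => //.
      by rewrite ger0_norm.
    apply: (le_trans (ler_normD _ _)); rewrite normr1; have := norm_cos_le1 (\sum_j a' j * Z w j + b').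
    by lra.
  apply: (@weighted_law_eq _ _ _ _ _ P P' _ _ (fun w => Y w j) (fun w => Y' w j) (1 * 2)) => //.
  - by apply: measurable_funM; [exact: mbox|apply: measurable_funD => //; exact: mlc].
  - by apply: measurable_funM; [exact: mbox|apply: measurable_funD => //; exact: mlc].
  move=> al be.
  pose e1 (i : J) : R := if i == j then al else 0.
  have lin dd (S : measurableType dd) (Z : S -> J -> R) w (a1 : J -> R) :
     \sum_i (a1 i + e1 i) * Z w i = \sum_i a1 i * Z w i + al * Z w j.
    under eq_bigr do rewrite mulrDl; rewrite big_split/=; congr (_ + _).
    rewrite (bigD1 j)//= /e1 eqxx big1 ?addr0// => i /negbTE ->; by rewrite mul0r.
  have lin' dd (S : measurableType dd) (Z : S -> J -> R) w (a1 : J -> R) :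
     \sum_i (a1 i - e1 i) * Z w i = \sum_i a1 i * Z w i - al * Z w j.
    under eq_bigr do rewrite mulrBl; rewrite sumrB; congr (_ - _).
    rewrite (bigD1 j)//= /e1 eqxx big1 ?addr0// => i /negbTE ->; by rewrite mul0r.
  have lin0 dd (S : measurableType dd) (Z : S -> J -> R) w :
     \sum_i e1 i * Z w i = al * Z w j.
    rewrite (bigD1 j)//= /e1 eqxx big1 ?addr0// => i /negbTE ->; by rewrite mul0r.
  (* The product formula for cosines expands the weighted cosine into three terms without the new
     coordinate's indicator, all covered by the induction hypothesis at shifted frequencies. *)
  have ex dd (S : measurableType dd) (PS : probability S R) (Z : S -> J -> R) :
    (forall j, mble (fun w => Z w j)) ->
    Ex PS (fun w => box s B (Z w) * (1 + cos (\sum_i a' i * Z w i + b')) * cos (al * Z w j + be)) =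
    Ex PS (fun w => box s B (Z w) * cos (\sum_i e1 i * Z w i + be)) +
    2^-1 * (Ex PS (fun w => box s B (Z w) * cos (\sum_i (a' i + e1 i) * Z w i + (b' + be))) +
            Ex PS (fun w => box s B (Z w) * cos (\sum_i (a' i - e1 i) * Z w i + (b' - be)))).
    move=> mZ; rewrite -ExD; [|exact: igbc|exact: igbc].
    rewrite -ExZ; last by apply: igD; exact: igbc.
    rewrite -ExD; [|exact: igbc|by apply: igZ; apply: igD; exact: igbc].
    apply: eq_Ex => w; rewrite lin lin' lin0.
    rewrite -mulrA mulrDl mul1r cosM.
    rewrite (_ : \sum_i a' i * Z w i + b' + (al * Z w j + be) =
      \sum_i a' i * Z w i + al * Z w j + (b' + be)); last by ring.
    rewrite (_ : \sum_i a' i * Z w i + b' - (al * Z w j + be) =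
      \sum_i a' i * Z w i - al * Z w j + (b' - be)); last by ring.
    by ring.
  by rewrite !ex// !IH.
(* At frequency 0 the weight [1 + cos] equals 2; half of that instance is subtracted to leave the
   cosine alone. *)
have ex dd (S : measurableType dd) (PS : probability S R) (Z : S -> J -> R) :
    (forall j, mble (fun w => Z w j)) ->
    Ex PS (fun w => box (j :: s) B (Z w) * cos (\sum_i a i * Z w i + b)) =
    Ex PS (fun w => box s B (Z w) * (1 + cos (\sum_i a i * Z w i + b)) * \1_(B j) (Z w j)) -
    2^-1 * Ex PS (fun w => box s B (Z w) * (1 + cos (\sum_i 0 * Z w i + 0)) * \1_(B j) (Z w j)).
  move=> mZ.
  have igg (a1 : J -> R) b1 : ig PS (fun w => box s B (Z w) * (1 + cos (\sum_i a1 i * Z w i + b1)) * \1_(B j) (Z w j)).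
    apply: (@ig_bnd _ _ _ _ _ (1 * 2 * 1)).
      apply: measurable_funM; last exact: (measurableT_comp (measurable_indic (mB j)) (mZ j)).
      by apply: measurable_funM; [exact: mbox|apply: measurable_funD => //; exact: mlc].
    move=> w; rewrite normrM; apply: ler_pM => //.
      have /andP[b0 b2] := box01 s B (Z w); rewrite normrM; apply: ler_pM => //.
        by rewrite ger0_norm.
      apply: (le_trans (ler_normD _ _)); rewrite normr1.
      by have := norm_cos_le1 (\sum_i a1 i * Z w i + b1); lra.
    by rewrite indicE; case: (_ \in _); rewrite ?normr1 ?normr0.
  rewrite -ExZ; last exact: (igg (fun=> 0) 0).
  rewrite -ExB; [|exact: igg|by apply: igZ; exact: (igg (fun=> 0) 0)].
  apply: eq_Ex => w; have s0 : \sum_i 0 * Z w i = 0 by apply: big1 => i _; rewrite mul0r.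
  rewrite s0 addr0 cos0 /box big_cons.
  by field.
by rewrite !ex// step (step (fun=> 0) 0).
Qed.

Lemma cramer_wold : same_law P P' (Y : T -> vec R J) (Y' : T' -> vec R J).
Proof.
pose boxes := [set [set v : J -> R | forall j, B j (v j)] |
  B in [set B : J -> set R | forall j, measurable (B j)]].
pose PP := [set A : set (vec R J) | P (Y @^-1` A) = P' (Y' @^-1` A)].
have mYv : mble (Y : T -> vec R J) by apply/measurable_vecP.
have mYv' : mble (Y' : T' -> vec R J) by apply/measurable_vecP.
have mpre dd (S : measurableType dd) (Z : S -> vec R J) A :
    mble Z -> measurable A -> measurable (Z @^-1` A).
  by move=> mZ mA; rewrite -[X in measurable X]setTI; exact: mZ.
have GE : @measurable _ (vec R J) = <<s boxes >>.
  apply/seteqP; split.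
    apply: smallest_sub; first exact: smallest_sigma_algebra.
    move=> _ [j [B [mB ->]]]; apply: sub_sigma_algebra.
    exists (fun i => if i == j then B else setT); first by move=> i /=; case: ifP.
    apply/seteqP; split => v /=; first by move=> /(_ j); rewrite eqxx.
    by move=> Bv i; case: eqP => [->|].
  apply: smallest_sub; first exact: smallest_sigma_algebra.
  move=> _ [B mB <-].
  rewrite (_ : [set v | _] = \bigcap_(j in [set: J]) ((fun v : vec R J => v j) @^-1` B j)).
    apply: (@fin_bigcap_measurable _ (vec R J)) => [|j _]; first exact: finite_finset.
    by have := measurable_coord j measurableT (mB j); rewrite setTI.
  by apply/seteqP; split => v /= h j; [move=> _; exact: h|exact: (h j I)].
move=> A mA; suff : PP A by [].
apply: (dynkin_induction GE); last by rewrite -GE.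
- move=> _ _ [B1 m1 <-] [B2 m2 <-]; exists (fun j => B1 j `&` B2 j).
    by move=> j /=; apply: measurableI.
  apply/seteqP; split => v /=; first by move=> h; split => j; have [] := h j.
  by move=> [h1 h2] j; split.
- by rewrite /PP/= !preimage_setT !probability_setT.
- move=> _ [B mB <-]; rewrite /PP/=.
  (* With frequency and phase 0 the cosine is 1, so [E_box] compares the probabilities of boxes. *)
  have ex dd (S : measurableType dd) (PS : probability S R) (Z : S -> J -> R) :
      (forall j, mble (fun w => Z w j)) ->
      PS (Z @^-1` [set v | forall j, B j (v j)]) =
      (Ex PS (fun w => box (enum J) B (Z w) * cos (\sum_j 0 * Z w j + 0)))%:E.
    move=> mZ; have mZv : mble (Z : S -> vec R J) by apply/measurable_vecP.
    have mb : measurable (Z @^-1` [set v | forall j, B j (v j)]).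
      apply: mpre => //; rewrite GE; apply: sub_sigma_algebra.
      by exists B.
    transitivity (Ex PS (\1_(Z @^-1` [set v | forall j, B j (v j)])))%:E.
      by rewrite Ex_indic// fineK// fin_num_measure.
    congr (_%:E); apply: eq_Ex => w.
    have s0 : \sum_i 0 * Z w i = 0 by apply: big1 => i _; rewrite mul0r.
    rewrite s0 addr0 cos0 mulr1 /box indicE.
    have [/set_mem/= h|] := boolP (_ \in _).
      by rewrite big1// => j _; rewrite indicE mem_set//; exact: h.
    rewrite notin_setE/= => /existsNP[j Bj].
    by rewrite (bigD1_seq j) ?mem_enum ?enum_uniq//= indicE memNset ?mul0r.
  by rewrite !ex// E_box.
- move=> S mS; rewrite /PP/= => ES.
  have m1 := mpre _ _ _ _ mYv mS; have m2 := mpre _ _ _ _ mYv' mS.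
  transitivity (1 - P (Y @^-1` S))%E; first by rewrite -(probability_setC P m1).
  by rewrite ES -(probability_setC P' m2).
- move=> F mF tF EF; rewrite /PP/= !preimage_bigcup.
  rewrite !measure_bigcup//=.
  + by apply: eq_eseriesr => i _; exact: EF.
  + by move=> i _; exact: mpre.
  + by move=> i j _ _ [w [wi wj]]; apply: (tF i j) => //; exists (Y' w).
  + by move=> i _; exact: mpre.
  + by move=> i j _ _ [w [wi wj]]; apply: (tF i j) => //; exists (Y w).
Qed.

End CramerWold.

(** * Gaussian variables *)

Section NormalIntegral.
Context {R : realType}.
Local Notation mu := (@lebesgue_measure R).
Import HBNNSimple.

Section density.
Variables (nu : {measure set (measurableTypeR R) -> \bar R}) (p : R -> R).
Hypotheses (mp : mble p) (p0 : forall x, 0 <= p x).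
Hypothesis nuE : forall A, measurable A -> nu A = (\int[mu]_(x in A) (p x)%:E)%E.

Let mpdf : mble (fun x : R => (p x)%:E).
Proof. exact/measurable_EFinP. Qed.

Let indic_case (E : set R) : measurable E ->
  (\int[nu]_x (\1_E x)%:E = \int[mu]_x ((\1_E x)%:E * (p x)%:E))%E.
Proof.
move=> mE; rewrite integral_indic//= setIT nuE// integral_mkcond/=.
apply: eq_integral => x _; rewrite patchE indicE.
by case: ifPn => xE; rewrite ?mul1e ?mul0e.
Qed.

Let nnsfun_case (f : {nnsfun (measurableTypeR R) >-> R}) :
  (\int[nu]_x (f x)%:E = \int[mu]_x ((f x)%:E * (p x)%:E))%E.
Proof.
under [LHS]eq_integral do rewrite fimfunE -fsumEFin//.
rewrite [LHS]ge0_integral_fsum//; last 2 first.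
  - by move=> r; exact/measurable_EFinP/measurableT_comp.
  - by move=> n x _; rewrite EFinM nnfun_muleindic_ge0.
under [RHS]eq_integral.
  move=> x xD; rewrite fimfunE -fsumEFin// muleC ge0_mule_fsumr; last first.
    by move=> r; rewrite EFinM nnfun_muleindic_ge0.
  over.
rewrite [RHS]ge0_integral_fsum//; last 2 first.
  - move=> r; apply: emeasurable_funM => //.
    by apply/measurable_EFinP; do 2 apply/measurableT_comp => //.
  - move=> n x _; rewrite EFinM mule_ge0//; last by rewrite nnfun_muleindic_ge0.
    by rewrite lee_fin.
apply: eq_fsbigr => r rf.
have mr : measurable (f @^-1` [set r]).
  by have := @measurable_funP _ _ _ _ _ f measurableT _ (measurable_set1 r); rewrite setTI.
have r0 : 0 <= r by move: rf; rewrite inE => -[x _ <-]; exact: fun_ge0.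
under [RHS]eq_integral do rewrite EFinM muleCA [X in (_ * X)%E]muleC.
rewrite [RHS]ge0_integralZl//.
- under [LHS]eq_integral do rewrite EFinM.
  rewrite ge0_integralZl//=.
  + by rewrite indic_case.
  + by apply/measurable_EFinP; exact: measurable_indic.
- by apply: emeasurable_funM => //; apply/measurable_EFinP; exact: measurable_indic.
- by move=> x _; rewrite mule_ge0// lee_fin.
Qed.

(** For an arbitrary density: it serves the normal laws and, later, the exponential law of the race
    clocks. *)
Lemma integral_density (f : measurableTypeR R -> \bar R) : mble f -> (forall x, 0 <= f x)%E ->
  (\int[nu]_x f x = \int[mu]_x (f x * (p x)%:E))%E.
Proof.
move=> mf f0.
pose f_ := nnsfun_approx measurableT mf.
transitivity (lim (\int[nu]_x (f_ n x)%:E @[n --> \oo])%E).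
  rewrite -monotone_convergence//=.
  - apply: eq_integral => ? /[!inE] xD; apply/esym/cvg_lim => //=.
    exact: cvg_nnsfun_approx.
  - by move=> n; exact/measurable_EFinP/measurable_funTS.
  - by move=> n ? _; rewrite lee_fin.
  - by move=> ? _ ? ? mn; rewrite lee_fin; exact/lefP/nd_nnsfun_approx.
transitivity (lim (\int[mu]_x ((f_ n x)%:E * (p x)%:E) @[n --> \oo])%E).
  by apply: congr_lim; apply/funext => n /=; exact: nnsfun_case.
rewrite -monotone_convergence//=.
- apply: eq_integral => x _; apply/cvg_lim => //.
  apply: cvgeZr => //; exact: cvg_nnsfun_approx.
- by move=> n; apply: emeasurable_funM => //; exact/measurable_EFinP.
- by move=> n x _; rewrite mule_ge0// lee_fin.
- move=> x _ a b ab; rewrite lee_wpmul2r ?lee_fin//.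
  exact/lefP/nd_nnsfun_approx.
Qed.

End density.

Lemma integral_normal (m s : R) (f : measurableTypeR R -> \bar R) : mble f -> (forall x, 0 <= f x)%E ->
  (\int[normal_prob m s]_x f x = \int[mu]_x (f x * (normal_pdf m s x)%:E))%E.
Proof.
apply: integral_density; first exact: measurable_normal_pdf.
- by move=> x; exact: normal_pdf_ge0.
- by [].
Qed.

Lemma lebesgue_translate (x : R) (f : R -> \bar R) : mble f -> (forall x, 0 <= f x)%E ->
  (\int[mu]_y f (x + y)%R = \int[mu]_y f y)%E.
Proof.
move=> mf f0.
have mp : mble (fun y : measurableTypeR R => (x + y : measurableTypeR R)) by exact: measurable_funD.
have := @ge0_integral_pushforward _ _ _ _ _ _ mp mu setT f measurableT mf (fun v _ => f0 v).
rewrite preimage_setT => <-.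
apply: eq_measure_integral => A mA _.
apply/esym; apply: (@lebesgue_measure_unique _ (pushforward mu (fun y : measurableTypeR R => (x + y : measurableTypeR R)))) => //.
move=> _ [[a b] /= _ <-].
rewrite /pushforward (_ : _ @^-1` _ = `](a - x), (b - x)]%classic).
  rewrite !lebesgue_measure_itv/= !lte_fin ltrD2r; case: ifP => // _.
  by rewrite -!EFinB; congr (_%:E); ring.
by apply/seteqP; split => y /=; rewrite !in_itv/= ltrBlDl lerBrDl.
Qed.

Lemma normal_prob_shift (s x : R) (A : set R) : s != 0 -> measurable A ->
  normal_prob 0 s [set y | A (x + y)%R] = normal_prob x s A.
Proof.
move=> s0 mA; rewrite /normal_prob [LHS]integral_mkcond [RHS]integral_mkcond.
rewrite -[RHS](lebesgue_translate x).
- apply: eq_integral => y _; rewrite !patchE.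
  rewrite (_ : (y \in [set y | A (x + y)%R]) = ((x + y)%R \in A)); last first.
    by apply/idP/idP => /set_mem h; exact/mem_set.
  case: ifP => // _; rewrite !normal_pdfE// /normal_fun.
  by rewrite subr0 (_ : x + y - x = y)//; ring.
- apply/(measurable_restrictT _ mA); apply: measurable_funTS.
  by apply/measurable_EFinP; exact: measurable_normal_pdf.
- by move=> y; rewrite patchE; case: ifP => // _; rewrite lee_fin normal_pdf_ge0.
Qed.

(** Bayes factorization: prior times likelihood is evidence times posterior. Integrating [x] out
    then gives the convolution of two normal laws at once. *)
Lemma normal_pdf_mul (s1 s2 x y : R) : 0 < s1 -> 0 < s2 ->
  let s := Num.sqrt (s1 ^+ 2 + s2 ^+ 2) in
  normal_pdf 0 s1 x * normal_pdf x s2 y =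
  normal_pdf 0 s y * normal_pdf (y * s1 ^+ 2 / s ^+ 2) (s1 * s2 / s) x.
Proof.
move=> s10 s20 s.
have ss : 0 < s1 ^+ 2 + s2 ^+ 2 by rewrite addr_gt0// exprn_gt0.
have sE : s ^+ 2 = s1 ^+ 2 + s2 ^+ 2 by rewrite sqr_sqrtr// ltW.
have s0 : 0 < s by rewrite sqrtr_gt0.
rewrite !normal_pdfE ?gt_eqF// ?divr_gt0 ?mulr_gt0//.
rewrite mulrACA [RHS]mulrACA /normal_fun -!expRD; congr (_ * expR _).
  have pk (u v : R) : 0 <= u -> normal_peak u * normal_peak v = (Num.sqrt ((u ^+ 2 * pi *+ 2) * (v ^+ 2 * pi *+ 2)))^-1.
    by move=> u0; rewrite /normal_peak -invfM sqrtrM// mulrn_wge0// mulr_ge0 ?sqr_ge0 ?pi_ge0.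
  rewrite !pk ?ltW//; congr (Num.sqrt _)^-1.
  rewrite expr_div_n exprMn; field; rewrite gt_eqF//.
rewrite !expr_div_n exprMn sE.
field.
rewrite !gt_eqF//.
Qed.

End NormalIntegral.

Section Gaussian.
Context {R : realType}.
Local Notation mu := (@lebesgue_measure R).

Section one.
Context {d : measure_display} {T : measurableType d}.
Variables (P : probability T R) (Y : T -> R) (v : R).
Hypothesis gY : centered_gaussian P Y v.

Lemma cg_mble : mble Y. Proof. by case: gY. Qed.

Lemma cg_integral (f : R -> \bar R) : 0 < v -> mble f -> (forall x, 0 <= f x)%E ->
  (\int[P]_w f (Y w) = \int[mu]_y (f y * (normal_pdf 0 (Num.sqrt v) y)%:E))%E.
Proof.
move=> v0 mf f0; rewrite -integral_normal//.
have [mY PY] := gY.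
have mY' : measurable_fun setT (Y : T -> measurableTypeR R) := mY.
have := @ge0_integral_pushforward _ _ T (measurableTypeR R) _ Y mY' P setT f measurableT mf (fun v _ => f0 v).
rewrite preimage_setT => <-.
apply: eq_measure_integral => A mA _.
have := PY A mA; rewrite gt_eqF//.
Qed.

(** For variance 0 the law is the Dirac mass at 0, which is also the law of the constant variable
    0. *)
Lemma cg0_ae (f : R -> R) : v = 0 -> mble f -> ig P (f \o Y) /\ Ex P (f \o Y) = f 0.
Proof.
move=> v0 mf; have [mY PY] := gY.
have mY0 : measurable (Y @^-1` [set 0]).
  by rewrite -[X in measurable X]setTI; exact: mY.
have sl : same_law P P Y (fun=> 0).
  move=> A mA; rewrite PY// v0 eqxx /dirac indicE.
  have [/set_mem A0|A0] := boolP (0 \in A).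
    by rewrite preimage_cst mem_set// probability_setT.
  by rewrite preimage_cst (negbTE A0) measure0.
have mc : mble (fun _ : T => 0 : R) by [].
have sl' : same_law P P (fun=> 0 : R) Y by move=> A mA; rewrite sl.
split; first by apply: (same_law_ig mc mY sl' mf); exact: ig_cst.
by rewrite (same_law_Ex mY mc sl mf); exact: Ex_cst.
Qed.

(** The mean of a likelihood ratio is the total mass of the new density. Both the second moment and
    the tilts of mean 1 of the converse come from this identity. *)
Lemma cg_change (b s : R) : 0 < v -> 0 < s ->
  let r y := normal_pdf b s y / normal_pdf 0 (Num.sqrt v) y in
  ig P (r \o Y) /\ Ex P (r \o Y) = 1.
Proof.
move=> v0 s0 r.
have sv0 : Num.sqrt v != 0 by rewrite gt_eqF// sqrtr_gt0.
have p0 y : 0 < normal_pdf 0 (Num.sqrt v) y.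
  by rewrite normal_pdfE// mulr_gt0 ?normal_peak_gt0// expR_gt0.
have mr : mble r.
  apply: measurable_funM; first exact: measurable_normal_pdf.
  apply: continuous_measurable_fun => y; apply: cvgV; first by rewrite gt_eqF.
  exact: continuous_normal_pdf.
have r0 y : 0 <= r y by rewrite divr_ge0 ?normal_pdf_ge0.
apply: ge0_igP => [|w|]; [exact: measurableT_comp cg_mble|exact: r0|].
rewrite (cg_integral (f := EFin \o r))//=.
- rewrite -[RHS](@integral_normal_pdf _ b s).
  by apply: eq_integral => y _; rewrite -EFinM divfK// gt_eqF.
- exact/measurable_EFinP.
Qed.

Lemma cg_exp (u : R) : 0 < v -> 0 < u ->
  let f y := expR ((1 - u ^+ 2) * (y ^+ 2 / v) / 2) in
  ig P (f \o Y) /\ Ex P (f \o Y) = u^-1.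
Proof.
move=> v0 u0 f.
have sv0 : 0 < Num.sqrt v by rewrite sqrtr_gt0.
have [I E] := cg_change 0 v0 (divr_gt0 sv0 u0).
have fE : f \o Y =1 (fun w => u^-1 * (normal_pdf 0 (Num.sqrt v / u) (Y w) / normal_pdf 0 (Num.sqrt v) (Y w))).
  move=> w; rewrite /f /= !normal_pdfE ?gt_eqF ?divr_gt0//.
  rewrite -mulf_div -expRB /normal_fun.
  have -> : normal_peak (Num.sqrt v / u) / normal_peak (Num.sqrt v) = u.
    rewrite /normal_peak invrK !sqr_sqrtr ?ltW// expr_div_n sqr_sqrtr ?ltW//.
    rewrite (_ : v / u ^+ 2 * pi *+ 2 = (v * pi *+ 2) * (u^-1) ^+ 2); last first.
      by field; rewrite gt_eqF.
    rewrite sqrtrM ?mulrn_wge0 ?mulr_ge0 ?pi_ge0 ?ltW// sqrtr_sqr gtr0_norm ?invr_gt0//.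
    rewrite invfM invrK mulrAC mulVf ?mul1r// gt_eqF// sqrtr_gt0 mulrn_wgt0// mulr_gt0 ?pi_gt0//.
  rewrite mulKf ?gt_eqF//; congr expR.
  rewrite expr_div_n !sqr_sqrtr ?ltW// subr0.
  by field; rewrite !gt_eqF.
split; first by apply: eq_ig (igZ u^-1 I) => w; rewrite fE.
by rewrite (eq_Ex _ fE) ExZ// E mulr1.
Qed.

Let small_bound (E : R) : (forall e : R, 0 < e -> e < 2^-1 -> 2 / ((1 + e) * (2 + e)) <= E /\
  E <= 2 / ((1 - e) * (2 - e))) -> E = 1.
Proof.
move=> h; apply/eqP; rewrite eq_le; apply/andP; split; apply/ler_addgt0Pr => e e0.
  pose x := Num.min (e / 6) 4^-1.
  have x0 : 0 < x by rewrite lt_min; apply/andP; split; lra.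
  have x4 : x <= 4^-1 by rewrite ge_min lexx orbT.
  have xe : x <= e / 6 by rewrite ge_min lexx.
  have [_ h2] := h x x0 (ltac:(lra)); apply: (le_trans h2).
  rewrite ler_pdivrMr; last by apply: mulr_gt0; lra.
  nra.
pose x := Num.min (e / 2) 4^-1.
have x0 : 0 < x by rewrite lt_min; apply/andP; split; lra.
have x4 : x <= 4^-1 by rewrite ge_min lexx orbT.
have xe : x <= e / 2 by rewrite ge_min lexx.
have [h2 _] := h x x0 (ltac:(lra)).
have h3 : 1 - 2 * x <= 2 / ((1 + x) * (2 + x)).
  rewrite ler_pdivlMr; last by apply: mulr_gt0; lra.
  nra.
lra.
Qed.

(** No moment integral is computed: [exp x >= 1 + x] applied to the identity of [cg_exp] bounds the
    mean of [Y ^ 2 / v] from above for [u < 1] and from below for [u > 1], and both bounds tend to 1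
    as [u] tends to 1. *)
Lemma cg_moments : 0 <= v ->
  ig P (fun w => Y w ^+ 2) /\ Ex P (fun w => Y w ^+ 2) = v.
Proof.
rewrite le_eqVlt => /predU1P[v0|v0].
  have mX : mble (fun x : R => x ^+ 2) by exact: measurable_funX.
  have [I2 E2] := cg0_ae (esym v0) mX.
  by split => //; rewrite -v0 -[LHS]/(Ex P ((fun x => x ^+ 2) \o Y)) E2 expr0n.
pose W w := Y w ^+ 2 / v.
have W0 w : 0 <= W w by rewrite divr_ge0 ?sqr_ge0// ltW.
have mW : mble W by apply: measurable_funM => //; apply: measurable_funX; exact: cg_mble.
have expW u w : expR ((1 - u ^+ 2) * (Y w ^+ 2 / v) / 2) >= 1 + (1 - u ^+ 2) / 2 * W w.
  by rewrite (mulrAC _ (Y w ^+ 2 / v)) -/(W w); exact: expR_ge1Dx.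
(* Integrability first: at [u = 1 / 2] the slope [(1 - u ^ 2) / 2] is [3 / 8], whence the factor
   [8 / 3]. *)
have [I1 _] := @cg_exp 2^-1 v0 (ltac:(lra)).
have IW : ig P W.
  apply: (ig_le mW _ (igZ (8 / 3) I1)) => w /=.
  have := expW 2^-1 w; rewrite ger0_norm//; lra.
have step u : 0 < u -> 1 + (1 - u ^+ 2) / 2 * Ex P W <= u^-1.
  move=> u0; have [I <-] := @cg_exp u v0 u0.
  rewrite -ExZ// -[X in X + _](Ex_cst P) -ExD; [|exact: ig_cst|exact: igZ].
  apply: Ex_le => //; first by apply: igD; [exact: ig_cst|exact: igZ].
have EW : Ex P W = 1.
  apply: small_bound => e e0 e1; split.
    have := step (1 + e) (ltac:(lra)); rewrite -[X in _ <= X]mul1r ler_pdivlMr; last lra.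
    move=> h; rewrite ler_pdivrMr; last by apply: mulr_gt0; lra.
    have h1 : 0 < e * (e + 2) by apply: mulr_gt0; lra.
    rewrite -(ler_pM2l e0); nra.
  have := step (1 - e) (ltac:(lra)); rewrite -[X in _ <= X]mul1r ler_pdivlMr; last lra.
  move=> h; rewrite ler_pdivlMr; last by apply: mulr_gt0; lra.
  rewrite -(ler_pM2l e0); nra.
have YW w : Y w ^+ 2 = v * W w by rewrite /W mulrC divfK// gt_eqF.
split; first by apply: eq_ig (igZ v IW) => w; rewrite YW.
by rewrite (eq_Ex _ YW) ExZ// EW mulr1.
Qed.

End one.

(** A zero variance has no density and is treated apart on either side. Otherwise the convolution is
    computed with densities, [normal_pdf_mul] allowing one variable to be integrated out. *)
Lemma cg_sum {d1 d2 : measure_display} {T1 : measurableType d1} {T2 : measurableType d2}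
  (P1 : probability T1 R) (P2 : probability T2 R) (Y1 : T1 -> R) (Y2 : T2 -> R) (v1 v2 : R) :
  0 <= v1 -> 0 <= v2 ->
  centered_gaussian P1 Y1 v1 -> centered_gaussian P2 Y2 v2 ->
  centered_gaussian (P1 \x P2)%E (fun w => Y1 w.1 + Y2 w.2) (v1 + v2).
Proof.
move=> v10 v20 g1 g2; have m1 := cg_mble g1; have m2 := cg_mble g2.
have mY1 : mble (fun w : T1 * T2 => Y1 w.1) by exact: (measurableT_comp m1 measurable_fst).
have mY2 : mble (fun w : T1 * T2 => Y2 w.2) by exact: (measurableT_comp m2 measurable_snd).
have mY : mble (fun w : T1 * T2 => Y1 w.1 + Y2 w.2) by exact: measurable_funD.
split => // A mA.
have mi : mble (\1_A : R -> R) := measurable_indic mA.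
have i0 (y : R) : 0 <= (\1_A y : R) by [].
have mS : measurable ((fun w : T1 * T2 => Y1 w.1 + Y2 w.2) @^-1` A).
  by rewrite -[X in measurable X]setTI; exact: mY.
have mI (f : R -> R) : mble f -> measurable (f @^-1` A).
  by move=> mf; rewrite -[X in measurable X]setTI; exact: mf.
have intI dd (S : measurableType dd) (PS : {measure set S -> \bar R}) (f : S -> R) : mble f ->
    (\int[PS]_w (\1_A (f w) : R)%:E)%E = PS (f @^-1` A).
  move=> mf; transitivity (\int[PS]_w (\1_(f @^-1` A) w : R)%:E)%E; first by apply: eq_integral.
  by rewrite integral_indic ?setIT// -[X in measurable X]setTI; exact: mf.
have L : (P1 \x P2)%E ((fun w => Y1 w.1 + Y2 w.2) @^-1` A) =
    (\int[P1]_w1 \int[P2]_w2 (\1_A (Y1 w1 + Y2 w2))%:E)%E.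
  rewrite -intI// fubini_tonelli1//.
  by apply/measurable_EFinP; exact: (measurableT_comp mi mY).
transitivity (\int[P1]_w1 \int[P2]_w2 (\1_A (Y1 w1 + Y2 w2) : R)%:E)%E; first exact: L.
have P2A (x : R) : (\int[P2]_w2 (\1_A (x + Y2 w2) : R)%:E)%E =
    if v2 == 0 then (\1_A x)%:E else normal_prob x (Num.sqrt v2) A.
  rewrite intI; last exact: measurable_funD.
  have [_ /(_ [set y | A (x + y)])] := g2; rewrite /preimage /= => ->; last first.
    by apply: (mI (fun y => x + y)); exact: measurable_funD.
  case: eqP => [v20'|/eqP v20'].
    rewrite /dirac !indicE; congr ((nat_of_bool _)%:R%:E).
    apply/idP/idP => /set_mem/= h; apply/mem_set; first by rewrite addr0 in h.
    by rewrite /= addr0.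
  by rewrite normal_prob_shift// gt_eqF// sqrtr_gt0 lt_def v20' v20.
under eq_integral do rewrite P2A.
have [v20'|v20'] := eqVneq v2 0.
  have [_ E1] := g1; transitivity (P1 (Y1 @^-1` A)); first exact: intI.
  by rewrite v20' addr0 E1.
have v2p : 0 < v2 by rewrite lt_def v20' v20.
have s2p : 0 < Num.sqrt v2 by rewrite sqrtr_gt0.
rewrite gt_eqF ?ltr_wpDl//.
have mk (s : R) : 0 < s -> mble (fun p : R * R => normal_pdf p.1 s p.2).
  move=> s0; under eq_fun do rewrite normal_pdfE ?gt_eqF//.
  apply: measurable_funM => //; apply: (measurableT_comp (@measurable_expR R)).
  apply: measurable_funM => //; apply: measurableT_comp => //.
  by apply: measurable_funX; apply: measurable_funB.
have mkA (s : R) : 0 < s -> mble (fun p : R * R => (normal_pdf p.1 s p.2 * \1_A p.2)%:E).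
  move=> s0; apply/measurable_EFinP; apply: measurable_funM; first exact: mk.
  exact: (measurableT_comp mi measurable_snd).
have npE (s x : R) : normal_prob x s A = (\int[mu]_z (normal_pdf x s z * \1_A z)%:E)%E.
  rewrite /normal_prob integral_mkcond; apply: eq_integral => z _.
  by rewrite patchE indicE; case: ifPn; rewrite ?mulr1 ?mulr0.
have mnp (s : R) : 0 < s -> mble (fun x => normal_prob x s A).
  move=> s0; under eq_fun do rewrite npE.
  apply: (@measurable_fun_fubini_tonelli_F _ _ _ _ _ mu _ (mkA s s0)).
  by move=> p; rewrite lee_fin mulr_ge0// normal_pdf_ge0.
have [v10'|v10'] := eqVneq v1 0.
  have mnp' : mble (fun x => fine (normal_prob x (Num.sqrt v2) A)).
    by apply: (measurableT_comp (fine_measurable _)) => //; exact: mnp.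
  have [I E] := cg0_ae g1 v10' mnp'.
  have nf x : normal_prob x (Num.sqrt v2) A = (fine (normal_prob x (Num.sqrt v2) A))%:E.
    by rewrite fineK// fin_num_measure.
  under eq_integral do rewrite nf.
  by rewrite -[LHS](EFin_Ex I) E -nf v10' add0r.
have v1p : 0 < v1 by rewrite lt_def v10' v10.
have s1p : 0 < Num.sqrt v1 by rewrite sqrtr_gt0.
rewrite (cg_integral g1 (f := fun x => normal_prob x (Num.sqrt v2) A))//; last exact: mnp.
set s := Num.sqrt (v1 + v2).
have sE : s = Num.sqrt (Num.sqrt v1 ^+ 2 + Num.sqrt v2 ^+ 2) by rewrite !sqr_sqrtr.
have s0 : 0 < s by rewrite sqrtr_gt0 addr_gt0.
transitivity (\int[mu]_y \int[mu]_z ((normal_pdf 0 (Num.sqrt v1) y * normal_pdf y (Num.sqrt v2) z) * \1_A z)%:E)%E.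
  apply: eq_integral => y _; rewrite npE -ge0_integralZr//.
  - by apply: eq_integral => z _; rewrite -EFinM; congr EFin; ring.
  - by apply/measurable_EFinP; apply: measurable_funM => //; exact: measurable_normal_pdf.
  - by move=> z _; rewrite lee_fin mulr_ge0// normal_pdf_ge0.
  - by rewrite lee_fin normal_pdf_ge0.
have mF : mble (fun p : R * R => ((normal_pdf 0 (Num.sqrt v1) p.1 * normal_pdf p.1 (Num.sqrt v2) p.2) * \1_A p.2)%:E).
  apply/measurable_EFinP; apply: measurable_funM.
    apply: measurable_funM; last exact: mk.
    by apply: (measurableT_comp (measurable_normal_pdf _ _)).
  exact: (measurableT_comp mi measurable_snd).
rewrite (@fubini_tonelli _ _ _ _ _ mu mu _ mF)/=; last first.
  by move=> p; rewrite lee_fin !mulr_ge0// normal_pdf_ge0.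
rewrite npE; apply: eq_integral => z _.
transitivity (\int[mu]_x ((normal_pdf 0 s z * \1_A z)%:E * (normal_pdf (z * Num.sqrt v1 ^+ 2 / s ^+ 2) (Num.sqrt v1 * Num.sqrt v2 / s) x)%:E))%E.
  apply: eq_integral => x _; rewrite -EFinM; congr EFin.
  by rewrite normal_pdf_mul// -sE; ring.
rewrite ge0_integralZl//.
- by rewrite integral_normal_pdf mule1.
- by apply/measurable_EFinP; exact: measurable_normal_pdf.
- by move=> x _; rewrite lee_fin normal_pdf_ge0.
- by rewrite lee_fin mulr_ge0// normal_pdf_ge0.
Qed.

End Gaussian.

(** * Gaussian vectors *)

Section GaussianVectors.
Context {R : realType}.

Definition quad {J : finType} (K : J -> J -> R) (a : J -> R) : R :=
  \sum_i \sum_j a i * a j * K i j.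

(** Joint Gaussianity through linear forms, so that [K] may be singular. Nonnegativity of the
    quadratic form is included because [centered_gaussian] has its intended meaning only for a
    nonnegative variance. *)
Definition gvec {d} {T : measurableType d} (P : probability T R) {J : finType}
    (Y : T -> J -> R) (K : J -> J -> R) : Prop :=
  forall a : J -> R, 0 <= quad K a /\
    centered_gaussian P (fun w => \sum_j a j * Y w j) (quad K a).

Section basics.
Context {d : measure_display} {T : measurableType d} {J : finType}.
Variables (P : probability T R) (Y : T -> J -> R) (K : J -> J -> R).
Hypothesis gY : gvec P Y K.

Lemma sum_delta (I : finType) (i : I) (F : I -> R) : \sum_j (j == i)%:R * F j = F i.
Proof.
rewrite (bigD1 i)//= eqxx mul1r big1 ?addr0// => j /negbTE ->; by rewrite mul0r.
Qed.

Lemma sum_unit (F : unit -> R) : \sum_j F j = F tt.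
Proof. by rewrite (big_pred1 tt) => // -[]. Qed.

Lemma gvec_eq_quad K' : (forall a, quad K a = quad K' a) -> gvec P Y K'.
Proof. by move=> e a; rewrite -e; exact: gY. Qed.

Lemma gvec_eqK K' : (forall i j, K i j = K' i j) -> gvec P Y K'.
Proof.
move=> e; apply: gvec_eq_quad => a; apply: eq_bigr => i _; apply: eq_bigr => j _.
by rewrite e.
Qed.

Lemma gvec_lin (I : finType) (L : I -> J -> R) :
  gvec P (fun w i => \sum_j L i j * Y w j)
    (fun i i' => \sum_j \sum_j' L i j * L i' j' * K j j').
Proof.
move=> a; pose b j := \sum_i a i * L i j.
have qE : quad (fun i i' => \sum_j \sum_j' L i j * L i' j' * K j j') a = quad K b.
  rewrite /quad /b; under eq_bigr do under eq_bigr do rewrite mulr_sumr.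
  under eq_bigr do rewrite exchange_big/=.
  rewrite exchange_big/=; apply: eq_bigr => j _.
  under eq_bigr do under eq_bigr do rewrite mulr_sumr.
  under eq_bigr do rewrite exchange_big/=.
  rewrite exchange_big/=; apply: eq_bigr => j' _.
  rewrite mulr_suml mulr_suml; apply: eq_bigr => i _.
  rewrite mulr_sumr mulr_suml; apply: eq_bigr => i' _; ring.
have lE w : \sum_i a i * (\sum_j L i j * Y w j) = \sum_j b j * Y w j.
  under eq_bigr do rewrite mulr_sumr.
  rewrite exchange_big/=; apply: eq_bigr => j _; rewrite /b mulr_suml.
  by apply: eq_bigr => i _; rewrite mulrA.
have [q0 cg] := gY b; rewrite qE; split=> //.
by under eq_fun do rewrite lE.
Qed.

Lemma gvec_coord (j : J) : 0 <= K j j /\ centered_gaussian P (fun w => Y w j) (K j j).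
Proof.
have := gY (fun i => (i == j)%:R).
rewrite (_ : quad _ _ = K j j); last first.
  rewrite /quad -[RHS](sum_delta j (fun i => K i j)).
  apply: eq_bigr => i _; rewrite -[K i j](sum_delta j (fun j' => K i j')) mulr_sumr.
  by apply: eq_bigr => j' _; ring.
by under eq_fun do rewrite sum_delta.
Qed.

Lemma gvec_mble j : mble (fun w => Y w j).
Proof. exact: (cg_mble (gvec_coord j).2). Qed.

Lemma gvec_mvec : mble (Y : T -> vec R J).
Proof. by apply/measurable_vecP; exact: gvec_mble. Qed.

Lemma gvec_L2 j : L2 P (fun w => Y w j).
Proof.
split; first exact: gvec_mble.
by have [k0 cg] := gvec_coord j; have [] := cg_moments cg k0.
Qed.

Lemma gvec_var j : Ex P (fun w => Y w j ^+ 2) = K j j.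
Proof. by have [k0 cg] := gvec_coord j; have [] := cg_moments cg k0. Qed.

End basics.

(** Allows any Gaussian model to be replaced by another one with the same covariance, possibly on
    another probability space. *)
Lemma gvec_same_law {d d'} {T : measurableType d} {T' : measurableType d'} {J : finType}
  (P : probability T R) (P' : probability T' R) (Y : T -> J -> R) (Y' : T' -> J -> R) K :
  gvec P Y K -> gvec P' Y' K -> same_law P P' (Y : T -> vec R J) (Y' : T' -> vec R J).
Proof.
move=> gY gY'; apply: cramer_wold; [exact: gvec_mble gY|exact: gvec_mble gY'|].
move=> a B mB; have [_ [_ cg]] := gY a; have [_ [_ cg']] := gY' a.
by have := cg B mB; rewrite -cg'.
Qed.

Section moments.
Context {d : measure_display} {T : measurableType d} {J : finType}.
Variables (P : probability T R) (Y : T -> J -> R) (K : J -> J -> R).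
Hypothesis gY : gvec P Y K.

(** The vector [- Y] has the same covariance, hence the same law. *)
Lemma gvec_mean j : Ex P (fun w => Y w j) = 0.
Proof.
have gN : gvec P (fun w i => \sum_j (- (j == i)%:R) * Y w j) K.
  apply: (gvec_eqK (gvec_lin gY (fun i j => - (j == i)%:R))) => i i'.
  rewrite -[RHS](sum_delta i (fun j => K j i')); apply: eq_bigr => k _.
  rewrite -[K k i'](sum_delta i' (fun j => K k j)) mulr_sumr.
  by apply: eq_bigr => k' _; ring.
have sl := gvec_same_law gY gN.
have e := same_law_Ex (gvec_mvec gY) (gvec_mvec gN) sl (measurable_coord j).
have e2 : Ex P (fun w => \sum_i (- (i == j)%:R) * Y w i) = - Ex P (fun w => Y w j).
  rewrite -ExN; last exact: L2_ig (gvec_L2 gY j).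
  apply: eq_Ex => w; under eq_bigr do rewrite mulNr.
  by rewrite sumrN sum_delta.
have e3 : Ex P (fun w => Y w j) = - Ex P (fun w => Y w j) by rewrite -e2; exact: e.
by move/eqP: e3; rewrite -subr_eq0 opprK -mulr2n mulrn_eq0/= => /eqP.
Qed.

(** Two independent copies are glued along [chi]. When the cross covariances vanish the covariance,
    hence the law, is unchanged: this is how uncorrelated becomes independent. *)
Lemma gvec_glue (chi : pred J) : (forall i j, chi i != chi j -> K i j = 0) ->
  gvec (P \x P)%E (fun w j => if chi j then Y w.1 j else Y w.2 j) K.
Proof.
move=> K0 a.
pose a1 j := if chi j then a j else 0; pose a2 j := if chi j then 0 else a j.
have qE : quad K a = quad K a1 + quad K a2.
  rewrite /quad -big_split/=; apply: eq_bigr => i _; rewrite -big_split/=.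
  apply: eq_bigr => j _; rewrite /a1 /a2.
  have [e|/K0 ->] := eqVneq (chi i) (chi j); last by rewrite !mulr0 addr0.
  by rewrite e; case: (chi j); ring.
have [q1 c1] := gY a1; have [q2 c2] := gY a2.
split; first exact: (gY a).1.
rewrite qE; have := cg_sum q1 q2 c1 c2.
congr (centered_gaussian _ _ _); apply/funext => w; rewrite -big_split/=.
by apply: eq_bigr => j _; rewrite /a1 /a2; case: (chi j); ring.
Qed.

Lemma gvec_indep (chi : pred J) (f h : vec R J -> R) :
  (forall i j, chi i != chi j -> K i j = 0) -> mble f -> mble h ->
  (forall v v', (forall j, chi j -> v j = v' j) -> f v = f v') ->
  (forall v v', (forall j, ~~ chi j -> v j = v' j) -> h v = h v') ->
  ig P (fun w => f (Y w)) -> ig P (fun w => h (Y w)) ->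
  ig P (fun w => f (Y w) * h (Y w)) /\
  Ex P (fun w => f (Y w) * h (Y w)) = Ex P (fun w => f (Y w)) * Ex P (fun w => h (Y w)).
Proof.
move=> K0 mf mh ff hh If Ih.
have gZ := gvec_glue K0; set Z := (Z in gvec _ Z _) in gZ.
have sl := gvec_same_law gZ gY.
have fZ w : f (Z w) = f (Y w.1) by apply: ff => j cj; rewrite /Z cj.
have hZ w : h (Z w) = h (Y w.2) by apply: hh => j cj; rewrite /Z (negbTE cj).
have mfh : mble (fun v : vec R J => f v * h v) by exact: measurable_funM.
have Iz : ig (P \x P)%E (fun w => f (Z w) * h (Z w)).
  by apply: eq_ig (ig_prod If Ih) => w; rewrite fZ hZ.
split; first exact: (same_law_ig (gvec_mvec gZ) (gvec_mvec gY) sl mfh Iz).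
rewrite -(Ex_prod If Ih).
have := same_law_Ex (gvec_mvec gZ) (gvec_mvec gY) sl mfh.
rewrite /comp => <-; apply: eq_Ex => w; by rewrite fZ hZ.
Qed.

Lemma gvec_indep_prod (I : eqType) (p : J -> I) (h : I -> vec R J -> R) (s : seq I) :
  uniq s -> (forall i j, p i != p j -> K i j = 0) -> (forall i, mble (h i)) ->
  (forall i v v', (forall j, p j = i -> v j = v' j) -> h i v = h i v') ->
  (forall i, ig P (fun w => h i (Y w))) ->
  ig P (fun w => \prod_(i <- s) h i (Y w)) /\
  Ex P (fun w => \prod_(i <- s) h i (Y w)) = \prod_(i <- s) Ex P (fun w => h i (Y w)).
Proof.
move=> + K0 mh hh Ih; elim: s => [_|i s IH /= /andP[si us]].
  split; first by apply: eq_ig (ig_cst P 1) => w; rewrite big_nil.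
  by under eq_Ex do rewrite big_nil; rewrite big_nil Ex_cst.
have [I2 E2] := IH us.
have [|||||||I3 E3] := @gvec_indep (fun j => p j == i) (h i) (fun v => \prod_(i <- s) h i v).
- by move=> j j' ne; apply: K0; apply: contraNN ne => /eqP ->.
- exact: mh.
- by apply: measurable_prod => k _; exact: mh.
- by move=> v v' e; apply: hh => j pj; apply: e; rewrite pj.
- move=> v v' e; apply: eq_big_seq => k ks; apply: hh => j pj; apply: e.
  by rewrite pj; apply: contraNN si => /eqP <-.
- exact: Ih.
- exact: I2.
- split; first by apply: eq_ig I3 => w; rewrite big_cons.
  by under eq_Ex do rewrite big_cons; rewrite big_cons -E2.
Qed.

End moments.

Lemma gvec_prod {d1 d2} {T1 : measurableType d1} {T2 : measurableType d2} {J1 J2 : finType}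
  (P1 : probability T1 R) (P2 : probability T2 R) (Y1 : T1 -> J1 -> R) (Y2 : T2 -> J2 -> R) K1 K2 :
  gvec P1 Y1 K1 -> gvec P2 Y2 K2 ->
  gvec (P1 \x P2)%E
    (fun w (j : J1 + J2) => match j with inl j => Y1 w.1 j | inr j => Y2 w.2 j end)
    (fun i j => match i, j with
      | inl i, inl j => K1 i j | inr i, inr j => K2 i j | _, _ => 0 end).
Proof.
move=> g1 g2 a.
have [q1 c1] := g1 (a \o inl); have [q2 c2] := g2 (a \o inr).
have qE : quad (fun i j => match i, j with
      | inl i, inl j => K1 i j | inr i, inr j => K2 i j | _, _ => 0 end) a =
    quad K1 (a \o inl) + quad K2 (a \o inr).
  rewrite /quad big_sumType/=; congr (_ + _); apply: eq_bigr => i _.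
    by rewrite big_sumType/= [X in _ + X]big1 ?addr0// => j _; rewrite mulr0.
  by rewrite big_sumType/= [X in X + _]big1 ?add0r// => j _; rewrite mulr0.
rewrite qE; split; first exact: addr_ge0.
have := cg_sum q1 q2 c1 c2; congr (centered_gaussian _ _ _); apply/funext => w.
by rewrite big_sumType.
Qed.

Definition KI {J : finType} (i j : J) : R := (i == j)%:R.

End GaussianVectors.

(** * The source as a Gaussian vector *)

Section Source.
Context {R : realType} {d : measure_display} {T : measurableType d}.
Variables (P : probability T R) (l : nat) (X Z : nat -> 'I_l -> T -> R).
Variables (gX rX gZ rZ : R).
Hypotheses (psdX : psd_eqcov l gX rX) (psdZ : psd_eqcov l gZ rZ).
Hypothesis src : gauss_source P X Z gX rX gZ rZ.

Lemma source_gvec (J : finType) (n : nat) (A B : J -> 'I_n -> 'I_l -> R) :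
  gvec P (fun w j => \sum_(t < n) \sum_(i < l) (A j t i * X t i w + B j t i * Z t i w))
    (fun j j' => \sum_(t < n) \sum_(i < l) \sum_(i' < l)
      (A j t i * A j' t i' * eqcov gX rX i i' + B j t i * B j' t i' * eqcov gZ rZ i i')).
Proof.
move=> a; pose a1 t i := \sum_j a j * A j t i; pose b1 t i := \sum_j a j * B j t i.
have qE : quad (fun j j' => \sum_(t < n) \sum_(i < l) \sum_(i' < l)
      (A j t i * A j' t i' * eqcov gX rX i i' + B j t i * B j' t i' * eqcov gZ rZ i i')) a =
   \sum_(t < n) \sum_(i < l) \sum_(j < l)
         (a1 t i * a1 t j * eqcov gX rX i j + b1 t i * b1 t j * eqcov gZ rZ i j).
  rewrite /quad; under eq_bigr do under eq_bigr do rewrite mulr_sumr.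
  under eq_bigr do rewrite exchange_big/=.
  rewrite exchange_big/=; apply: eq_bigr => t _.
  under eq_bigr do under eq_bigr do rewrite mulr_sumr.
  under eq_bigr do rewrite exchange_big/=.
  rewrite exchange_big/=; apply: eq_bigr => i _.
  under eq_bigr do under eq_bigr do rewrite mulr_sumr.
  under eq_bigr do rewrite exchange_big/=.
  rewrite exchange_big/=; apply: eq_bigr => i' _.
  rewrite /a1 /b1 !mulr_suml -big_split/=; apply: eq_bigr => j _.
  rewrite !mulr_sumr !mulr_suml -big_split/=; apply: eq_bigr => j' _; ring.
split.
  rewrite qE; apply: sumr_ge0 => t _; under eq_bigr do rewrite big_split/=.
  rewrite big_split/=; apply: addr_ge0; [exact: psdX|exact: psdZ].
rewrite qE; have := src a1 b1; congr (centered_gaussian _ _ _); apply/funext => w.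
under [RHS]eq_bigr do rewrite mulr_sumr.
rewrite [RHS]exchange_big/=; apply: eq_bigr => t _.
under [RHS]eq_bigr do rewrite mulr_sumr.
rewrite [RHS]exchange_big/=; apply: eq_bigr => i _.
rewrite /a1 /b1 !mulr_suml -big_split/=; apply: eq_bigr => j _; ring.
Qed.

Lemma slot_gvec (I : finType) (n : nat) (tau : I -> 'I_n) (a b : I -> 'I_l -> R) :
  gvec P (fun w j => \sum_i (a j i * X (tau j) i w + b j i * Z (tau j) i w))
   (fun j j' => (tau j == tau j')%:R *
      \sum_i \sum_i' (a j i * a j' i' * eqcov gX rX i i' + b j i * b j' i' * eqcov gZ rZ i i')).
Proof.
have g := source_gvec (fun j t i => (t == tau j)%:R * a j i)
   (fun j t i => (t == tau j)%:R * b j i).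
have e w j : \sum_(t < n) \sum_(i < l) ((t == tau j)%:R * a j i * X t i w +
    (t == tau j)%:R * b j i * Z t i w) =
    \sum_i (a j i * X (tau j) i w + b j i * Z (tau j) i w).
  rewrite -[RHS](sum_delta (tau j) (fun t : 'I_n => \sum_i (a j i * X t i w + b j i * Z t i w))).
  by apply: eq_bigr => t _; rewrite mulr_sumr; apply: eq_bigr => i _; ring.
rewrite (_ : (fun w j => _) = (fun w j => \sum_(t < n) \sum_(i < l) ((t == tau j)%:R * a j i * X t i w +
    (t == tau j)%:R * b j i * Z t i w))); last first.
  by apply/funext => w; apply/funext => j; rewrite e.
apply: (gvec_eqK g) => j j'.
transitivity (\sum_(t < n) (t == tau j)%:R * ((t == tau j')%:R *
   \sum_i \sum_i' (a j i * a j' i' * eqcov gX rX i i' + b j i * b j' i' * eqcov gZ rZ i i'))).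
  apply: eq_bigr => t _; rewrite !mulr_sumr; apply: eq_bigr => i _; rewrite !mulr_sumr.
  by apply: eq_bigr => i' _; ring.
by rewrite sum_delta.
Qed.

End Source.

(** * The likelihood-ratio bound for distributed encoders *)

Lemma ln_prod {R : realType} (n : nat) (f : 'I_n -> R) :
  (forall t, 0 < f t) -> ln (\prod_t f t) = \sum_t ln (f t).
Proof.
move=> f0; elim: n f f0 => [|n IH] f f0; first by rewrite !big_ord0 ln1.
rewrite !big_ord_recl lnM ?posrE ?IH//; exact: prodr_gt0.
Qed.

Section FiniteValued.
Context {R : realType} {d : measure_display} {T : measurableType d} {F : finType}.
Variables (P : probability T R) (c : T -> F).
Hypothesis mc : forall x, measurable [set w | c w = x].

Lemma mble_bool (b : T -> bool) : measurable [set w | b w] ->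
  mble (fun w => (b w)%:R : R).
Proof.
move=> mb; rewrite (_ : (fun w => _) = \1_[set w | b w]).
  exact: measurable_indic.
apply/funext => w; rewrite indicE; congr (_%:R)%R; congr nat_of_bool.
by apply/idP/idP => [h|]; [apply/mem_set|move/set_mem].
Qed.

Lemma mble_eqc x : mble (fun w => (x == c w)%:R : R).
Proof.
apply: mble_bool; rewrite (_ : [set w | _] = [set w | c w = x])//.
by apply/seteqP; split => w /= => [/eqP|->].
Qed.

(** Reduces a quantity depending on a codeword to the finitely many quantities with the codeword
    frozen. *)
Lemma caseE (g : F -> T -> R) w : g (c w) w = \sum_x (x == c w)%:R * g x w.
Proof. by rewrite (sum_delta (c w) (fun x => g x w)). Qed.

Lemma mble_case (g : F -> T -> R) : (forall x, mble (g x)) -> mble (fun w => g (c w) w).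
Proof.
move=> mg; under eq_fun do rewrite caseE.
by apply: measurable_sum => x; apply: measurable_funM => //; exact: mble_eqc.
Qed.

Lemma ig_case (g : F -> T -> R) : (forall x, ig P (g x)) -> ig P (fun w => g (c w) w).
Proof.
move=> mg; under eq_fun do rewrite caseE.
apply: ig_sum => x _; apply: (ig_bndM (c := 1)) => //; first exact: mble_eqc.
by move=> w; case: eqP; rewrite ?normr1 ?normr0.
Qed.

Lemma L2_case (g : F -> T -> R) : (forall x, L2 P (g x)) -> L2 P (fun w => g (c w) w).
Proof.
move=> mg; under eq_fun do rewrite caseE.
apply: L2_sum => x _; apply: (L2_bndM (c := 1)) => //; first exact: mble_eqc.
by move=> w; case: eqP; rewrite ?normr1 ?normr0.
Qed.

Lemma L2_fin (g : F -> R) : L2 P (fun w => g (c w)).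
Proof. by apply: (@L2_case (fun x _ => g x)) => x; exact: L2_cst. Qed.

Lemma Ex_case (g : F -> T -> R) : (forall x, ig P (g x)) ->
  Ex P (fun w => g (c w) w) = \sum_x Ex P (fun w => (x == c w)%:R * g x w).
Proof.
move=> mg; under eq_Ex do rewrite caseE.
rewrite Ex_sum// => x _; apply: (ig_bndM (c := 1)) => //; first exact: mble_eqc.
by move=> w; case: eqP; rewrite ?normr1 ?normr0.
Qed.

(** The degenerate case of Cauchy-Schwarz. It covers codewords of probability 0, whose conditional
    means are quotients by 0. *)
Lemma Ex_null (f h : T -> R) : L2 P f -> L2 P h -> Ex P (fun w => h w ^+ 2) = 0 ->
  Ex P (fun w => f w * h w) = 0.
Proof.
move=> Lf Lh h0; set v := Ex P _.
have q s : 0 <= s ^+ 2 * Ex P (fun w => f w ^+ 2) + 2 * s * v.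
  have : 0 <= Ex P (fun w => (s * f w + h w) ^+ 2) by apply: Ex_ge0 => w; exact: sqr_ge0.
  rewrite (_ : Ex P _ = s ^+ 2 * Ex P (fun w => f w ^+ 2) + 2 * s * v)//.
  rewrite -[RHS]addr0 -h0 /v -ExZ; last exact: L2_sqr.
  rewrite -ExZ; last exact: L2_mul.
  rewrite -ExD; [|by apply: igZ; exact: L2_sqr|by apply: igZ; exact: L2_mul].
  rewrite -ExD; last exact: L2_sqr.
    by apply: eq_Ex => w; ring.
  by apply: igD; apply: igZ; [exact: L2_sqr|exact: L2_mul].
have f0 : 0 <= Ex P (fun w => f w ^+ 2) by apply: Ex_ge0 => w; exact: sqr_ge0.
set E := Ex P _ in q f0; have E1 : 0 < E + 1 by lra.
(* The minimizer of the quadratic form would be [- v / E]; the shift by 1 avoids a vanishing [E] and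
   still gives a negative value unless [v = 0]. *)
have := q (- v / (E + 1)).
rewrite (_ : _ + _ = - v ^+ 2 * (E + 2) / (E + 1) ^+ 2); last by field; rewrite gt_eqF.
rewrite pmulr_lge0 ?invr_gt0 ?exprn_gt0//.
by move=> v0; apply/eqP; rewrite -sqrf_eq0; apply/eqP; have := sqr_ge0 v; nra.
Qed.

End FiniteValued.

(** * Tilted Gaussian densities *)

Section Tilt.
Context {R : realType} {d : measure_display} {T : measurableType d}.
Variable P : probability T R.

Lemma sqrt_expR_ln (a : R) : 0 < a -> Num.sqrt a = expR (ln a / 2).
Proof.
move=> a0; rewrite -{1}(lnK a0) -[in LHS](divfK (x := 2) _ (ln a)) ?pnatr_eq0//.
by rewrite mulr_natr mulr2n expRD -expr2 sqrtr_sqr ger0_norm// expR_ge0.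
Qed.

Lemma tilt_pdf (a b y : R) : 0 < a ->
  expR (ln a / 2 + y ^+ 2 / 2 - a * (y - b) ^+ 2 / 2) =
  normal_pdf b (Num.sqrt a)^-1 y / normal_pdf 0 (Num.sqrt 1) y.
Proof.
move=> a0; have sa : 0 < (Num.sqrt a)^-1 by rewrite invr_gt0 sqrtr_gt0.
rewrite sqrtr1 !normal_pdfE ?oner_neq0 ?gt_eqF//.
rewrite -mulf_div -expRB /normal_fun.
have -> : normal_peak (Num.sqrt a)^-1 / normal_peak 1 = expR (ln a / 2).
  rewrite /normal_peak invrK exprVn sqr_sqrtr ?ltW// expr1n mul1r -mulrnAr.
  rewrite sqrtrM ?invr_ge0 ?ltW// invfM.
  rewrite mulfVK; last by rewrite gt_eqF// sqrtr_gt0 mulrn_wgt0// pi_gt0.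
  by rewrite sqrtrV ?ltW// invrK sqrt_expR_ln.
rewrite -expRD; congr expR.
rewrite exprVn sqr_sqrtr ?ltW// subr0 expr1n.
by field; rewrite gt_eqF.
Qed.

Lemma tilt1 (Y : T -> R) (a b : R) : centered_gaussian P Y 1 -> 0 < a ->
  let f (y : R) := expR (ln a / 2 + y ^+ 2 / 2 - a * (y - b) ^+ 2 / 2) in
  ig P (f \o Y) /\ Ex P (f \o Y) = 1.
Proof.
move=> gY a0 f; have sa : 0 < (Num.sqrt a)^-1 by rewrite invr_gt0 sqrtr_gt0.
have [I E] := cg_change gY b ltr01 sa.
have fE : f \o Y =1 (fun w => normal_pdf b (Num.sqrt a)^-1 (Y w) / normal_pdf 0 (Num.sqrt 1) (Y w)).
  by move=> w; rewrite /f /= tilt_pdf.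
split; first by apply: eq_ig I => w; rewrite fE.
by rewrite (eq_Ex _ fE) E.
Qed.

Lemma tilt (J : finType) (Y : T -> J -> R) (a b : J -> R) : gvec P Y KI ->
  (forall j, 0 < a j) ->
  let f w := expR (\sum_j (ln (a j) / 2 + Y w j ^+ 2 / 2 - a j * (Y w j - b j) ^+ 2 / 2)) in
  ig P f /\ Ex P f = 1.
Proof.
move=> gY a0 f.
pose h j (v : vec R J) := expR (ln (a j) / 2 + v j ^+ 2 / 2 - a j * (v j - b j) ^+ 2 / 2).
have h1 j : ig P (fun w => h j (Y w)) /\ Ex P (fun w => h j (Y w)) = 1.
  have [_ cg] := gvec_coord gY j; rewrite /KI eqxx in cg.
  exact: (tilt1 (b j) cg (a0 j)).
have fE w : f w = \prod_j h j (Y w) by rewrite /f expR_sum.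
have [|||||I E] := @gvec_indep_prod _ _ _ _ P Y _ gY _ id h (index_enum J).
- exact: index_enum_uniq.
- by move=> i j /negbTE ij; rewrite /KI ij.
- move=> j; rewrite /h; apply: (measurableT_comp (@measurable_expR R)).
  have mj := measurable_coord j : mble (fun v : vec R J => v j).
  apply: measurable_funB; first apply: measurable_funD => //.
    by apply: measurable_funM => //; exact: measurable_funX.
  apply: measurable_funM => //; apply: measurable_funM => //; apply: measurable_funX.
  exact: measurable_funB.
- by move=> j v v' e; rewrite /h e.
- by move=> j; case: (h1 j).
- split; first by apply: eq_ig I => w; rewrite fE.
  under eq_Ex do rewrite fE.
  by rewrite E big1// => j _; case: (h1 j).
Qed.

End Tilt.

(** * Separate encoders with independent white inputs *)

Section Blocks.
Context {R : realType} {d : measure_display} {T : measurableType d}.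
Variables (P : probability T R) (n l : nat) (M : 'I_l -> nat).
Variable psi : forall i : 'I_l, ('I_n * 'I_l -> R) -> 'I_(M i).
Hypothesis mpsi : forall i c, measurable [set v : vec R ('I_n * 'I_l)%type | psi i v = c].
Hypothesis dpsi : forall i v v', (forall t, v (t, i) = v' (t, i)) -> psi i v = psi i v'.

Definition cells := {dffun forall i : 'I_l, 'I_(M i)}.
Definition enc (v : 'I_n * 'I_l -> R) : cells := finfun (fun i => psi i v).

Lemma card_cells : (#|cells|%:R : R) = \prod_i (M i)%:R.
Proof.
rewrite card_dep_ffun foldrE big_map enumT natr_prod.
by apply: eq_bigr => i _; rewrite card_ord.
Qed.

Lemma eq_encP c v : (c == enc v) = [forall i, c i == psi i v].
Proof.
apply/eqP/forallP => [-> i|h]; first by rewrite ffunE.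
by apply/ffunP => i; rewrite ffunE; apply/eqP.
Qed.

Lemma menc c : measurable [set v : vec R ('I_n * 'I_l)%type | enc v = c].
Proof.
rewrite (_ : [set _ | _] = \bigcap_(i in [set: 'I_l]) [set v | psi i v = c i]).
  by apply: fin_bigcap_measurable => [|i _]; [exact: finite_finset|exact: mpsi].
apply/seteqP; split => v /= => [<- i _|h] /=; first by rewrite ffunE.
by apply/ffunP => i; rewrite ffunE; exact: h.
Qed.

Variable zeta : T -> 'I_n * 'I_l -> R.
Hypothesis gz : gvec P zeta KI.

Let mz : mble (zeta : T -> vec R ('I_n * 'I_l)%type) := gvec_mvec gz.

Lemma menc_z c : measurable [set w | enc (zeta w) = c].
Proof. by rewrite -[X in measurable X]setTI; exact: (mz measurableT (menc c)). Qed.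

Lemma mpsi_z i c : measurable [set w | psi i (zeta w) = c].
Proof. by rewrite -[X in measurable X]setTI; exact: (mz measurableT (mpsi c)). Qed.

Let blk i c (v : vec R ('I_n * 'I_l)%type) : R := (psi i v == c)%:R.

Let mblk i (c : 'I_(M i)) : mble (blk c).
Proof.
apply: mble_bool; rewrite (_ : [set w | _] = [set w | psi i w = c]).
  exact: mpsi.
by apply/seteqP; split => w /= /eqP.
Qed.

Let blk_bnd i (c : 'I_(M i)) v : `|blk c v| <= 1.
Proof. by rewrite /blk; case: eqP; rewrite ?normr1 ?normr0. Qed.

Let Lblk i (c : 'I_(M i)) : L2 P (fun w => blk c (zeta w)).
Proof.
apply: (@L2_bnd _ _ _ _ _ 1) => [|w]; last exact: blk_bnd.
exact: (measurableT_comp (mblk c) mz).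
Qed.

(** The conditional mean of [zeta (t, i)] given that encoder [i] sends [c]; it is 0 for a message of
    probability 0. *)
Definition cmean i t (c : 'I_(M i)) : R :=
  Ex P (fun w => zeta w (t, i) * blk c (zeta w)) / Ex P (fun w => blk c (zeta w)).

Definition dev i t (v : vec R ('I_n * 'I_l)%type) : R := v (t, i) - cmean t (psi i v).

Let mdev i t : mble (dev i t).
Proof.
apply: measurable_funB; first exact: measurable_coord.
exact: (@mble_case _ _ _ _ (fun v : vec R ('I_n * 'I_l)%type => psi i v) (mpsi (i := i)) (fun c _ => cmean t c)).
Qed.

Lemma L2_dev i t : L2 P (fun w => dev i t (zeta w)).
Proof.
apply: L2B; first exact: (gvec_L2 gz).
exact: (L2_fin P (@mpsi_z i) (cmean t)).
Qed.

Lemma Ex_dev_blk i t (c : 'I_(M i)) : Ex P (fun w => dev i t (zeta w) * blk c (zeta w)) = 0.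
Proof.
have -> : Ex P (fun w => dev i t (zeta w) * blk c (zeta w)) =
  Ex P (fun w => zeta w (t, i) * blk c (zeta w)) - cmean t c * Ex P (fun w => blk c (zeta w)).
  rewrite -ExZ; last exact: L2_ig (Lblk _).
  rewrite -ExB; last by apply: igZ; exact: L2_ig (Lblk _).
    by apply: eq_Ex => w; rewrite /dev /blk; case: eqP => [->|_] /=; rewrite ?mulr1 ?mulr0 ?subr0.
  exact: L2_mul (gvec_L2 gz _) (Lblk _).
have [e|ne] := eqVneq (Ex P (fun w => blk c (zeta w))) 0.
  rewrite e mulr0 subr0; apply: Ex_null (gvec_L2 gz _) (Lblk _) _.
  by rewrite -e; apply: eq_Ex => w; rewrite /blk; case: eqP; rewrite ?expr1n ?expr0n.
by rewrite /cmean divfK// subrr.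
Qed.

(** For a fixed codeword the event factors over the encoders, whose inputs are independent. The
    deviation of encoder [i] meets only the factor of its own message, where it has mean 0 by
    [Ex_dev_blk]. *)
Lemma Ex_dev_enc i t (g : cells -> R) :
  Ex P (fun w => dev i t (zeta w) * g (enc (zeta w))) = 0.
Proof.
rewrite (Ex_case menc_z (g := fun c w => dev i t (zeta w) * g c)); last first.
  by move=> c; apply: L2_mul (L2_dev _ _) (L2_cst _ _).
rewrite big1// => c _.
pose h k (v : vec R ('I_n * 'I_l)%type) := (if k == i then dev i t v else 1) * blk (c k) v.
have dblk k (a : 'I_(M k)) v v' : (forall j, j.2 = k -> v j = v' j) -> blk a v = blk a v'.
  by move=> e; rewrite /blk (dpsi (v' := v'))// => t'; exact: e.
have [|||||I E] := @gvec_indep_prod _ _ _ _ P zeta _ gz _ snd h (index_enum 'I_l).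
- exact: index_enum_uniq.
- by move=> x y; rewrite /KI; case: (x =P y) => [->|//]; rewrite eqxx.
- move=> k; apply: measurable_funM; last exact: mblk.
  by case: (k == i) => //; exact: mdev.
- move=> k v v' e; rewrite /h (dblk _ _ _ _ e); congr (_ * _).
  by case: eqP => // ki; rewrite /dev (dpsi (v' := v')) ?e// -ki// => t'; exact: e.
- move=> k; apply: L2_mul (Lblk _).
  by case: (k == i); [exact: L2_dev|exact: L2_cst].
transitivity (g c * Ex P (fun w => \prod_(k <- index_enum 'I_l) h k (zeta w))).
  rewrite -ExZ//; apply: eq_Ex => w; rewrite /h big_split/=.
  rewrite (bigD1_seq i)//= ?index_enum_uniq ?mem_index_enum// eqxx.
  rewrite [X in _ * X * _]big1 ?mulr1; last by move=> k /negbTE ->.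
  rewrite (_ : \prod_(k <- _) _ = (c == enc (zeta w))%:R); first by ring.
  rewrite eq_encP; case: forallP => [al|nal]; rewrite /blk.
    by rewrite big1// => k _; rewrite eq_sym al.
  apply/eqP/prodf_eq0; have /existsNP[k kn] := nal.
  by exists k => //; move/negP/negbTE: kn; rewrite eq_sym => ->.
rewrite E (bigD1_seq i)//= ?index_enum_uniq ?mem_index_enum// /h eqxx Ex_dev_blk.
by rewrite mul0r mulr0.
Qed.

Lemma Ex_dev i t : Ex P (fun w => dev i t (zeta w)) = 0.
Proof.
by rewrite -[RHS](Ex_dev_enc i t (fun=> 1)); apply: eq_Ex => w; rewrite mulr1.
Qed.

Lemma Ex_dev_dev i i' t : i != i' ->
  Ex P (fun w => dev i t (zeta w) * dev i' t (zeta w)) = 0.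
Proof.
move=> ii'.
have [|||||||_ ->] := @gvec_indep _ _ _ _ P zeta _ gz (fun j => j.2 == i) (dev i t) (dev i' t).
- by move=> x y; rewrite /KI; case: (x =P y) => [->|//]; rewrite eqxx.
- exact: mdev.
- exact: mdev.
- by move=> v v' e; rewrite /dev (dpsi (v' := v')) ?e//= => t'; apply: e => /=.
- by move=> v v' e; rewrite /dev (dpsi (v' := v')) ?e//= 1?eq_sym// => t'; apply: e => /=; rewrite eq_sym.
- exact: L2_ig (L2_dev _ _).
- exact: L2_ig (L2_dev _ _).
- by rewrite Ex_dev mul0r.
Qed.

Lemma Ex_sqsum (I : finType) (F : I -> T -> R) : (forall i, L2 P (F i)) ->
  Ex P (fun w => (\sum_i F i w) ^+ 2) = \sum_i \sum_j Ex P (fun w => F i w * F j w).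
Proof.
move=> LF; under [RHS]eq_bigr => i _.
  rewrite -Ex_sum; last by move=> j _; exact: L2_mul.
  over.
rewrite -Ex_sum; last by move=> i _; apply: ig_sum => j _; exact: L2_mul.
apply: eq_Ex => w; rewrite expr2 mulr_suml; apply: eq_bigr => i _.
by rewrite mulr_sumr.
Qed.

(* The deviations of different encoders are uncorrelated, and orthogonal to any function of the codeword. *)
Lemma block_lower (h : 'I_l -> R) t (g : cells -> R) :
  \sum_i h i ^+ 2 * Ex P (fun w => dev i t (zeta w) ^+ 2) <=
  Ex P (fun w => (\sum_i h i * zeta w (t, i) - g (enc (zeta w))) ^+ 2).
Proof.
pose Y w := \sum_i h i * dev i t (zeta w).
pose G (c : cells) := \sum_i h i * cmean t (c i) - g c.
have LY : L2 P Y by apply: L2_sum => i _; apply: L2Z; exact: L2_dev.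
have LG : L2 P (fun w => G (enc (zeta w))) by exact: (L2_fin P menc_z G).
have DE w : \sum_i h i * zeta w (t, i) - g (enc (zeta w)) = Y w + G (enc (zeta w)).
  rewrite /Y /G addrA -big_split/=; congr (_ - _); apply: eq_bigr => i _.
  by rewrite /dev ffunE; ring.
have YG : Ex P (fun w => Y w * G (enc (zeta w))) = 0.
  rewrite /Y; under eq_Ex do rewrite mulr_suml.
  rewrite Ex_sum => [|i _].
    rewrite big1// => i _; under eq_Ex do rewrite -mulrA.
    rewrite ExZ ?Ex_dev_enc ?mulr0//; exact: L2_mul (L2_dev _ _) LG.
  by apply: L2_mul LG; apply: L2Z; exact: L2_dev.
have -> : \sum_i h i ^+ 2 * Ex P (fun w => dev i t (zeta w) ^+ 2) =
   Ex P (fun w => Y w ^+ 2 + 2 * (Y w * G (enc (zeta w)))).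
  rewrite ExD; [|exact: L2_sqr|by apply: igZ; exact: L2_mul].
  rewrite ExZ ?YG ?mulr0 ?addr0; last exact: L2_mul.
  rewrite /Y Ex_sqsum; last by move=> i; apply: L2Z; exact: L2_dev.
  apply: eq_bigr => i _; rewrite (bigD1 i)//= big1 ?addr0 => [|j ji].
    by rewrite -ExZ; [apply: eq_Ex => w; ring|exact: L2_sqr (L2_dev _ _)].
  transitivity (h i * h j * Ex P (fun w => dev i t (zeta w) * dev j t (zeta w))).
    rewrite -ExZ; first by apply: eq_Ex => w; ring.
    exact: L2_mul (L2_dev _ _) (L2_dev _ _).
  by rewrite Ex_dev_dev ?mulr0// eq_sym.
apply: Ex_le.
- by apply: igD; [exact: L2_sqr|apply: igZ; exact: L2_mul].
- by under eq_fun do rewrite DE; apply: L2_sqr; exact: L2D.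
- move=> w; rewrite DE; have := sqr_ge0 (G (enc (zeta w))); nra.
Qed.

(** The tangent inequality [x <= exp x / K - 1 + ln K] replaces Jensen, and the term of the actual
    codeword is enlarged to the sum over all codewords, each of whose tilts has mean 1. The values
    [u] are left free: they will be the log-likelihood ratios of the common part [xi], over which an
    average is still to be taken. *)
Lemma log_bound (b : R) (u : cells -> R) : 0 < b ->
  Ex P (fun w => u (enc (zeta w)) + \sum_t \sum_i
    (ln b / 2 + zeta w (t, i) ^+ 2 / 2 - b * dev i t (zeta w) ^+ 2 / 2)) <=
  (\sum_c expR (u c)) / #|cells|%:R - 1 + ln #|cells|%:R.
Proof.
move=> b0; set K : R := #|cells|%:R.
have K0 : 0 < K.
  rewrite ltr0n; apply/card_gt0P; exists (enc (fun=> 0)); by [].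
pose W (c : cells) w := \sum_(j : 'I_n * 'I_l) (ln b / 2 + zeta w j ^+ 2 / 2 - b * (zeta w j - cmean j.1 (c j.2)) ^+ 2 / 2).
have WE w : \sum_t \sum_i (ln b / 2 + zeta w (t, i) ^+ 2 / 2 - b * dev i t (zeta w) ^+ 2 / 2) =
    W (enc (zeta w)) w.
  rewrite /W pair_big/=; apply: eq_bigr => -[t i] _ /=.
  by rewrite ffunE.
have tl (c : cells) := tilt (fun j => cmean j.1 (c j.2)) gz (fun=> b0).
have IW c : ig P (fun w => expR (W c w)) by case: (tl c).
have EW c : Ex P (fun w => expR (W c w)) = 1 by case: (tl c).
have Is : ig P (fun w => \sum_c expR (u c) * expR (W c w)).
  by apply: ig_sum => c _; exact: igZ.
have -> : (\sum_c expR (u c)) / K - 1 + ln K =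
    Ex P (fun w => (\sum_c expR (u c) * expR (W c w)) * K^-1 + (ln K - 1)).
  have -> : Ex P (fun w => (\sum_c expR (u c) * expR (W c w)) * K^-1 + (ln K - 1)) =
      (\sum_c expR (u c)) / K + (ln K - 1); last by ring.
    under eq_Ex do rewrite mulrC.
    rewrite ExD ?Ex_cst; [|by apply: igZ|exact: ig_cst].
    rewrite ExZ// Ex_sum => [|c _]; last exact: igZ.
    rewrite mulrC; congr (_ / _ + _); apply: eq_bigr => c _.
    by rewrite ExZ// EW mulr1.
apply: Ex_le.
- apply: igD; first exact: L2_ig (L2_fin P menc_z u).
  apply: ig_sum => t _; apply: ig_sum => i _; apply: igB.
    apply: igD; first exact: ig_cst.
    by under eq_fun do rewrite mulrC; apply: igZ; exact: L2_sqr (gvec_L2 gz _).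
  by under eq_fun do rewrite mulrAC; apply: igZ; exact: L2_sqr (L2_dev _ _).
- apply: igD; last exact: ig_cst.
  by under eq_fun do rewrite mulrC; apply: igZ.
- move=> w; rewrite WE; set c0 := enc (zeta w); set L := _ + _.
  have h1 : L <= expR L / K + (ln K - 1).
    have := expR_ge1Dx (L - ln K); rewrite expRB lnK//; lra.
  apply: (le_trans h1); rewrite lerD2r ler_pM2r ?invr_gt0//.
  rewrite expRD (bigD1 c0)//= lerDl sumr_ge0// => c _.
Qed.

End Blocks.

Section Identity.
Context {R : realType}.

Lemma gvec_linI {d} {T : measurableType d} (P : probability T R) {J I : finType}
  (Y : T -> J -> R) (L : I -> J -> R) : gvec P Y KI ->
  gvec P (fun w i => \sum_j L i j * Y w j) (fun i i' => \sum_j L i j * L i' j).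
Proof.
move=> gY; apply: (gvec_eqK (gvec_lin gY L)) => i i'; apply: eq_bigr => j _.
rewrite -[L i' j in RHS](sum_delta j (fun j' => L i' j')) mulr_sumr.
by apply: eq_bigr => j' _; rewrite /KI eq_sym; ring.
Qed.

Lemma gvec_prodI {d1 d2} {T1 : measurableType d1} {T2 : measurableType d2} {J1 J2 : finType}
  (P1 : probability T1 R) (P2 : probability T2 R) (Y1 : T1 -> J1 -> R) (Y2 : T2 -> J2 -> R) :
  gvec P1 Y1 KI -> gvec P2 Y2 KI ->
  gvec (P1 \x P2)%E
    (fun w (j : J1 + J2) => match j with inl j => Y1 w.1 j | inr j => Y2 w.2 j end) KI.
Proof.
move=> g1 g2; apply: (gvec_eqK (gvec_prod g1 g2)) => -[i|i] [j|j] //.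
Qed.

End Identity.

Section InnerBound.
Context {R : realType} {d : measure_display} {T : measurableType d}.
Variables (P : probability T R) (n l : nat) (M : 'I_l -> nat).
Variable psi : forall i : 'I_l, ('I_n * 'I_l -> R) -> 'I_(M i).
Hypothesis mpsi : forall i c, measurable [set v : vec R ('I_n * 'I_l)%type | psi i v = c].
Hypothesis dpsi : forall i v v', (forall t, v (t, i) = v' (t, i)) -> psi i v = psi i v'.
Variable zeta : T -> 'I_n * 'I_l -> R.
Hypothesis gz : gvec P zeta KI.

(** The normalization of [eta] gives each encoder total weight 1, so the sum of the encoders'
    deviations is also a weighted sum over directions. In each direction [block_lower] replaces it
    by the error of an arbitrary estimate [g]. *)
Lemma inner_bound (b : R) (u : cells M -> R) (eta : 'I_l -> R) (H : 'I_l -> 'I_l -> R)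
    (g : 'I_n -> 'I_l -> cells M -> R) :
  0 < b -> (forall k, 0 <= eta k) -> (forall i, \sum_k eta k * H k i ^+ 2 = 1) ->
  Ex P (fun w => u (enc psi (zeta w)) - \sum_t \sum_k b / 2 * eta k *
    (\sum_i H k i * zeta w (t, i) - g t k (enc psi (zeta w))) ^+ 2) +
  (n * l)%:R * (ln b / 2 + 2^-1) <=
  (\sum_c expR (u c)) / #|cells M|%:R - 1 + ln #|cells M|%:R.
Proof.
move=> b0 eta0 eta1; apply: (le_trans _ (log_bound mpsi gz u b0)).
have mc := menc_z mpsi gz.
have Iu : ig P (fun w => u (enc psi (zeta w))) by exact: L2_ig (L2_fin P mc u).
have Ld t i := L2_dev mpsi gz i t.
have LD t k : L2 P (fun w => \sum_i H k i * zeta w (t, i) - g t k (enc psi (zeta w))).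
  apply: L2B; last exact: (L2_fin P mc (g t k)).
  by apply: L2_sum => i _; apply: L2Z; exact: (gvec_L2 gz).
have Iz t i : ig P (fun w => zeta w (t, i) ^+ 2 / 2).
  by under eq_fun do rewrite mulrC; apply: igZ; exact: L2_sqr (gvec_L2 gz _).
have Id t i : ig P (fun w => b * dev P psi zeta i t (zeta w) ^+ 2 / 2).
  by under eq_fun do rewrite mulrAC; apply: igZ; exact: L2_sqr (Ld t i).
rewrite ExB//; last first.
  by apply: ig_sum => t _; apply: ig_sum => k _; apply: igZ; exact: L2_sqr.
rewrite ExD//; last first.
  apply: ig_sum => t _; apply: ig_sum => i _; apply: igB => //.
  by apply: igD => //; exact: ig_cst.
rewrite -addrA lerD2l Ex_sum; last first.
  by move=> t _; apply: ig_sum => k _; apply: igZ; exact: L2_sqr.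
rewrite Ex_sum; last first.
  move=> t _; apply: ig_sum => i _; apply: igB => //.
  by apply: igD => //; exact: ig_cst.
have -> : (n * l)%:R * (ln b / 2 + 2^-1) = \sum_(t < n) l%:R * (ln b / 2 + 2^-1).
  by rewrite sumr_const card_ord natrM -mulrA mulr_natl.
rewrite -sumrN -big_split/=; apply: ler_sum => t _.
rewrite Ex_sum; last by move=> k _; apply: igZ; exact: L2_sqr.
rewrite Ex_sum; last first.
  move=> i _; apply: igB => //.
  by apply: igD => //; exact: ig_cst.
pose e i := Ex P (fun w => dev P psi zeta i t (zeta w) ^+ 2).
have -> : \sum_i Ex P (fun w => ln b / 2 + zeta w (t, i) ^+ 2 / 2 - b * dev P psi zeta i t (zeta w) ^+ 2 / 2)
  = l%:R * (ln b / 2 + 2^-1) - b / 2 * \sum_i e i.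
  have -> : l%:R * (ln b / 2 + 2^-1) = \sum_(i < l) (ln b / 2 + 2^-1).
    by rewrite sumr_const card_ord mulr_natl.
  rewrite mulr_sumr -sumrN -big_split/=.
  apply: eq_bigr => i _; rewrite ExB//; last by apply: igD => //; exact: ig_cst.
  rewrite ExD ?Ex_cst//; last exact: ig_cst.
  congr (_ + _ - _).
    under eq_Ex do rewrite mulrC.
    by rewrite ExZ ?(gvec_var gz) /KI ?eqxx ?mulr1//; exact: L2_sqr (gvec_L2 gz _).
  by rewrite -ExZ; [apply: eq_Ex => w; ring|exact: L2_sqr (Ld t i)].
rewrite addrC lerD2l lerN2.
have -> : \sum_i e i = \sum_k eta k * \sum_i H k i ^+ 2 * e i.
  under [RHS]eq_bigr do rewrite mulr_sumr.
  rewrite exchange_big/=; apply: eq_bigr => i _.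
  by under eq_bigr do rewrite mulrA; rewrite -mulr_suml eta1 mul1r.
rewrite mulr_sumr; apply: ler_sum => k _.
rewrite ExZ; last exact: L2_sqr.
rewrite mulrA ler_wpM2l//; last exact: block_lower.
by rewrite mulr_ge0// divr_ge0// ltW.
Qed.

End InnerBound.

Lemma mphi_comp {R : realType} {J : finType} (n : nat) (F : Type) (f : ('I_n -> R) -> F) (c : F)
  (L : vec R J -> 'I_n -> R) : borelRn [set s | f s = c] ->
  (forall t, mble (fun v => L v t)) -> measurable [set v | f (L v) = c].
Proof.
move=> bf mL; have mLv : mble (L : vec R J -> vec R 'I_n) by apply/measurable_vecP.
by rewrite -[X in measurable X]setTI; exact: (mLv measurableT [set s | f s = c] bf).
Qed.

Lemma sum_snd {R : realType} (n l : nat) (f : 'I_l -> R) :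
  \sum_(j : 'I_n * 'I_l) f j.2 = n%:R * \sum_k f k.
Proof.
by rewrite -(pair_bigA _ (fun _ k => f k))/= sumr_const card_ord mulr_natl.
Qed.

(** * Averaging over the common part *)

Section OuterBound.
Context {R : realType} {d1 d2 : measure_display} {T1 : measurableType d1} {T2 : measurableType d2}.
Variables (P1 : probability T1 R) (P2 : probability T2 R) (n l : nat) (M : 'I_l -> nat).
Variable phi : forall i : 'I_l, ('I_n -> R) -> 'I_(M i).
Hypothesis bphi : forall i c, borelRn [set s | phi i s = c].
Variables (xi : T1 -> 'I_n * 'I_l -> R) (zeta : T2 -> 'I_n * 'I_l -> R).
Hypotheses (gx : gvec P1 xi KI) (gz : gvec P2 zeta KI).
Variables (H : 'I_l -> 'I_l -> R).
Hypothesis HH : forall k k', \sum_i H k i * H k' i = (k == k')%:R.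
Hypothesis HH' : forall i i', \sum_k H k i * H k i' = (i == i')%:R.
Variables (sig : 'I_l -> R) (s : R).
Let PP : probability _ R := (P1 \x P2)%E.
Local Notation J := ('I_n * 'I_l)%type.

Definition unrot (v : J -> R) (i : 'I_l) (t : 'I_n) : R := \sum_k H k i * v (t, k).

Definition ecode : (J -> R) -> cells M := enc (fun i v => phi i (unrot v i)).

Lemma mecode c : measurable [set v : vec R J | ecode v = c].
Proof.
apply: menc => i a; apply: (@mphi_comp R J n _ (phi i) a (fun v => unrot v i)) => // t.
by apply: measurable_sum => k; apply: measurable_funM => //; exact: measurable_coord.
Qed.

Let zr w (j : J) : R := \sum_i H j.2 i * zeta w (j.1, i).
Let St (w : T1 * T2) (j : J) : R := sig j.2 * xi w.1 j + s * zr w.2 j.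

Let psi0 w1 i (v : J -> R) := phi i (fun t => \sum_k H k i * (sig k * xi w1 (t, k)) + s * v (t, i)).

Let mpsi0 w1 i c : measurable [set v : vec R J | psi0 w1 i v = c].
Proof.
apply: (@mphi_comp R J n _ (phi i) c (fun v t => _ + s * v (t, i))) => // t.
by apply: measurable_funD => //; apply: measurable_funM => //; exact: measurable_coord.
Qed.

(** White noise stays white in every orthonormal basis: rotating back, the part [s * zr] becomes
    [s * zeta] coordinate by coordinate. This is why the split of [S] isolates a multiple of the
    identity. *)
Let codeE w : ecode (St w) = enc (psi0 w.1) (zeta w.2).
Proof.
apply/ffunP => i; rewrite !ffunE /psi0; congr phi; apply/funext => t.
rewrite /unrot /St /zr/=; under eq_bigr do rewrite mulrDr.
rewrite big_split/=; congr (_ + _).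
under eq_bigr do rewrite mulrCA mulr_sumr.
rewrite -mulr_sumr exchange_big/= -[zeta w.2 (t, i)](sum_delta i (fun i' => zeta w.2 (t, i'))).
congr (_ * _); apply: eq_bigr => i' _; under eq_bigr do rewrite mulrA.
by rewrite -mulr_suml HH' eq_sym.
Qed.

Let gzr : gvec P2 zr KI.
Proof.
have := gvec_linI (fun j j' : J => (j.1 == j'.1)%:R * H j.2 j'.2) gz.
have e : (fun w (j : J) => \sum_j' (j.1 == j'.1)%:R * H j.2 j'.2 * zeta w j') = zr.
  apply/funext => w; apply/funext => j; rewrite /zr.
  transitivity (\sum_t \sum_i (j.1 == t)%:R * H j.2 i * zeta w (t, i)).
    by rewrite pair_bigA/=; apply: eq_bigr => -[].
  rewrite -[RHS](sum_delta j.1 (fun t => \sum_i H j.2 i * zeta w (t, i))).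
  apply: eq_bigr => t _; rewrite mulr_sumr eq_sym; apply: eq_bigr => i _; ring.
rewrite e => g; apply: (gvec_eqK g) => -[t k] [t' k']/=.
transitivity (\sum_t0 \sum_i (t == t0)%:R * H k i * ((t' == t0)%:R * H k' i)).
  by rewrite pair_bigA/=; apply: eq_bigr => -[].
transitivity (\sum_t0 (t0 == t)%:R * ((t' == t0)%:R * (k == k')%:R) : R).
  apply: eq_bigr => t0 _; rewrite -HH eq_sym !mulr_sumr; apply: eq_bigr => i _; ring.
by rewrite sum_delta /KI xpair_eqE eq_sym -natrM mulnb.
Qed.

Let Y (w : T1 * T2) (j : J + J) := match j with inl j => xi w.1 j | inr j => zr w.2 j end.

Let gY : gvec PP Y KI.
Proof. exact: (gvec_prodI gx gzr). Qed.

Variable shat : cells M -> J -> R.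

Let lam k := sig k ^+ 2 + s ^+ 2.

Let L (g : 'I_l -> R * R) : (J + J) -> (J + J) -> R := fun p q =>
  match p, q with
  | inl a, inl b => (b == a)%:R * sig a.2
  | inl a, inr b => (b == a)%:R * s
  | inr a, inl b => (b == a)%:R * (g a.2).1
  | inr a, inr b => (b == a)%:R * (g a.2).2
  end.

Let gL g : gvec PP (fun w j => match j with inl j => St w j
   | inr j => (g j.2).1 * xi w.1 j + (g j.2).2 * zr w.2 j end)
  (fun i j => match i, j with
    | inl i, inl j => (i == j)%:R * (sig i.2 * sig j.2 + s * s)
    | inl i, inr j => (i == j)%:R * (sig i.2 * (g j.2).1 + s * (g j.2).2)
    | inr i, inl j => (i == j)%:R * ((g i.2).1 * sig j.2 + (g i.2).2 * s)
    | inr i, inr j => (i == j)%:R * ((g i.2).1 * (g j.2).1 + (g i.2).2 * (g j.2).2)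
   end).
Proof.
have := gvec_linI (L g) gY.
have e (w : T1 * T2) (j : J + J) : \sum_j' L g j j' * Y w j' = match j with inl j => St w j
   | inr j => (g j.2).1 * xi w.1 j + (g j.2).2 * zr w.2 j end.
  rewrite big_sumType/=; case: j => j /=.
    rewrite /St; congr (_ + _).
      rewrite -[RHS](sum_delta j (fun j' => sig j.2 * xi w.1 j')).
      by apply: eq_bigr => j' _; ring.
    rewrite -[RHS](sum_delta j (fun j' => s * zr w.2 j')).
    by apply: eq_bigr => j' _; ring.
  congr (_ + _).
    rewrite -[RHS](sum_delta j (fun j' => (g j.2).1 * xi w.1 j')).
    by apply: eq_bigr => j' _; ring.
  rewrite -[RHS](sum_delta j (fun j' => (g j.2).2 * zr w.2 j')).
  by apply: eq_bigr => j' _; ring.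
rewrite (_ : (fun w i => _) = (fun w (j : J + J) => match j with inl j => St w j
   | inr j => (g j.2).1 * xi w.1 j + (g j.2).2 * zr w.2 j end)); last first.
  by apply/funext => w; apply/funext => j; rewrite e.
have f (i j : J) (a b a' b' : R) :
   \sum_k (k == i)%:R * a * ((k == j)%:R * b) + \sum_k (k == i)%:R * a' * ((k == j)%:R * b') =
   (i == j)%:R * (a * b + a' * b').
  have h (x y : R) : \sum_k (k == i)%:R * x * ((k == j)%:R * y) = (i == j)%:R * (x * y).
    rewrite -(sum_delta i (fun k => (k == j)%:R * (x * y))).
    by apply: eq_bigr => k _; ring.
  by rewrite !h; ring.
by move=> g1; apply: (gvec_eqK g1) => -[i|i] [j|j]; rewrite big_sumType/= f.
Qed.

Lemma gSt : gvec PP St (fun i j => (i == j)%:R * lam i.2).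
Proof.
have := gvec_lin (gL (fun=> (0, 0))) (fun (i : J) j => match j with inl j => (j == i)%:R | inr _ => 0 end).
have e w i : \sum_j (match j with inl j => (j == i)%:R | inr _ => 0 end) *
    (match j with inl j => St w j | inr j => (0, 0).1 * xi w.1 j + (0, 0).2 * zr w.2 j end) = St w i :> R.
  rewrite big_sumType/= [X in _ + X]big1 ?addr0 ?sum_delta// => j _.
  by rewrite mul0r.
rewrite (_ : (fun w i => _) = St); last first.
  by apply/funext => w; apply/funext => j; rewrite e.
move=> g1; apply: (gvec_eqK g1) => i j; rewrite big_sumType/=.
rewrite [X in _ + X]big1 ?addr0 => [|k _]; last first.
  by rewrite big_sumType/= !big1 ?addr0// => k' _; rewrite !mul0r.
rewrite -[RHS](sum_delta i (fun i => (i == j)%:R * lam i.2)); apply: eq_bigr => k _.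
rewrite big_sumType/= [X in _ + X]big1 ?addr0 => [|k' _]; last by rewrite mulr0 mul0r.
under eq_bigr do rewrite -mulrA; rewrite -mulr_sumr; congr (_ * _).
rewrite (sum_delta j (fun k' => (k == k')%:R * (sig k.2 * sig k'.2 + s * s))).
by have [->|_] := eqVneq k j; rewrite ?mul0r// /lam; ring.
Qed.

Lemma L2_shat (j : J) : L2 PP (fun w => shat (ecode (St w)) j).
Proof.
apply: (@L2_fin _ _ _ _ PP (fun w => ecode (St w)) _ (fun c => shat c j)) => c.
rewrite -[X in measurable X]setTI; exact: (gvec_mvec gSt measurableT (mecode c)).
Qed.

(** [beta] is the regression coefficient on [St], and the regression residual is independent of the
    whole of [St], hence of the codeword; the cross term vanishes. If [lam k = 0] then [sig k] and
    [s] vanish, and the quotients, read as 0, are the right values. *)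
Lemma proj_error (a c : R) (j : J) :
  let k := j.2 in let beta := (a * sig k + c * s) / lam k in
  Ex PP (fun w => (a * xi w.1 j + c * zr w.2 j - beta * shat (ecode (St w)) j) ^+ 2) =
  a ^+ 2 + c ^+ 2 - (a * sig k + c * s) ^+ 2 / lam k +
    beta ^+ 2 * Ex PP (fun w => (St w j - shat (ecode (St w)) j) ^+ 2).
Proof.
move=> k beta.
have lam0 k' : lam k' = 0 -> sig k' = 0 /\ s = 0.
  move/eqP; rewrite paddr_eq0 ?sqr_ge0// !sqrf_eq0 => /andP[/eqP -> /eqP ->].
  by [].
pose bt k' := (a * sig k' + c * s) / lam k'.
have orth k' : sig k' * (a - bt k' * sig k') + s * (c - bt k' * s) = 0.
  have [e|ne] := eqVneq (lam k') 0.
    by have [-> ->] := lam0 _ e; rewrite !mul0r addr0.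
  rewrite (_ : _ + _ = a * sig k' + c * s - bt k' * lam k'); last by rewrite /lam; ring.
  by rewrite /bt divfK// subrr.
have lb : beta * (a * sig k + c * s) = (a * sig k + c * s) ^+ 2 / lam k.
  by rewrite /beta mulrAC -expr2.
have blam : beta ^+ 2 * lam k = (a * sig k + c * s) ^+ 2 / lam k.
  have [e|ne] := eqVneq (lam k) 0; first by rewrite e invr0 !mulr0.
  by rewrite /beta exprMn exprVn; field.
pose g k' := (a - bt k' * sig k', c - bt k' * s).
have gg := gL g.
pose r w := (g j.2).1 * xi w.1 j + (g j.2).2 * zr w.2 j.
pose D w := St w j - shat (ecode (St w)) j.
have Lr : L2 PP r := gvec_L2 gg (inr j).
have LSt : L2 PP (fun w => St w j) := gvec_L2 gg (inl j).
have LD : L2 PP D by apply: L2B => //; exact: L2_shat.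
have rD : Ex PP (fun w => r w * D w) = 0.
  have [|||||||_ ->] := @gvec_indep _ _ _ _ PP _ _ gg (fun p => if p is inr _ then true else false)
     (fun v => v (inr j)) (fun v => v (inl j) - shat (ecode (fun j => v (inl j))) j).
  - move=> [p|p] [p'|p']//= _; have [->|_] := eqVneq p p'; rewrite ?mul0r//.
      by rewrite orth mulr0.
    by rewrite mulrC [X in _ + X]mulrC [X in X + _]mulrC orth mul0r.
  - exact: measurable_coord.
  - apply: measurable_funB; first exact: measurable_coord.
    apply: (@mble_case _ _ _ _ (fun v : vec R (J + J)%type => ecode (fun p => v (inl p))) _
      (fun c _ => shat c j)) => // x.
    have mi : mble ((fun v p => v (inl p)) : vec R (J + J)%type -> vec R J).
      by apply/measurable_vecP => p; exact: measurable_coord.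
    by rewrite -[X in measurable X]setTI; exact: (mi measurableT _ (mecode x)).
  - by move=> v v' e; exact: e.
  - move=> v v' e; rewrite e//; congr (_ - shat (ecode _) _).
    by apply/funext => p; exact: e.
  - exact: L2_ig Lr.
  - exact: L2_ig LD.
  - by rewrite (gvec_mean gg (inr j)) mul0r.
have DE w : a * xi w.1 j + c * zr w.2 j - beta * shat (ecode (St w)) j = r w + beta * D w.
  rewrite -[r w]/((a - beta * sig k) * xi w.1 j + (c - beta * s) * zr w.2 j).
  by rewrite -[D w]/(sig k * xi w.1 j + s * zr w.2 j - shat (ecode (St w)) j); ring.
have -> : Ex PP (fun w => (a * xi w.1 j + c * zr w.2 j - beta * shat (ecode (St w)) j) ^+ 2) =
    Ex PP (fun w => r w ^+ 2 + (2 * beta) * (r w * D w) + beta ^+ 2 * D w ^+ 2).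
  by apply: eq_Ex => w; rewrite DE; ring.
have Ir2 := L2_sqr Lr; have Ird := L2_mul Lr LD; have ID2 := L2_sqr LD.
rewrite ExD; [|by apply: igD => //; exact: igZ|exact: igZ].
rewrite ExD//; last exact: igZ.
rewrite !ExZ// rD mulr0 addr0 (gvec_var gg (inr j)) eqxx mul1r /g /= -/k -[bt k]/beta.
congr (_ + _).
rewrite (_ : _ + _ = a ^+ 2 + c ^+ 2 - 2 * (beta * (a * sig k + c * s)) + beta ^+ 2 * lam k); last first.
  by rewrite /lam; ring.
by rewrite lb blam; ring.
Qed.

Variables (A eta alpha : 'I_l -> R) (b : R).
Hypotheses (A0 : forall k, 0 < A k) (b0 : 0 < b) (eta0 : forall k, 0 <= eta k).
Hypothesis eta1 : forall i, \sum_k eta k * H k i ^+ 2 = 1.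

Let bx k := (1 * sig k + 0 * s) / lam k.
Let bz k := (alpha k * sig k + 1 * s) / lam k.

(** Integrating [inner_bound] over [xi]: each [expR (u w1 c)] has mean 1, so the average over
    codewords is 1 and cancels the [- 1]. Both tilts are centred at regression multiples of the same
    [shat], so by [proj_error] only the errors on [S] remain. *)
Lemma outer_bound :
  n%:R * \sum_k (ln (A k) + ln b + 2 - A k * (1 - sig k ^+ 2 / lam k)
    - b * eta k * (alpha k ^+ 2 + 1 - (alpha k * sig k + s) ^+ 2 / lam k)) -
  \sum_j (A j.2 * (sig j.2 / lam j.2) ^+ 2 + b * eta j.2 * ((alpha j.2 * sig j.2 + s) / lam j.2) ^+ 2) *
    Ex PP (fun w => (St w j - shat (ecode (St w)) j) ^+ 2) <= 2 * ln (\prod_i (M i)%:R).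
Proof.
pose ex w j := 1 * xi w.1 j + 0 * zr w.2 j - bx j.2 * shat (ecode (St w)) j.
pose ez w j := alpha j.2 * xi w.1 j + 1 * zr w.2 j - bz j.2 * shat (ecode (St w)) j.
pose F w := \sum_j (ln (A j.2) / 2 + 2^-1 * xi w.1 j ^+ 2 - A j.2 / 2 * ex w j ^+ 2) -
  \sum_j b / 2 * eta j.2 * ez w j ^+ 2.
have Lxi j : L2 PP (fun w => xi w.1 j) := gvec_L2 gY (inl j).
have Lzr j : L2 PP (fun w => zr w.2 j) := gvec_L2 gY (inr j).
have Lex j : L2 PP (ex^~ j).
  by apply: L2B; [apply: L2D; exact: L2Z|apply: L2Z; exact: L2_shat].
have Lez j : L2 PP (ez^~ j).
  by apply: L2B; [apply: L2D; exact: L2Z|apply: L2Z; exact: L2_shat].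
have mc0 w1 := menc_z (mpsi0 w1) gz.
have Ls w1 j : L2 P2 (fun w2 => shat (ecode (St (w1, w2))) j).
  by under eq_fun do rewrite codeE; exact: (L2_fin P2 (mc0 w1) (fun c => shat c j)).
have Lex' w1 j : L2 P2 (fun w2 => ex (w1, w2) j).
  by rewrite /ex/=; apply: L2B; [apply: L2D; [exact: L2_cst|apply: L2Z; exact: (gvec_L2 gzr)]|exact: L2Z].
have Lez' w1 j : L2 P2 (fun w2 => ez (w1, w2) j).
  by rewrite /ez/=; apply: L2B; [apply: L2D; [exact: L2_cst|apply: L2Z; exact: (gvec_L2 gzr)]|exact: L2Z].
have IF : ig PP F.
  apply: igB; apply: ig_sum => j _; last by apply: igZ; exact: L2_sqr.
  apply: igB; last by apply: igZ; exact: L2_sqr.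
  by apply: igD; [exact: ig_cst|apply: igZ; exact: L2_sqr].
have IF' w1 : ig P2 (fun w2 => F (w1, w2)).
  apply: igB; apply: ig_sum => j _; last by apply: igZ; exact: L2_sqr.
  rewrite /=; apply: igB; last by apply: igZ; exact: L2_sqr.
  exact: ig_cst.
pose u w1 (c : cells M) := \sum_j (ln (A j.2) / 2 + xi w1 j ^+ 2 / 2 - A j.2 * (xi w1 j - bx j.2 * shat c j) ^+ 2 / 2).
have tl c := tilt (fun j => bx j.2 * shat c j) gx (fun j => A0 j.2).
have Iu c : ig P1 (fun w1 => expR (u w1 c)) by case: (tl c).
have Eu c : Ex P1 (fun w1 => expR (u w1 c)) = 1 by case: (tl c).
set K : R := #|cells M|%:R.
have KE : K = \prod_i (M i)%:R by rewrite /K card_cells.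
have step w1 : Ex P2 (fun w2 => F (w1, w2)) + (n * l)%:R * (ln b / 2 + 2^-1) <=
    (\sum_c expR (u w1 c)) / K - 1 + ln K.
  have d0 i v v' : (forall t, v (t, i) = v' (t, i)) -> psi0 w1 i v = psi0 w1 i v'.
    by move=> e; rewrite /psi0; congr phi; apply/funext => t; rewrite e.
  have ib := inner_bound (mpsi0 w1) d0 gz (u w1) (fun t k c => bz k * shat c (t, k) - alpha k * xi w1 (t, k)) b0 eta0 eta1.
  apply: (le_trans _ ib).
  rewrite lerD2r le_eqVlt; apply/orP; left; apply/eqP; apply: eq_Ex => w2.
  rewrite /F; congr (_ - _).
    apply: eq_bigr => j _; rewrite /ex codeE/= mul1r mul0r addr0; ring.
  rewrite pair_bigA/=; apply: eq_bigr => -[t k] _.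
  rewrite /ez codeE/= mul1r /zr/=; congr (_ * _ ^+ 2); ring.
have EF : Ex PP F = n%:R * \sum_k (ln (A k) / 2 + 2^-1) -
    \sum_j (A j.2 / 2 * Ex PP (fun w => ex w j ^+ 2) + b / 2 * eta j.2 * Ex PP (fun w => ez w j ^+ 2)).
  rewrite /F ExB; last 2 first.
  - apply: ig_sum => j _; apply: igB; last by apply: igZ; exact: L2_sqr.
    by apply: igD; [exact: ig_cst|apply: igZ; exact: L2_sqr].
  - by apply: ig_sum => j _; apply: igZ; exact: L2_sqr.
  rewrite Ex_sum; last first.
    move=> j _; apply: igB; last by apply: igZ; exact: L2_sqr.
    by apply: igD; [exact: ig_cst|apply: igZ; exact: L2_sqr].
  rewrite Ex_sum; last by move=> j _; apply: igZ; exact: L2_sqr.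
  rewrite -sum_snd -!sumrN -!big_split/=; apply: eq_bigr => j _.
  rewrite ExB; last 2 first.
  - by apply: igD; [exact: ig_cst|apply: igZ; exact: L2_sqr].
  - by apply: igZ; exact: L2_sqr.
  rewrite ExD ?Ex_cst; last 2 first.
  - exact: ig_cst.
  - by apply: igZ; exact: L2_sqr.
  rewrite !ExZ; [|exact: L2_sqr|exact: L2_sqr|exact: L2_sqr].
  have v1 : Ex PP (fun w => xi w.1 j ^+ 2) = 1.
    by have := gvec_var gY (inl j); rewrite /KI eqxx.
  set a1 := Ex PP (fun w => ex w j ^+ 2); set a2 := Ex PP (fun w => ez w j ^+ 2).
  set a3 := Ex PP _; have -> : a3 = 1 := v1; ring.
have EEF : Ex PP F + (n * l)%:R * (ln b / 2 + 2^-1) <= ln K.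
  have K0 : K != 0.
    rewrite gt_eqF// ltr0n; apply/card_gt0P; by exists (ecode (fun=> 0)).
  have IEF := ig_fubini IF IF'.
  have Is : ig P1 (fun w1 => \sum_c expR (u w1 c)) by apply: ig_sum.
  rewrite (Ex_fubini IF IF').
  have -> : ln K = Ex P1 (fun w1 => K^-1 * (\sum_c expR (u w1 c)) + (ln K - 1)).
    rewrite ExD ?Ex_cst; [|exact: igZ|exact: ig_cst].
    rewrite ExZ// Ex_sum//; under eq_bigr do rewrite Eu.
    by rewrite sumr_const -/K mulVf//; ring.
  rewrite -[X in _ + X](Ex_cst P1) -ExD//; last exact: ig_cst.
  apply: Ex_le => [||w1].
  - by apply: igD => //; exact: ig_cst.
  - by apply: igD; [exact: igZ|exact: ig_cst].
  - by apply: (le_trans (step w1)); rewrite mulrC -addrA (addrC (-1)).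
rewrite -KE; move: EEF; rewrite EF.
pose E j := Ex PP (fun w => (St w j - shat (ecode (St w)) j) ^+ 2).
have pex j : Ex PP (fun w => ex w j ^+ 2) = 1 ^+ 2 + 0 ^+ 2 - (1 * sig j.2 + 0 * s) ^+ 2 / lam j.2 +
    ((1 * sig j.2 + 0 * s) / lam j.2) ^+ 2 * E j := proj_error 1 0 j.
have pez j : Ex PP (fun w => ez w j ^+ 2) = alpha j.2 ^+ 2 + 1 ^+ 2 - (alpha j.2 * sig j.2 + 1 * s) ^+ 2 / lam j.2 +
    ((alpha j.2 * sig j.2 + 1 * s) / lam j.2) ^+ 2 * E j := proj_error (alpha j.2) 1 j.
under [X in (_ - X + _ <= _) -> _]eq_bigr do rewrite pex pez.
move=> h.
have -> : n%:R * \sum_k (ln (A k) + ln b + 2 - A k * (1 - sig k ^+ 2 / lam k)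
    - b * eta k * (alpha k ^+ 2 + 1 - (alpha k * sig k + s) ^+ 2 / lam k)) -
  \sum_j (A j.2 * (sig j.2 / lam j.2) ^+ 2 + b * eta j.2 * ((alpha j.2 * sig j.2 + s) / lam j.2) ^+ 2) * E j =
  2 * (n%:R * \sum_k (ln (A k) / 2 + 2^-1) - \sum_j (A j.2 / 2 *
    (1 ^+ 2 + 0 ^+ 2 - (1 * sig j.2 + 0 * s) ^+ 2 / lam j.2 + ((1 * sig j.2 + 0 * s) / lam j.2) ^+ 2 * E j) +
    b / 2 * eta j.2 * (alpha j.2 ^+ 2 + 1 ^+ 2 - (alpha j.2 * sig j.2 + 1 * s) ^+ 2 / lam j.2 +
     ((alpha j.2 * sig j.2 + 1 * s) / lam j.2) ^+ 2 * E j)) + (n * l)%:R * (ln b / 2 + 2^-1)).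
  have -> : (n * l)%:R * (ln b / 2 + 2^-1) = n%:R * \sum_(k < l) (ln b / 2 + 2^-1).
    by rewrite sumr_const card_ord natrM -mulrA -(mulr_natl (_ + _) l).
  rewrite -!sum_snd mulrDr mulrBr !mulr_sumr -!sumrN -!big_split/=.
  by apply: eq_bigr => j _; move: (lam j.2)^-1 (E j) => il e; field.
by rewrite ler_pM2l.
Qed.

End OuterBound.

(** * The converse *)

Section Weights.
Context {R : realType}.

(* weighted index classes: 0 has the larger eigenvalue *)
(* [p0] and [p1] are the multiplicities of the larger and of the smaller eigenvalue of [Gamma_S];
   the two cases of the theorem correspond to [(p0, p1) = (1, l - 1)] and [(l - 1, 1)]. *)
Lemma weights (p0 p1 L l0 l1 x0 x1 q : R) :
  0 < p0 -> 0 < p1 -> p0 + p1 = L -> 0 < q -> 0 <= l1 -> l1 <= l0 ->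
  0 <= x0 <= l0 -> 0 <= x1 <= l1 -> 0 < p0 * x0 + p1 * x1 ->
  let mu := (l1 - l1 * (l1 + q)^-1 * l1) / (l0 - l0 * (l0 + q)^-1 * l0) in
  0 <= p1 * x1 ^+ 2 * l0 ^+ 2 * mu * (mu - 1) + L * x0 ^+ 2 * l1 ^+ 2 ->
  exists th e0 e1 : R, [/\ 0 <= th, 0 <= e0, 0 <= e1, p0 * e0 + p1 * e1 = L &
   ((l0 + q) / (l1 + q) * (l0 - l1) / l0 ^+ 2 +
      (l1 + q) / q * e0 * (l1 * ((l0 + q) / (l1 + q)) ^+ 2 / l0 ^+ 2) = th * (x0 / l0) ^+ 2) /\
   ((l1 + q) / q * e1 * (l1 / l1 ^+ 2) = th * (x1 / l1) ^+ 2)].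
Proof.
move=> p00 p10 <- q0 l10 l01 /andP[x00 x0l] /andP[x10 x1l] xp mu cnd.
have l0q : 0 < l0 + q by lra.
have l1q : 0 < l1 + q by lra.
have [l1z|l1n] := eqVneq l1 0.
  have x1z : x1 = 0 by lra.
  have x0p : 0 < x0 by move: xp; rewrite x1z mulr0 addr0 pmulr_rgt0.
  have l0p : 0 < l0 by lra.
  (* For [l1 = 0] also [x1 = 0] and the second equation is trivial. All the weight goes to the
     larger eigenvalue, and [th] is read off from the first equation. *)
  exists ((l0 + q) / q / l0 / (x0 / l0) ^+ 2), ((p0 + p1) / p0), 0; split => //.
  - by rewrite divr_ge0 ?sqr_ge0// !divr_ge0// ltW.
  - by rewrite divr_ge0// ltW// addr_gt0.
  - by field; rewrite gt_eqF.
  rewrite l1z x1z; split; last by rewrite !mul0r expr0n mulr0 mulr0.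
  by field; rewrite !gt_eqF//.
have l1p : 0 < l1 by rewrite lt_neqAle eq_sym l1n.
have l0p : 0 < l0 by lra.
pose a := (l0 + q) / (l1 + q) * (l0 - l1) / l0 ^+ 2.
pose B := (l1 + q) / q.
pose tau := l1 * ((l0 + q) / (l1 + q)) ^+ 2 / l0 ^+ 2.
pose w0 := (x0 / l0) ^+ 2; pose w1 := (x1 / l1) ^+ 2.
have B0 : 0 < B by rewrite divr_gt0.
have tau0 : 0 < tau by rewrite divr_gt0// ?exprn_gt0// mulr_gt0// exprn_gt0// divr_gt0.
have a0 : 0 <= a.
  by rewrite divr_ge0 ?sqr_ge0// mulr_ge0 ?subr_ge0// divr_ge0 ?ltW.
have w00 : 0 <= w0 := sqr_ge0 _; have w10 : 0 <= w1 := sqr_ge0 _.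
(* Eliminating [e0] and [e1] from the three linear equations leaves
   [th * D = p0 * a + B * (p0 + p1) * tau]. *)
pose D := p0 * w0 + p1 * w1 * l1 * tau.
have D0 : 0 < D.
  have w1t : 0 <= p1 * w1 * l1 * tau.
    by rewrite (mulr_ge0 _ (ltW tau0))// (mulr_ge0 _ l10)// (mulr_ge0 (ltW p10)).
  have [x0z|x0n] := eqVneq x0 0.
    have x1p : 0 < x1 by move: xp; rewrite x0z mulr0 add0r pmulr_rgt0.
    have w1p : 0 < w1 by rewrite exprn_gt0// divr_gt0.
    apply: ltr_wpDl; first exact: mulr_ge0 (ltW p00) w00.
    exact: mulr_gt0 (mulr_gt0 (mulr_gt0 p10 w1p) l1p) tau0.
  rewrite ltr_pwDl// mulr_gt0// exprn_gt0// divr_gt0//.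
  by rewrite lt_neqAle eq_sym x0n.
(* Only the sign of [e0] is in question; after elimination it is this inequality, which is the
   hypothesis up to a positive factor. *)
have key : a * (p1 * w1 * l1) <= w0 * (B * (p0 + p1)).
  rewrite -subr_ge0.
  rewrite (_ : _ - _ = (p1 * x1 ^+ 2 * l0 ^+ 2 * mu * (mu - 1) + (p0 + p1) * x0 ^+ 2 * l1 ^+ 2) *
     ((l1 + q) / (q * l1 ^+ 2 * l0 ^+ 2))).
    by rewrite mulr_ge0// ltW// divr_gt0// !mulr_gt0// ?exprn_gt0.
  rewrite /a /w0 /w1 /B /mu; field.
  by rewrite !gt_eqF//= (_ : l0 * (l0 + q) - l0 * l0 = l0 * q) ?gt_eqF ?mulr_gt0//; ring.
pose th := (p0 * a + B * (p0 + p1) * tau) / D.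
have thD : th * D = p0 * a + B * (p0 + p1) * tau by rewrite /th divfK// gt_eqF.
have th0 : 0 <= th.
  apply: divr_ge0 (ltW D0); apply: addr_ge0; first exact: mulr_ge0 (ltW p00) a0.
  exact: mulr_ge0 (mulr_ge0 (ltW B0) (ltW (addr_gt0 p00 p10))) (ltW tau0).
pose e1 := th * w1 * l1 / B.
pose e0 := (th * w0 - a) / (B * tau).
exists th, e0, e1; split => //.
- apply: divr_ge0; last exact: mulr_ge0 (ltW B0) (ltW tau0).
  rewrite subr_ge0 -(ler_pM2r D0).
  have -> : th * w0 * D = w0 * (p0 * a + B * (p0 + p1) * tau) by rewrite -thD; ring.
  rewrite -subr_ge0 (_ : _ - _ = (w0 * (B * (p0 + p1)) - a * (p1 * w1 * l1)) * tau).
    by apply: mulr_ge0 (ltW tau0); rewrite subr_ge0.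
  by rewrite -[D]/(p0 * w0 + p1 * w1 * l1 * tau); ring.
- apply: divr_ge0 (ltW B0); exact: mulr_ge0 (mulr_ge0 th0 w10) l10.
- rewrite /e0 /e1.
  have -> : p0 * ((th * w0 - a) / (B * tau)) + p1 * (th * w1 * l1 / B) =
     (th * D - p0 * a) / (B * tau) by rewrite /D; field; rewrite !gt_eqF.
  by rewrite thD; field; rewrite !gt_eqF.
split; rewrite -/B -/w0 -/w1 -/tau -/a.
  by rewrite /e0; field; rewrite !gt_eqF.
by rewrite /e1; field; rewrite !gt_eqF.
Qed.

(** In a direction of eigenvalue [lk] with output [U = S + sqrt q G]: [A] and [b] are the posterior
    precisions of [xi] given [U] and of [zeta'] given [xi] and [U], [al] is minus the coefficient of
    [xi] in the mean of [zeta'] given both, and [D] is the mean square error on [S] given [U]. The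
    first two identities say that an error [D] makes both normalized quadratic terms equal to 1. *)
Lemma slot_identities (lk lam q s sg : R) : 0 < q -> 0 <= lam -> lam <= lk ->
  s ^+ 2 = lam -> sg ^+ 2 = lk - lam ->
  let A := (lk + q) / (lam + q) in let b := (lam + q) / q in
  let al := s * sg / (lam + q) in let D := lk * q / (lk + q) in
  [/\ A * (1 - sg ^+ 2 / lk) = 1 - A * (sg / lk) ^+ 2 * D,
      b * (al ^+ 2 + 1 - (al * sg + s) ^+ 2 / lk) = 1 - b * ((al * sg + s) / lk) ^+ 2 * D,
      A * (sg / lk) ^+ 2 = A * (lk - lam) / lk ^+ 2 &
      ((al * sg + s) / lk) ^+ 2 = lam * ((lk + q) / (lam + q)) ^+ 2 / lk ^+ 2].
Proof.
move=> q0 lam0 laml s2 sg2 A b al D.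
have lamq : lam + q != 0 by rewrite gt_eqF//; lra.
have lkq : lk + q != 0 by rewrite gt_eqF//; lra.
have qn : q != 0 by rewrite gt_eqF.
have kE : al * sg + s = s * ((lk + q) / (lam + q)).
  rewrite /al (_ : _ + _ = s * (sg ^+ 2 + lam + q) / (lam + q)); last by field.
  by rewrite sg2 subrK mulrA.
have alE : al ^+ 2 = lam * (lk - lam) / (lam + q) ^+ 2.
  by rewrite /al expr_div_n exprMn s2 sg2.
have k2 : (al * sg + s) ^+ 2 = lam * ((lk + q) / (lam + q)) ^+ 2.
  by rewrite kE exprMn s2.
have [lkz|lkn] := eqVneq lk 0.
  have lamz : lam = 0 by lra.
  have sz : s = 0 by apply/eqP; rewrite -sqrf_eq0 s2 lamz.
  have sgz : sg = 0 by apply/eqP; rewrite -sqrf_eq0 sg2 lamz lkz subr0.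
  rewrite /A /b /D /al sz sgz lkz lamz !add0r !(mul0r, mulr0, subr0, addr0, invr0, expr0n)/=.
  rewrite divff//; split => //; rewrite ?(mul0r, mulr0, subr0, addr0, add0r)//; ring.
split.
- by rewrite sg2 expr_div_n sg2 /A /D; field; rewrite lkn lkq.
- rewrite alE [in RHS]expr_div_n k2 /b /D; field.
  by rewrite qn lkn lkq lamq.
- by rewrite expr_div_n sg2 mulrA.
- by rewrite expr_div_n k2.
Qed.

Lemma sum_class (l : nat) (a b : R) : (0 < l)%N ->
  \sum_(k < l) (if val k == 0%N then a else b) = a + (l.-1)%:R * b.
Proof.
case: l => // l _; rewrite big_ord_recl/=; congr (_ + _).
by rewrite sumr_const card_ord mulr_natl.
Qed.

(** The Householder reflection exchanging the first basis vector with the unit constant vector: [u]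
    is their difference, of squared norm [2 * (1 - a)]. It is symmetric, so orthonormal rows give
    orthonormal columns. *)
Lemma ortho_basis (l : nat) : (2 <= l)%N -> exists H : 'I_l -> 'I_l -> R,
  [/\ forall k k', \sum_i H k i * H k' i = (k == k')%:R,
      forall i i', \sum_k H k i * H k i' = (i == i')%:R &
      forall k i, val k = 0%N -> H k i = (Num.sqrt l%:R)^-1].
Proof.
move=> l2; pose a : R := (Num.sqrt l%:R)^-1.
have sl : 1 < Num.sqrt (l%:R : R) by rewrite -[X in X < _]sqrtr1 ltr_sqrt ?ltr1n// ltr0n (leq_trans _ l2).
have a0 : 0 < a by rewrite invr_gt0; lra.
have a1 : a < 1 by rewrite invf_lt1//; lra.
have la : l%:R * a ^+ 2 = 1.
  by rewrite /a exprVn sqr_sqrtr// divff// pnatr_eq0 -lt0n (leq_trans _ l2).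
pose u (i : 'I_l) := (val i == 0%N)%:R - a.
have u2 : \sum_i u i * u i = 2 * (1 - a).
  rewrite (eq_bigr (fun i : 'I_l => if val i == 0%N then (1 - a) ^+ 2 else a ^+ 2)); last first.
    by move=> i _; rewrite /u; case: eqP => _ /=; ring.
  rewrite sum_class ?(leq_trans _ l2)//.
  have -> : (l.-1)%:R = l%:R - 1 :> R by rewrite -[in RHS](prednK (leq_trans _ l2))// -natr1 addrK.
  rewrite mulrBl la; ring.
pose H k i := (k == i)%:R - u k * u i / (1 - a).
have HH k k' : \sum_i H k i * H k' i = (k == k')%:R.
  transitivity (\sum_i ((i == k)%:R * (k' == i)%:R - (i == k)%:R * (u k' * u i / (1 - a)) -
     (i == k')%:R * (u k * u i / (1 - a)) + (u k * u k' / (1 - a) ^+ 2) * (u i * u i))).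
    apply: eq_bigr => i _; rewrite /H (eq_sym k i) (eq_sym i k').
    by field; rewrite gt_eqF// subr_gt0.
  rewrite big_split/= -mulr_sumr u2 !big_split/= !sumrN !sum_delta (eq_sym k' k).
  by field; rewrite gt_eqF// subr_gt0.
exists H; split => //.
- have Hs i k : H k i = H i k by rewrite /H (eq_sym k i) (mulrC (u k)).
  by move=> i i'; under eq_bigr do rewrite ![H _ i]Hs ![H _ i']Hs; exact: HH.
- move=> k i k0; rewrite /H.
  have -> : u k = 1 - a by rewrite /u k0 eqxx.
  have n1 : 1 - a != 0 by rewrite gt_eqF// subr_gt0.
  rewrite mulrAC divff// mul1r /u -val_eqE k0 eq_sym.
  by rewrite opprB addrCA subrr addr0.
Qed.

End Weights.

(** * Rotation of the source to its eigendirections *)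

Section SourceFacts.
Context {R : realType}.
Variable l : nat.

Definition lamk (g rho : R) (k : 'I_l) := if val k == 0%N then lam1 l g rho else lam2 g rho.

Variables (H : 'I_l -> 'I_l -> R).
Hypothesis HH : forall k k', \sum_i H k i * H k' i = (k == k')%:R.
Hypothesis HH' : forall i i', \sum_k H k i * H k i' = (i == i')%:R.
Hypothesis H0 : forall k i, val k = 0%N -> H k i = (Num.sqrt l%:R)^-1.

Lemma sumH k : (0 < l)%N -> \sum_i H k i = (val k == 0%N)%:R * Num.sqrt l%:R.
Proof.
move=> l0; have s0 : Num.sqrt (l%:R : R) != 0 by rewrite gt_eqF// sqrtr_gt0 ltr0n.
have := HH k (Ordinal l0).
under eq_bigr do rewrite (H0 _ (k := Ordinal l0))//.
by rewrite -mulr_suml -val_eqE/= => <-; rewrite divfK.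
Qed.

(** [eqcov] is [(1 - rho) * g] times the identity plus [rho * g] times the all-ones matrix, and
    every row of [H] but the first sums to 0. *)
Lemma diag_eqcov g rho k k' : (0 < l)%N ->
  \sum_i \sum_i' H k i * H k' i' * eqcov g rho i i' = (k == k')%:R * lamk g rho k.
Proof.
move=> l0.
transitivity (\sum_i \sum_i' ((i' == i)%:R * ((1 - rho) * g * (H k i * H k' i')) + rho * g * H k i * H k' i')).
  apply: eq_bigr => i _; apply: eq_bigr => i' _; rewrite /eqcov eq_sym.
  by case: eqP => _ /=; ring.
under eq_bigr do rewrite big_split/= (sum_delta _ (fun i' => (1 - rho) * g * (H k _ * H k' i'))) -mulr_sumr.
rewrite big_split/= -mulr_sumr HH -mulr_suml -mulr_sumr !sumH//.
rewrite /lamk /lam1 /lam2 -!val_eqE; have [->|kk'] := eqVneq (val k) (val k').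
  case: (val k' == 0%N); rewrite ?(mulr1, mul1r, mul0r, mulr0, addr0)//.
  rewrite -mulrA -expr2 sqr_sqrtr ?ler0n//.
  rewrite -[l in l%:R](prednK l0) -natr1; ring.
rewrite mulr0 mul0r add0r; case: eqP => k0; last by rewrite mul0r mulr0 mul0r.
by case: eqP => k'0; rewrite ?mul0r ?mulr0//; move: kk'; rewrite k0 k'0 eqxx.
Qed.

Lemma psd_lamk g rho k : (0 < l)%N -> psd_eqcov l g rho -> 0 <= lamk g rho k.
Proof. by move=> l0 /(_ (H k)); rewrite diag_eqcov// eqxx mul1r. Qed.

Lemma orth_sqsum (v : 'I_l -> R) : \sum_k (\sum_i H k i * v i) ^+ 2 = \sum_i v i ^+ 2.
Proof.
transitivity (\sum_i \sum_i' (i' == i)%:R * (v i * v i')); last first.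
  by apply: eq_bigr => i _; rewrite (sum_delta i (fun i' => v i * v i')).
transitivity (\sum_k \sum_i \sum_i' (H k i * H k i') * (v i * v i')).
  apply: eq_bigr => k _; rewrite expr2 mulr_suml; apply: eq_bigr => i _.
  by rewrite mulr_sumr; apply: eq_bigr => i' _; ring.
rewrite exchange_big/=; apply: eq_bigr => i _; rewrite exchange_big/=; apply: eq_bigr => i' _.
by rewrite -mulr_suml HH' eq_sym.
Qed.

Context {d : measure_display} {T : measurableType d}.
Variables (P : probability T R) (X Z : nat -> 'I_l -> T -> R).
Variables (gX rX gZ rZ : R).
Hypotheses (psdX : psd_eqcov l gX rX) (psdZ : psd_eqcov l gZ rZ).
Hypothesis src : gauss_source P X Z gX rX gZ rZ.

(** White noise of any finite size on the given space: the first component of [X] at [#|J|] distinct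
    times, divided by its standard deviation. *)
Lemma std_gvec (J : finType) : (0 < l)%N -> 0 < gX -> exists Y : T -> J -> R, gvec P Y KI.
Proof.
move=> l0 gX0; pose i0 := Ordinal l0.
have sg : Num.sqrt gX ^+ 2 = gX by rewrite sqr_sqrtr// ltW.
have := source_gvec psdX psdZ src (fun j (t : 'I_#|J|) i => (t == enum_rank j)%:R * ((i == i0)%:R / Num.sqrt gX))
  (fun _ _ _ => 0).
move=> g; eexists; apply: (gvec_eqK g) => j j'.
transitivity (\sum_(t < #|J|) (t == enum_rank j)%:R * ((t == enum_rank j')%:R : R)).
  apply: eq_bigr => t _.
  transitivity (\sum_(i < l) (i == i0)%:R * (\sum_(i' < l) (i' == i0)%:R *
     ((t == enum_rank j)%:R * (t == enum_rank j')%:R / Num.sqrt gX ^+ 2 * eqcov gX rX i i'))).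
    apply: eq_bigr => i _; rewrite mulr_sumr; apply: eq_bigr => i' _.
    by field; rewrite gt_eqF// sqrtr_gt0.
  by rewrite !sum_delta sg /eqcov eqxx divfK// gt_eqF.
by rewrite sum_delta /KI (inj_eq enum_rank_inj).
Qed.

Lemma rot_gvec (I : finType) (n : nat) (tau : I -> 'I_n) (kap : I -> 'I_l) (a b : I -> R) :
  (0 < l)%N ->
  gvec P (fun w j => \sum_i H (kap j) i * (a j * X (tau j) i w + b j * Z (tau j) i w))
   (fun j j' => (tau j == tau j')%:R * (kap j == kap j')%:R *
      (a j * a j' * lamk gX rX (kap j) + b j * b j' * lamk gZ rZ (kap j))).
Proof.
move=> l0.
have g := slot_gvec psdX psdZ src tau (fun j i => a j * H (kap j) i) (fun j i => b j * H (kap j) i).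
rewrite (_ : (fun w j => _) = (fun w j => \sum_i (a j * H (kap j) i * X (tau j) i w +
    b j * H (kap j) i * Z (tau j) i w))); last first.
  by apply/funext => w; apply/funext => j; apply: eq_bigr => i _; ring.
apply: (gvec_eqK g) => j j'; rewrite -mulrA; congr (_ * _).
rewrite mulrDr ![(kap j == kap j')%:R * _]mulrCA -!(diag_eqcov _ _ _ _ l0) !mulr_sumr -big_split/=.
apply: eq_bigr => i _; rewrite !mulr_sumr -big_split/=; apply: eq_bigr => i' _; ring.
Qed.

End SourceFacts.

(** * The converse for one block code *)

Section ConverseBlock.
Context {R : realType} (l : nat) {d : measure_display} {T : measurableType d}.
Variables (P : probability T R) (X Z : nat -> 'I_l -> T -> R).
Variables (gX rX gZ rZ : R).
Hypotheses (l0 : (0 < l)%N) (gX0 : 0 < gX).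
Hypotheses (psdX : psd_eqcov l gX rX) (psdZ : psd_eqcov l gZ rZ).
Hypothesis src : gauss_source P X Z gX rX gZ rZ.
Variables (H : 'I_l -> 'I_l -> R).
Hypothesis HH : forall k k', \sum_i H k i * H k' i = (k == k')%:R.
Hypothesis HH' : forall i i', \sum_k H k i * H k i' = (i == i')%:R.
Hypothesis H0 : forall k i, val k = 0%N -> H k i = (Num.sqrt l%:R)^-1.
Variables (n : nat) (M : 'I_l -> nat) (phi : forall i : 'I_l, ('I_n -> R) -> 'I_(M i)).
Hypothesis bphi : forall i c, borelRn [set s | phi i s = c].
Local Notation J := ('I_n * 'I_l)%type.

Let lX (k : 'I_l) := lamk gX rX k.
Let lZ (k : 'I_l) := lamk gZ rZ k.
Let lS k := lX k + lZ k.

Definition rotS w (j : J) := \sum_i H j.2 i * (X j.1 i w + Z j.1 i w).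

Lemma unrot_rotS w i : unrot H (rotS w) i = Sblock X Z i w.
Proof.
apply/funext => t; rewrite /unrot /rotS /Sblock/=.
under eq_bigr do rewrite mulr_sumr; rewrite exchange_big/=.
rewrite -(sum_delta i (fun i' => X t i' w + Z t i' w)); apply: eq_bigr => i' _.
by under eq_bigr do rewrite mulrA; rewrite -mulr_suml HH' eq_sym.
Qed.

Definition xhat (c : cells M) (t : nat) (i : 'I_l) : R :=
  let C := [set w | forall i, i \in [set: 'I_l]%SET -> phi i (@Sblock R l n T X Z i w) = c i] in
  fine (\int[P]_(w in C) (X t i w)%:E)%E / fine (P C).

Lemma XhatE t i w : Xhat P phi X Z [set: 'I_l]%SET t i w = xhat (ecode phi H (rotS w)) t i.
Proof.
rewrite /Xhat /xhat (_ : cell _ _ _ _ _ = [set w' | forall i, i \in [set: 'I_l]%SET ->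
  phi i (@Sblock R l n T X Z i w') = ecode phi H (rotS w) i])//.
by apply/seteqP; split => w' /= h k kA; rewrite (h k kA) ffunE unrot_rotS.
Qed.

(** The left coordinates are the rotated [S]; the right ones are the residuals [X - (lX / lS) S] of
    the regression of [X] on [S], uncorrelated with them. *)
Let g2 := rot_gvec HH H0 psdX psdZ src
  (fun j : J + J => match j with inl j | inr j => j.1 end)
  (fun j : J + J => match j with inl j | inr j => j.2 end)
  (fun j => match j with inl j => 1 | inr j => 1 - lX j.2 / lS j.2 end)
  (fun j => match j with inl j => 1 | inr j => - (lX j.2 / lS j.2) end) l0.

Let Rk w (j : J) := \sum_i H j.2 i *
  ((1 - lX j.2 / lS j.2) * X j.1 i w + (- (lX j.2 / lS j.2)) * Z j.1 i w).

Let lX0 k : 0 <= lX k. Proof. exact: (psd_lamk HH H0 k l0 psdX). Qed.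
Let lZ0 k : 0 <= lZ k. Proof. exact: (psd_lamk HH H0 k l0 psdZ). Qed.
Let lS0 k : lS k = 0 -> lX k = 0 /\ lZ k = 0.
Proof. by have := lX0 k; have := lZ0 k; rewrite /lS => ? ? ?; split; lra. Qed.

Lemma rotS_gvec : gvec P rotS (fun i j : J => (i == j)%:R * lS i.2).
Proof.
have g := rot_gvec HH H0 psdX psdZ src (fun j : J => j.1) (fun j : J => j.2) (fun=> 1) (fun=> 1) l0.
have e : (fun w (j : J) => \sum_i H j.2 i * (1 * X j.1 i w + 1 * Z j.1 i w)) = rotS.
  apply/funext => w; apply/funext => j; apply: eq_bigr => i _; by rewrite !mul1r.
rewrite e in g; apply: (gvec_eqK g) => -[t k] [t' k'] /=.
by rewrite xpair_eqE /lS !mul1r -natrM mulnb.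
Qed.

Variable (q : R).
Hypothesis q0 : 0 < q.

Let L2_code (f : cells M -> R) : L2 P (fun w => f (ecode phi H (rotS w))).
Proof.
apply: (L2_fin P (c := fun w => ecode phi H (rotS w)) _ f) => c.
by rewrite -[X in measurable X]setTI; exact: (gvec_mvec rotS_gvec measurableT (mecode bphi H c)).
Qed.

Let Xrot w (j : J) := \sum_i H j.2 i * X j.1 i w.
Let gr (c : cells M) (j : J) := \sum_i H j.2 i * xhat c j.1 i.
(** The decoder's estimate of [X] read as an estimate of [S], by undoing the regression coefficient.
    If that coefficient is 0 the value is 0, and the error on [S] in this direction enters the
    bounds with coefficient 0. *)
Let shat (c : cells M) (j : J) := gr c j / (lX j.2 / lS j.2).

Let dpart k := dmin_part (lX k) (lZ k) (lS k).

(** The residual of [X] on [S] is independent of the codeword and contributes the irreducible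
    [dpart]; what remains is the error on [S] times the squared coefficient. There is equality when
    that coefficient is not 0. *)
Lemma mse_lower (j : J) :
  dpart j.2 + (lX j.2 / lS j.2) ^+ 2 *
     Ex P (fun w => (rotS w j - shat (ecode phi H (rotS w)) j) ^+ 2) <=
  Ex P (fun w => (Xrot w j - gr (ecode phi H (rotS w)) j) ^+ 2).
Proof.
set b := lX j.2 / lS j.2.
have LR : L2 P (fun w => Rk w j) := gvec_L2 g2 (inr j).
have LS : L2 P (fun w => rotS w j) := gvec_L2 rotS_gvec j.
have Lg := L2_code (fun c => gr c j).
have Lh := L2_code (fun c => shat c j).
have LD : L2 P (fun w => b * rotS w j - gr (ecode phi H (rotS w)) j).
  by apply: L2B => //; exact: L2Z.
have bS k : lX k / lS k * lS k = lX k.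
  by have [e|ne] := eqVneq (lS k) 0; [have [-> _] := lS0 e; rewrite !mul0r|rewrite divfK].
have RD : Ex P (fun w => Rk w j * (b * rotS w j - gr (ecode phi H (rotS w)) j)) = 0.
  have sE w : (fun p : J => \sum_i H p.2 i * (1 * X p.1 i w + 1 * Z p.1 i w)) = rotS w.
    by apply/funext => p; apply: eq_bigr => i _; rewrite !mul1r.
  have [|||||||_] := @gvec_indep _ _ _ _ P _ _ g2 (fun p => if p is inr _ then true else false)
     (fun v => v (inr j)) (fun v => b * v (inl j) - gr (ecode phi H (fun p => v (inl p))) j).
  - move=> [p|p] [p'|p']//= _; have [e1|] := eqVneq p.1 p'.1; rewrite ?mul0r//;
    have [e2|] := eqVneq p.2 p'.2; rewrite ?mulr0 ?mul0r// e2 !mul1r.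
      rewrite -/(lX p'.2) -/(lZ p'.2) (_ : _ + _ = lX p'.2 - lX p'.2 / lS p'.2 * (lX p'.2 + lZ p'.2)); last by ring.
      by rewrite bS subrr.
    rewrite !mulr1 -/(lX p'.2) -/(lZ p'.2) (_ : _ + _ = lX p'.2 - lX p'.2 / lS p'.2 * (lX p'.2 + lZ p'.2)); last by ring.
    by rewrite bS subrr.
  - exact: measurable_coord.
  - apply: measurable_funB; first by apply: measurable_funM => //; exact: measurable_coord.
    apply: (@mble_case _ _ _ _ (fun v : vec R (J + J)%type => ecode phi H (fun p => v (inl p))) _
      (fun c _ => gr c j)) => // x.
    have mi : mble ((fun v p => v (inl p)) : vec R (J + J)%type -> vec R J).
      by apply/measurable_vecP => p; exact: measurable_coord.
    by rewrite -[X in measurable X]setTI; exact: (mi measurableT _ (mecode bphi H x)).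
  - by move=> v v' e; exact: e.
  - move=> v v' e; rewrite e//; congr (_ - gr (ecode _ _ _) _).
    by apply/funext => p; exact: e.
  - exact: L2_ig LR.
  - apply: eq_ig (L2_ig LD) => w /=; rewrite sE; congr (_ * _ - _).
    by apply: eq_bigr => i _; rewrite !mul1r.
  rewrite (gvec_mean g2 (inr j)) mul0r => h; rewrite -[RHS]h; apply: eq_Ex => w /=.
  by rewrite sE -[rotS w j]/(rotS w j) /rotS; congr (_ * (_ * _ - _)); apply: eq_bigr => i _; rewrite !mul1r.
have XE w : Xrot w j - gr (ecode phi H (rotS w)) j =
   Rk w j + (b * rotS w j - gr (ecode phi H (rotS w)) j).
  rewrite addrA; congr (_ - _); rewrite /Xrot /Rk /rotS mulr_sumr -big_split/=.
  by apply: eq_bigr => i _; rewrite -/b; ring.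
have -> : Ex P (fun w => (Xrot w j - gr (ecode phi H (rotS w)) j) ^+ 2) =
    Ex P (fun w => Rk w j ^+ 2 + 2 * (Rk w j * (b * rotS w j - gr (ecode phi H (rotS w)) j)) +
      (b * rotS w j - gr (ecode phi H (rotS w)) j) ^+ 2).
  by apply: eq_Ex => w; rewrite XE; ring.
have IR := L2_sqr LR; have IRD := L2_mul LR LD; have ID := L2_sqr LD.
rewrite ExD//; last by apply: igD => //; exact: igZ.
rewrite ExD//; last exact: igZ.
rewrite ExZ// RD mulr0 addr0 (gvec_var g2 (inr j)) !eqxx !mul1r.
apply: lerD.
  rewrite -/b -/(lX j.2) -/(lZ j.2) /dpart /dmin_part; case: eqVneq => [e|ne].
    by have [-> ->] := lS0 e; rewrite !mulr0 addr0.
  by rewrite le_eqVlt /b; apply/orP; left; apply/eqP; move: ne; rewrite /lS => ne; field.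
have [b0|bn] := eqVneq b 0.
  by rewrite b0 expr0n mul0r; apply: Ex_ge0 => w; exact: sqr_ge0.
rewrite -ExZ; last by apply: L2_sqr; exact: L2B.
rewrite le_eqVlt; apply/orP; left; apply/eqP; apply: eq_Ex => w.
by rewrite -exprMn mulrBr /shat -/b (mulrC b (_ / b)) divfK.
Qed.

(** The equations on the weights turn the coefficient of each error on [S] in [outer_bound] into
    [th * (lX k / lS k) ^+ 2], the same multiple [th] of its share in [mse_lower]. The errors can
    then be summed over directions and replaced by the total distortion. *)
Lemma converse_block (lam th D : R) (eta : 'I_l -> R) :
  0 <= lam -> (forall k, lam <= lS k) -> 0 <= th -> (forall k, 0 <= eta k) ->
  (forall i, \sum_k eta k * H k i ^+ 2 = 1) ->
  (forall k, (lS k + q) / (lam + q) * (lS k - lam) / lS k ^+ 2 +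
      (lam + q) / q * eta k * (lam * ((lS k + q) / (lam + q)) ^+ 2 / lS k ^+ 2) = th * (lX k / lS k) ^+ 2) ->
  (\sum_(i in [set: 'I_l]%SET) \sum_(t < n) mse P phi X Z [set: 'I_l]%SET t i <= D%:E)%E ->
  n%:R * \sum_k (ln ((lS k + q) / q) + 1 - eta k + th * (lX k / lS k) ^+ 2 * (lS k * q / (lS k + q))) -
   th * (D - n%:R * \sum_k dpart k) <= 2 * ln (\prod_i (M i)%:R).
Proof.
move=> lam0 laml th0 eta0 eta1 wt hD.
have [Y gY] := std_gvec psdX psdZ src J l0 gX0.
pose sig k := Num.sqrt (lS k - lam); pose s := Num.sqrt lam.
have sig2 k : sig k ^+ 2 = lS k - lam by rewrite sqr_sqrtr// subr_ge0.
have s2 : s ^+ 2 = lam by rewrite sqr_sqrtr.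
have lkE k : sig k ^+ 2 + s ^+ 2 = lS k by rewrite sig2 s2 subrK.
have lamq : 0 < lam + q by rewrite ltr_wpDl.
have lSq k : 0 < lS k + q by rewrite ltr_wpDl// (le_trans lam0).
have A0 k : 0 < (lS k + q) / (lam + q) by rewrite divr_gt0.
have b0 : 0 < (lam + q) / q by rewrite divr_gt0.
(* The same white vector serves as [xi] and as [zeta]: read on the two factors of [P \x P], its
   copies are independent. *)
have ob := outer_bound bphi gY gY HH HH' sig s shat (fun k => s * sig k / (lam + q)) A0 b0 eta0 eta1.
have gS := gSt gY gY HH sig s.
cbv beta in ob, gS.
set St := (fun (w : T * T) (j : J) => _ : R) in gS.
pose E j := Ex P (fun w => (rotS w j - shat (ecode phi H (rotS w)) j) ^+ 2).
have EE j : Ex (P \x P)%E (fun w => (St w j - shat (ecode phi H (St w)) j) ^+ 2) = E j.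
  have gS' : gvec (P \x P)%E St (fun i j => (i == j)%:R * lS i.2).
    by apply: (gvec_eqK gS) => i i'; rewrite lkE.
  have sl := gvec_same_law gS' rotS_gvec.
  have mf : mble (fun v : vec R J => (v j - shat (ecode phi H v) j) ^+ 2).
    apply: measurable_funX; apply: measurable_funB; first exact: measurable_coord.
    exact: (mble_case (mecode bphi H) (g := fun c _ => shat c j)).
  exact: (same_law_Ex (gvec_mvec gS') (gvec_mvec rotS_gvec) sl mf).
have {}ob : n%:R * \sum_k (ln ((lS k + q) / q) + 1 - eta k + th * (lX k / lS k) ^+ 2 * (lS k * q / (lS k + q))) -
  \sum_j th * (lX j.2 / lS j.2) ^+ 2 * E j <= 2 * ln (\prod_i (M i)%:R).
  apply: le_trans ob; rewrite le_eqVlt; apply/orP; left; apply/eqP; congr (_ * _ - _).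
    apply: eq_bigr => k _; rewrite lkE.
    have [i1 i2 i3 i4] := slot_identities q0 lam0 (laml k) s2 (sig2 k).
    rewrite i1 [in RHS](mulrAC _ (eta k)) i2 -wt -i3 -i4.
    rewrite (_ : (lS k + q) / q = (lS k + q) / (lam + q) * ((lam + q) / q)); last first.
      by field; rewrite !gt_eqF.
    by rewrite lnM ?posrE//; ring.
  apply: eq_bigr => j _; rewrite lkE EE; congr (_ * _).
  have [_ _ i3 i4] := slot_identities q0 lam0 (laml j.2) s2 (sig2 j.2).
  by rewrite -wt -i3 -i4.
have Lx (t : 'I_n) i : L2 P (fun w => X t i w - xhat (ecode phi H (rotS w)) t i).
  apply: L2B; last exact: (L2_code (fun c => xhat c t i)).
  have g := source_gvec psdX psdZ src
    (fun (_ : unit) (t' : 'I_n) i' => (t' == t)%:R * (i' == i)%:R) (fun _ _ _ => 0).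
  apply: eq_L2 (gvec_L2 g tt) => w.
  rewrite -[RHS](sum_delta t (fun t' : 'I_n => X t' i w)); apply: eq_bigr => t' _.
  rewrite -[X t' i w in RHS](sum_delta i (fun i' => X t' i' w)) mulr_sumr.
  by apply: eq_bigr => i' _; ring.
(* An orthogonal rotation preserves the sum of the squared errors. *)
have hD2 : \sum_j Ex P (fun w => (Xrot w j - gr (ecode phi H (rotS w)) j) ^+ 2) <= D.
  rewrite -lee_fin; apply: le_trans hD.
  have mE (i : 'I_l) (t : 'I_n) : mse P phi X Z [set: 'I_l]%SET t i =
      (Ex P (fun w => (X t i w - xhat (ecode phi H (rotS w)) t i) ^+ 2))%:E.
    rewrite EFin_Ex; last exact: L2_sqr (Lx t i).
    by apply: eq_integral => w _; rewrite XhatE.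
  rewrite [X in (_ <= X)%E](_ : _ = (\sum_(i in [set: 'I_l]%SET) \sum_(t < n)
      Ex P (fun w => (X t i w - xhat (ecode phi H (rotS w)) t i) ^+ 2))%:E); last first.
    rewrite -sumEFin; apply: eq_bigr => i _; rewrite -sumEFin; apply: eq_bigr => t _.
    exact: mE.
  rewrite lee_fin le_eqVlt; apply/orP; left; apply/eqP.
  transitivity (\sum_t \sum_k Ex P (fun w => (Xrot w (t, k) - gr (ecode phi H (rotS w)) (t, k)) ^+ 2)).
    by rewrite pair_bigA/=; apply: eq_bigr => -[].
  rewrite [RHS]exchange_big/=; apply: eq_bigr => t _.
  have dE w k : Xrot w (t, k) - gr (ecode phi H (rotS w)) (t, k) =
      \sum_i H k i * (X t i w - xhat (ecode phi H (rotS w)) t i).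
    by rewrite /Xrot /gr/= -sumrB; apply: eq_bigr => i _; rewrite mulrBr.
  transitivity (\sum_k Ex P (fun w => (\sum_i H k i * (X t i w - xhat (ecode phi H (rotS w)) t i)) ^+ 2)).
    by apply: eq_bigr => k _; apply: eq_Ex => w; rewrite dE.
  rewrite -Ex_sum => [|k _]; last first.
    by apply: L2_sqr; apply: L2_sum => i _; apply: L2Z; exact: Lx.
  under [RHS]eq_bigl do rewrite inE.
  rewrite -[RHS]Ex_sum => [|i _]; last exact: L2_sqr (Lx t i).
  by apply: eq_Ex => w; rewrite (orth_sqsum HH').
have hlow : n%:R * \sum_k dpart k + \sum_j (lX j.2 / lS j.2) ^+ 2 * E j <= D.
  apply: le_trans hD2; rewrite -sum_snd -big_split/=; apply: ler_sum => j _; exact: mse_lower.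
apply: le_trans ob; rewrite lerD2l lerN2.
under eq_bigr do rewrite -mulrA.
by rewrite -mulr_sumr ler_wpM2l// lerBrDl.
Qed.

End ConverseBlock.

(** * From block codes to the rate *)

Section Converse.
Context {R : realType} (l : nat) {d : measure_display} {T : measurableType d}.
Variables (P : probability T R) (X Z : nat -> 'I_l -> T -> R).
Variables (gX rX gZ rZ : R).
Hypotheses (l2 : (2 <= l)%N) (gX0 : 0 < gX).
Hypotheses (psdX : psd_eqcov l gX rX) (psdZ : psd_eqcov l gZ rZ).

Lemma lam_sum (g rho : R) : lam1 l g rho + (l.-1)%:R * lam2 g rho = l%:R * g.
Proof.
rewrite /lam1 /lam2 -[l in RHS](prednK (leq_trans (isT : 0 < 2)%N l2)) -natr1; ring.
Qed.

Lemma psd_lam (g rho : R) : psd_eqcov l g rho -> [/\ 0 <= lam1 l g rho, 0 <= lam2 g rho & 0 <= g].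
Proof.
move=> psd; have [H [HH HH' H0]] := @ortho_basis R l l2.
have l0 : (0 < l)%N by apply: leq_trans l2.
have h1 := psd_lamk HH H0 (Ordinal l0) l0 psd.
have h2 := psd_lamk HH H0 (Ordinal (leq_trans (isT : 1 < 2)%N l2)) l0 psd.
split => //; rewrite -(pmulr_rge0 _ (_ : 0 < l%:R)) ?ltr0n// -(lam_sum g rho).
by apply: addr_ge0 => //; apply: mulr_ge0.
Qed.

Lemma lam1S : 0 <= gZ -> lam1 l (gammaS gX gZ) (rhoS gX rX gZ rZ) = lam1 l gX rX + lam1 l gZ rZ.
Proof.
by move=> gZ0; rewrite /lam1 /gammaS /rhoS; field; rewrite gt_eqF// ltr_pwDl.
Qed.

Lemma lam2S : 0 <= gZ -> lam2 (gammaS gX gZ) (rhoS gX rX gZ rZ) = lam2 gX rX + lam2 gZ rZ.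
Proof.
by move=> gZ0; rewrite /lam2 /gammaS /rhoS; field; rewrite gt_eqF// ltr_pwDl.
Qed.

(** The test channel distortion in one direction: what [S] leaves unknown of [X], plus the scaled
    error of estimating [S] from the channel output. *)
Lemma dpart_sum (x z q : R) : 0 <= x -> 0 <= z -> 0 < q ->
  dmin_part x z (x + z) + (x / (x + z)) ^+ 2 * ((x + z) * q / (x + z + q)) =
  x * (z + q) / (x + z + q).
Proof.
move=> x0 z0 q0; rewrite /dmin_part; case: eqVneq => [e|ne].
  have -> : x = 0 by lra.
  by rewrite !mul0r expr0n mul0r addr0.
by field; rewrite ne gt_eqF//; lra.
Qed.

Hypothesis src : gauss_source P X Z gX rX gZ rZ.
Variables (q dl : R).
Hypotheses (q0 : 0 < q) (dE : distQ l gX rX gZ rZ q = dl).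

Let lS1 := lam1 l (gammaS gX gZ) (rhoS gX rX gZ rZ).
Let lS2 := lam2 (gammaS gX gZ) (rhoS gX rX gZ rZ).
Let lX1 := lam1 l gX rX.
Let lX2 := lam2 gX rX.

Lemma converse_tail (lam th ea eb : R) : 0 <= lam -> lam <= lS1 -> lam <= lS2 ->
  0 <= th -> 0 <= ea -> 0 <= eb -> ea + (l.-1)%:R * eb = l%:R ->
  (lS1 + q) / (lam + q) * (lS1 - lam) / lS1 ^+ 2 +
      (lam + q) / q * ea * (lam * ((lS1 + q) / (lam + q)) ^+ 2 / lS1 ^+ 2) = th * (lX1 / lS1) ^+ 2 ->
  (lS2 + q) / (lam + q) * (lS2 - lam) / lS2 ^+ 2 +
      (lam + q) / q * eb * (lam * ((lS2 + q) / (lam + q)) ^+ 2 / lS2 ^+ 2) = th * (lX2 / lS2) ^+ 2 ->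
  forall r, achievable P X Z l r (fun=> dl) -> rbar l gX rX gZ rZ q <= r.
Proof.
move=> lam0 lam1' lam2' th0 ea0 eb0 eab w1 w2 r ach.
have [X1 X2 _] := psd_lam psdX; have [Z1 Z2 gZ0] := psd_lam psdZ.
have l0 : (0 < l)%N by apply: leq_trans l2.
have lR : 0 < l%:R :> R by rewrite ltr0n.
have [H [HH HH' H0]] := @ortho_basis R l l2.
pose eta (k : 'I_l) := if val k == 0%N then ea else eb.
have S1E := lam1S gZ0; have S2E := lam2S gZ0; rewrite -/lS1 in S1E; rewrite -/lS2 in S2E.
have lSE (k : 'I_l) : lamk gX rX k + lamk gZ rZ k = if val k == 0%N then lS1 else lS2.
  by rewrite /lamk S1E S2E; case: ifP.
(* The columns of [H] have norm 1 and the squares in its first row are [1 / l], so the normalization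
   is exactly [ea + (l - 1) * eb = l]. *)
have eta1 i : \sum_k eta k * H k i ^+ 2 = 1.
  have h : \sum_k H k i ^+ 2 = 1 by have := HH' i i; rewrite eqxx => e; rewrite -[RHS]e; apply: eq_bigr => k _; rewrite expr2.
  transitivity (\sum_k (eb * H k i ^+ 2 + (k == Ordinal l0)%:R * ((ea - eb) * H k i ^+ 2))).
    by apply: eq_bigr => k _; rewrite /eta -val_eqE/=; case: eqP => _ /=; ring.
  rewrite big_split/= -mulr_sumr h sum_delta H0// exprVn sqr_sqrtr ?ler0n//.
  have lE : l%:R = (l.-1)%:R + 1 :> R by rewrite natr1 prednK.
  have -> : ea - eb = l%:R * (1 - eb) by rewrite mulrBr -{1}eab lE; ring.
  by rewrite mulrAC divff ?gt_eqF//; ring.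
(* The slack [eps] of the code is paid once in the rate and [th / 2] times through the
   distortion. *)
apply/ler_addgt0Pr => e e0; pose eps := e / (1 + th / 2).
have eps0 : 0 < eps by rewrite divr_gt0//; lra.
have [n [M [phi [n0 bphi rate dist]]]] := ach eps eps0.
have nR : 0 < n%:R :> R by rewrite ltr0n.
have M0 i : (0 < M i)%N by apply: leq_ltn_trans (ltn_ord (phi i (fun=> 0))).
have cardT : #|[set: 'I_l]%SET| = l by rewrite cardsT card_ord.
have := rate [set: 'I_l]%SET cardT.
under eq_bigl do rewrite inE.
rewrite -ln_prod => [|i]; last by rewrite ltr0n.
rewrite mulrC ler_pdivrMr ?ltr0n ?muln_gt0 ?l0// => hr.
have := dist [set: 'I_l]%SET; rewrite cardT leqnn => /(_ isT) hd.
pose lS (k : 'I_l) := lamk gX rX k + lamk gZ rZ k.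
pose dp (k : 'I_l) := dmin_part (lamk gX rX k) (lamk gZ rZ k) (lS k).
have S10 : 0 < lS1 + q by rewrite ltr_wpDl// S1E addr_ge0.
have S20 : 0 < lS2 + q by rewrite ltr_wpDl// S2E addr_ge0.
have hb : n%:R * \sum_k (ln ((lS k + q) / q) + 1 - eta k + th * (lamk gX rX k / lS k) ^+ 2 * (lS k * q / (lS k + q))) -
   th * ((l * n)%:R * (dl + eps) - n%:R * \sum_k dp k) <= 2 * ln (\prod_i (M i)%:R).
  apply: (converse_block l0 gX0 psdX psdZ src HH HH' H0 bphi q0 lam0) => //.
  - by move=> k; rewrite lSE; case: ifP.
  - by move=> k; rewrite /eta; case: ifP.
  - by move=> k; rewrite lSE /eta /lamk; case: ifP.
  - by move: hd; rewrite lee_pdivrMl ?ltr0n ?muln_gt0 ?l0.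
have rE : \sum_k ln ((lS k + q) / q) = 2 * l%:R * rbar l gX rX gZ rZ q.
  rewrite /rbar -/lS1 -/lS2 natrM mulrA divff ?mul1r; last by rewrite mulf_neq0 ?gt_eqF.
  rewrite (eq_bigr (fun k : 'I_l => if val k == 0%N then ln ((lS1 + q) / q) else ln ((lS2 + q) / q))); last first.
    by move=> k _; rewrite /lS lSE; case: ifP.
  rewrite sum_class// !ln_div ?posrE// ?exprn_gt0//; last by rewrite mulr_gt0// exprn_gt0.
  rewrite lnM ?posrE ?exprn_gt0// !lnXn// -(mulr_natl (ln (lS2 + q))) -(mulr_natl (ln q) l).
  have -> : l%:R = (l.-1)%:R + 1 :> R by rewrite natr1 prednK.
  by ring.
have eE : \sum_k eta k = l%:R by rewrite sum_class.
have dE' : \sum_k (dp k + (lamk gX rX k / lS k) ^+ 2 * (lS k * q / (lS k + q))) = l%:R * dl.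
  transitivity (\sum_(k < l) if val k == 0%N then lX1 * (lam1 l gZ rZ + q) / (lS1 + q)
      else lX2 * (lam2 gZ rZ + q) / (lS2 + q)).
    apply: eq_bigr => k _; rewrite /dp dpart_sum//.
    - by rewrite -/(lS k) /lS lSE /lamk; case: ifP.
    - by rewrite /lamk; case: ifP.
    - by rewrite /lamk; case: ifP.
  rewrite sum_class// -dE /distQ -/lS1 -/lS2 -/lX1 -/lX2; field.
  by rewrite !gt_eqF.
have key : 2 * l%:R * rbar l gX rX gZ rZ q - th * l%:R * eps <= 2 * (l%:R * (r + eps)).
  rewrite -(ler_pM2l nR); apply: le_trans (le_trans hb _); last first.
    rewrite mulrCA ler_pM2l// (le_trans hr)// natrM le_eqVlt; apply/orP; left; apply/eqP; ring.
  rewrite le_eqVlt; apply/orP; left; apply/eqP.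
  under eq_bigr do rewrite -mulrA.
  rewrite !big_split/= sumrN rE eE sumr_const card_ord addrK.
  rewrite -mulr_sumr; move: dE'; rewrite big_split/= => /(canRL (addrK _)) ->.
  by rewrite natrM; ring.
have {}key : rbar l gX rX gZ rZ q <= r + (1 + th / 2) * eps.
  rewrite -(ler_pM2l (_ : 0 < 2 * l%:R)) ?mulr_gt0//.
  have -> : 2 * l%:R * (r + (1 + th / 2) * eps) = 2 * (l%:R * (r + eps)) + th * l%:R * eps by field.
  by rewrite -lerBlDr.
by apply: (le_trans key); rewrite /eps mulrC divfK// gt_eqF//; lra.
Qed.

Lemma converse :
  (let mu := (lS2 - lS2 * (lS2 + q)^-1 * lS2) / (lS1 - lS1 * (lS1 + q)^-1 * lS1) in
   let nu := (lS1 - lS1 * (lS1 + q)^-1 * lS1) / (lS2 - lS2 * (lS2 + q)^-1 * lS2) in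
   (0 <= rhoS gX rX gZ rZ /\
      0 <= (l.-1)%:R * lX2 ^+ 2 * lS1 ^+ 2 * mu * (mu - 1) + l%:R * lX1 ^+ 2 * lS2 ^+ 2)
   \/
   (rhoS gX rX gZ rZ <= 0 /\
      0 <= lX1 ^+ 2 * lS2 ^+ 2 * nu * (nu - 1) + l%:R * lX2 ^+ 2 * lS1 ^+ 2)) ->
  forall r, achievable P X Z l r (fun=> dl) -> rbar l gX rX gZ rZ q <= r.
Proof.
move=> cnd r; move: cnd => /= cnd; move: r.
have [X1 X2 _] := psd_lam psdX; have [Z1 Z2 gZ0] := psd_lam psdZ.
have l0 : (0 < l)%N by apply: leq_trans l2.
have lR : 0 < l%:R :> R by rewrite ltr0n.
have lE : l%:R = (l.-1)%:R + 1 :> R by rewrite natr1 prednK.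
have l1R : 0 < (l.-1)%:R :> R by rewrite ltr0n -ltnS prednK.
have S1E := lam1S gZ0; have S2E := lam2S gZ0; rewrite -/lS1 in S1E; rewrite -/lS2 in S2E.
have Xp : 0 < lX1 + (l.-1)%:R * lX2 by rewrite lam_sum mulr_gt0.
(* The sign of [rhoS] decides which eigenvalue is the smaller one, hence which is split off as white
   noise. *)
have dS : lS1 - lS2 = l%:R * rhoS gX rX gZ rZ * gammaS gX gZ.
  by rewrite /lS1 /lS2 /lam1 /lam2 lE; ring.
have gS0 : 0 < gammaS gX gZ by rewrite ltr_pwDl.
have zz (x : R) : (x - x) = 0 by rewrite subrr.
have X1S : 0 <= lX1 <= lS1 by rewrite X1 S1E lerDl.
have X2S : 0 <= lX2 <= lS2 by rewrite X2 S2E lerDl.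
have S10 : 0 <= lS1 by case/andP: X1S; apply: le_trans.
have S20 : 0 <= lS2 by case/andP: X2S; apply: le_trans.
have qq (x : R) : 0 <= x -> (x + q) / (x + q) = 1 by move=> x0; rewrite divff// gt_eqF// ltr_wpDl.
case: cnd => -[rho c].
  have le12 : lS2 <= lS1 by rewrite -subr_ge0 dS (mulr_ge0 _ (ltW gS0))// mulr_ge0// ltW.
  have [|||th [e0 [e1 [th0 e00 e10 ee [w0 w1]]]]] := weights ltr01 l1R (L := l%:R) _ q0 S20 le12 X1S X2S.
  - by rewrite lE addrC.
  - by rewrite mul1r.
  - exact: c.
  apply: (@converse_tail lS2 th e0 e1) => //; first by rewrite -ee mul1r.
  by rewrite subrr mulr0 mul0r add0r qq// expr1n mulr1.
have le12 : lS1 <= lS2.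
  by rewrite -subr_ge0 -opprB oppr_ge0 dS (mulr_le0_ge0 _ (ltW gS0))// mulr_ge0_le0// ltW.
have [|||th [e0 [e1 [th0 e00 e10 ee [w0 w1]]]]] := weights l1R ltr01 (L := l%:R) _ q0 S10 le12 X2S X1S.
- by rewrite lE.
- by rewrite mul1r addrC.
- by rewrite mul1r; exact: c.
apply: (@converse_tail lS1 th e1 e0) => //; first by rewrite -ee mul1r addrC.
by rewrite subrr mulr0 mul0r add0r qq// expr1n mulr1.
Qed.

End Converse.

(** * Exponential races *)

Section Copies.
Context {R : realType}.

(** Independence is stated through the two kinds of products that occur: one factor per coordinate,
    and each coordinate paired with a distinguished one. Indexing by [nat] with only [b < N]
    significant keeps the type of [pr] fixed in the induction on [N]. *)
Definition iid_family {d d'} {O : measurableType d} {O' : measurableType d'}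
    (mu : probability O R) (mu' : probability O' R) (N : nat) (pr : nat -> O' -> O) :=
  [/\ forall b, mble (pr b),
      forall f : nat -> O -> R, (forall b, mble (f b)) -> (forall b x, 0 <= f b x <= 1) ->
        Ex mu' (fun w => \prod_(b < N) f b (pr b w)) = \prod_(b < N) Ex mu (f b) &
      forall (a : nat) (g : nat -> O * O -> R), (a < N)%N ->
        (forall b, mble (g b)) -> (forall b z, 0 <= g b z <= 1) ->
        Ex mu' (fun w => \prod_(b < N) g b (pr a w, pr b w)) =
        Ex mu (fun x => \prod_(b < N) if val b == a then g b (x, x) else Ex mu (fun y => g b (x, y)))].

Lemma prod_in01 (I : finType) (p : pred I) (F : I -> R) : (forall i, 0 <= F i <= 1) ->
  0 <= \prod_(i | p i) F i <= 1.
Proof.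
move=> F01; apply/andP; split; first by apply: prodr_ge0 => i _; case/andP: (F01 i).
have := @ler_prod R I (index_enum I) p F (fun=> 1) (fun i _ => F01 i).
by rewrite [X in _ <= X]big1.
Qed.

Lemma ig01 {d} {O : measurableType d} (mu : probability O R) (f : O -> R) : mble f ->
  (forall x, 0 <= f x <= 1) -> ig mu f.
Proof.
by move=> mf f01; apply: (@ig_bnd _ _ _ _ _ 1) => // w; case/andP: (f01 w) => ? ?; rewrite ger0_norm.
Qed.

Lemma Ex01 {d} {O : measurableType d} (mu : probability O R) (f : O -> R) : mble f ->
  (forall x, 0 <= f x <= 1) -> 0 <= Ex mu f <= 1.
Proof.
move=> mf f01; rewrite Ex_ge0 => [|w]; last by case/andP: (f01 w).
rewrite -[leRHS](Ex_cst mu); apply: Ex_le; [exact: ig01|exact: ig_cst|].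
by move=> w; case/andP: (f01 w).
Qed.

(* By independence all coordinates but one can be integrated out, which is what races need: the
   clock of the candidate winner is compared with all the others. *)
Lemma iid_copies {d} {O : measurableType d} (mu : probability O R) (N : nat) :
  exists d' (O' : measurableType d') (mu' : probability O' R) (pr : nat -> O' -> O),
    iid_family mu mu' N pr.
Proof.
elim: N => [|N IH].
  exists d, O, mu, (fun _ x => x); split => //.
  by move=> f _ _; under eq_Ex do rewrite big_ord0; rewrite big_ord0 Ex_cst.
case: IH => d'; case=> O'; case=> nu; case=> pr; case=> mpr pr1 pr2.
pose pr' b (w : O' * O) := if b == N then w.2 else pr b w.1.
have pr'N w : pr' N w = w.2 by rewrite /pr' eqxx.
have pr'l b w : (b < N)%N -> pr' b w = pr b w.1.
  by move=> bN; rewrite /pr' ltn_eqF.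
have mpr' b : mble (pr' b).
  rewrite /pr'; case: eqP => _; first exact: measurable_snd.
  by apply: measurableT_comp => //; exact: measurable_fst.
exists _, (O' * O)%type, (nu \x mu)%E, pr'; split => //.
- move=> f mf f01; rewrite big_ord_recr/= -(pr1 f)//.
  rewrite -Ex_prod; [|apply: ig01|exact: ig01]; last first.
  + by move=> x; apply: prod_in01.
  + by apply: measurable_prod => b _; exact: measurableT_comp.
  apply: eq_Ex => w; rewrite big_ord_recr/= pr'N; congr (_ * _).
  by apply: eq_bigr => b _; rewrite pr'l.
move=> a g; rewrite ltnS leq_eqVlt => aN mg g01.
have mF : mble (fun w => \prod_(b < N.+1) g b (pr' a w, pr' b w)).
  apply: measurable_prod => b _; apply: (measurableT_comp (mg b)).
  exact: measurable_fun_pair.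
have F01 w : 0 <= \prod_(b < N.+1) g b (pr' a w, pr' b w) <= 1 by exact: prod_in01.
have IF := ig01 (nu \x mu)%E mF F01.
have msec b x : mble (fun y => g b (x, y)).
  by apply: (measurableT_comp (mg b)); exact: measurable_fun_pair.
have mh b : mble (fun x => Ex mu (fun y => g b (x, y))).
  by apply: mble_tonelli => // z; case/andP: (g01 b z).
case/predU1P: aN => [aN|aN].
  subst a.
  rewrite (Ex_fubini' IF); last first.
    by move=> y; exact: (ig01 _ (mble_section' y mF) (fun x => F01 (x, y))).
  apply: eq_Ex => x; rewrite big_ord_recr/= eqxx.
  transitivity (Ex nu (fun w => g N (x, x) * \prod_(b < N) g b (x, pr b w))).
    apply: eq_Ex => w; rewrite big_ord_recr/= !pr'N mulrC; congr (_ * _).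
    by apply: eq_bigr => b _; rewrite pr'l.
  rewrite ExZ; last first.
    apply: ig01; first by apply: measurable_prod => b _; exact: (measurableT_comp (msec b x) (mpr b)).
    by move=> w; exact: prod_in01.
  rewrite mulrC (pr1 (fun b y => g b (x, y)))//; congr (_ * _).
  by apply: eq_bigr => b _; rewrite ltn_eqF.
rewrite (Ex_fubini IF); last first.
  by move=> x; exact: (ig01 _ (mble_section x mF) (fun y => F01 (x, y))).
pose h x := Ex mu (fun y => g N (x, y)).
have h01 x : 0 <= h x <= 1 by exact: Ex01.
(* Once integrated out, the new coordinate leaves a function of the distinguished one, which is
   absorbed into the factor of index [a]. *)
pose g' b z := g b z * (if b == a then h z.1 else 1).
transitivity (Ex nu (fun w => \prod_(b < N) g' b (pr a w, pr b w))).
  apply: eq_Ex => w.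
  transitivity (Ex mu (fun y => \prod_(b < N) g b (pr a w, pr b w) * g N (pr a w, y))).
    apply: eq_Ex => y; rewrite big_ord_recr/= pr'N pr'l//=; congr (_ * _).
    by apply: eq_bigr => b _; rewrite pr'l.
  rewrite ExZ; last exact: ig01.
  rewrite /g' big_split/=; congr (_ * _).
  rewrite (bigD1 (Ordinal aN))//= eqxx big1 ?mulr1// => b.
  by rewrite -val_eqE/= => /negbTE ->.
rewrite pr2//.
- apply: eq_Ex => x; rewrite big_ord_recr/= (gtn_eqF aN).
  transitivity (\prod_(b < N) ((if val b == a then g b (x, x) else Ex mu (fun y => g b (x, y))) *
       (if val b == a then h x else 1))).
    apply: eq_bigr => b _; rewrite /g'; case: eqP => //= _.
    by rewrite mulr1; apply: eq_Ex => y; rewrite mulr1.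
  rewrite big_split/=; congr (_ * _).
  rewrite (bigD1 (Ordinal aN))//= eqxx big1 ?mulr1// => b.
  by rewrite -val_eqE/= => /negbTE ->.
- move=> b; rewrite /g'; apply: measurable_funM => //; case: eqP => // _.
  by apply: (measurableT_comp (mh N)); exact: measurable_fst.
- move=> b z; rewrite /g'; case: eqP => _; last by rewrite mulr1.
  have /andP[g0 g1] := g01 b z; have /andP[h0 h1] := h01 z.1.
  by rewrite mulr_ge0//= mulr_ile1.
Qed.

End Copies.

(** * Exponential clocks *)

Section Exponential.
Context {R : realType}.
Local Notation leb := (@lebesgue_measure R).

(** The clock is [Num.max y 0], nonnegative everywhere and not just almost surely. Its tail and its
    Laplace transform are all that a race requires. *)
Lemma exponential_facts : exists mu : probability (measurableTypeR R) R,
  (forall x : R, 0 <= x -> Ex mu (fun y : R => ((x < Num.max y 0)%R)%:R) = expR (- x)) /\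
  (forall c : R, 0 <= c -> Ex mu (fun y : R => expR (- (c * Num.max y 0))) = (1 + c)^-1).
Proof.
have [mu muE] : exists mu : probability (measurableTypeR R) R, forall A, mu A = exponential_prob 1 A.
  unshelve eexists; first refine (exponential_prob 1 : probability _ R).
  - exact: ltr01.
  - by [].
have mI (b : R -> bool) : measurable [set y | b y] -> mble (fun y : measurableTypeR R => (b y)%:R : R).
  exact: (@mble_bool R _ (measurableTypeR R)).
have pos0 (c : R) : 0 <= c -> Ex mu (fun y : R => expR (- (c * Num.max y 0))) = (1 + c)^-1.
  move=> c0; have c1 : 0 < 1 + c by lra.
  have mf : mble (fun y : R => expR (- (c * Num.max y 0))).
    apply: (measurableT_comp (@measurable_expR R)); apply: measurableT_comp => //.
    by apply: measurable_funM => //; exact: measurable_maxr.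
  have [//|||//] := @ge0_igP _ _ _ mu (fun y : R => expR (- (c * Num.max y 0))) (1 + c)^-1.
    by move=> w; exact: expR_ge0.
  rewrite (@integral_density _ mu (exponential_pdf 1) _ _ _ (fun y => (expR (- (c * Num.max y 0)))%:E)).
  - transitivity (\int[leb]_y ((1 + c)^-1%:E * (exponential_pdf (1 + c) y)%:E))%E.
      apply: eq_integral => y _; rewrite -!EFinM; congr EFin.
      have [y0|y0] := ltP y 0; first by rewrite !lt0_exponential_pdf// !mulr0.
      rewrite !exponential_pdfE// mulKf ?gt_eqF// mul1r -expRD; congr expR.
      by ring.
    rewrite ge0_integralZl//.
    + by rewrite integral_exponential_pdf// mule1.
    + by apply/measurable_EFinP; exact: measurable_exponential_pdf.
    + by move=> y _; rewrite lee_fin exponential_pdf_ge0// ltW.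
    + by rewrite lee_fin invr_ge0 ltW.
  - exact: measurable_exponential_pdf.
  - by move=> y; apply: exponential_pdf_ge0.
  - by move=> A _; exact: muE.
  - exact/measurable_EFinP.
  - by move=> y; rewrite lee_fin expR_ge0.
exists mu; split => // x x0.
have cexp : continuous (fun z : R^o => expR (- 1 * z)).
  move=> z; apply: continuous_comp; last exact: continuous_expR.
  by apply: continuousM => //; apply: (@continuousN _ R^o); exact: cst_continuous.
rewrite (_ : (fun y : R => ((x < Num.max y 0)%R)%:R) = \1_(`]x, +oo[ : set (measurableTypeR R))); last first.
  apply/funext => y; rewrite indicE lt_max [x < 0]ltNge x0 orbF; congr (_%:R)%R; congr nat_of_bool.
  by apply/idP/idP => [h|]; [apply/mem_set|move/set_mem]; rewrite /= in_itv/= andbT.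
rewrite Ex_indic; last exact: measurable_itv.
rewrite muE /exponential_prob integral_itv_obnd_cbnd; last first.
  by apply/measurable_EFinP/measurable_funTS; exact: measurable_exponential_pdf.
rewrite (@ge0_continuous_FTC2y _ _ (fun y => - (expR (- 1 * y))) _ 0)//.
- by rewrite mulN1r sub0e EFinN oppeK.
- by move=> y _; exact: exponential_pdf_ge0.
- apply: (@continuous_subspaceW R^o _ _ [set` `[0, +oo[%R]).
  + by apply: subset_itvr; rewrite bnd_simp.
  + exact: within_continuous_exponential_pdf.
- rewrite -oppr0; apply: cvgN.
  rewrite (_ : (fun y => expR (- 1 * y)) = (fun z => expR (- z))); last first.
    by apply/funext => y; rewrite mulN1r.
  exact: cvgr_expR.
- by apply: cvgN; apply/cvg_at_right_filter; exact: cexp.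
- move=> z; rewrite in_itv/= andbT => xz; apply: derive1_exponential_pdf.
  by rewrite in_itv/= andbT (le_lt_trans x0).
Qed.

End Exponential.

Section Race.
Context {R : realType}.

Lemma mble_lt {d} {O : measurableType d} (f g : O -> R) : mble f -> mble g ->
  mble (fun w => ((f w < g w)%R)%:R : R).
Proof.
move=> mf mg; apply: mble_bool; rewrite -[X in measurable X]setTI.
exact: (measurable_fun_ltr mf mg measurableT (Y := [set true])).
Qed.

Lemma bool01 (b : bool) : 0 <= (b%:R : R) <= 1.
Proof. by case: b; rewrite ?lexx ?ler01. Qed.

(** Given the clock of [a], the comparisons are independent of probabilities [exp (- c b * e a)];
    their product is averaged by the Laplace transform. The predicate [D] selects the
    competitors. *)
Lemma race_family (K : nat) :
  exists d (O : measurableType d) (mu : probability O R) (e : nat -> O -> R),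
  [/\ forall b, mble (e b), forall b w, 0 <= e b w &
   forall (a : nat) (D : pred nat) (c : nat -> R), (a < K)%N -> (forall b, 0 <= c b) ->
    Ex mu (fun w => \prod_(b < K | (val b != a) && D (val b)) ((c b * e a w < e b w)%R)%:R) =
    (1 + \sum_(b < K | (val b != a) && D (val b)) c b)^-1].
Proof.
have [nu [tail lapl]] := @exponential_facts R.
case: (iid_copies nu K) => d; case=> O; case=> mu; case=> pr; case=> mpr _ pr2.
have mm : mble (fun y : measurableTypeR R => Num.max y 0 : R) by exact: measurable_maxr.
exists d, O, mu, (fun b w => Num.max (pr b w) 0); split.
- by move=> b; exact: (measurableT_comp mm (mpr b)).
- by move=> b w; rewrite le_max lexx orbT.
move=> a D c aK c0.
pose g b (z : measurableTypeR R * measurableTypeR R) : R :=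
  if (b != a) && D b then ((c b * Num.max z.1 0 < Num.max z.2 0)%R)%:R else 1.
transitivity (Ex mu (fun w => \prod_(b < K) g b (pr a w, pr b w))).
  by apply: eq_Ex => w; rewrite [LHS]big_mkcond.
rewrite pr2//.
- transitivity (Ex nu (fun x : R => expR (- ((\sum_(b < K | (val b != a) && D (val b)) c b) * Num.max x 0)))).
    apply: eq_Ex => x; rewrite mulr_suml -sumrN expR_sum [RHS]big_mkcond/=.
    apply: eq_bigr => b _; rewrite /g; case: eqP => //= _.
    case: (D b); last by rewrite Ex_cst.
    by rewrite tail// mulr_ge0// le_max lexx orbT.
  by rewrite lapl// sumr_ge0.
- move=> b; rewrite /g; case: (_ && _) => //; apply: mble_lt.
    by apply: measurable_funM => //; apply: (measurableT_comp mm); exact: measurable_fst.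
  by apply: (measurableT_comp mm); exact: measurable_snd.
- by move=> b z; rewrite /g; case: ifP => _; [exact: bool01|rewrite ler01 lexx].
Qed.

Lemma big_rank (S : Type) (idx : S) (op : Monoid.com_law idx) (V : finType) (K : nat)
  (Q : pred nat) (G : nat -> S) (Q' : pred V) (G' : V -> S) : (#|V| <= K)%N ->
  (forall k, (#|V| <= k)%N -> Q k = false) ->
  (forall v, Q (enum_rank v) = Q' v) -> (forall v, Q' v -> G (enum_rank v) = G' v) ->
  \big[op/idx]_(b < K | Q b) G b = \big[op/idx]_(v | Q' v) G' v.
Proof.
move=> VK Q0 QE GE.
transitivity (\big[op/idx]_(b < K | Q b && (b < #|V|)%N) G b).
  apply: eq_bigl => b; case: ltnP => bV; rewrite ?andbT ?andbF//; exact: Q0.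
rewrite (big_ord_narrow_cond VK) (reindex (@enum_rank V))/=; last exact: onW_bij (@enum_rank_bij V).
by apply: eq_big => v /=; [exact: QE|rewrite QE; exact: GE].
Qed.

(** One family of clocks, read through [enum_rank], serves all finite types of at most [K] elements:
    the message sets of the encoders have different sizes but must be raced on copies of a single
    space. *)
Lemma race_fin (K : nat) :
  exists d (O : measurableType d) (mu : probability O R) (e : forall V : finType, V -> O -> R),
  [/\ forall (V : finType) (b : V), mble (e V b), forall (V : finType) (b : V) w, 0 <= e V b w &
   forall (V : finType) (a : V) (D : pred V) (c : V -> R), (#|V| <= K)%N -> (forall b, 0 <= c b) ->
    Ex mu (fun w => \prod_(b | (b != a) && D b) ((c b * e V a w < e V b w)%R)%:R) =
    (1 + \sum_(b | (b != a) && D b) c b)^-1].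
Proof.
have [d [W [mu [e [me e0 er]]]]] := race_family K.
exists d, W, mu, (fun V v => e (enum_rank v)); split => [V b|V b w|V a D c VK c0].
- exact: me.
- exact: e0.
pose ev k : option V := omap enum_val (insub k : option 'I_#|V|).
have evE v : ev (enum_rank v) = Some v by rewrite /ev valK/= enum_rankK.
have ev0 k : (#|V| <= k)%N -> ev k = None by move=> h; rewrite /ev insubF// ltnNge h.
pose D' k := if ev k is Some v then D v else false.
pose c' k := if ev k is Some v then c v else 0.
have aK : (enum_rank a < K)%N by apply: leq_trans VK.
have c0' k : 0 <= c' k by rewrite /c'; case: (ev k).
have nE v : ((enum_rank v : nat) != enum_rank a) && D' (enum_rank v) = (v != a) && D v.
  by rewrite /D' evE val_eqE (inj_eq enum_rank_inj).
have := er _ D' c' aK c0'.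
rewrite (@big_rank _ _ _ V K (fun k => (k != enum_rank a) && D' k) c' (fun v => (v != a) && D v) c)//; last 2 first.
- by move=> k /ev0; rewrite /D' => ->; rewrite andbF.
- by move=> v _; rewrite /c' evE.
move=> <-; apply: eq_Ex => w.
rewrite (@big_rank _ _ _ V K (fun k => (k != enum_rank a) && D' k)
  (fun k => ((c' k * e (enum_rank a) w < e k w)%R)%:R) (fun v => (v != a) && D v)
  (fun b => ((c b * e (enum_rank a) w < e (enum_rank b) w)%R)%:R))//.
- by move=> k /ev0; rewrite /D' => ->; rewrite andbF.
- by move=> v _; rewrite /c' evE.
Qed.

End Race.

(** * Random codes from races *)

Section Win.
Context {R : realType}.

(* [e] are exponential clocks and [k] rates: [v] minimizes [e v / k v]. *)
Definition win {V : finType} (k e : V -> R) (v : V) : bool :=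
  (0 < k v) && [forall b, (b != v) ==> (e v * k b < e b * k v)].

Lemma win_uniq {V : finType} (k e : V -> R) v v' : win k e v -> win k e v' -> v = v'.
Proof.
move=> /andP[_ /forallP h] /andP[_ /forallP h']; apply/eqP/negPn/negP => ne.
have := h v'; rewrite eq_sym ne/= => h1; have := h' v; rewrite ne/= => h2.
by have := lt_trans h1 h2; rewrite ltxx.
Qed.

Lemma winE {V : finType} (k e : V -> R) v : (win k e v)%:R =
  ((0 < k v)%R)%:R * \prod_(b | b != v) ((e v * k b < e b * k v)%R)%:R :> R.
Proof.
rewrite /win; case: (0 < k v); rewrite ?mul1r ?mul0r//=.
case: forallP => [h|h].
  by rewrite big1// => b bv; have := h b; rewrite bv/= => ->.
have /existsNP[b /negP] := h; rewrite negb_imply => /andP[bv /negbTE nb].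
by rewrite (bigD1 b)//= nb mul0r.
Qed.

Lemma mble_prod {d} {T : measurableType d} (I : finType) (p : pred I) (F : I -> T -> R) :
  (forall i, p i -> mble (F i)) -> mble (fun w => \prod_(i | p i) F i w).
Proof.
move=> mF; under eq_fun do rewrite big_mkcond.
apply: measurable_prod => i _.
by have [ip|_] := boolP (p i); [exact: mF|exact: measurable_cst].
Qed.

Lemma mble_win {d} {T : measurableType d} {V : finType} (k e : T -> V -> R) v :
  (forall b, mble (fun w => k w b)) -> (forall b, mble (fun w => e w b)) ->
  mble (fun w => (win (k w) (e w) v)%:R : R).
Proof.
move=> mk me; under eq_fun do rewrite winE.
apply: measurable_funM; first exact: mble_lt.
apply: mble_prod => b _; apply: mble_lt; exact: measurable_funM.
Qed.

Context {d : measure_display} {W : measurableType d}.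
Variables (mu : probability W R) (U : finType) (m : nat).
Let V := (U * 'I_m)%type.
Variable e : W -> V -> R.
Hypotheses (me : forall b, mble (fun w => e w b)) (e0 : forall w b, 0 <= e w b).
Hypothesis race : forall (a : V) (c : V -> R), (forall b, 0 <= c b) ->
  Ex mu (fun w => \prod_(b | b != a) ((c b * e w a < e w b)%R)%:R) = (1 + \sum_(b | b != a) c b)^-1.
Variables (kap Q : U -> R).
Hypotheses (kap0 : forall u, 0 <= kap u) (kap1 : \sum_u kap u = 1).
Hypotheses (Q0 : forall u, 0 < Q u) (Q1 : \sum_u Q u = 1).
Hypothesis m0 : (0 < m)%N.

Let encw (v : V) w := win (fun b : V => kap b.1) (e w) v.
Let decw (v : V) w := win Q (fun u => e w (u, v.2)) v.1.

Lemma mble_encw v : mble (fun w => (encw v w)%:R : R).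
Proof. exact: mble_win. Qed.

Lemma mble_decw v : mble (fun w => (decw v w)%:R : R).
Proof. exact: mble_win. Qed.

Let mR : 0 < m%:R :> R. Proof. by rewrite ltr0n. Qed.

Let sum_pair (f : U -> R) : \sum_(b : V) f b.1 = m%:R * \sum_u f u.
Proof.
transitivity (\sum_u \sum_(j < m) f u); first by rewrite pair_bigA.
by rewrite mulr_sumr; apply: eq_bigr => u _; rewrite sumr_const card_ord mulr_natl.
Qed.

Lemma win_prob v : Ex mu (fun w => (encw v w)%:R) = kap v.1 / m%:R.
Proof.
have [kv|kv] := eqVneq (kap v.1) 0.
  rewrite kv mul0r -[RHS](Ex_cst mu); apply: eq_Ex => w.
  by rewrite /encw winE kv ltxx mul0r.
have kp : 0 < kap v.1 by rewrite lt_neqAle eq_sym kv kap0.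
transitivity (Ex mu (fun w => \prod_(b | b != v) ((kap b.1 / kap v.1 * e w v < e w b)%R)%:R)).
  apply: eq_Ex => w; rewrite /encw winE kp mul1r; apply: eq_bigr => b _.
  by rewrite mulrAC ltr_pdivrMr// mulrC.
rewrite race; last by move=> b; rewrite divr_ge0.
rewrite -mulr_suml; have := sum_pair kap; rewrite (bigD1 v)//= kap1 mulr1.
move=> /(canRL (addKr _)) ->; rewrite -[RHS]invf_div; congr (_^-1); by field.
Qed.

(** [v] wins both races as soon as it beats each competitor at the sum of its two relative rates.
    That is a single race, whose probability is known exactly. *)
Lemma win_lose v : Ex mu (fun w => (encw v w)%:R * (~~ decw v w)%:R) <=
  kap v.1 / m%:R * (kap v.1 / (kap v.1 + m%:R * Q v.1)).
Proof.
have I1 : ig mu (fun w => (encw v w)%:R).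
  by apply: ig01; [exact: mble_encw|move=> w; exact: bool01].
have I2 : ig mu (fun w => (encw v w)%:R * (decw v w)%:R).
  apply: ig01; first by apply: measurable_funM; [exact: mble_encw|exact: mble_decw].
  by move=> w; rewrite -natrM mulnb; exact: bool01.
have -> : Ex mu (fun w => (encw v w)%:R * (~~ decw v w)%:R) =
    kap v.1 / m%:R - Ex mu (fun w => (encw v w)%:R * (decw v w)%:R).
  rewrite -win_prob -ExB//; apply: eq_Ex => w.
  by case: (decw v w); rewrite ?mulr1 ?mulr0 ?subr0 ?subrr.
have [kv|kv] := eqVneq (kap v.1) 0.
  by rewrite kv !mul0r sub0r oppr_le0; apply: Ex_ge0 => w; rewrite -natrM ler0n.
have kp : 0 < kap v.1 by rewrite lt_neqAle eq_sym kv kap0.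
have Qp := Q0 v.1.
(* The decoder's rates only concern the clocks of the message [v.2]. *)
pose c (b : V) := kap b.1 / kap v.1 + (b.2 == v.2)%:R * (Q b.1 / Q v.1).
have cc0 b : 0 <= c b by rewrite addr_ge0// ?mulr_ge0 ?invr_ge0// ltW.
have low : (1 + \sum_(b | b != v) c b)^-1 <= Ex mu (fun w => (encw v w)%:R * (decw v w)%:R).
  rewrite -race//; apply: Ex_le => //.
    apply: ig01; first by apply: mble_prod => b _; apply: mble_lt => //; exact: measurable_funM.
    by move=> w; apply: prod_in01 => b; exact: bool01.
  move=> w; have [/forallP h|] := boolP [forall b, (b != v) ==> (c b * e w v < e w b)].
    have -> : encw v w.
      rewrite /encw /win kp/=; apply/forallP => b; apply/implyP => bv; have := h b; rewrite bv/= => hb.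
      rewrite mulrC -ltr_pdivrMr// mulrAC (le_lt_trans _ hb)// ler_wpM2r// lerDl.
      by rewrite mulr_ge0// divr_ge0// ltW.
    have -> : decw v w.
      rewrite /decw /win Qp/=; apply/forallP => u; apply/implyP => uv; have := h (u, v.2).
      have -> : (u, v.2) != v by apply: contraNN uv => /eqP <-.
      rewrite /= => hb; rewrite mulrC -ltr_pdivrMr// mulrAC -[(v.1, v.2)]surjective_pairing (le_lt_trans _ hb)// ler_wpM2r//.
      by rewrite /c/= eqxx mul1r lerDr divr_ge0.
    by rewrite mulr1; case/andP: (prod_in01 (fun b => b != v) (fun b => bool01 (R := R) (c b * e w v < e w b)%R)).
  rewrite negb_forall => /existsP[b]; rewrite negb_imply => /andP[bv /negbTE nb].
  by rewrite (bigD1 b)//= nb mul0r -natrM ler0n.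
have a1 : 1 <= 1 + \sum_(b | b != v) c b by rewrite lerDl sumr_ge0.
apply: le_trans (lerB (lexx _) low) _; move: a1.
have -> : \sum_(b | b != v) c b = (m%:R - kap v.1) / kap v.1 + (1 - Q v.1) / Q v.1.
  rewrite big_split/=; congr (_ + _).
    rewrite -mulr_suml; have := sum_pair kap; rewrite (bigD1 v)//= kap1 mulr1.
    by move=> /(canRL (addKr _)) ->; rewrite addrC.
  have : \sum_(b : V) (b.2 == v.2)%:R * (Q b.1 / Q v.1) = (Q v.1)^-1.
    transitivity (\sum_u \sum_(j < m) (j == v.2)%:R * (Q u / Q v.1)); first by rewrite pair_bigA.
    under eq_bigr do rewrite (sum_delta v.2 (fun=> Q _ / Q v.1)).
    by rewrite -mulr_suml Q1 mul1r.
  rewrite (bigD1 v)//= eqxx mul1r => /(canRL (addKr _)) ->.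
  by field; rewrite gt_eqF.
have mQ : 0 < m%:R * Q v.1 by rewrite mulr_gt0.
have mQk : 0 < kap v.1 + m%:R * Q v.1 by rewrite addr_gt0.
have -> : 1 + ((m%:R - kap v.1) / kap v.1 + (1 - Q v.1) / Q v.1) =
    (kap v.1 + m%:R * Q v.1) / (kap v.1 * Q v.1) - 1 by field; rewrite !gt_eqF.
(* The probability of winning both races is at least [(X - 1)^-1]; weakening it to [X^-1] gives the
   closed form. *)
set X := _ / _; move=> a1; have a0 : 0 < X - 1 by lra.
have -> : kap v.1 / m%:R * (kap v.1 / (kap v.1 + m%:R * Q v.1)) = kap v.1 / m%:R - X^-1.
  by rewrite /X; field; rewrite !gt_eqF.
by rewrite lerD2l lerN2 lef_pV2 ?posrE//; lra.
Qed.

End Win.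

(** * One-shot coding with shared clocks *)

Section OneShot.
Context {R : realType} {l : nat} {U : finType} {M : 'I_l -> nat}.
Implicit Types (u : {ffun 'I_l -> U}) (c : cells M).

Definition encs (kap : 'I_l -> U -> R) (e : forall i, U * 'I_(M i) -> R) u c : bool :=
  [forall i, win (fun b : U * 'I_(M i) => kap i b.1) (e i) (u i, c i)].

Definition decs (Q : 'I_l -> {ffun 'I_l -> U} -> U -> R) (e : forall i, U * 'I_(M i) -> R) u c i : bool :=
  win (Q i u) (fun b => e i (b, c i)) (u i).

Lemma forallE (I : finType) (b : I -> bool) : ([forall i, b i])%:R = \prod_i (b i)%:R :> R.
Proof.
case: forallP => [h|/existsNP[i /negP/negbTE nb]]; first by rewrite big1// => i _; rewrite h.
by rewrite (bigD1 i)//= nb mul0r.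
Qed.

(** The encoders use independent copies of the clocks, so probabilities multiply over [i]. The
    clocks come before [kap] and [Q]: [kap] will depend on the source outcome and [Q] on the blocks
    already decoded, while the code is to be one outcome of the clocks. *)
Lemma random_code : (forall i, 0 < M i)%N ->
  exists d (W : measurableType d) (mu : probability W R) (e : W -> forall i, U * 'I_(M i) -> R),
  (forall i b, mble (fun w => e w i b)) /\
  forall (kap : 'I_l -> U -> R) (Q : 'I_l -> {ffun 'I_l -> U} -> U -> R),
  (forall i a, 0 <= kap i a) -> (forall i, \sum_a kap i a = 1) ->
  (forall i u a, 0 < Q i u a) -> (forall i u, \sum_a Q i u a = 1) ->
  (forall u c, Ex mu (fun w => (encs kap (e w) u c)%:R) = \prod_i (kap i (u i) / (M i)%:R)) /\
  (forall u c i, Ex mu (fun w => (encs kap (e w) u c)%:R * (~~ decs Q (e w) u c i)%:R) <=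
    \prod_i (kap i (u i) / (M i)%:R) * (kap i (u i) / (kap i (u i) + (M i)%:R * Q i u (u i)))).
Proof.
move=> M0; pose K := (\sum_i #|{: U * 'I_(M i)}|)%N.
have VK i : (#|{: U * 'I_(M i)}| <= K)%N by rewrite /K (bigD1 i)//= leq_addr.
have [d [W [mu [e [me e0 er]]]]] := @race_fin R K.
case: (iid_copies mu l) => d'; case=> W'; case=> mu'; case=> pr; case=> mpr pr1 _.
pose ee i (b : U * 'I_(M i)) w := e (U * 'I_(M i))%type b w.
have mee i b : mble (ee i b) by exact: me.
have ee0 i b w : 0 <= ee i b w by exact: e0.
have race i (a : U * 'I_(M i)) (c : U * 'I_(M i) -> R) : (forall b, 0 <= c b) ->
    Ex mu (fun w => \prod_(b | b != a) ((c b * ee i a w < ee i b w)%R)%:R) = (1 + \sum_(b | b != a) c b)^-1.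
  move=> c0; have := er _ a xpredT c (VK i) c0.
  under eq_bigl do rewrite andbT.
  move=> <-; apply: eq_Ex => w; by apply: eq_bigl => b; rewrite andbT.
exists d', W', mu', (fun w i b => ee i b (pr i w)); split.
  by move=> i b; exact: (measurableT_comp (mee i b) (mpr i)).
move=> kap Q kap0 kap1 Q0 Q1.
pose A i (v : U * 'I_(M i)) (w : W) := win (fun b : U * 'I_(M i) => kap i b.1) (fun b => ee i b w) v.
pose D i u (v : U * 'I_(M i)) (w : W) := win (Q i u) (fun b => ee i (b, v.2) w) v.1.
have mA i v : mble (fun w => (A i v w)%:R : R) by apply: mble_win.
have mD i u v : mble (fun w => (D i u v w)%:R : R) by apply: mble_win.
have pA i v : Ex mu (fun w => (A i v w)%:R) = kap i v.1 / (M i)%:R.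
  exact: (win_prob (e := fun w b => ee i b w) (race i) (kap := kap i) (kap0 i) (kap1 i) v).
split.
  move=> u c.
  have := pr1 (fun k w => if insub k is Some i then (A i (u i, c i) w)%:R else 1) _ _.
  have -> : \prod_(b < l) Ex mu (fun w => if insub (val b) is Some i then (A i (u i, c i) w)%:R else 1) =
     \prod_i (kap i (u i) / (M i)%:R).
    by apply: eq_bigr => i _; rewrite valK pA.
  move=> <-.
  - by apply: eq_Ex => w; rewrite /encs forallE; apply: eq_bigr => i _; rewrite valK.
  - by move=> k; case: (insub k) => [i|]; [exact: mA|exact: measurable_cst].
  - by move=> k w; case: (insub k) => [i|]; [exact: bool01|rewrite ler01 lexx].
move=> u c i.
pose f k w := if insub k is Some j then (A j (u j, c j) w)%:R * (if j == i then (~~ D i u (u i, c i) w)%:R else 1) else 1 : R.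
have mf k : mble (f k).
  rewrite /f; case: (insub k) => [j|]; last exact: measurable_cst.
  apply: measurable_funM => //; case: eqP => // _.
  rewrite (_ : (fun w => _) = (fun w => 1 - (D i u (u i, c i) w)%:R)); last first.
    by apply/funext => w; case: (D _ _ _ _); rewrite ?subrr ?subr0.
  exact: measurable_funB.
have f01 k w : 0 <= f k w <= 1.
  rewrite /f; case: (insub k) => [j|]; last by rewrite ler01 lexx.
  by case: (j == i); rewrite ?mulr1 -?natrM ?mulnb; exact: bool01.
have -> : Ex mu' (fun w => (encs kap (fun i b => ee i b (pr i w)) u c)%:R * (~~ decs Q (fun i b => ee i b (pr i w)) u c i)%:R) =
    \prod_(k < l) Ex mu (f k).
  rewrite -(pr1 f)//; apply: eq_Ex => w; rewrite /encs forallE.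
  under [RHS]eq_bigr do rewrite /f valK.
  by rewrite big_split/= -big_mkcond/= big_pred1_eq.
rewrite [leLHS](bigD1 i)//= [in leRHS](bigD1 i)//= mulrAC.
have -> : \prod_(k < l | k != i) Ex mu (f k) = \prod_(k < l | k != i) (kap k (u k) / (M k)%:R).
  apply: eq_bigr => k /negbTE ki; rewrite -[u k]/((u k, c k).1) -pA; apply: eq_Ex => w.
  by rewrite /f valK ki mulr1.
apply: ler_wpM2r; first by apply: prodr_ge0 => k _; rewrite divr_ge0.
have := win_lose (e := fun w b => ee i b w) (mee i) (fun w b => ee0 i b w) (race i) (kap0 i) (kap1 i) (Q0 i u) (Q1 i u) (M0 i) (u i, c i).
apply: le_trans; rewrite le_eqVlt; apply/orP; left; apply/eqP; apply: eq_Ex => w.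
by rewrite /f valK eqxx.
Qed.

Variables (x0 : U) (M0 : forall i, (0 < M i)%N).

(** A tie leaves the race without a winner; an arbitrary message is then sent. *)
Definition race_encode (k : U -> R) i (e : U * 'I_(M i) -> R) : 'I_(M i) :=
  if [pick v | win (fun b : U * 'I_(M i) => k b.1) e v] is Some v then v.2 else Ordinal (M0 i).

(** Sequential decoding expressed as a simultaneous condition on all blocks. For causal [Q] at most
    one family satisfies it, by [decs_uniq]. *)
Definition race_decode (Q : 'I_l -> {ffun 'I_l -> U} -> U -> R) (e : forall i, U * 'I_(M i) -> R) c :
    {ffun 'I_l -> U} :=
  odflt [ffun=> x0] [pick u | [forall i, decs Q e u c i]].

Definition causal (Q : 'I_l -> {ffun 'I_l -> U} -> U -> R) :=
  forall (i : 'I_l) u u', (forall j : 'I_l, (j < i)%N -> u j = u' j) -> Q i u = Q i u'.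

Lemma encs_uniq kap e u c u' c' : encs kap e u c -> encs kap e u' c' -> u = u' /\ c = c'.
Proof.
move=> /forallP h /forallP h'.
have e1 i : (u i, c i) = (u' i, c' i) by exact: win_uniq (h i) (h' i).
by split; apply/ffunP => i; case: (e1 i).
Qed.

Lemma decs_uniq Q e u u' c : causal Q -> (forall i, decs Q e u c i) ->
  (forall i, decs Q e u' c i) -> u = u'.
Proof.
move=> cQ h h'; apply/ffunP.
suff : forall n (i : 'I_l), (i < n)%N -> u i = u' i by move=> H i; exact: (H l).
elim=> // n IH i; rewrite ltnS => iN.
have e1 : Q i u = Q i u' by apply: cQ => j ji; apply: IH; exact: leq_trans ji iN.
have := h' i; rewrite /decs -e1 => h2.
exact: win_uniq (h i) h2.
Qed.

(** Pointwise in the clocks. At most one pair [(u, c)] has a nonzero indicator; the factor of [fmax]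
    charges the absence of a winner and, by a union bound, each encoder whose block is lost. Sums of
    indicators make the average over the clocks immediate. *)
Lemma decode_bound kap Q e (f : {ffun 'I_l -> U} -> R) fmax : causal Q ->
  (forall u, 0 <= f u <= fmax) ->
  f (race_decode Q e (finfun (fun i => race_encode (kap i) (e i)))) <=
  \sum_u \sum_c (encs kap e u c)%:R * f u +
  (1 - \sum_u \sum_c (encs kap e u c)%:R + \sum_u \sum_c \sum_i (encs kap e u c)%:R * (~~ decs Q e u c i)%:R) * fmax.
Proof.
move=> cQ f0.
have [p Ap|nA] := pickP (fun p : {ffun 'I_l -> U} * cells M => encs kap e p.1 p.2); last first.
  have z u c : encs kap e u c = false := nA (u, c).
  rewrite [X in X + _]big1 => [|u _]; last by rewrite big1// => c _; rewrite z mul0r.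
  rewrite [X in (1 - X + _)]big1 => [|u _]; last by rewrite big1// => c _; rewrite z.
  rewrite [X in (1 - 0 + X)]big1 => [|u _]; last first.
    by rewrite big1// => c _; rewrite big1// => i _; rewrite z mul0r.
  by rewrite add0r subr0 addr0 mul1r; case/andP: (f0 (race_decode Q e (finfun (fun i => race_encode (kap i) (e i))))).
move: Ap; set u := p.1; set c := p.2 => Auc.
have col (F : {ffun 'I_l -> U} -> cells M -> R) : \sum_u' \sum_c' (encs kap e u' c')%:R * F u' c' = F u c.
  rewrite (bigD1 u)//= (bigD1 c)//= Auc mul1r big1 ?addr0 => [|c' ne]; last first.
    case A : (encs _ _ _ _); last by rewrite mul0r.
    by have [_ ec] := encs_uniq Auc A; move: ne; rewrite ec eqxx.
  rewrite big1 ?addr0// => u' ne; rewrite big1// => c' _.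
  case A : (encs _ _ _ _); last by rewrite mul0r.
  by have [eu _] := encs_uniq Auc A; move: ne; rewrite eu eqxx.
have -> : \sum_u \sum_c (encs kap e u c)%:R = 1 :> R.
  by rewrite -[RHS](col (fun _ _ => 1)); apply: eq_bigr => ? _; apply: eq_bigr => ? _; rewrite mulr1.
have -> : \sum_u \sum_c \sum_i (encs kap e u c)%:R * (~~ decs Q e u c i)%:R =
    \sum_i (~~ decs Q e u c i)%:R :> R.
  rewrite -[RHS](col (fun u c => \sum_i (~~ decs Q e u c i)%:R)).
  by apply: eq_bigr => ? _; apply: eq_bigr => ? _; rewrite mulr_sumr.
rewrite (col (fun u _ => f u)) subrr add0r.
have -> : finfun (fun i => race_encode (kap i) (e i)) = c.
  apply/ffunP => i; rewrite ffunE /race_encode; move/forallP: Auc => /(_ i) Ai.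
  case: pickP => [v Av|/(_ (u i, c i))]; last by rewrite Ai.
  by rewrite (win_uniq Av Ai).
have fmax0 : 0 <= fmax by case/andP: (f0 u) => h1 h2; exact: le_trans h1 h2.
have [/forallP Du|] := boolP [forall i, decs Q e u c i].
  have -> : race_decode Q e c = u.
    rewrite /race_decode; case: pickP => [u' /forallP Du'|/(_ u)] /=.
      exact: decs_uniq cQ Du' Du.
    by move/negbT; rewrite negb_forall => /existsP[i]; rewrite Du.
  by rewrite lerDl mulr_ge0// sumr_ge0.
rewrite negb_forall => /existsP[i ni].
case/andP: (f0 (race_decode Q e c)) => _ h; case/andP: (f0 u) => h1 _.
apply: (le_trans h); rewrite -[leLHS]add0r lerD// ler_peMl//.
by rewrite (bigD1 i)//= ni lerDl sumr_ge0.
Qed.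

End OneShot.

(** * Quantization and divergence *)

Section Quantizer.
Context {R : realType}.
Variable B : nat.
Let b : R := B.+1%:R.
Let K := (2 * B.+1 * B.+1).+1.

(* The thresholds are spaced by [1 / b] and cover [[-b, b]]. *)
Definition thr (k : nat) : R := k%:R / b - b.

(** A cell is coded by its comparisons with all the thresholds, which makes finiteness and
    measurability evident. *)
Definition quant (y : R) : {ffun 'I_K -> bool} := [ffun k : 'I_K => thr k <= y].

(** Some point of the cell inside the covered interval, 0 if there is none. *)
Definition qval (u : {ffun 'I_K -> bool}) : R := xget 0 [set y : R | `|y| <= b /\ quant y = u].

Let b0 : 0 < b. Proof. by rewrite ltr0n. Qed.

Lemma measurable_quant u : measurable [set y : R | quant y = u].
Proof.
rewrite (_ : [set _ | _] = \bigcap_(k in [set: 'I_K]) [set y | (thr k <= y) = u k]).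
  apply: fin_bigcap_measurable => [|k _]; first exact: finite_finset.
  case: (u k).
    rewrite (_ : [set _ | _] = `[thr k, +oo[%classic); first exact: measurable_itv.
    by apply/seteqP; split => y /=; rewrite in_itv/= andbT.
  rewrite (_ : [set _ | _] = `]-oo, thr k[%classic); first exact: measurable_itv.
  apply/seteqP; split => y /=; rewrite in_itv/= ltNge; [by move=> ->|by move=> /negbTE].
apply/seteqP; split => y /= => [<- k _|h] /=; first by rewrite ffunE.
by apply/ffunP => k; rewrite ffunE h.
Qed.

Lemma same_quant y y' : `|y| <= b -> `|y'| <= b -> quant y = quant y' -> y' <= y + b^-1.
Proof.
move=> yb y'b e; rewrite leNgt; apply/negP => lt.
(* The first threshold strictly above [y]; it is at most [y + b^-1], so it would separate the two
   points. *)
pose k := (Num.truncn ((y + b) * b)).+1.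
have yb0 : 0 <= (y + b) * b by apply: mulr_ge0 (ltW b0); move: yb; rewrite ler_norml => /andP[h _]; rewrite -lerBlDr sub0r.
have k1 : (y + b) * b < k%:R by rewrite truncnS_gt.
have k2 : k%:R <= (y + b) * b + 1 by rewrite /k -natr1 lerD2r truncn_le.
have t1 : y < thr k by rewrite /thr ltrBrDr ltr_pdivlMr.
have t2 : thr k <= y'.
  apply: le_trans (ltW lt); rewrite /thr lerBlDr ler_pdivrMr//.
  by rewrite addrAC [leRHS]mulrDl mulVf ?gt_eqF.
have kK : (k < K)%N.
  rewrite ltnS -(ler_nat R) !natrM -/b.
  have : thr k <= b by apply: (le_trans t2); move: y'b; rewrite ler_norml => /andP[].
  by rewrite /thr lerBlDr ler_pdivrMr//; lra.
have := congr1 (fun u : {ffun 'I_K -> bool} => u (Ordinal kK)) e.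
by rewrite !ffunE/= t2 leNgt t1.
Qed.

Lemma qval_close y : `|y| <= b -> `|qval (quant y) - y| <= b^-1.
Proof.
move=> yb; have [h1 h2] : `|qval (quant y)| <= b /\ quant (qval (quant y)) = quant y.
  by apply: (@xgetPex _ 0 [set z | `|z| <= b /\ quant z = quant y]); exists y.
rewrite ler_norml; apply/andP; split.
  by rewrite lerBrDr addrC lerBlDr; exact: same_quant h1 yb h2.
by rewrite lerBlDr addrC; exact: same_quant yb h1 (esym h2).
Qed.

Lemma qval_bound u : `|qval u| <= b.
Proof.
have [[y yu]|n] := pselect (exists y : R, `|y| <= b /\ quant y = u).
  by have [] := @xgetPex _ 0 [set z | `|z| <= b /\ quant z = u] (ex_intro _ y yu).
by rewrite /qval xgetPN ?normr0 ?ltW// => y yu; apply: n; exists y.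
Qed.

(** A bound free of [B], integrable for Gaussian [y], that dominates the limit of fine
    quantization. *)
Lemma qval_sqr y : (qval (quant y) - y) ^+ 2 <= 4 * y ^+ 2 + 1.
Proof.
have [yb|yb] := leP `|y| b.
  have := qval_close yb; have : b^-1 <= 1 by rewrite invf_le1// ler1n.
  move=> b1 h; have {}h := le_trans h b1; have y2 := sqr_ge0 y.
  by move: h; rewrite -(ler_pXn2r (_ : 0 < 2)%N) ?nnegrE// real_normK ?num_real// expr1n; lra.
have h : `|qval (quant y)| <= `|y| by apply: le_trans (qval_bound _) (ltW yb).
have {}h : qval (quant y) ^+ 2 <= y ^+ 2.
  by rewrite -(real_normK (num_real y)) -(real_normK (num_real (qval _))) ler_pXn2r.
by have := sqr_ge0 (qval (quant y) + y); lra.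
Qed.

Lemma mble_quant (d : measure_display) (T : measurableType d) (F : {ffun 'I_K -> bool} -> T -> R) (Y : T -> R) :
  mble Y -> (forall u, mble (F u)) -> mble (fun w => F (quant (Y w)) w).
Proof.
move=> mY mF; apply: (mble_case (c := fun w => quant (Y w))) => // u.
by rewrite -[X in measurable X]setTI; exact: (mY measurableT _ (measurable_quant u)).
Qed.

End Quantizer.

Section QuantizerLimit.
Context {R : realType}.

(** [B] is chosen on one reference variable and depends on the law only, so it suits the letters of
    blocks whose length is fixed afterwards. *)
Lemma quant_approx (v e : R) {d} {T : measurableType d} (P : probability T R) (Y : T -> R) :
  0 <= v -> centered_gaussian P Y v -> 0 < e ->
  exists B, forall d' (T' : measurableType d') (P' : probability T' R) (Y' : T' -> R),
    centered_gaussian P' Y' v -> Ex P' (fun w => (qval (quant B (Y' w)) - Y' w) ^+ 2) <= e.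
Proof.
move=> v0 gY e0; have mY := cg_mble gY; have [IY _] := cg_moments gY v0.
pose f B w := (qval (quant B (Y w)) - Y w) ^+ 2.
have mf B : mble (fun y : R => (qval (quant B y) - y) ^+ 2).
  apply: measurable_funX; apply: measurable_funB => //.
  exact: (mble_quant (F := fun u _ => qval u)).
have lim : Ex P (f n) @[n --> \oo] --> Ex P (fun=> 0).
  apply: (Ex_dct (g := fun w => 4 * Y w ^+ 2 + 1)).
  - by move=> B; exact: (measurableT_comp (mf B) mY).
  - exact: measurable_cst.
  - move=> w; apply/cvgrPdist_le => x x0.
    have lim1 : ((n.+1%:R : R)^-1) @[n --> \oo] --> (0 : R) by exact: cvg_harmonic.
    have : \forall n \near \oo, `|0 - (n.+1%:R : R)^-1| <= Num.min x 1.
      by move/cvgrPdist_le: lim1; apply; rewrite lt_min x0 ltr01.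
    have : \forall n \near \oo, `|Y w| <= n.+1%:R.
      near=> n; apply: (le_trans (ltW (truncnS_gt _))); rewrite ler_nat ltnS.
      by near: n; exact: nbhs_infty_ge.
    move=> n1 n2; near=> n.
    have h1 : `|Y w| <= n.+1%:R by near: n.
    have : `|0 - (n.+1%:R : R)^-1| <= Num.min x 1 by near: n.
    rewrite sub0r normrN ger0_norm ?invr_ge0// le_min => /andP[h2 h3].
    rewrite sub0r normrN ger0_norm ?sqr_ge0// /f -(real_normK (num_real (_ - _))).
    have h4 := qval_close h1.
    apply: le_trans h2; rewrite expr2; apply: le_trans (ler_pM _ _ h4 (le_trans h4 h3)) _ => //.
    by rewrite mulr1.
  - by apply: igD; [exact: igZ|exact: ig_cst].
  - by move=> B w; rewrite /f ger0_norm ?sqr_ge0//; exact: qval_sqr.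
have [B hB] : exists B, Ex P (f B) <= e.
  move: lim; rewrite Ex_cst => /cvgrPdist_le/(_ e e0)[N _ /(_ N (leqnn N))].
  rewrite sub0r normrN => h; exists N; exact: le_trans (ler_norm _) h.
exists B => d' T' P' Y' gY'.
have sl : same_law P' P Y' Y by move=> A mA; case: gY' => _ ->//; case: gY => _ ->.
by have := same_law_Ex (cg_mble gY') mY sl (mf B); rewrite /comp => ->.
Unshelve. all: by end_near. Qed.

End QuantizerLimit.

(** * Quantized Gaussian kernels and their divergence *)

Section Kernel.
Context {R : realType} {d : measure_display} {T : measurableType d}.
Variables (P : probability T R) (g : T -> R).
Hypothesis gg : gvec P (fun w (_ : unit) => g w) KI.
Variables (U : finType) (qt : R -> U).
Hypothesis mqt : forall u, measurable [set y | qt y = u].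

Let cg1 : centered_gaussian P g 1.
Proof. by have [_] := gvec_coord gg tt; rewrite /KI eqxx. Qed.

Let mg : mble g := cg_mble cg1.

Definition kern (u : U) (m t : R) : R := Ex P (fun w => (qt (m + t * g w) == u)%:R).

Lemma mble_qt {d'} {T' : measurableType d'} (Y : T' -> R) u : mble Y ->
  mble (fun w => (qt (Y w) == u)%:R : R).
Proof.
move=> mY; apply: mble_bool.
rewrite (_ : [set w | _] = setT `&` Y @^-1` [set y | qt y = u]); first exact: mY.
by rewrite setTI; apply/seteqP; split => w /= /eqP.
Qed.

Let mk u m t : mble (fun w => (qt (m + t * g w) == u)%:R : R).
Proof. by apply: mble_qt; apply: measurable_funD => //; exact: measurable_funM. Qed.

Lemma kern01 u m t : 0 <= kern u m t <= 1.
Proof. by apply: Ex01 => // w; exact: bool01. Qed.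

Lemma kern_ge0 u m t : 0 <= kern u m t. Proof. by case/andP: (kern01 u m t). Qed.

Lemma kern_sum m t : \sum_u kern u m t = 1.
Proof.
rewrite -Ex_sum => [|u _]; last by apply: ig01 => // w; exact: bool01.
rewrite -[RHS](Ex_cst P 1); apply: eq_Ex => w; under eq_bigr do rewrite eq_sym -[_%:R]mulr1.
exact: (sum_delta (qt (m + t * g w)) (fun=> 1)).
Qed.

Lemma mble_kern u t : mble (fun m => kern u m t).
Proof.
apply: (@mble_tonelli _ _ _ _ _ P (fun z : R * T => (qt (z.1 + t * g z.2) == u)%:R)) => [|z]; last exact: ler0n.
apply: mble_qt; apply: measurable_funD; first exact: measurable_fst.
by apply: measurable_funM => //; apply: (measurableT_comp mg); exact: measurable_snd.
Qed.

(** Expresses the kernel of another mean and variance as a reweighting of the same noise [g], which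
    makes two kernels comparable under one expectation. *)
Lemma tilt_indic (a b : R) (B : set R) : 0 < a -> measurable B ->
  Ex P (fun w => expR (ln a / 2 + g w ^+ 2 / 2 - a * (g w - b) ^+ 2 / 2) * \1_B (g w)) =
  Ex P (fun w => \1_B (b + (Num.sqrt a)^-1 * g w)).
Proof.
move=> a0 mB; set s := (Num.sqrt a)^-1; have s0 : 0 < s by rewrite invr_gt0 sqrtr_gt0.
have m1 : mble (\1_B : R -> R) := measurable_indic mB.
rewrite /Ex /Rintegral; congr fine.
pose f (y : R) := expR (ln a / 2 + y ^+ 2 / 2 - a * (y - b) ^+ 2 / 2) * \1_B y.
have mf : mble f.
  apply: measurable_funM => //; apply: (measurableT_comp (@measurable_expR R)).
  apply: measurable_funB; first by apply: measurable_funD => //; apply: measurable_funM => //; exact: measurable_funX.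
  apply: measurable_funM => //; apply: measurable_funM => //; apply: measurable_funX.
  exact: measurable_funB.
have f0 y : (0 <= (f y)%:E)%E by rewrite lee_fin mulr_ge0 ?expR_ge0// indicE ler0n.
transitivity (normal_prob b s B).
  have mfE : mble (EFin \o f) by exact/measurable_EFinP.
  rewrite [LHS](cg_integral cg1 ltr01 mfE f0) /normal_prob [RHS]integral_mkcond.
  apply: eq_integral => y _; rewrite patchE /= /f tilt_pdf// -EFinM indicE.
  have p0 : normal_pdf 0 (Num.sqrt 1) y != 0 :> R.
    by rewrite sqrtr1 normal_pdfE ?oner_neq0// gt_eqF// mulr_gt0 ?normal_peak_gt0 ?expR_gt0// oner_neq0.
  by case: (y \in B); rewrite ?mulr1 ?mulr0 ?mul0r// divfK.
rewrite -normal_prob_shift ?gt_eqF//.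
have gs := gvec_lin gg (fun (_ : unit) _ => s).
have [_ [ms cgs]] := gvec_coord gs tt.
have e (w : T) : \sum_(j : unit) s * g w = s * g w.
  exact: sum_unit.
have mBb : measurable [set y : R | B (b + y)].
  have mb : mble (fun y : R => b + y) by exact: measurable_funD.
  by rewrite -[X in measurable X]setTI; exact: (mb measurableT B mB).
have := cgs _ mBb; rewrite (_ : _ == 0 = false); last first.
  rewrite !sum_unit.
  by rewrite /KI eqxx mulr1 mulf_eq0 orbb gt_eqF.
rewrite (_ : Num.sqrt _ = s); last first.
  rewrite !sum_unit.
  by rewrite /KI eqxx mulr1 -expr2 sqrtr_sqr gtr0_norm.
move=> <-.
have mC : measurable [set w | B (b + s * g w)].
  have mb : mble (fun w => b + s * g w) by apply: measurable_funD => //; exact: measurable_funM.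
  by rewrite -[X in measurable X]setTI; exact: (mb measurableT B mB).
transitivity (P [set w | B (b + s * g w)]).
  by congr (P _); apply/funext => w; rewrite /preimage/= e.
rewrite -[LHS](_ : \int[P]_w (\1_[set w | B (b + s * g w)] w)%:E = _)%E; last by rewrite integral_indic// setIT.
by apply: eq_integral => w _; rewrite !indicE.
Qed.

Let g2 : ig P (fun w => g w ^+ 2) /\ Ex P (fun w => g w ^+ 2) = 1 := cg_moments cg1 ler01.

Let Lg : L2 P g. Proof. by split => //; case: g2. Qed.

Let gmean : Ex P g = 0 := gvec_mean gg tt.

(* The uniform part keeps the log-likelihood ratio bounded below. *)
Definition mixq (eta : R) (u : U) (m t : R) : R := (1 - eta) * kern u m t + eta / #|U|%:R.

(** Data processing: quantization does not increase the divergence of N(s, q) from N(mu, v), whose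
    value is the bound without its last bracket; that bracket pays for the uniform part of [mixq].
    The proof is the variational inequality [1 + ln c - c * exp L <= - L], with a constant [c]
    chosen on each cell. *)
Lemma kl_bound (s mu q v eta : R) : 0 < q -> 0 < v -> 0 < eta < 1 ->
  \sum_u kern u s (Num.sqrt q) *
     (ln (kern u s (Num.sqrt q)) - ln (mixq eta u mu (Num.sqrt v))) <=
  ln (v / q) / 2 - 2^-1 + (q + (mu - s) ^+ 2) / (2 * v) + (eta / (1 - eta) + eta).
Proof.
move=> q0 v0 /andP[eta0 eta1].
have sq : 0 < Num.sqrt q by rewrite sqrtr_gt0.
have sv : 0 < Num.sqrt v by rewrite sqrtr_gt0.
have U0 : 0 < #|U|%:R :> R by rewrite ltr0n; apply/card_gt0P; exists (qt 0).
set k := fun u => kern u s (Num.sqrt q); set Q := fun u => mixq eta u mu (Num.sqrt v).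
have Q0 u : 0 < Q u.
  rewrite /Q /mixq ltr_wpDl ?divr_gt0// mulr_ge0 ?kern_ge0// subr_ge0 ltW//.
have k0 u : 0 <= k u := kern_ge0 u s _.
(* In the coordinate [g] with [y = s + sqrt q * g], the law N(mu, v) has mean [b] and precision
   [a]. *)
pose a := q / v; pose b := (mu - s) / Num.sqrt q.
have a0 : 0 < a by rewrite divr_gt0.
pose lr w := ln a / 2 + g w ^+ 2 / 2 - a * (g w - b) ^+ 2 / 2.
pose ind u w : R := (qt (s + Num.sqrt q * g w) == u)%:R.
have Iind u : ig P (ind u) by apply: ig01 => [|w]; [exact: mk|exact: bool01].
have LgB : L2 P (fun w => g w - b) by apply: L2B => //; exact: L2_cst.
have Ilr : ig P lr.
  apply: igB; first apply: igD; first exact: ig_cst.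
    by under eq_fun do rewrite mulrC; apply: igZ; exact: L2_sqr.
  by under eq_fun do rewrite mulrAC; apply: igZ; exact: L2_sqr.
have Irho : ig P (fun w => expR (lr w)) by case: (tilt1 b cg1 a0).
have Irho1 u : ig P (fun w => ind u w * expR (lr w)).
  apply: (ig_bndM (c := 1)) => //; first exact: mk.
  by move=> w; rewrite /ind; case: eqP; rewrite ?normr1 ?normr0.
have Eind u : Ex P (fun w => ind u w * expR (lr w)) = kern u mu (Num.sqrt v).
  have mB : measurable [set y : R | qt (s + Num.sqrt q * y) = u].
    have ms : mble (fun y : R => s + Num.sqrt q * y) by apply: measurable_funD => //; exact: measurable_funM.
    by rewrite -[X in measurable X]setTI; exact: (ms measurableT _ (mqt u)).
  have := tilt_indic b a0 mB => h.
  transitivity (Ex P (fun w => expR (lr w) * \1_[set y | qt (s + Num.sqrt q * y) = u] (g w))).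
    apply: eq_Ex => w; rewrite mulrC; congr (_ * _); rewrite /ind indicE; congr (_%:R)%R; congr nat_of_bool.
    by apply/eqP/idP => [h1|]; [apply/mem_set|move/set_mem].
  rewrite h; apply: eq_Ex => w; rewrite indicE; congr (_%:R)%R; congr nat_of_bool.
  have -> : mu + Num.sqrt v * g w = s + Num.sqrt q * (b + (Num.sqrt a)^-1 * g w).
    rewrite /a sqrtrM ?ltW// sqrtrV ?ltW// /b; field.
    by rewrite !gt_eqF.
  by apply/idP/eqP => [/set_mem|h1]; [|apply/mem_set].
(* The constant on a cell is the ratio of the two quantized probabilities. Where [k u] vanishes any
   positive value is admissible, and [eta] keeps the total cost of these cells below [eta]. *)
pose c u := if k u == 0 then eta else k u / Q u.
have c0 u : 0 < c u.
  by rewrite /c; case: eqVneq => // ne; rewrite divr_gt0// lt_neqAle eq_sym ne k0.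
have main : Ex P (fun w => \sum_u (ind u w * (ln (c u) + 1) - c u * (ind u w * expR (lr w)))) <= Ex P (fun w => - lr w).
  apply: Ex_le.
  - by apply: ig_sum => u _; apply: igB; [under eq_fun do rewrite mulrC; exact: igZ|exact: igZ].
  - exact: igN.
  - move=> w; rewrite (eq_bigr (fun u => (u == qt (s + Num.sqrt q * g w))%:R * (ln (c u) + 1 - c u * expR (lr w)))); last first.
      by move=> u _; rewrite /ind eq_sym; ring.
    rewrite sum_delta; set u := qt _.
    have := expR_ge1Dx (ln (c u) + lr w); rewrite expRD lnK ?posrE//; lra.
have EL : Ex P (fun w => - lr w) = ln (v / q) / 2 - 2^-1 + (q + (mu - s) ^+ 2) / (2 * v).
  have Ig : ig P g := L2_ig Lg.
  have [Ig2 Eg2] := g2.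
  rewrite ExN//.
  have -> : Ex P lr = Ex P (fun w => (ln a / 2 - a * b ^+ 2 / 2) + ((2^-1 - a / 2) * g w ^+ 2 + (a * b) * g w)).
    by apply: eq_Ex => w; rewrite /lr; field.
  rewrite ExD; [|exact: ig_cst|exact: (igD (igZ _ Ig2) (igZ _ Ig))].
  rewrite (ExD (igZ _ Ig2) (igZ _ Ig)).
  rewrite Ex_cst (ExZ _ Ig2) (ExZ _ Ig) Eg2 gmean mulr0 addr0 mulr1.
  have -> : ln a = - ln (v / q) by rewrite -lnV ?posrE ?divr_gt0// invf_div.
  have -> : b ^+ 2 = (mu - s) ^+ 2 / q by rewrite expr_div_n sqr_sqrtr ?ltW.
  by rewrite /a; field; rewrite !gt_eqF.
rewrite -EL; apply: le_trans (lerD main (lexx _)).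
rewrite Ex_sum; last by move=> u _; apply: igB; [under eq_fun do rewrite mulrC; exact: igZ|exact: igZ].
(* The error budget is spread over the cells, so that the comparison is made cell by cell. *)
have e1 : eta / (1 - eta) + eta = \sum_u ((k u) * (1 - eta)^-1 + eta * kern u mu (Num.sqrt v) - k u).
  rewrite sumrB big_split/= -mulr_suml -mulr_sumr !kern_sum; field; lra.
rewrite e1 -big_split/=; apply: ler_sum => u _.
rewrite ExB; [|by under eq_fun do rewrite mulrC; exact: igZ|exact: igZ].
have -> : Ex P (fun w => ind u w * (ln (c u) + 1)) = k u * (ln (c u) + 1).
  by under eq_Ex do rewrite mulrC; rewrite ExZ// mulrC.
rewrite ExZ// Eind /c -/(k u) -/(Q u).
have kv0 := kern_ge0 u mu (Num.sqrt v).
case: eqVneq => [->|ne].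
  by rewrite !mul0r; lra.
have kp : 0 < k u by rewrite lt_neqAle eq_sym ne k0.
rewrite ln_div ?posrE//.
suff : k u / Q u * kern u mu (Num.sqrt v) <= k u * (1 - eta)^-1 by have := mulr_ge0 (ltW eta0) kv0; lra.
rewrite -mulrA ler_pM2l// mulrC ler_pdivrMr// mulrC ler_pdivlMr ?subr_gt0//.
by rewrite /Q /mixq mulrC lerDl divr_ge0// ltW.
Qed.

End Kernel.

Section BestPrediction.
Context {R : realType} {d : measure_display} {T : measurableType d} {F : finType}.
Variables (P : probability T R) (z : T -> F).
Hypothesis mz : forall x, measurable [set w | z w = x].

Lemma best_prediction (X : T -> R) (f : F -> R) : L2 P X ->
  let m x := Ex P (fun w => X w * (x == z w)%:R) / Ex P (fun w => (x == z w)%:R) in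
  L2 P (fun w => X w - m (z w)) /\
  Ex P (fun w => (X w - m (z w)) ^+ 2) <= Ex P (fun w => (X w - f (z w)) ^+ 2).
Proof.
move=> LX m.
have Lm : L2 P (fun w => m (z w)) by exact: L2_fin.
have Lf : L2 P (fun w => f (z w)) by exact: L2_fin.
have L1 x : L2 P (fun w => (x == z w)%:R).
  apply: (@L2_bnd _ _ _ _ _ 1); first exact: mble_eqc.
  by move=> w; case: eqP; rewrite ?normr1 ?normr0.
have Ld : L2 P (fun w => X w - m (z w)) by exact: L2B.
split => //.
have Lmf : L2 P (fun w => m (z w) - f (z w)) by exact: L2B.
have orth : Ex P (fun w => (X w - m (z w)) * (m (z w) - f (z w))) = 0.
  rewrite (Ex_case mz (g := fun x w => (X w - m (z w)) * (m x - f x))); last first.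
    by move=> x; apply: L2_mul Ld (L2_cst _ _).
  rewrite big1// => x _.
  transitivity (Ex P (fun w => (m x - f x) * (X w * (x == z w)%:R - m x * (x == z w)%:R))).
    by apply: eq_Ex => w; case: eqP => [->|_]; rewrite ?mulr1 ?mulr0 ?mul0r ?mul1r//; ring.
  rewrite ExZ ?ExB ?ExZ; [|exact: L2_ig|exact: L2_mul|by apply: igZ; exact: L2_ig|by apply: igB; [exact: L2_mul|apply: igZ; exact: L2_ig]].
  have [e|ne] := eqVneq (Ex P (fun w => (x == z w)%:R)) 0.
    rewrite e mulr0 subr0 (_ : Ex P (fun w => X w * _) = 0) ?mulr0//.
    apply: Ex_null => //; rewrite -[RHS]e; apply: eq_Ex => w.
    by case: eqP; rewrite ?expr1n ?expr0n.
  by rewrite /m divfK// subrr mulr0.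
have -> : Ex P (fun w => (X w - f (z w)) ^+ 2) =
    Ex P (fun w => (X w - m (z w)) ^+ 2 + 2 * ((X w - m (z w)) * (m (z w) - f (z w))) + (m (z w) - f (z w)) ^+ 2).
  by apply: eq_Ex => w; ring.
have I1 := L2_sqr Ld; have I2 := L2_mul Ld Lmf; have I3 := L2_sqr Lmf.
rewrite ExD//; last by apply: igD => //; exact: igZ.
rewrite ExD//; last exact: igZ.
rewrite ExZ// orth mulr0 addr0 lerDl; apply: Ex_ge0 => w; exact: sqr_ge0.
Qed.

End BestPrediction.

(** * Typicality of blocks *)

Lemma mble_sumc {R : realType} {d'} {T' : measurableType d'} (I : finType) (p : pred I) (f : I -> T' -> R) :
  (forall j, mble (f j)) -> mble (fun w => \sum_(j | p j) f j w).
Proof.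
move=> mf; rewrite (_ : (fun w => _) = (fun w => \sum_j if p j then f j w else 0)).
  by apply: measurable_sum => j; case: (p j).
by apply/funext => w; rewrite big_mkcond.
Qed.

Lemma chebyshev_sum {R : realType} {d} {T : measurableType d} (P : probability T R) (n : nat)
    (D : 'I_n -> T -> R) (V r de : R) : (0 < n)%N -> 0 < de ->
  (forall t, L2 P (D t)) -> (forall t, Ex P (fun w => D t w ^+ 2) <= V) -> (forall t, Ex P (D t) <= r) ->
  (forall t t', t != t' -> Ex P (fun w => (D t w - Ex P (D t)) * (D t' w - Ex P (D t'))) = 0) ->
  Ex P (fun w => ((n%:R * (r + de) < \sum_t D t w)%R)%:R) <= V / (n%:R * de ^+ 2).
Proof.
move=> n0 de0 LD DV Dr D0; have nR : 0 < n%:R :> R by rewrite ltr0n.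
pose C t w := D t w - Ex P (D t).
have LC t : L2 P (C t) by apply: L2B => //; exact: L2_cst.
have CV t : Ex P (fun w => C t w * C t w) <= V.
  apply: le_trans (DV t).
  rewrite (_ : Ex P (fun w => C t w * C t w) = Ex P (fun w => D t w ^+ 2) - Ex P (D t) ^+ 2).
    by rewrite gerBl sqr_ge0.
  have -> : Ex P (fun w => C t w * C t w) =
      Ex P (fun w => D t w ^+ 2 + ((- 2 * Ex P (D t)) * D t w + Ex P (D t) ^+ 2)).
    by apply: eq_Ex => w; rewrite /C; ring.
  rewrite ExD; [|exact: L2_sqr|by apply: igD; [apply: igZ; exact: L2_ig|exact: ig_cst]].
  by rewrite ExD ?Ex_cst ?ExZ; [ring|exact: L2_ig|apply: igZ; exact: L2_ig|exact: ig_cst].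
have sV : Ex P (fun w => (\sum_t C t w) ^+ 2) <= n%:R * V.
  rewrite Ex_sqsum// mulr_natl -[X in V *+ X](card_ord n) -sumr_const; apply: ler_sum => t _.
  rewrite (bigD1 t)//= big1 ?addr0// => t' tt'; apply: D0; by rewrite eq_sym.
have LS : L2 P (fun w => \sum_t C t w) by exact: L2_sum.
apply: le_trans (_ : Ex P (fun w => ((n%:R * de) ^+ 2)^-1 * (\sum_t C t w) ^+ 2) <= _).
  apply: Ex_le => [||w].
  - apply: ig01 => [|w]; last exact: bool01.
    by apply: mble_lt => //; apply: L2_mble; exact: L2_sum.
  - by apply: igZ; exact: L2_sqr.
  - case: ltP => h; last by rewrite mulr_ge0 ?sqr_ge0// invr_ge0 sqr_ge0.
    rewrite ler_pdivlMl ?exprn_gt0 ?mulr_gt0// mulr1 ler_pXn2r ?nnegrE ?mulr_ge0 ?ltW//.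
      have : \sum_t D t w <= \sum_t C t w + n%:R * r.
        rewrite [n%:R * r]mulr_natl -[X in r *+ X](card_ord n) -sumr_const -big_split/=.
        by apply: ler_sum => t _; rewrite /C -[leLHS](subrK (Ex P (D t))) lerD2l.
      by move: h; rewrite mulrDr; lra.
    have : \sum_t D t w <= \sum_t C t w + n%:R * r.
      rewrite [n%:R * r]mulr_natl -[X in r *+ X](card_ord n) -sumr_const -big_split/=.
      by apply: ler_sum => t _; rewrite /C -[leLHS](subrK (Ex P (D t))) lerD2l.
    by move: h (mulr_gt0 nR de0); rewrite mulrDr; lra.
rewrite ExZ; last exact: L2_sqr.
rewrite mulrC ler_pdivrMr ?exprn_gt0 ?mulr_gt0//; apply: le_trans sV _.
rewrite le_eqVlt; apply/orP; left; apply/eqP; field.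
by rewrite !gt_eqF.
Qed.

(** * Log-likelihood ratios of letters and of blocks *)

Section Letters.
Context {R : realType} {d : measure_display} {T : measurableType d}.
Variables (P : probability T R) (g : T -> R).
Hypothesis gg : gvec P (fun w (_ : unit) => g w) KI.
Variables (U : finType) (qt : R -> U).
Hypothesis mqt : forall u, measurable [set y | qt y = u].

Lemma kern_law {d'} {T' : measurableType d'} (P' : probability T' R) (Y : T' -> R) (u : U) (m t : R) :
  centered_gaussian P' Y 1 -> Ex P' (fun w => (qt (m + t * Y w) == u)%:R) = kern P g qt u m t.
Proof.
move=> gY; have [_ g1] := gvec_coord gg tt; rewrite /KI eqxx in g1.
have sl : same_law P' P Y g by move=> A mA; case: gY => _ ->//; case: g1 => _ ->.
have mf : mble (fun y : R => (qt (m + t * y) == u)%:R : R).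
  by apply: mble_qt => //; apply: measurable_funD => //; exact: measurable_funM.
exact: (same_law_Ex (cg_mble gY) (cg_mble g1) sl mf).
Qed.

(** The logarithm of the kernel is unbounded; weighted by the kernel itself, its square is not. With
    [x = exp (- y)] this is [y <= 2 * exp (y / 2)]. *)
Lemma xln2_le (x : R) : 0 <= x <= 1 -> x * ln x ^+ 2 <= 4.
Proof.
move=> /andP[x0 x1]; have [->|xn] := eqVneq x 0; first by rewrite mul0r.
have xp : 0 < x by rewrite lt_neqAle eq_sym xn.
pose y := - ln x; have y0 : 0 <= y by rewrite /y oppr_ge0 ln_le0.
have xE : x = (expR (y / 2))^-2.
  by rewrite -exprVn -expRN -expRM_natl /y -[LHS](lnK (x := x)) ?posrE//; congr expR; field.
have e1 : 1 + y / 2 <= expR (y / 2) by exact: expR_ge1Dx.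
have e0 : 0 < expR (y / 2) by exact: expR_gt0.
rewrite (_ : ln x ^+ 2 = y ^+ 2); last by rewrite /y sqrrN.
rewrite xE mulrC ler_pdivrMr ?exprn_gt0//.
have : y ^+ 2 <= (2 * expR (y / 2)) ^+ 2.
  rewrite ler_pXn2r ?nnegrE ?mulr_ge0 ?expR_ge0//; lra.
by rewrite exprMn; lra.
Qed.

Variables (n l : nat) (S G : T -> 'I_n * 'I_l -> R) (KS : 'I_n * 'I_l -> 'I_n * 'I_l -> R).
Hypotheses (gS : gvec P S KS) (gG : gvec P G KI).
Hypothesis KS0 : forall j j', j.1 != j'.1 -> KS j j' = 0.
Variables (val : U -> R) (q eta : R) (a v : 'I_l -> R).
Hypotheses (q0 : 0 < q) (eta01 : 0 < eta < 1) (v0 : forall i, 0 < v i).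
Local Notation J := ('I_n * 'I_l)%type.
Let PP : probability _ R := (P \x P)%E.
Let sq := Num.sqrt q.

Let kp (s : R) (u : U) := kern P g qt u s sq.
(** The predicted mean of letter [i] from the earlier encoders. The sources being exchangeable, one
    coefficient serves all the earlier letters. *)
Let muh (x : 'I_l -> U) (i : 'I_l) := a i * \sum_(j < l | (j < i)%N) val (x j).
Let Qs (x : 'I_l -> U) (i : 'I_l) u := mixq P g qt eta u (muh x i) (Num.sqrt (v i)).

Definition Ut (w : T * T) (j : J) : U := qt (S w.1 j + sq * G w.2 j).

Let U0 : 0 < #|U|%:R :> R.
Proof. by rewrite ltr0n; apply/card_gt0P; exists (qt 0). Qed.

Lemma mixq_bounds u m t : eta / #|U|%:R <= mixq P g qt eta u m t <= 1.
Proof.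
case/andP: eta01 => e0 e1; have /andP[k0 k1] := kern01 gg mqt u m t.
rewrite /mixq lerDr mulr_ge0 ?subr_ge0 ?(ltW e1)//=.
have : eta / #|U|%:R <= eta by rewrite ler_pdivrMr// ler_peMr ?(ltW e0)// ler1n -(ltr0n R).
nra.
Qed.

Lemma mixq_gt0 u m t : 0 < mixq P g qt eta u m t.
Proof.
case/andP: (mixq_bounds u m t) => h _; apply: lt_le_trans h.
by rewrite divr_gt0//; case/andP: eta01.
Qed.

Lemma mixq_sum m t : \sum_u mixq P g qt eta u m t = 1.
Proof.
rewrite big_split/= -mulr_sumr (kern_sum gg mqt) sumr_const -[X in _ + X]mulr_natr divfK ?gt_eqF//; ring.
Qed.

Definition lmax : R := - ln (eta / #|U|%:R).

Lemma ln_mixq_le u m t : `|ln (mixq P g qt eta u m t)| <= lmax.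
Proof.
have /andP[h1 h2] := mixq_bounds u m t; have e0 : 0 < eta / #|U|%:R by rewrite divr_gt0//; case/andP: eta01.
by rewrite ler0_norm ?ln_le0// lerN2 ler_ln ?posrE// mixq_gt0.
Qed.

Let YY (w : T * T) (j : J + J) := match j with inl j => S w.1 j | inr j => G w.2 j end.
Let KY (i j : J + J) := match i, j with
  | inl i, inl j => KS i j | inr i, inr j => KI i j | _, _ => 0 end : R.
Let gY : gvec PP YY KY := gvec_prod gS gG.

Let Uf (y : J + J -> R) (j : J) := qt (y (inl j) + sq * y (inr j)).

Let mUf j u : measurable [set y : vec R (J + J)%type | Uf y j = u].
Proof.
have m1 : mble (fun y : vec R (J + J)%type => y (inl j) + sq * y (inr j)).
  apply: measurable_funD; first exact: measurable_coord.
  by apply: measurable_funM => //; exact: measurable_coord.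
by rewrite -[X in measurable X]setTI; exact: (m1 measurableT _ (mqt u)).
Qed.

Let mln {d'} {T' : measurableType d'} (f : T' -> R) : mble f -> mble (fun w => ln (f w)).
Proof. by move=> mf; exact: (measurableT_comp (@measurable_ln R) mf). Qed.

Let mmix {d'} {T' : measurableType d'} (f : T' -> R) u t : mble f ->
  mble (fun w => mixq P g qt eta u (f w) t).
Proof.
move=> mf; apply: measurable_funD => //; apply: measurable_funM => //.
exact: (measurableT_comp (mble_kern gg mqt u t) mf).
Qed.

Let Lf (t : 'I_n) (i : 'I_l) (y : J + J -> R) : R :=
  ln (kp (y (inl (t, i))) (Uf y (t, i))) - ln (Qs (fun j => Uf y (t, j)) i (Uf y (t, i))).

Let mkp t i : mble (fun y : vec R (J + J)%type => ln (kp (y (inl (t, i))) (Uf y (t, i)))).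
Proof.
apply: (mble_case (mUf (t, i)) (g := fun u (y : vec R (J + J)%type) => ln (kp (y (inl (t, i))) u))).
move=> u; apply: mln; apply: (measurableT_comp (mble_kern gg mqt u sq)).
exact: measurable_coord.
Qed.

Let mmuh t i : mble (fun y : vec R (J + J)%type => muh (fun j => Uf y (t, j)) i).
Proof.
apply: measurable_funM => //; apply: mble_sumc => j.
exact: (mble_case (mUf (t, j)) (g := fun u _ => val u)).
Qed.

Let mQs t i : mble (fun y : vec R (J + J)%type => ln (Qs (fun j => Uf y (t, j)) i (Uf y (t, i)))).
Proof.
apply: (mble_case (mUf (t, i)) (g := fun u (y : vec R (J + J)%type) => ln (Qs (fun j => Uf y (t, j)) i u))).
by move=> u; apply: mln; exact: (mmix u _ (mmuh t i)).
Qed.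

Let mLf t i : mble (fun y : vec R (J + J)%type => Lf t i y).
Proof. exact: (measurable_funB (mkp t i) (mQs t i)). Qed.

Definition llr (w : T * T) (t : 'I_n) (i : 'I_l) : R := Lf t i (YY w).

Let mYY : mble (YY : T * T -> vec R (J + J)%type) := gvec_mvec gY.

Let gG1 j : centered_gaussian P (fun w => G w j) 1.
Proof. by have [_] := gvec_coord gG j; rewrite /KI eqxx. Qed.

Lemma measurable_Ut w1 j u : measurable [set w2 | Ut (w1, w2) j = u].
Proof.
have m1 : mble (fun w2 => S w1 j + sq * G w2 j).
  by apply: measurable_funD => //; apply: measurable_funM => //; exact: cg_mble (gG1 j).
by rewrite -[X in measurable X]setTI; exact: (m1 measurableT _ (mqt u)).
Qed.

Lemma letter_law w1 j (f : U -> R) :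
  Ex P (fun w2 => f (Ut (w1, w2) j)) = \sum_u kern P g qt u (S w1 j) sq * f u.
Proof.
rewrite (Ex_case (measurable_Ut w1 j) (g := fun u _ => f u)) => [|u]; last exact: ig_cst.
apply: eq_bigr => u _; rewrite -(kern_law u _ _ (gG1 j)) mulrC -ExZ.
  by apply: eq_Ex => w; rewrite mulrC eq_sym.
apply: ig01 => [|w]; last exact: bool01.
apply: mble_qt => //; apply: measurable_funD => //; apply: measurable_funM => //; exact: cg_mble (gG1 j).
Qed.

(** From [(x - y) ^ 2 <= 2 * x ^ 2 + 2 * y ^ 2]: [xln2_le] bounds the kernel's share letter by
    letter, and [lmax] bounds the logarithm of the mixture. *)
Definition lvar : R := 2 * (4 * #|U|%:R) + 2 * lmax ^+ 2.

Lemma L2_llr t i : L2 PP (fun w => llr w t i) /\ Ex PP (fun w => llr w t i ^+ 2) <= lvar.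
Proof.
pose f1 (w : T * T) := ln (kp (S w.1 (t, i)) (Ut w (t, i))).
pose f2 (w : T * T) := ln (Qs (fun j => Ut w (t, j)) i (Ut w (t, i))).
have m1 : mble f1 := measurableT_comp (mkp t i) mYY.
have m2 : mble f2 := measurableT_comp (mQs t i) mYY.
have f2b w : `|f2 w| <= lmax by exact: ln_mixq_le.
have sec w1 : Ex P (fun w2 => f1 (w1, w2) ^+ 2) = \sum_u kp (S w1 (t, i)) u * ln (kp (S w1 (t, i)) u) ^+ 2.
  exact: (letter_law w1 (t, i) (fun u => ln (kp (S w1 (t, i)) u) ^+ 2)).
have secb w1 : 0 <= Ex P (fun w2 => f1 (w1, w2) ^+ 2) <= 4 * #|U|%:R.
  rewrite Ex_ge0 => [|w]; last exact: sqr_ge0.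
  rewrite sec mulr_natr -sumr_const; apply: ler_sum => u _.
  by apply: xln2_le; exact: (kern01 gg mqt).
have isec w1 : ig P (fun w2 => f1 (w1, w2) ^+ 2).
  exact: L2_ig (L2_fin P (measurable_Ut w1 (t, i)) (fun u => ln (kp (S w1 (t, i)) u) ^+ 2)).
have i1 : ig PP (fun w => f1 w ^+ 2).
  apply: ig_tonelli => //; [exact: measurable_funX|by move=> w; exact: sqr_ge0|].
  apply: (@ig_bnd _ _ _ _ _ (4 * #|U|%:R)).
    by apply: (@mble_tonelli _ _ _ _ _ P (fun w => f1 w ^+ 2)) => [|w]; [exact: measurable_funX|exact: sqr_ge0].
  by move=> w; case/andP: (secb w) => h1 h2; rewrite ger0_norm.
have L1 : L2 PP f1 by [].
have L2' : L2 PP f2 by exact: L2_bnd f2b.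
split; first exact: L2B.
apply: le_trans (_ : Ex PP (fun w => 2 * f1 w ^+ 2 + 2 * lmax ^+ 2) <= _).
  apply: Ex_le; [by apply: L2_sqr; exact: L2B|by apply: igD; [exact: igZ|exact: ig_cst]|].
  move=> w; rewrite -[llr w t i]/(f1 w - f2 w).
  have : f2 w ^+ 2 <= lmax ^+ 2.
    by rewrite -(real_normK (num_real (f2 w))) ler_pXn2r ?nnegrE// (le_trans _ (f2b w)).
  by have := sqr_ge0 (f1 w + f2 w); lra.
rewrite ExD; [|exact: igZ|exact: ig_cst].
rewrite Ex_cst ExZ// lerD2r ler_pM2l//.
rewrite (Ex_fubini i1 isec) -[leRHS](Ex_cst P); apply: Ex_le.
- exact: (ig_fubini i1 isec).
- exact: ig_cst.
- by move=> w; case/andP: (secb w).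
Qed.

(** Given the source and the earlier letters, the mean of [llr] is the divergence bounded by
    [kl_bound]. When the prediction error is [v i - q], its Gaussian terms collapse to
    [ln (v i / q) / 2]; [de] is the loss due to quantized predictors. *)
Lemma llr_mean t i (de : R) :
  Ex PP (fun w => (a i * \sum_(j < l | (j < i)%N) val (Ut w (t, j)) - S w.1 (t, i)) ^+ 2) <= v i - q + de ->
  Ex PP (fun w => llr w t i) <= ln (v i / q) / 2 + de / (2 * v i) + (eta / (1 - eta) + eta).
Proof.
move=> hde; have [LL _] := L2_llr t i.
pose mw w := a i * \sum_(j < l | (j < i)%N) val (Ut w (t, j)).
have Lm : L2 PP mw.
  apply: L2Z; apply: L2_sum => j _.
  apply: (@L2_fin _ _ _ _ PP (fun w => Ut w (t, j)) _ val) => u.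
  by rewrite -[X in measurable X]setTI; exact: (mYY measurableT (mUf (t, j) u)).
have LS : L2 PP (fun w => S w.1 (t, i)) := gvec_L2 gY (inl (t, i)).
have LmS : L2 PP (fun w => mw w - S w.1 (t, i)) by exact: L2B.
pose bd (w : T * T) := ln (v i / q) / 2 - 2^-1 + (q + (mw w - S w.1 (t, i)) ^+ 2) / (2 * v i) + (eta / (1 - eta) + eta).
have Ibd : ig PP bd.
  apply: igD; last exact: ig_cst.
  apply: igD; first exact: ig_cst.
  by under eq_fun do rewrite mulrC; apply: igZ; apply: igD; [exact: ig_cst|exact: L2_sqr].
have Lm1 w1 : L2 P (fun w2 => mw (w1, w2)).
  by apply: L2Z; apply: L2_sum => j _; exact: (L2_fin P (measurable_Ut w1 (t, j)) val).
have LmS1 w1 : L2 P (fun w2 => mw (w1, w2) - S w1 (t, i)).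
  by apply: L2B => //; exact: L2_cst.
have Ibd1 w1 : ig P (fun w2 => bd (w1, w2)).
  apply: igD; last exact: ig_cst.
  apply: igD; first exact: ig_cst.
  by under eq_fun do rewrite mulrC; apply: igZ; apply: igD; [exact: ig_cst|exact: L2_sqr].
have qa (w1 : T) u : mble (fun y : vec R J => ln (mixq P g qt eta u (a i * \sum_(j < l | (j < i)%N) val (qt (S w1 (t, j) + sq * y (t, j)))) (Num.sqrt (v i)))).
  apply: mln; apply: mmix; apply: measurable_funM => //; apply: mble_sumc => j.
  apply: (@mble_case _ _ _ _ (fun y : vec R J => qt (S w1 (t, j) + sq * y (t, j))) _ (fun u _ => val u)) => // x.
  have m1 : mble (fun y : vec R J => S w1 (t, j) + sq * y (t, j)).
    by apply: measurable_funD => //; apply: measurable_funM => //; exact: measurable_coord.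
  by rewrite -[X in measurable X]setTI; exact: (m1 measurableT _ (mqt x)).
have Iqa w1 u : ig P (fun w2 => ln (mixq P g qt eta u (mw (w1, w2)) (Num.sqrt (v i)))).
  apply: (@ig_bnd _ _ _ _ _ lmax) => [|w]; last exact: ln_mixq_le.
  exact: (measurableT_comp (qa w1 u) (gvec_mvec gG)).
have inner w1 : ig P (fun w2 => llr (w1, w2) t i) /\
   Ex P (fun w2 => llr (w1, w2) t i) <= Ex P (fun w2 => bd (w1, w2)).
  set s := S w1 (t, i).
  pose F u w2 := ln (kp s u) - ln (mixq P g qt eta u (mw (w1, w2)) (Num.sqrt (v i))).
  have IF u : ig P (F u) by apply: igB; [exact: ig_cst|exact: Iqa].
  have Ill : ig P (fun w2 => llr (w1, w2) t i) by exact: (ig_case (measurable_Ut w1 (t, i)) (g := F)).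
  split => //.
  rewrite [leLHS](Ex_case (measurable_Ut w1 (t, i)) (g := F) IF).
  have Ikp u : ig P (fun w2 => kp s u * F u w2) by exact: igZ.
  apply: le_trans (_ : Ex P (fun w2 => \sum_u kp s u * F u w2) <= _); last first.
    apply: Ex_le => [||w2]; [exact: ig_sum|exact: Ibd1|].
    exact: (kl_bound gg mqt s (mw (w1, w2)) q0 (v0 i) eta01).
  rewrite Ex_sum// le_eqVlt; apply/orP; left; apply/eqP; apply: eq_bigr => u _.
  rewrite ExZ//.
  (* With the source frozen, letter [(t, i)] depends only on its own noise and the prediction only
     on the noises of earlier encoders. *)
  have [|||||||_ E] := @gvec_indep _ _ _ _ P G _ gG (fun j => j == (t, i))
     (fun y => (qt (s + sq * y (t, i)) == u)%:R)
     (fun y => ln (kp s u) - ln (mixq P g qt eta u (a i * \sum_(j < l | (j < i)%N) val (qt (S w1 (t, j) + sq * y (t, j)))) (Num.sqrt (v i)))).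
  - by move=> x y; rewrite /KI; case: (x =P y) => [->|//]; rewrite eqxx.
  - apply: mble_qt => //.
    by apply: measurable_funD => //; apply: measurable_funM => //; exact: measurable_coord.
  - by apply: measurable_funB => //; exact: qa.
  - by move=> y y' e; rewrite e.
  - move=> y y' e; rewrite [in LHS](eq_bigr (fun j => val (qt (S w1 (t, j) + sq * y' (t, j)))))// => j ji.
    by rewrite e// xpair_eqE eqxx/= -val_eqE/= ltn_eqF.
  - apply: ig01 => [|w]; last exact: bool01.
    apply: mble_qt => //.
    by apply: measurable_funD => //; apply: measurable_funM => //; exact: cg_mble (gG1 _).
  - exact: IF.
  - rewrite /kp -(kern_law u s sq (gG1 (t, i))) -[RHS]E; apply: eq_Ex => w.
    by rewrite [in LHS]eq_sym.
apply: le_trans (_ : Ex PP bd <= _).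
  rewrite (Ex_fubini (L2_ig LL) (fun w1 => (inner w1).1)) (Ex_fubini Ibd Ibd1).
  apply: Ex_le => [||w1]; [exact: (ig_fubini (L2_ig LL) (fun w1 => (inner w1).1))|exact: ig_fubini|].
  exact: (inner w1).2.
have -> : Ex PP bd = ln (v i / q) / 2 - 2^-1 + (q + Ex PP (fun w => (mw w - S w.1 (t, i)) ^+ 2)) / (2 * v i) + (eta / (1 - eta) + eta).
  rewrite /bd ExD ?Ex_cst; [|by apply: igD; [exact: ig_cst|under eq_fun do rewrite mulrC; apply: igZ; apply: igD; [exact: ig_cst|exact: L2_sqr]]|exact: ig_cst].
  congr (_ + _); rewrite ExD ?Ex_cst; [|exact: ig_cst|by under eq_fun do rewrite mulrC; apply: igZ; apply: igD; [exact: ig_cst|exact: L2_sqr]].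
  congr (_ + _); under eq_Ex do rewrite mulrC.
  rewrite ExZ; last by apply: igD; [exact: ig_cst|exact: L2_sqr].
  by rewrite ExD ?Ex_cst 1?mulrC//; [exact: ig_cst|exact: L2_sqr].
rewrite lerD2r.
have vi := v0 i; set E := Ex PP _ in hde *.
have -> : ln (v i / q) / 2 + de / (2 * v i) = ln (v i / q) / 2 - 2^-1 + (q + (v i - q + de)) / (2 * v i).
  by field; rewrite gt_eqF.
by rewrite lerD2l ler_pM2r ?invr_gt0 ?mulr_gt0// lerD2l.
Qed.

Lemma llr_uncor i t t' : t != t' ->
  Ex PP (fun w => (llr w t i - Ex PP (fun w => llr w t i)) * (llr w t' i - Ex PP (fun w => llr w t' i))) = 0.
Proof.
move=> tt'; set c := Ex PP (fun w => llr w t i); set c' := Ex PP (fun w => llr w t' i).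
have Lc s b : L2 PP (fun w => llr w s i - b) by apply: L2B; [exact: (L2_llr s i).1|exact: L2_cst].
have dep s y y' b : (forall j, j.1 = s -> y (inl j) = y' (inl j) /\ y (inr j) = y' (inr j)) ->
    Lf s i y - b = Lf s i y' - b.
  move=> e; have eU j : Uf y (s, j) = Uf y' (s, j) by rewrite /Uf; case: (e (s, j) erefl) => -> ->.
  have eU' : (fun j => Uf y (s, j)) = (fun j => Uf y' (s, j)) by exact/funext.
  by rewrite /Lf eU' eU; case: (e (s, i) erefl) => -> _.
have [|||||||_ E] := @gvec_indep _ _ _ _ PP YY _ gY
  (fun j => match j with inl j => j.1 == t | inr j => j.1 == t end)
  (fun y => Lf t i y - c) (fun y => Lf t' i y - c').
- move=> [j|j] [j'|j']//= ne; first by apply: KS0; apply: contraNN ne => /eqP ->.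
  by rewrite /KI; case: (j =P j') ne => // ->; rewrite eqxx.
- by apply: measurable_funB => //; exact: mLf.
- by apply: measurable_funB => //; exact: mLf.
- by move=> y y' e; apply: dep => j jt; split; apply: e; rewrite jt.
- by move=> y y' e; apply: dep => j jt; split; apply: e; rewrite jt eq_sym.
- exact: L2_ig (Lc t c).
- exact: L2_ig (Lc t' c').
rewrite [LHS]E; apply/eqP; rewrite mulf_eq0; apply/orP; left; apply/eqP.
rewrite -(subrr c) -[X in _ = _ - X](Ex_cst PP c); apply: ExB; last exact: ig_cst.
exact: L2_ig (L2_llr t i).1.
Qed.

Local Notation Un := {ffun 'I_n -> U}.

Definition bkern (s : 'I_n -> R) (b : Un) : R := \prod_t kp (s t) (b t).
Definition bmix (i : 'I_l) (u : {ffun 'I_l -> Un}) (b : Un) : R := \prod_t Qs (fun j => u j t) i (b t).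
Definition Ub (w : T * T) : {ffun 'I_l -> Un} := [ffun i => [ffun t => Ut w (t, i)]].

Lemma bkern_ge0 s b : 0 <= bkern s b.
Proof. by apply: prodr_ge0 => t _; exact: kern_ge0. Qed.

Lemma bkern_sum s : \sum_b bkern s b = 1.
Proof.
rewrite /bkern -(bigA_distr_bigA (fun t u => kp (s t) u)) big1// => t _; exact: (kern_sum gg mqt).
Qed.

Lemma bmix_gt0 i u b : 0 < bmix i u b.
Proof. by apply: prodr_gt0 => t _; exact: mixq_gt0. Qed.

Lemma bmix_sum i u : \sum_b bmix i u b = 1.
Proof.
rewrite /bmix -(bigA_distr_bigA (fun t x => Qs (fun j => u j t) i x)) big1// => t _; exact: mixq_sum.
Qed.

Lemma bmix_causal : causal bmix.
Proof.
move=> i u u' e; apply/funext => b; apply: eq_bigr => t _; rewrite /Qs /muh.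
by rewrite (eq_bigr (fun j => val (u' j t)))// => j ji; rewrite e.
Qed.

Lemma mble_bkern {d'} {T' : measurableType d'} (s : T' -> 'I_n -> R) b :
  (forall t, mble (fun w => s w t)) -> mble (fun w => bkern (s w) b).
Proof.
move=> ms; apply: measurable_prod => t _.
exact: (measurableT_comp (mble_kern gg mqt (b t) sq) (ms t)).
Qed.

Lemma block_law w1 (f : {ffun 'I_l -> Un} -> R) :
  Ex P (fun w2 => f (Ub (w1, w2))) = \sum_(u : {ffun 'I_l -> Un}) (\prod_i bkern (fun t => S w1 (t, i)) (u i)) * f u.
Proof.
have mU u : measurable [set w2 | Ub (w1, w2) = u].
  rewrite (_ : [set _ | _] = \bigcap_(j in [set: J]) [set w2 | Ut (w1, w2) j = u j.2 j.1]).
    by apply: fin_bigcap_measurable => [|j _]; [exact: finite_finset|exact: measurable_Ut].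
  apply/seteqP; split => w2 /=.
    by move=> <- [t i] _ /=; rewrite !ffunE.
  by move=> h; apply/ffunP => i; apply/ffunP => t; rewrite !ffunE; exact: (h (t, i)).
rewrite (Ex_case mU (g := fun u _ => f u)) => [|u]; last exact: ig_cst.
apply: eq_bigr => u _; rewrite mulrC.
transitivity (Ex P (fun w2 => f u * \prod_(j : J) (qt (S w1 j + sq * G w2 j) == u j.2 j.1)%:R)).
  apply: eq_Ex => w2; rewrite mulrC; congr (_ * _).
  rewrite -(forallE (fun j : J => qt (S w1 j + sq * G w2 j) == u j.2 j.1)); congr ((nat_of_bool _)%:R); apply/idP/idP => [/eqP -> | /forallP h].
    by apply/forallP => -[t i]; rewrite !ffunE.
  by rewrite eq_sym; apply/eqP/ffunP => i; apply/ffunP => t; rewrite !ffunE; exact/eqP/(h (t, i)).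
have mq j : mble (fun y : vec R J => (qt (S w1 j + sq * y j) == u j.2 j.1)%:R : R).
  apply: mble_qt => //; apply: measurable_funD => //; apply: measurable_funM => //.
  exact: measurable_coord.
have iq j : ig P (fun w2 => (qt (S w1 j + sq * G w2 j) == u j.2 j.1)%:R).
  by apply: ig01 => [|w]; [exact: (measurableT_comp (mq j) (gvec_mvec gG))|exact: bool01].
have [||||| I E] := @gvec_indep_prod _ _ _ _ P G _ gG _ id
  (fun j (y : vec R J) => (qt (S w1 j + sq * y j) == u j.2 j.1)%:R) (index_enum J).
- exact: index_enum_uniq.
- by move=> i j ij; rewrite /KI (negbTE ij).
- exact: mq.
- by move=> j y y' e; rewrite e.
- exact: iq.
rewrite ExZ// E; congr (_ * _).
under eq_bigr => j _ do rewrite kern_law//.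
rewrite /bkern exchange_big pair_big/=.
by apply: eq_bigr => -[t i].
Qed.

Lemma measurable_Ub u : measurable [set w : T * T | Ub w = u].
Proof.
rewrite (_ : [set _ | _] = \bigcap_(j in [set: J]) [set w | Ut w j = u j.2 j.1]).
  apply: fin_bigcap_measurable => [|j _]; first exact: finite_finset.
  by rewrite -[X in measurable X]setTI; exact: (mYY measurableT (mUf j (u j.2 j.1))).
apply/seteqP; split => w /=; first by move=> <- [t i] _ /=; rewrite !ffunE.
by move=> h; apply/ffunP => i; apply/ffunP => t; rewrite !ffunE; exact: (h (t, i)).
Qed.

(** Taking logarithms turns the event into a deviation of the sum of [llr] over uncorrelated times,
    and Chebyshev applies. The strict inequality itself forces the kernel to be positive, so its
    logarithm is legitimate. *)
Lemma atypical (i : 'I_l) (r de : R) : (0 < n)%N -> 0 < de ->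
  (forall t, Ex PP (fun w => llr w t i) <= r) ->
  Ex PP (fun w => ((expR (n%:R * (r + de)) * bmix i (Ub w) (Ub w i) <
    bkern (fun t => S w.1 (t, i)) (Ub w i))%R)%:R) <= lvar / (n%:R * de ^+ 2).
Proof.
move=> n0 de0 Er; have mS t : mble (fun w : T * T => S w.1 (t, i)) := L2_mble (gvec_L2 gY (inl (t, i))).
have h := @chebyshev_sum _ _ _ PP n (fun t w => llr w t i) lvar r de n0 de0
  (fun t => (L2_llr t i).1) (fun t => (L2_llr t i).2) Er (@llr_uncor i).
apply: le_trans h; apply: Ex_le => [||w].
- apply: ig01 => [|w]; last exact: bool01.
  apply: (@mble_case _ _ _ _ Ub measurable_Ub (fun u w => ((expR (n%:R * (r + de)) * bmix i u (u i) <
    bkern (fun t => S w.1 (t, i)) (u i))%R)%:R)) => u.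
  by apply: mble_lt => //; exact: mble_bkern.
- apply: ig01 => [|w]; last exact: bool01.
  by apply: mble_lt => //; apply: L2_mble; apply: L2_sum => t _; exact: (L2_llr t i).1.
case: ltP => //= lt; case: ltP => //= le; exfalso.
have Q0 := bmix_gt0 i (Ub w) (Ub w i).
have k0 : 0 < bkern (fun t => S w.1 (t, i)) (Ub w i).
  by apply: le_lt_trans lt; rewrite mulr_ge0 ?expR_ge0 ?ltW.
have kt t : 0 < kp (S w.1 (t, i)) (Ub w i t).
  rewrite lt_neqAle kern_ge0// andbT eq_sym; apply: contraTneq k0 => z.
  by rewrite /bkern (bigD1 t)//= z mul0r ltxx.
have E1 : ln (bkern (fun t => S w.1 (t, i)) (Ub w i)) - ln (bmix i (Ub w) (Ub w i)) = \sum_t llr w t i.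
  rewrite /bkern /bmix !ln_prod// => [|t]; last exact: mixq_gt0.
  rewrite -sumrB; apply: eq_bigr => t _.
  have eU : (fun j => Ub w j t) = (fun j => Ut w (t, j)) by apply/funext => j; rewrite !ffunE.
  by rewrite eU !ffunE.
move: lt; rewrite -ltr_pdivlMr// -ltr_ln ?posrE ?expR_gt0 ?divr_gt0// expRK ln_div ?posrE//.
by rewrite E1 ltNge le.
Qed.

End Letters.

(** * Averaging over codes *)

Lemma igZr {R : realType} {d} {T : measurableType d} (P : probability T R) c (f : T -> R) :
  ig P f -> ig P (fun w => f w * c).
Proof. by move=> If; apply: (eq_ig _ (igZ c If)) => w; rewrite mulrC. Qed.

Lemma ig_fubini' {R : realType} {d1 d2} {T1 : measurableType d1} {T2 : measurableType d2}
    (P1 : probability T1 R) (P2 : probability T2 R) (F : T1 * T2 -> R) : ig (P1 \x P2)%E F ->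
  (forall y, ig P1 (fun x => F (x, y))) -> ig P2 (fun y => Ex P1 (fun x => F (x, y))).
Proof.
move=> IF I1; have GE y : fubini_G P1 (EFin \o F) y = (Ex P1 (fun x => F (x, y)))%:E.
  by rewrite /fubini_G/= -EFin_Ex.
have mG := measurable_fubini_G IF.
suff : P2.-integrable setT (fubini_G P1 (EFin \o F)) by apply: eq_integrable => // y _; rewrite GE.
have mF : measurable_fun setT (EFin \o F) by case/integrableP: IF.
have h := (@integrable21ltyP _ _ _ _ _ P1 P2 _ mF).1 IF.
apply/integrableP; split => //; apply: (le_lt_trans _ h).
apply: ge0_le_integral => //.
- exact: measurableT_comp.
- apply: (@measurable_fun_fubini_tonelli_G _ _ _ _ _ P1 (abse \o (EFin \o F))) => //.
    exact: measurableT_comp.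
  by move=> x; exact: abse_ge0.
- move=> y _; apply: le_abse_integral => //; exact: measurableT_comp.
Qed.

Lemma measurable_finfun {d} {T : measurableType d} (I : finType) (F : I -> finType)
    (z : T -> forall i, F i) (t : {dffun forall i, F i}) :
  (forall i x, measurable [set w | z w i = x]) -> measurable [set w | finfun (z w) = t].
Proof.
move=> mz; rewrite (_ : [set _ | _] = \bigcap_(i in [set: I]) [set w | z w i = t i]).
  by apply: fin_bigcap_measurable => [|i _]; [exact: finite_finset|exact: mz].
apply/seteqP; split => w /=; first by move=> <- i _ /=; rewrite ffunE.
by move=> h; apply/ffunP => i; rewrite ffunE; exact: h.
Qed.

Lemma measurable_fincomp {d} {T : measurableType d} (F : finType) (F' : eqType) (z : T -> F) (g : F -> F') y :
  (forall x, measurable [set w | z w = x]) -> measurable [set w | g (z w) = y].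
Proof.
move=> mz; rewrite (_ : [set _ | _] = \bigcup_(x in [set x | g x = y]) [set w | z w = x]).
  by apply: fin_bigcup_measurable => [|x _]; [exact: finite_finset|exact: mz].
by apply/seteqP; split => w /= => [h|[x /= <- ->]//]; exists (z w).
Qed.

Lemma measurable_race_encode {R : realType} {d} {T : measurableType d} (l : nat) (U : finType) (M : 'I_l -> nat)
    (M0 : forall i, (0 < M i)%N) (i : 'I_l) (k : T -> U -> R) (e : U * 'I_(M i) -> R) c :
  (forall b, mble (fun w => k w b)) -> measurable [set w | race_encode M0 (k w) e = c].
Proof.
move=> mk; pose z w := [ffun v => win (fun b : U * 'I_(M i) => k w b.1) e v].
pose g (t : {ffun U * 'I_(M i) -> bool}) := if [pick v | t v] is Some v then v.2 else Ordinal (M0 i).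
rewrite (_ : [set _ | _] = [set w | g (z w) = c]); last first.
  have e1 w : race_encode M0 (k w) e = g (z w).
    rewrite /race_encode /g (_ : [pick v | z w v] = [pick v | win (fun b : U * 'I_(M i) => k w b.1) e v])//.
    by apply: eq_pick => v; rewrite ffunE.
  by apply/seteqP; split => w /=; rewrite e1.
apply: measurable_fincomp => t; apply: (@measurable_finfun _ _ _ (fun=> bool : finType)) => v b.
have mw : mble (fun w => (win (fun b : U * 'I_(M i) => k w b.1) e v)%:R : R) by apply: mble_win.
have := mw measurableT [set b%:R] (measurable_set1 _); rewrite setTI; congr (measurable _).
apply/seteqP; split => w /=; last by move=> ->.
by case: (win _ _ _); case: b => // /eqP; rewrite ?oner_eq0// eq_sym oner_eq0.
Qed.

(** * A deterministic code from random clocks *)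

Section RandomCoding.
Context {R : realType} {d : measure_display} {T : measurableType d}.
Variables (P : probability T R) (l : nat) (U : finType) (M : 'I_l -> nat) (x0 : U).
Hypothesis M0 : forall i, (0 < M i)%N.
Variables (kap : T -> 'I_l -> U -> R) (Q : 'I_l -> {ffun 'I_l -> U} -> U -> R).
Hypotheses (mkap : forall i b, mble (fun w => kap w i b)) (kap0 : forall w i b, 0 <= kap w i b)
  (kap1 : forall w i, \sum_b kap w i b = 1).
Hypotheses (Q0 : forall i u b, 0 < Q i u b) (Q1 : forall i u, \sum_b Q i u b = 1) (cQ : causal Q).
Variables (f : T -> {ffun 'I_l -> U} -> R) (fm : T -> R) (tau : 'I_l -> R).
Hypotheses (mf : forall u, mble (fun w => f w u)) (f0 : forall w u, 0 <= f w u <= fm w)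
  (Ifm : ig P fm) (tau0 : forall i, 0 <= tau i).

(** Bounds the factor [kap / (kap + M * Q)] of [random_code], summed over the encoders: it is at
    most 1 where [kap / Q] exceeds [tau], and at most [tau / M] elsewhere. *)
Definition coding_error (w : T) (u : {ffun 'I_l -> U}) : R :=
  \sum_i (((tau i * Q i u (u i) < kap w i (u i))%R)%:R + tau i / (M i)%:R).

(** The right-hand side [F] of [decode_bound] is averaged in both orders: over the clocks first it
    is controlled by [random_code], over the source first it singles out an outcome of the clocks.
    The bound [fm] depends on the source outcome since Gaussian distortion is unbounded. *)
Lemma random_coding e : 0 < e -> exists ee : forall i, U * 'I_(M i) -> R,
  Ex P (fun w => f w (race_decode x0 Q ee (finfun (fun i => race_encode M0 (kap w i) (ee i))))) <=
  Ex P (fun w => \sum_(u : {ffun 'I_l -> U}) (\prod_i kap w i (u i)) * (f w u + coding_error w u * fm w)) + e.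
Proof.
move=> e0; have [d' [W [mu [ee [mee rc]]]]] := @random_code R l U M M0.
have fm0 w : 0 <= fm w by case/andP: (f0 w [ffun=> x0]) => h1 h2; exact: le_trans h1 h2.
pose en u c (z : T * W) : R := (encs (kap z.1) (ee z.2) u c)%:R.
pose nd u c i (z : T * W) : R := (~~ decs Q (ee z.2) u c i)%:R.
have mk i b : mble (fun z : T * W => kap z.1 i b) := measurableT_comp (mkap i b) measurable_fst.
have me i b : mble (fun z : T * W => ee z.2 i b) := measurableT_comp (mee i b) measurable_snd.
have men u c : mble (en u c).
  rewrite (_ : en u c = fun z => \prod_i (win (fun b : U * 'I_(M i) => kap z.1 i b.1) (ee z.2 i) (u i, c i))%:R).
    by apply: mble_prod => i _; apply: mble_win.
  by apply/funext => z; rewrite /en /encs forallE.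
have mnd u c i : mble (nd u c i).
  rewrite (_ : nd u c i = fun z => 1 - (win (Q i u) (fun b => ee z.2 i (b, c i)) (u i))%:R).
    by apply: measurable_funB => //; apply: mble_win.
  by apply/funext => z; rewrite /nd /decs; case: (win _ _ _); rewrite ?subrr ?subr0.
pose A u z : R := \sum_c en u c z.
pose B z : R := \sum_u \sum_c \sum_i en u c z * nd u c i z.
have A0 u z : 0 <= A u z <= #|cells M|%:R.
  rewrite sumr_ge0//= -sum1_card natr_sum; apply: ler_sum => c _.
  by rewrite /en; case: (encs _ _ _ _).
have B0 z : 0 <= B z <= \sum_(u : {ffun 'I_l -> U}) \sum_(c : cells M) \sum_(i < l) 1.
  rewrite !sumr_ge0//=; last by move=> u _; apply: sumr_ge0 => c _; apply: sumr_ge0 => i _; rewrite mulr_ge0.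
  apply: ler_sum => u _; apply: ler_sum => c _; apply: ler_sum => i _.
  by rewrite /en /nd; case: (encs _ _ _ _); case: (decs _ _ _ _ _); rewrite ?mulr0 ?mul0r ?mulr1.
have mA u : mble (A u) by exact: measurable_sum.
have mB : mble B.
  do 3!(apply: measurable_sum => ?); exact: measurable_funM.
pose F z := \sum_u A u z * f z.1 u + (1 - \sum_u A u z + B z) * fm z.1.
have If u : ig P (fun w => f w u).
  by apply: (ig_le (mf u) _ Ifm) => w; case/andP: (f0 w u) => h1 h2; rewrite ger0_norm.
have bA u z : `|A u z| <= #|cells M|%:R by case/andP: (A0 u z) => h1 h2; rewrite ger0_norm.
have mC : mble (fun z => 1 - \sum_u A u z + B z).
  by apply: measurable_funD => //; apply: measurable_funB => //; exact: measurable_sum.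
pose bC : R := 1 + \sum_(u : {ffun 'I_l -> U}) #|cells M|%:R + \sum_(u : {ffun 'I_l -> U}) \sum_(c : cells M) \sum_(i < l) 1.
have bCz z : `|1 - \sum_u A u z + B z| <= bC.
  apply: (le_trans (ler_normD _ _)); apply: lerD.
    apply: (le_trans (ler_normB _ _)); rewrite normr1 lerD2l.
    by apply: (le_trans (ler_norm_sum _ _ _)); apply: ler_sum => u _; exact: bA.
  by case/andP: (B0 z) => h1 h2; rewrite ger0_norm.
have IF : ig (P \x mu)%E F.
  apply: igD.
    apply: ig_sum => u _; apply: (ig_bndM (mA u) (bA u)); exact: (ig_fst mu (If u)).
  by apply: (ig_bndM mC bCz); exact: (ig_fst mu Ifm).
have IF1 y : ig P (fun w => F (w, y)).
  apply: igD.
    apply: ig_sum => u _; apply: (ig_bndM _ (fun w => bA u (w, y)) (If u)).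
    exact: (mble_section' y (mA u)).
  apply: (ig_bndM _ (fun w => bCz (w, y)) Ifm); exact: (mble_section' y mC).
have Ien u c w : ig mu (fun y => en u c (w, y)).
  by apply: ig01 => [|y]; [exact: (mble_section w (men u c))|exact: bool01].
have IA u w : ig mu (fun y => A u (w, y)) by apply: ig_sum => c _; exact: Ien.
have Ind u c i w : ig mu (fun y => en u c (w, y) * nd u c i (w, y)).
  apply: ig01 => [|y]; last by rewrite -natrM mulnb; exact: bool01.
  by apply: measurable_funM; [exact: (mble_section w (men u c))|exact: (mble_section w (mnd u c i))].
have IB w : ig mu (fun y => B (w, y)).
  by do 3!(apply: ig_sum => ? _); exact: Ind.
have IF2 w : ig mu (fun y => F (w, y)).
  apply: igD.
    by apply: ig_sum => u _; exact: (igZr (f w u) (IA u w)).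
  apply: (@igZr _ _ _ mu (fm w)); apply: igD => //; apply: igB; first exact: ig_cst.
  by apply: ig_sum => u _.
pose pk w (u : {ffun 'I_l -> U}) := \prod_i kap w i (u i).
have pk0 w u : 0 <= pk w u by apply: prodr_ge0.
have pk1 w : \sum_u pk w u = 1.
  by rewrite /pk -(bigA_distr_bigA (fun i b => kap w i b)) big1.
have M1 : \prod_i ((M i)%:R : R) != 0.
  by apply/prodf_neq0 => i _; rewrite pnatr_eq0 -lt0n.
have sumc w (u : {ffun 'I_l -> U}) (z : R) : \sum_(c : cells M) \prod_i (kap w i (u i) / (M i)%:R) * z = pk w u * z.
  rewrite sumr_const -[LHS]mulr_natr card_cells big_split/= prodfV.
  by rewrite mulrAC -mulrA [X in _ * X = _]mulrC mulrA -/(pk w u); field.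
have EA w u : Ex mu (fun y => A u (w, y)) = pk w u.
  rewrite Ex_sum => [|c _]; last exact: Ien.
  have [h _] := rc (kap w) Q (kap0 w) (kap1 w) Q0 Q1.
  under eq_bigr do rewrite h.
  by rewrite -[RHS]mulr1 -(sumc w u 1); apply: eq_bigr => c _; rewrite mulr1.
have EB w : Ex mu (fun y => B (w, y)) <= \sum_u pk w u * coding_error w u.
  rewrite Ex_sum => [|u _]; last by do 2!(apply: ig_sum => ? _); exact: Ind.
  apply: ler_sum => u _; rewrite -sumc.
  rewrite Ex_sum => [|c _]; last by apply: ig_sum => ? _; exact: Ind.
  apply: ler_sum => c _; rewrite Ex_sum => [|i _]; last exact: Ind.
  rewrite mulr_sumr; apply: ler_sum => i _.
  have [_ h] := rc (kap w) Q (kap0 w) (kap1 w) Q0 Q1.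
  apply: (le_trans (h u c i)); apply: ler_wpM2l.
    by apply: prodr_ge0 => k _; rewrite divr_ge0.
  set k := kap w i (u i); set qq := Q i u (u i).
  have k0 : 0 <= k by exact: kap0.
  have q0 : 0 < qq by exact: Q0.
  have m0 : 0 < (M i)%:R :> R by rewrite ltr0n.
  have D0 : 0 < k + (M i)%:R * qq by apply: ltr_wpDl => //; exact: mulr_gt0.
  have t0 : 0 <= tau i / (M i)%:R by rewrite divr_ge0.
  case: ltP => h1.
    apply: le_trans (_ : 1 <= _); last by rewrite lerDl.
    by rewrite ler_pdivrMr// mul1r lerDl ltW// mulr_gt0.
  rewrite add0r ler_pdivrMr// mulrDr.
  apply: (le_trans h1); rewrite -[leLHS]add0r; apply: lerD; first exact: mulr_ge0.
  by rewrite mulrA divfK// gt_eqF.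
have EF w : Ex mu (fun y => F (w, y)) <= \sum_u pk w u * (f w u + coding_error w u * fm w).
  have I1 : ig mu (fun y => \sum_u A u (w, y) * f w u).
    by apply: ig_sum => u _; exact: (igZr (f w u) (IA u w)).
  have I2 : ig mu (fun y => \sum_u A u (w, y)) by apply: ig_sum.
  have I3 : ig mu (fun y => 1 - \sum_u A u (w, y)) by apply: igB => //; exact: ig_cst.
  rewrite ExD//; last by apply: (@igZr _ _ _ mu (fm w)); exact: igD.
  under [in leRHS]eq_bigr do rewrite mulrDr.
  rewrite big_split/=; apply: lerD.
    rewrite Ex_sum => [|u _]; last exact: (igZr (f w u) (IA u w)).
    apply: ler_sum => u _; rewrite -EA mulrC -ExZ//.
    by rewrite le_eqVlt; apply/orP; left; apply/eqP; apply: eq_Ex => y; rewrite mulrC.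
  under eq_Ex do rewrite mulrC.
  rewrite ExZ; last exact: igD.
  rewrite ExD// ExB//; last exact: ig_cst.
  have EsA : Ex mu (fun y => \sum_u A u (w, y)) = 1.
    rewrite (@Ex_sum _ _ _ mu _ _ _ (fun u y => A u (w, y))); last by move=> u _.
    by rewrite -(pk1 w); apply: eq_bigr => u _; exact: EA.
  rewrite Ex_cst EsA subrr add0r; under [in leRHS]eq_bigr do rewrite mulrA.
  by rewrite -mulr_suml mulrC ler_wpM2r.
have mpk u : mble (fun w => pk w u) by apply: mble_prod => i _; exact: mkap.
have mce u : mble (fun w => coding_error w u).
  apply: measurable_sum => i; apply: measurable_funD => //; apply: mble_lt => //; exact: mkap.
have ce0 w u : 0 <= coding_error w u <= \sum_i (1 + tau i / (M i)%:R).
  rewrite sumr_ge0 => [|i _]; last by rewrite addr_ge0// divr_ge0.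
  by apply: ler_sum => i _; rewrite lerD2r; case: (_ < _).
have pkb w u : `|pk w u| <= 1.
  by rewrite ger0_norm// -(pk1 w) (bigD1 u)//= lerDl sumr_ge0.
have IG : ig P (fun w => \sum_u pk w u * (f w u + coding_error w u * fm w)).
  apply: ig_sum => u _; apply: (ig_bndM (mpk u) (fun w => pkb w u)); apply: igD => //.
  apply: (ig_bndM (mce u) _ Ifm) => w; case/andP: (ce0 w u) => h1 h2; rewrite ger0_norm//; exact: h2.
set D := Ex P _ in IG *.
have ED : Ex mu (fun y => Ex P (fun w => F (w, y))) <= D.
  rewrite -(Ex_fubini' IF IF1) (Ex_fubini IF IF2); apply: Ex_le => //.
  exact: (ig_fubini IF IF2).
(* If every outcome of the clocks exceeded [D + e], so would the average. *)
have [y Dy] : exists y, Ex P (fun w => F (w, y)) <= D + e.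
  apply: contrapT => /forallNP h.
  have : D + e <= D.
    apply: le_trans ED; rewrite -[leLHS](Ex_cst mu); apply: Ex_le; first exact: ig_cst.
      exact: (ig_fubini' IF IF1).
    by move=> y; rewrite ltW// ltNge; apply/negP; exact: h.
  by rewrite gerDl leNgt e0.
exists (ee y); apply: le_trans Dy.
have bd w : f w (race_decode x0 Q (ee y) (finfun (fun i => race_encode M0 (kap w i) (ee y i)))) <= F (w, y).
  have := decode_bound x0 M0 (kap w) (ee y) cQ (f0 w); congr (_ <= _ + _).
  by apply: eq_bigr => u _; rewrite mulr_suml.
apply: Ex_le => //.
apply: (@ig_case _ _ _ _ P (fun w => race_decode x0 Q (ee y) (finfun (fun i => race_encode M0 (kap w i) (ee y i)))) _ (fun u w => f w u)) => // u.
apply: (measurable_fincomp (fun c => race_decode x0 Q (ee y) c)) => c; apply: measurable_finfun => i x.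
exact: measurable_race_encode.
Qed.
End RandomCoding.

(** * The test channel *)

Section Estimates.
Context {R : realType}.

(** The truncation level [K] depends on the law only, so it can be fixed before the block length. It
    makes the unbounded distortion of rare coding errors negligible. *)
Lemma gauss_tail (v e : R) {d} {T : measurableType d} (P : probability T R) (Y : T -> R) :
  0 <= v -> centered_gaussian P Y v -> 0 < e ->
  exists K : nat, forall d' (T' : measurableType d') (P' : probability T' R) (Y' : T' -> R),
    centered_gaussian P' Y' v -> Ex P' (fun w => Y' w ^+ 2 * ((K%:R < Y' w ^+ 2)%R)%:R) <= e.
Proof.
move=> v0 gY e0; have mY := cg_mble gY; have [IY _] := cg_moments gY v0.
pose f K w := Y w ^+ 2 * ((K%:R < Y w ^+ 2)%R)%:R.
have mf K : mble (fun y : R => y ^+ 2 * ((K%:R < y ^+ 2)%R)%:R).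
  by apply: measurable_funM; [exact: measurable_funX|apply: mble_lt => //; exact: measurable_funX].
have lim : Ex P (f n) @[n --> \oo] --> Ex P (fun=> 0).
  apply: (Ex_dct (g := fun w => Y w ^+ 2)) => //.
  - by move=> K; exact: (measurableT_comp (mf K) mY).
  - move=> w; apply/cvgrPdist_le => x x0.
    exists (Num.truncn (Y w ^+ 2)).+1 => // K /= hK; rewrite /f.
    have h : Y w ^+ 2 < K%:R by apply: lt_le_trans (truncnS_gt _) _; rewrite ler_nat.
    by move/ltW: h; rewrite leNgt => /negbTE ->; rewrite mulr0 subrr normr0 ltW.
  - move=> K w; have y0 := sqr_ge0 (Y w); rewrite /f.
    by case: (_ < _); rewrite ?mulr1 ?mulr0 ?normr0// ger0_norm.
have [K hK] : exists K, Ex P (f K) <= e.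
  move: lim; rewrite Ex_cst => /cvgrPdist_le/(_ e e0)[N _ /(_ N (leqnn N))].
  rewrite sub0r normrN => h; exists N; exact: le_trans (ler_norm _) h.
exists K => d' T' P' Y' gY'.
have sl : same_law P' P Y' Y by move=> A mA; case: gY' => _ ->//; case: gY => _ ->.
by have := same_law_Ex (cg_mble gY') mY sl (mf K); rewrite /comp => ->.
Qed.

(** Young's inequality [(A + B) ^ 2 <= (1 + s) * A ^ 2 + (1 + 1 / s) * B ^ 2]: [s] is small enough
    for [s * al <= de / 2], then [e] is such that [(1 + 1 / s) * e = de / 2]. Both are independent
    of the probability space. *)
Lemma sqr_perturb (al de : R) : 0 <= al -> 0 < de -> exists2 e : R, 0 < e &
  forall d (T : measurableType d) (P : probability T R) (A B : T -> R), L2 P A -> L2 P B ->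
  Ex P (fun w => A w ^+ 2) <= al -> Ex P (fun w => B w ^+ 2) <= e ->
  Ex P (fun w => (A w + B w) ^+ 2) <= Ex P (fun w => A w ^+ 2) + de.
Proof.
move=> al0 de0; pose s := de / (2 * (al + 1)).
have al1 : 0 < al + 1 by rewrite ltr_wpDl.
have s0 : 0 < s by rewrite divr_gt0// mulr_gt0.
have c0 : 0 < 1 + s^-1 by rewrite addr_gt0// invr_gt0.
exists (de / 2 / (1 + s^-1)); first by rewrite !divr_gt0.
move=> d T P A B LA LB EA EB.
apply: le_trans (_ : Ex P (fun w => (1 + s) * A w ^+ 2 + (1 + s^-1) * B w ^+ 2) <= _).
  apply: Ex_le => [||w].
  - by apply: L2_sqr; exact: L2D.
  - by apply: igD; apply: igZ; exact: L2_sqr.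
  have : 0 <= s * (A w - s^-1 * B w) ^+ 2 by rewrite mulr_ge0 ?sqr_ge0 ?ltW.
  have -> : s * (A w - s^-1 * B w) ^+ 2 = s * A w ^+ 2 - 2 * A w * B w + s^-1 * B w ^+ 2.
    by field; rewrite gt_eqF.
  nra.
rewrite ExD; [|apply: igZ; exact: L2_sqr|apply: igZ; exact: L2_sqr].
rewrite !ExZ; [|exact: L2_sqr|exact: L2_sqr].
set EAA := Ex P (fun w => A w ^+ 2) in EA *.
have h1 : (1 + s) * EAA <= EAA + de / 2.
  rewrite mulrDl mul1r lerD2l.
  have -> : de / 2 = s * (al + 1) by rewrite /s; field; rewrite gt_eqF.
  by apply: ler_wpM2l; [exact: ltW|apply: (le_trans EA); rewrite lerDl].
have h2 : (1 + s^-1) * Ex P (fun w => B w ^+ 2) <= de / 2.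
  by rewrite mulrC -ler_pdivlMr.
lra.
Qed.

Lemma sqr_sum_le (I : finType) (x : I -> R) : (\sum_i x i) ^+ 2 <= #|I|%:R * \sum_i x i ^+ 2.
Proof.
rewrite expr2 mulr_suml; under eq_bigr do rewrite mulr_sumr.
apply: le_trans (_ : \sum_i \sum_j (x i ^+ 2 / 2 + x j ^+ 2 / 2) <= _).
  by apply: ler_sum => i _; apply: ler_sum => j _; have := sqr_ge0 (x i - x j); nra.
rewrite (eq_bigr (fun i => #|I|%:R * (x i ^+ 2 / 2) + \sum_j x j ^+ 2 / 2)) => [|i _]; last first.
  by rewrite big_split/= sumr_const mulr_natl.
rewrite big_split/= -mulr_sumr sumr_const [X in _ + X](_ : _ = #|I|%:R * \sum_j x j ^+ 2 / 2); last first.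
  by rewrite mulr_natl.
by rewrite -mulr_suml; lra.
Qed.

Lemma sum_eqcov (l : nat) (g r : R) (x : 'I_l -> R) :
  \sum_i \sum_j x i * x j * eqcov g r i j = (1 - r) * g * \sum_i x i ^+ 2 + r * g * (\sum_i x i) ^+ 2.
Proof.
rewrite [(\sum_i x i) ^+ 2]expr2 mulr_suml !mulr_sumr -big_split/=; apply: eq_bigr => i _.
rewrite !mulr_sumr -[x i ^+ 2](sum_delta i (fun=> x i ^+ 2)) mulr_sumr -big_split/=.
by apply: eq_bigr => j _; rewrite /eqcov eq_sym; case: eqP => [->|_]/=; ring.
Qed.

End Estimates.

(** * Second moments of linear forms in source and noise *)

Section SourceMoments.
Context {R : realType} {l : nat} {d : measure_display} {T : measurableType d}.
Variables (P : probability T R) (X Z : nat -> 'I_l -> T -> R) (gX rX gZ rZ : R).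
Hypotheses (psdX : psd_eqcov l gX rX) (psdZ : psd_eqcov l gZ rZ).
Hypothesis src : gauss_source P X Z gX rX gZ rZ.

Lemma source_cg n (t : 'I_n) i : centered_gaussian P (X t i) gX.
Proof.
have [_] := gvec_coord (slot_gvec psdX psdZ src (fun _ : unit => t) (fun _ k => (k == i)%:R) (fun _ _ => 0)) tt.
congr (centered_gaussian _ _ _).
  apply/funext => w; rewrite -[RHS](sum_delta i (fun k => X t k w)).
  by apply: eq_bigr => k _; rewrite mul0r addr0.
rewrite eqxx mul1r -[RHS](sum_delta i (fun=> gX)); apply: eq_bigr => k _.
rewrite -[(k == i)%:R * gX](sum_delta i (fun=> (k == i)%:R * gX)); apply: eq_bigr => k' _.
by rewrite /eqcov; case: (k =P i) => [->|_]/=; case: (k' =P i) => [->|_]/=; rewrite ?eqxx; ring.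
Qed.

Variables (n : nat) (G : T -> 'I_n * 'I_l -> R).
Hypothesis gG : gvec P G KI.
Let PP : probability _ R := (P \x P)%E.

Lemma lin_var t (a b c : 'I_l -> R) :
  let D w := \sum_i (a i * X (nat_of_ord t) i w.1 + b i * Z (nat_of_ord t) i w.1) + \sum_i c i * G w.2 (t, i) in
  L2 PP D /\ Ex PP (fun w => D w ^+ 2) =
    (1 - rX) * gX * \sum_i a i ^+ 2 + rX * gX * (\sum_i a i) ^+ 2 +
    ((1 - rZ) * gZ * \sum_i b i ^+ 2 + rZ * gZ * (\sum_i b i) ^+ 2) + \sum_i c i ^+ 2.
Proof.
move=> D.
have g1 := slot_gvec psdX psdZ src (fun _ : unit => t) (fun=> a) (fun=> b).
have g2 := gvec_lin gG (fun (_ : unit) j => (j.1 == t)%:R * c j.2).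
have e2 w : \sum_j (j.1 == t)%:R * c j.2 * G w j = \sum_i c i * G w (t, i).
  transitivity (\sum_t' \sum_i (t' == t)%:R * c i * G w (t', i)).
    by rewrite pair_big/=; apply: eq_bigr => -[].
  rewrite -[RHS](sum_delta t (fun t' => \sum_i c i * G w (t', i))).
  by apply: eq_bigr => t' _; rewrite mulr_sumr; apply: eq_bigr => i _; rewrite mulrA.
have g3 := gvec_lin (gvec_prod g1 g2) (fun (_ : unit) _ => 1).
have e3 w : D w = \sum_(j : unit + unit) 1 * (match j with
      | inl j => \sum_i (a i * X t i w.1 + b i * Z t i w.1)
      | inr j => \sum_j (j.1 == t)%:R * c j.2 * G w.2 j end : R).
  by rewrite big_sumType/= !sum_unit; rewrite !mul1r e2.
split; first by apply: (eq_L2 _ (gvec_L2 g3 tt)) => w; rewrite e3.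
transitivity (Ex PP (fun w => (\sum_(j : unit + unit) 1 * (match j with
      | inl j => \sum_i (a i * X t i w.1 + b i * Z t i w.1)
      | inr j => \sum_j (j.1 == t)%:R * c j.2 * G w.2 j end : R)) ^+ 2)).
  by apply: eq_Ex => w; rewrite e3.
rewrite (gvec_var g3 tt).
have S2 (F : unit + unit -> unit + unit -> R) : \sum_j \sum_j' F j j' =
    F (inl tt) (inl tt) + F (inl tt) (inr tt) + (F (inr tt) (inl tt) + F (inr tt) (inr tt)).
  by rewrite big_sumType/= !sum_unit !big_sumType/= !sum_unit.
apply: (etrans (S2 _)); cbn iota beta.
rewrite eqxx !mulr0 !mul1r add0r addr0; congr (_ + _).
  by under eq_bigr do rewrite big_split/=; rewrite big_split/= !sum_eqcov.
transitivity (\sum_j (j.1 == t)%:R * c j.2 ^+ 2).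
  apply: eq_bigr => j _; rewrite -[RHS](sum_delta j (fun=> (j.1 == t)%:R * c j.2 ^+ 2)).
  by apply: eq_bigr => j' _; rewrite /KI (eq_sym j j'); case: (j' =P j) => [->|_]/=; case: (_ == t) => /=; ring.
transitivity (\sum_t' \sum_i (t' == t)%:R * c i ^+ 2).
  by rewrite pair_big/=; apply: eq_bigr => -[].
rewrite -[RHS](sum_delta t (fun t' => \sum_i c i ^+ 2)).
by apply: eq_bigr => t' _; rewrite mulr_sumr.
Qed.

End SourceMoments.

(** * Linear prediction and estimation in the test channel *)

Section TestChannel.
Context {R : realType} {l : nat} {d : measure_display} {T : measurableType d}.
Variables (P : probability T R) (X Z : nat -> 'I_l -> T -> R) (gX rX gZ rZ dl q : R).
Hypotheses (l2 : (2 <= l)%N) (gX0 : 0 < gX) (q0 : 0 < q).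
Hypotheses (psdX : psd_eqcov l gX rX) (psdZ : psd_eqcov l gZ rZ).
Hypothesis src : gauss_source P X Z gX rX gZ rZ.
Hypothesis dE : distQ l gX rX gZ rZ q = dl.

Let lX1 := lam1 l gX rX.
Let lX2 := lam2 gX rX.
Let lS1 := lam1 l (gammaS gX gZ) (rhoS gX rX gZ rZ).
Let lS2 := lam2 (gammaS gX gZ) (rhoS gX rX gZ rZ).
Let c := rX * gX + rZ * gZ.

Let l0 : (0 < l)%N. Proof. exact: leq_trans l2. Qed.
Let lR : 0 < l%:R :> R. Proof. by rewrite ltr0n. Qed.
Let gZ0 : 0 <= gZ. Proof. by have [] := psd_lam l2 psdZ. Qed.

(* [m] test channel outputs [S_i + sqrt q G_i] have covariance determinant [wt 0 ^+ m.-1 * wt m]. *)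
Definition wt (m : nat) : R := gX + gZ + q + (m%:R - 1) * c.
Definition pred_coef (i : 'I_l) : R := c / wt i.
(** The ratio of the determinants of the first [i + 1] and the first [i] outputs, that is the
    conditional variance of output [i] given the earlier ones. *)
Definition pred_var (i : 'I_l) : R := wt 0 * wt i.+1 / wt i.
(** The entries of [Gamma_X * (Gamma_S + q)^-1]: this matrix has eigenvalue [lX1 / (lS1 + q)] on
    constant vectors and [lX2 / (lS2 + q)] on their complement. *)
Definition est_coef (i j : 'I_l) : R :=
  (lX1 / (lS1 + q) - lX2 / (lS2 + q)) / l%:R + (j == i)%:R * (lX2 / (lS2 + q)).

Let lpred : (l.-1)%:R = l%:R - 1 :> R.
Proof. by rewrite -{2}(prednK l0) -natr1 addrK. Qed.

Let gS0 : gX + gZ != 0. Proof. by rewrite gt_eqF// ltr_pwDl. Qed.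

Let cE : c = rhoS gX rX gZ rZ * gammaS gX gZ.
Proof. by rewrite /rhoS /gammaS divfK. Qed.

Lemma wt_0 : wt 0 = lS2 + q.
Proof. by rewrite /lS2 /lam2 mulrBl mul1r -cE /wt /gammaS; ring. Qed.

Lemma wt_l : wt l = lS1 + q.
Proof. by rewrite /lS1 /lam1 mulrDl mul1r -mulrA -cE lpred /wt /gammaS; ring. Qed.

Let lS10 : 0 < lS1 + q.
Proof.
have [h _ _] := psd_lam l2 psdX; have [h' _ _] := psd_lam l2 psdZ.
by rewrite /lS1 lam1S// ltr_wpDl// addr_ge0.
Qed.
Let lS20 : 0 < lS2 + q.
Proof.
have [_ h _] := psd_lam l2 psdX; have [_ h' _] := psd_lam l2 psdZ.
by rewrite /lS2 lam2S// ltr_wpDl// addr_ge0.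
Qed.

(** [wt] is affine in [m] and positive at both ends, where it takes the values of the two
    eigenvalues plus [q]. *)
Lemma wt_gt0 m : (m <= l)%N -> 0 < wt m.
Proof.
move=> ml; rewrite -(pmulr_rgt0 _ lR).
have -> : l%:R * wt m = (l%:R - m%:R) * wt 0 + m%:R * wt l by rewrite /wt; ring.
have ml' : 0 <= l%:R - m%:R :> R by rewrite subr_ge0 ler_nat.
rewrite wt_0 wt_l; case: m ml {ml'} => [|m] ml.
  by rewrite mulr0n mul0r addr0 subr0 mulr_gt0.
by rewrite ltr_wpDl// ?mulr_gt0 ?mulr_ge0 ?subr_ge0 ?ler_nat// ltW.
Qed.

Let wS (m : nat) : wt m.+1 = wt m + c. Proof. by rewrite /wt -natr1; ring. Qed.

Lemma pred_var_gt0 i : 0 < pred_var i.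
Proof. by rewrite divr_gt0 ?mulr_gt0 ?wt_gt0// ltnW. Qed.

Lemma sum_ln_pred_var : \sum_i ln (pred_var i / q) / 2 = l%:R * rbar l gX rX gZ rZ q.
Proof.
have e (i : 'I_l) : ln (pred_var i / q) / 2 = (ln (wt i.+1) - ln (wt i)) / 2 + (ln (wt 0) - ln q) / 2.
  have h1 := wt_gt0 (ltn_ord i); have h2 := wt_gt0 (ltnW (ltn_ord i)); have h3 := wt_gt0 (leq0n l).
  rewrite /pred_var !ln_div ?lnM ?posrE ?divr_gt0 ?mulr_gt0//; lra.
rewrite (eq_bigr _ (fun i _ => e i)) big_split/= sumr_const card_ord -mulr_suml -(big_mkord xpredT (fun i => ln (wt i.+1) - ln (wt i))) telescope_sumr//.
rewrite /rbar -/lS1 -/lS2 ln_div ?posrE ?mulr_gt0 ?exprn_gt0// lnM ?posrE ?exprn_gt0// !lnXn// wt_0 wt_l.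
rewrite -[X in _ + X = _]mulr_natl -[ln (lS2 + q) *+ _]mulr_natl -[ln q *+ _]mulr_natl natrM lpred; field; by rewrite gt_eqF.
Qed.

Section Block.
Variables (n : nat) (G : T -> 'I_n * 'I_l -> R).
Hypothesis gG : gvec P G KI.
Let PP : probability _ R := (P \x P)%E.
Local Notation J := ('I_n * 'I_l)%type.

Definition srcS (w : T) (j : J) : R := X j.1 j.2 w + Z j.1 j.2 w.
Definition srcY (w : T * T) (j : J) : R := srcS w.1 j + Num.sqrt q * G w.2 j.

Lemma srcS_gvec : exists2 KS, gvec P srcS KS &
  (forall j j', j.1 != j'.1 -> KS j j' = 0) /\ (forall j, KS j j = gX + gZ).
Proof.
have g := slot_gvec psdX psdZ src (fun j : J => j.1) (fun j i => (i == j.2)%:R) (fun j i => (i == j.2)%:R).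
eexists.
  move: g; congr (gvec _ _ _); apply/funext => w; apply/funext => j.
  rewrite -[RHS](sum_delta j.2 (fun i => X j.1 i w + Z j.1 i w)).
  by apply: eq_bigr => i _; rewrite mulrDr.
split=> [j j' /negbTE -> | j]; first by rewrite mul0r.
rewrite eqxx mul1r -[RHS](sum_delta j.2 (fun=> gX + gZ)); apply: eq_bigr => k _.
rewrite -[(k == j.2)%:R * (gX + gZ)](sum_delta j.2 (fun=> (k == j.2)%:R * (gX + gZ))); apply: eq_bigr => k' _.
by rewrite /eqcov; case: (k =P j.2) => [->|_]/=; case: (k' =P j.2) => [->|_]/=; rewrite ?eqxx; ring.
Qed.

Lemma srcY_cg j : centered_gaussian PP (fun w => srcY w j) (gX + gZ + q).
Proof.
have [KS gS [_ KSd]] := srcS_gvec; have [h1 c1] := gvec_coord gS j; rewrite KSd in h1 c1.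
have gN := gvec_lin gG (fun (_ : unit) k => (k == j)%:R * Num.sqrt q).
have [h2 c2] := gvec_coord gN tt.
have e : \sum_k \sum_k' (k == j)%:R * Num.sqrt q * ((k' == j)%:R * Num.sqrt q) * KI k k' = q.
  rewrite -[RHS](sum_delta j (fun=> q)); apply: eq_bigr => k _.
  rewrite -[RHS](sum_delta j (fun=> (k == j)%:R * q)); apply: eq_bigr => k' _.
  have sq : Num.sqrt q ^+ 2 = q by rewrite sqr_sqrtr// ltW.
  rewrite /KI; case: (k =P j) => [->|_]/=; case: (k' =P j) => [->|_]/=; rewrite ?eqxx ?mul0r ?mulr0 ?mul0r//.
  by rewrite !mul1r mulr1 -expr2.
rewrite e in h2 c2; have := cg_sum h1 h2 c1 c2; congr (centered_gaussian _ _ _).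
apply/funext => w; rewrite /srcY; congr (_ + _).
rewrite -[RHS](sum_delta j (fun k => Num.sqrt q * G w.2 k)).
by apply: eq_bigr => k _; rewrite mulrA.
Qed.

Let sq : Num.sqrt q ^+ 2 = q. Proof. by rewrite sqr_sqrtr// ltW. Qed.

Let sum_lt (i : 'I_l) : \sum_(j < l) ((j < i)%N)%:R = i%:R :> R.
Proof.
rewrite (eq_bigr (fun j : 'I_l => if (j < i)%N then 1 else 0)) => [|j _]; last by case: (j < i)%N.
by rewrite -big_mkcond/= -(big_ord_widen _ (fun=> 1) (ltnW (ltn_ord i))) sumr_const card_ord.
Qed.

(** The prediction targets [S_i] and not the noisy output; the independent noise accounts for the
    difference [q]. *)
Lemma pred_mse t i :
  let D w := pred_coef i * \sum_(j < l | (j < i)%N) srcY w (t, j) - srcS w.1 (t, i) in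
  L2 PP D /\ Ex PP (fun w => D w ^+ 2) = pred_var i - q.
Proof.
move=> D; set a := pred_coef i; pose s := Num.sqrt q.
pose al (j : 'I_l) : R := ((j < i)%N)%:R * a - (j == i)%:R.
have [L E] := lin_var psdX psdZ src gG t al al (fun j => ((j < i)%N)%:R * (a * s)).
have De w : D w = \sum_i0 (al i0 * X t i0 w.1 + al i0 * Z t i0 w.1) + \sum_(i0 < l) ((i0 < i)%N)%:R * (a * s) * G w.2 (t, i0).
  rewrite /D -/a mulr_sumr big_mkcond/= -(sum_delta i (fun j => srcS w.1 (t, j))) -sumrB -big_split/=.
  by apply: eq_bigr => j _; rewrite /al /srcY /srcS/=; rewrite /s; case: (j < i)%N => /=; ring.
split; first by apply: (eq_L2 _ L) => w; rewrite De.
under eq_Ex do rewrite De.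
rewrite [LHS]E.
have e1 : \sum_j al j ^+ 2 = i%:R * a ^+ 2 + 1.
  rewrite -(sum_lt i) mulr_suml -[X in _ + X](sum_delta i (fun=> 1)) -big_split/=.
  apply: eq_bigr => j _; rewrite /al.
  by case: (j =P i) => [->|_]; rewrite ?ltnn/=; [ring|case: (j < i)%N => /=; ring].
have e2 : \sum_j al j = i%:R * a - 1.
  rewrite sumrB -mulr_suml sum_lt; congr (_ - _).
  by rewrite -[RHS](sum_delta i (fun=> 1)); apply: eq_bigr => j _; rewrite mulr1.
have e3 : \sum_(j < l) (((j < i)%N)%:R * (a * s)) ^+ 2 = i%:R * a ^+ 2 * q.
  rewrite -(sum_lt i) !mulr_suml; apply: eq_bigr => j _.
  by rewrite -sq -/s; case: (j < i)%N => /=; ring.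
rewrite e1 e2 e3 /a /pred_coef /pred_var wS.
have w0 : wt i != 0 by rewrite gt_eqF// wt_gt0// ltnW.
have w0' : gX + gZ + q + (i%:R - 1) * c != 0 by [].
rewrite /wt /c in w0' *; field.
by rewrite -/c.
Qed.

(** By symmetry every component has the same error, so each equals the average over the
    eigendirections, which is [distQ]. *)
Lemma est_mse t i :
  let D w := X (nat_of_ord t) i w.1 - \sum_j est_coef i j * srcY w (t, j) in
  L2 PP D /\ Ex PP (fun w => D w ^+ 2) = dl.
Proof.
move=> D; pose s := Num.sqrt q; pose b := est_coef i.
have [L E] := lin_var psdX psdZ src gG t (fun j => (j == i)%:R - b j) (fun j => - b j) (fun j => - (b j * s)).
have De w : D w = \sum_i0 (((i0 == i)%:R - b i0) * X t i0 w.1 + - b i0 * Z t i0 w.1) + \sum_i0 - (b i0 * s) * G w.2 (t, i0).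
  rewrite /D -/b -(sum_delta i (fun j => X t j w.1)) -sumrB -big_split/=.
  by apply: eq_bigr => j _; rewrite /srcY /srcS/= /s; ring.
split; first by apply: (eq_L2 _ L) => w; rewrite De.
under eq_Ex do rewrite De.
rewrite [LHS]E.
pose b2 := lX2 / (lS2 + q); pose b1 := (lX1 / (lS1 + q) - b2) / l%:R.
have bE j : b j = b1 + (j == i)%:R * b2 by [].
have s1 (x : R) : \sum_(j < l) x = l%:R * x by rewrite sumr_const card_ord mulr_natl.
have e1 (x y : R) : \sum_(j < l) (x + (j == i)%:R * y) = l%:R * x + y.
  by rewrite big_split/= s1 (sum_delta i (fun=> y)).
have e2 (x y : R) : \sum_(j < l) (x + (j == i)%:R * y) ^+ 2 = l%:R * x ^+ 2 + (2 * x * y + y ^+ 2).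
  by rewrite -e1; apply: eq_bigr => j _; case: (j == i) => /=; ring.
have f1 : \sum_j ((j == i)%:R - b j) = l%:R * (- b1) + (1 - b2).
  by rewrite -e1; apply: eq_bigr => j _; rewrite bE; ring.
have f2 : \sum_j ((j == i)%:R - b j) ^+ 2 = l%:R * (- b1) ^+ 2 + (2 * (- b1) * (1 - b2) + (1 - b2) ^+ 2).
  by rewrite -e2; apply: eq_bigr => j _; rewrite bE; ring.
have f3 : \sum_j - b j = - (l%:R * b1 + b2).
  by rewrite sumrN -e1; congr (- _); apply: eq_bigr => j _; rewrite bE.
have f4 : \sum_j (- b j) ^+ 2 = l%:R * b1 ^+ 2 + (2 * b1 * b2 + b2 ^+ 2).
  by rewrite -e2; apply: eq_bigr => j _; rewrite bE sqrrN.
have f5 : \sum_j (- (b j * s)) ^+ 2 = q * (l%:R * b1 ^+ 2 + (2 * b1 * b2 + b2 ^+ 2)).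
  rewrite -e2 mulr_sumr; apply: eq_bigr => j _; rewrite bE -[in RHS]sq -/s; ring.
rewrite f1 f2 f3 f4 f5 -dE /distQ -/lX1 -/lX2 -/lS1 -/lS2.
have h1 := lS10; have h2 := lS20.
move: h1 h2; rewrite /b1 /b2 /lS1 /lS2 lam1S// lam2S// -/lX1 -/lX2.
set lZ1 := lam1 l gZ rZ; set lZ2 := lam2 gZ rZ => h1 h2.
have eX1 : lX1 = (1 + (l%:R - 1) * rX) * gX by rewrite /lX1 /lam1 lpred.
have eX2 : lX2 = (1 - rX) * gX by [].
have eZ1 : lZ1 = (1 + (l%:R - 1) * rZ) * gZ by rewrite /lZ1 /lam1 lpred.
have eZ2 : lZ2 = (1 - rZ) * gZ by [].
have kX : rX * gX = (lX1 - lX2) / l%:R by rewrite eX1 eX2; field; rewrite gt_eqF.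
have kZ : rZ * gZ = (lZ1 - lZ2) / l%:R by rewrite eZ1 eZ2; field; rewrite gt_eqF.
rewrite -eX2 -eZ2 kX kZ lpred; field.
by rewrite !gt_eqF.
Qed.

End Block.
End TestChannel.

(** * Achievability *)

(** The prescribed reconstruction is the conditional mean given the codeword, which no other
    function of the codeword beats. An explicit linear estimate may therefore be analysed in its
    place. *)
Lemma mse_best {R : realType} {l : nat} {d} {T : measurableType d} (P : probability T R) (n : nat) (M : 'I_l -> nat)
    (phi : forall i : 'I_l, ('I_n -> R) -> 'I_(M i)) (X Z : nat -> 'I_l -> T -> R) (t : nat) (i : 'I_l)
    (f : cells M -> R) :
  let z w : cells M := finfun (fun i => phi i (Sblock X Z i w)) in
  (forall c, measurable [set w | z w = c]) -> L2 P (X t i) ->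
  (mse P phi X Z [set: 'I_l]%SET t i <= (Ex P (fun w => (X t i w - f (z w)) ^+ 2))%:E)%E.
Proof.
move=> z mz LX.
pose m x := Ex P (fun w => X t i w * (x == z w)%:R) / Ex P (fun w => (x == z w)%:R).
have [LD le] : L2 P (fun w => X t i w - m (z w)) /\
    Ex P (fun w => (X t i w - m (z w)) ^+ 2) <= Ex P (fun w => (X t i w - f (z w)) ^+ 2).
  exact: (best_prediction mz f LX).
have XE w : Xhat P phi X Z [set: 'I_l]%SET t i w = m (z w).
  have CE : cell phi X Z [set: 'I_l]%SET w = [set w' | z w' = z w].
    apply/seteqP; split => w' /= h; first by apply/ffunP => j; rewrite !ffunE h ?inE.
    by move=> j _; have := congr1 (fun c : cells M => c j) h; rewrite !ffunE.
  rewrite /Xhat CE /m; congr (_ / _).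
    rewrite /Ex /Rintegral [in LHS]integral_mkcond; congr fine; apply: eq_integral => w' _.
    rewrite patchE; case: ifPn => [/set_mem/= ->|/negP h]; first by rewrite eqxx mulr1.
    by case: eqP => [e|_]; [case: h; rewrite inE/=|rewrite mulr0].
  rewrite -Ex_indic//; apply: eq_Ex => w'; rewrite indicE; congr ((nat_of_bool _)%:R).
  by apply/idP/eqP => [/set_mem/= ->//|e]; rewrite inE/=.
rewrite /mse; under eq_integral do rewrite XE.
by rewrite -EFin_Ex ?lee_fin//; exact: L2_sqr.
Qed.

Section Achievability.
Context {R : realType} {l : nat} {d : measure_display} {T : measurableType d}.
Variables (P : probability T R) (X Z : nat -> 'I_l -> T -> R) (gX rX gZ rZ dl q : R).
Hypotheses (l2 : (2 <= l)%N) (gX0 : 0 < gX) (q0 : 0 < q).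
Hypotheses (psdX : psd_eqcov l gX rX) (psdZ : psd_eqcov l gZ rZ).
Hypothesis src : gauss_source P X Z gX rX gZ rZ.
Hypothesis dE : distQ l gX rX gZ rZ q = dl.
Let PP : probability _ R := (P \x P)%E.
Local Notation pcoef := (@pred_coef R l gX rX gZ rZ q).
Local Notation pvar := (@pred_var R l gX rX gZ rZ q).
Local Notation ecoef := (@est_coef R l gX rX gZ rZ q).
Local Notation srcSn n := (@srcS R l d T X Z n).

Let l0 : (0 < l)%N. Proof. exact: leq_trans l2. Qed.
Let lR : 0 < l%:R :> R. Proof. by rewrite ltr0n. Qed.
Let gZ0 : 0 <= gZ. Proof. by have [] := psd_lam l2 psdZ. Qed.

Let nonneg : (forall i, 0 <= pvar i - q) /\ 0 <= dl.
Proof.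
have [G gG] := std_gvec psdX psdZ src ('I_1 * 'I_l)%type l0 gX0; split=> [i|].
  have [_ <-] := pred_mse l2 gX0 q0 psdX psdZ src gG ord0 i; apply: Ex_ge0 => w; exact: sqr_ge0.
have [_ <-] := est_mse l2 gX0 q0 psdX psdZ src dE gG ord0 (Ordinal l0); apply: Ex_ge0 => w; exact: sqr_ge0.
Qed.

(** A single [B] for every block length, time and encoder: all channel outputs have the same law. *)
Lemma quantizer_choice de : 0 < de -> exists B, forall n (G : T -> 'I_n * 'I_l -> R), gvec P G KI ->
  let U := Ut (quant B) (srcSn n) G q in forall (t : 'I_n) (i : 'I_l),
  [/\ Ex PP (fun w => (pcoef i * \sum_(j < l | (j < i)%N) qval (U w (t, j)) - srcS X Z w.1 (t, i)) ^+ 2) <=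
       pvar i - q + de,
     L2 PP (fun w => X t i w.1 - \sum_j ecoef i j * qval (U w (t, j))) &
     Ex PP (fun w => (X t i w.1 - \sum_j ecoef i j * qval (U w (t, j))) ^+ 2) <= dl + de].
Proof.
move=> de0; have [pv0 dl0] := nonneg.
have [e e0 he] := @sqr_perturb R (dl + \sum_i (pvar i - q)) de (addr_ge0 dl0 (sumr_ge0 _ (fun i _ => pv0 i))) de0.
(* Bounds the squared norm of every coefficient vector applied to the quantization errors; [1 +]
   keeps it positive. *)
pose cc := 1 + \sum_i (l%:R * pcoef i ^+ 2 + \sum_j ecoef i j ^+ 2).
have c2 i : 0 <= l%:R * pcoef i ^+ 2 by rewrite mulr_ge0 ?sqr_ge0.
have c3 i : 0 <= \sum_j ecoef i j ^+ 2 by apply: sumr_ge0 => j _; exact: sqr_ge0.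
have cb i : l%:R * pcoef i ^+ 2 + \sum_j ecoef i j ^+ 2 <= cc.
  rewrite /cc [X in _ <= 1 + X](bigD1 i)//= [leRHS]addrCA lerDl addr_ge0// sumr_ge0// => k _; exact: addr_ge0.
have cc0 : 0 < cc by rewrite ltr_wpDr// sumr_ge0// => k _; exact: addr_ge0.
have [G0 gG0] := std_gvec psdX psdZ src ('I_1 * 'I_l)%type l0 gX0.
have g0 : 0 <= gX + gZ + q by rewrite !addr_ge0// ltW.
have e2 : 0 < e / (l%:R * cc) by rewrite divr_gt0// mulr_gt0.
have [B hB] := quant_approx g0 (srcY_cg q0 psdX psdZ src gG0 (ord0, Ordinal l0)) e2.
exists B => n G gG U t i.
pose er j w := qval (U w (t, j)) - srcY X Z q G w (t, j).
have LY j : L2 PP (fun w => srcY X Z q G w (t, j)).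
  have cg := srcY_cg q0 psdX psdZ src gG (t, j); split; first exact: (cg_mble cg).
  by have [] := cg_moments cg g0.
have LU j : L2 PP (fun w => qval (U w (t, j))).
  apply: (@L2_bnd _ _ _ _ _ B.+1%:R) => [|w]; last exact: qval_bound.
  exact: (mble_quant (F := fun u _ => qval u) (L2_mble (LY j))).
have Ler j : L2 PP (er j) by exact: L2B.
have Eer j : Ex PP (fun w => er j w ^+ 2) <= e / (l%:R * cc) := hB _ _ _ _ (srcY_cg q0 psdX psdZ src gG (t, j)).
have Lx (x : 'I_l -> R) : L2 PP (fun w => \sum_j x j * er j w) by apply: L2_sum => j _; exact: L2Z.
have Ix (x : 'I_l -> R) j : ig PP (fun w => (x j * er j w) ^+ 2) by apply: L2_sqr; exact: L2Z.
have Ecomb (x : 'I_l -> R) : \sum_j x j ^+ 2 <= cc -> Ex PP (fun w => (\sum_j x j * er j w) ^+ 2) <= e.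
  move=> xc; apply: le_trans (_ : Ex PP (fun w => l%:R * \sum_j (x j * er j w) ^+ 2) <= _).
    apply: Ex_le => [||w]; first exact: L2_sqr.
      by apply: igZ; apply: ig_sum.
    by have := sqr_sum_le (fun j => x j * er j w); rewrite card_ord.
  rewrite ExZ; last exact: ig_sum.
  rewrite Ex_sum//; apply: le_trans (_ : l%:R * \sum_j x j ^+ 2 * (e / (l%:R * cc)) <= _).
    rewrite ler_wpM2l//; apply: ler_sum => j _; under eq_Ex do rewrite exprMn.
    by rewrite ExZ ?ler_wpM2l ?sqr_ge0//; exact: L2_sqr.
  rewrite -mulr_suml mulrCA.
  have -> : l%:R * (e / (l%:R * cc)) = e / cc by field; rewrite !gt_eqF.
  by rewrite mulrA ler_pdivrMr// mulrC ler_wpM2l// ltW.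
have [L1 E1] := pred_mse l2 gX0 q0 psdX psdZ src gG t i.
have [L3 E3] := est_mse l2 gX0 q0 psdX psdZ src dE gG t i.
pose x1 (j : 'I_l) := if (j < i)%N then pcoef i else 0.
have D1 w : pcoef i * \sum_(j < l | (j < i)%N) qval (U w (t, j)) - srcS X Z w.1 (t, i) =
    (pcoef i * \sum_(j < l | (j < i)%N) srcY X Z q G w (t, j) - srcS X Z w.1 (t, i)) + \sum_j x1 j * er j w.
  rewrite addrAC; congr (_ - _); rewrite !mulr_sumr ![\sum_(j < l | (j < i)%N) _]big_mkcond/= -big_split/=.
  by apply: eq_bigr => j _; rewrite /x1 /er; case: ifP => _; ring.
have D3 w : X t i w.1 - \sum_j ecoef i j * qval (U w (t, j)) =
    (X t i w.1 - \sum_j ecoef i j * srcY X Z q G w (t, j)) + \sum_j - ecoef i j * er j w.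
  rewrite -addrA; congr (_ + _); rewrite -!sumrN -big_split/=; apply: eq_bigr => j _; rewrite /er; ring.
split.
- under eq_Ex do rewrite D1.
  rewrite -E1; apply: (he _ _ _ _ _ L1 (Lx x1)).
    by rewrite E1 (bigD1 i)//= addrCA lerDl addr_ge0// sumr_ge0.
  apply: Ecomb; apply: le_trans (cb i); apply: le_trans (_ : l%:R * pcoef i ^+ 2 <= _); last by rewrite lerDl.
  rewrite mulr_natl -[X in _ *+ X](card_ord l) -sumr_const; apply: ler_sum => j _; rewrite /x1.
  by case: ifP => _//; rewrite expr0n sqr_ge0.
- by apply: (eq_L2 _ (L2D L3 (Lx (fun j => - ecoef i j)))) => w; rewrite D3.
under eq_Ex do rewrite D3.
rewrite -E3; apply: (he _ _ _ _ _ L3 (Lx (fun j => - ecoef i j))).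
  by rewrite E3 lerDl sumr_ge0.
apply: Ecomb; apply: le_trans (cb i); under eq_bigr do rewrite sqrrN.
by rewrite lerDr.
Qed.

Section Code.
Variables (n B K : nat) (G : T -> 'I_n * 'I_l -> R) (g : T -> R) (ga et de : R).
Hypotheses (n0 : (0 < n)%N) (gG : gvec P G KI) (gg : gvec P (fun w (_ : unit) => g w) KI).
Hypotheses (ga0 : 0 < ga) (de_ga : de <= q * ga).
Let U := Ut (quant B) (srcSn n) G q.
Hypothesis quB : forall (t : 'I_n) (i : 'I_l),
  [/\ Ex PP (fun w => (pcoef i * \sum_(j < l | (j < i)%N) qval (U w (t, j)) - srcS X Z w.1 (t, i)) ^+ 2) <=
       pvar i - q + de,
     L2 PP (fun w => X t i w.1 - \sum_j ecoef i j * qval (U w (t, j))) &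
     Ex PP (fun w => (X t i w.1 - \sum_j ecoef i j * qval (U w (t, j))) ^+ 2) <= dl + de].
Hypothesis tailK : forall (t : 'I_n) i, Ex P (fun w => X t i w ^+ 2 * ((K%:R < X t i w ^+ 2)%R)%:R) <= et.

Local Notation FU := {ffun 'I_(2 * B.+1 * B.+1).+1 -> bool}.
Local Notation Un := {ffun 'I_n -> FU}.
(** Solves [eta / (1 - eta) = ga / 6]. The two mixture terms cost at most [ga / 3], the quantization
    at most [ga / 2], so the mean of [llr] stays within the margin [ga] of [block_rate]. *)
Definition mix_weight : R := ga / (ga + 6).
Definition block_rate (i : 'I_l) : R := ln (pvar i / q) / 2 + ga.
Definition est_bound : R := \sum_i \sum_j `|ecoef i j| * B.+1%:R.
Definition bk (s : 'I_n -> R) (b : Un) : R := bkern P g (quant B) q s b.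
Definition bm (i : 'I_l) (u : {ffun 'I_l -> Un}) (b : Un) : R :=
  bmix P g (quant B) (@qval R B) mix_weight pcoef pvar i u b.
Definition block_dist (w : T) (u : {ffun 'I_l -> Un}) : R :=
  \sum_i \sum_(t < n) (X t i w - \sum_j ecoef i j * qval (u j t)) ^+ 2.

Let eta01 : 0 < mix_weight < 1.
Proof. by rewrite /mix_weight divr_gt0 ?addr_gt0//= ltr_pdivrMr ?addr_gt0// mul1r ltrDl. Qed.

Let v0 i : 0 < pvar i. Proof. exact: pred_var_gt0 l2 gX0 q0 psdX psdZ i. Qed.
Let mqt := @measurable_quant R B.

Lemma block_llr_mean t i :
  Ex PP (fun w => llr P g (quant B) (srcSn n) G (@qval R B) q mix_weight pcoef pvar w t i) <= block_rate i.
Proof.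
have [KS gS _] := srcS_gvec psdX psdZ src n.
have [h _ _] := quB t i.
apply: le_trans (llr_mean gg mqt gS gG q0 eta01 v0 h) _.
rewrite /block_rate -addrA lerD2l.
have vq : q <= pvar i by rewrite -subr_ge0; exact: nonneg.1.
have h1 : de / (2 * pvar i) <= ga / 2.
  have vi := v0 i; rewrite ler_pdivrMr; last by rewrite mulr_gt0.
  apply: (le_trans de_ga).
  have -> : ga / 2 * (2 * pvar i) = pvar i * ga by field.
  by rewrite ler_pM2r.
have e1 : mix_weight / (1 - mix_weight) = ga / 6.
  by rewrite /mix_weight; field; rewrite gt_eqF ?addr_gt0//= addrAC subrr add0r.
have e2 : mix_weight <= ga / 6.
  by rewrite ler_pM2l// lef_pV2 ?posrE ?addr_gt0// lerDr ltW.
have h2 := lerD h1 (lerD (lexx (ga / 6)) e2); rewrite e1; apply: (le_trans h2).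
rewrite -subr_ge0 (_ : ga - _ = ga / 6); first by rewrite divr_ge0// ltW.
by field.
Qed.

Lemma est_bounded i (u : 'I_l -> FU) : `|\sum_j ecoef i j * qval (u j)| <= est_bound.
Proof.
apply: (le_trans (ler_norm_sum _ _ _)); rewrite /est_bound [leRHS](bigD1 i)//=.
apply: le_trans (_ : \sum_j `|ecoef i j| * B.+1%:R <= _).
  by apply: ler_sum => j _; rewrite normrM ler_wpM2l// qval_bound.
rewrite lerDl; apply: sumr_ge0 => k _; apply: sumr_ge0 => j _; exact: mulr_ge0.
Qed.

Variables (M : 'I_l -> nat).
Hypothesis M0 : forall i, (0 < M i)%N.
Hypothesis Mr : forall i, expR (n%:R * (block_rate i + 2 * ga)) <= (M i)%:R.

(** The typical part gives [dl + de]. Coding errors are rare but weighted by an unbounded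
    distortion: below the truncation level [K] their probability counts, above it their number is
    bounded and the tail [et] counts. *)
Lemma code_exists e : 0 < e -> exists dec (ee : forall i, Un * 'I_(M i) -> R),
  Ex P (fun w => block_dist w (dec (finfun (fun i => race_encode M0 (bk (fun t => srcS X Z w (t, i))) (ee i))))) <=
  (n * l)%:R * (dl + de + 2 * (K%:R + est_bound ^+ 2) *
      (l%:R * (lvar FU mix_weight / (n%:R * ga ^+ 2) + expR (- (n%:R * ga)))) + 4 * l%:R * et) + e.
Proof.
move=> e0; have [KS gS [KS0 _]] := srcS_gvec psdX psdZ src n.
(* The threshold lies between the typical ratio [exp (n * block_rate i)] and the number of messages,
   with a factor [exp (n * ga)] to spare on each side. *)
pose tau i := expR (n%:R * (block_rate i + ga)).
pose fm (w : T) : R := \sum_(i < l) \sum_(t < n) (2 * X t i w ^+ 2 + 2 * est_bound ^+ 2).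
have LX (t : 'I_n) i : L2 P (fun w => X t i w).
  have cg := source_cg psdX psdZ src t i; split; first exact: (cg_mble cg).
  by have [] := cg_moments cg (ltW gX0).
have eb0 : 0 <= est_bound.
  by apply: sumr_ge0 => k _; apply: sumr_ge0 => j _; exact: mulr_ge0.
have f0 w u : 0 <= block_dist w u <= fm w.
  apply/andP; split; first by apply: sumr_ge0 => i _; apply: sumr_ge0 => t _; exact: sqr_ge0.
  apply: ler_sum => i _; apply: ler_sum => t _.
  have := est_bounded i (fun j => u j t); set y := \sum_j _ => yb.
  have y2 : y ^+ 2 <= est_bound ^+ 2 by rewrite -(real_normK (num_real y)) ler_pXn2r ?nnegrE.
  by have := sqr_ge0 (X t i w + y); nra.
have mf u : mble (fun w => block_dist w u).
  apply: measurable_sum => i; apply: measurable_sum => t; apply: measurable_funX.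
  by apply: measurable_funB => //; exact: L2_mble (LX t i).
have Ifm : ig P fm.
  apply: ig_sum => i _; apply: ig_sum => t _; apply: igD; last exact: ig_cst.
  by apply: igZ; exact: L2_sqr.
have mS (i : 'I_l) b : mble (fun w => bk (fun t => srcS X Z w (t, i)) b).
  by apply: (mble_bkern gg mqt) => t; exact: L2_mble (gvec_L2 gS (t, i)).
pose kap w (i : 'I_l) := bk (fun t => srcS X Z w (t, i)).
have k0 w i b : 0 <= kap w i b by exact: (bkern_ge0 gg mqt).
have k1 w i : \sum_b kap w i b = 1 by exact: (bkern_sum gg mqt).
have b0 i u b : 0 < bm i u b by exact: (bmix_gt0 gg mqt).
have b1 i u : \sum_b bm i u b = 1 by exact: (bmix_sum gg mqt).
have bc : causal bm by exact: bmix_causal.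
have t0 i : 0 <= tau i by exact: expR_ge0.
have rcod := @random_coding R d T P l Un M [ffun=> quant B (0 : R)] M0 kap bm mS k0 k1 b0 b1 bc.
have [ee hee] := rcod block_dist fm tau mf f0 Ifm t0 e e0.
exists (race_decode [ffun=> quant B (0 : R)] bm ee), ee; apply: (le_trans hee); rewrite lerD2r.
pose ind (w : T * T) i : R := ((tau i * bm i (Ub (quant B) (srcSn n) G q w) (Ub (quant B) (srcSn n) G q w i) <
    kap w.1 i (Ub (quant B) (srcSn n) G q w i))%R)%:R.
set Ubl := Ub (quant B) (srcSn n) G q in ind.
pose ce (w : T * T) : R := \sum_i (ind w i + tau i / (M i)%:R).
have tM i : tau i / (M i)%:R <= expR (- (n%:R * ga)).
  rewrite ler_pdivrMr ?ltr0n//; apply: le_trans (ler_wpM2l (expR_ge0 _) (Mr i)).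
  by rewrite -expRD /tau le_eqVlt; apply/orP; left; apply/eqP; congr expR; ring.
have ng0 : 0 <= n%:R * ga by rewrite mulr_ge0// ltW.
have tM1 i : 0 <= tau i / (M i)%:R <= 1.
  by rewrite divr_ge0//=; apply: (le_trans (tM i)); rewrite expR_le1 oppr_le0.
have ind01 w i : 0 <= ind w i <= 1 by exact: bool01.
have ce0 w : 0 <= ce w <= 2 * l%:R.
  apply/andP; split.
    apply: sumr_ge0 => i _; case/andP: (ind01 w i) => h1 _; case/andP: (tM1 i) => h2 _; exact: addr_ge0.
  rewrite mulr_natr -[X in _ *+ X](card_ord l) -sumr_const; apply: ler_sum => i _.
  by case/andP: (ind01 w i) => _ h1; case/andP: (tM1 i) => _ h2; exact: lerD.
pose F (w : T * T) := block_dist w.1 (Ubl w) + ce w * fm w.1.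
(* For a fixed source outcome the products of kernels are the law of the quantized channel outputs,
   realized by the noise on the second factor. *)
have step1 : Ex P (fun w => \sum_(u : {ffun 'I_l -> Un}) (\prod_i kap w i (u i)) *
      (block_dist w u + coding_error M kap bm tau w u * fm w)) =
    Ex P (fun w => Ex P (fun w2 => F (w, w2))).
  apply: eq_Ex => w.
  by rewrite -(block_law gg mqt (srcSn n) gG q w (fun u => block_dist w u + coding_error M kap bm tau w u * fm w)).
rewrite {}step1.
have mUb := measurable_Ub mqt gS gG q.
have mfst (h : T -> R) : mble h -> mble (fun w : T * T => h w.1) by move=> mh; exact: (measurableT_comp mh measurable_fst).
have mind i : mble (fun w => ind w i).
  apply: (mble_case mUb (g := fun u w => ((tau i * bm i u (u i) < kap w.1 i (u i))%R)%:R)) => u.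
  by apply: mble_lt; [exact: measurable_cst|exact: (mfst (fun w => kap w i (u i)) (mS i (u i)))].
have mce : mble ce by apply: measurable_sum => i; apply: measurable_funD.
have ceb w : `|ce w| <= 2 * l%:R by case/andP: (ce0 w) => h1 h2; rewrite ger0_norm.
have IX2 (t : 'I_n) i : ig P (fun w => X t i w ^+ 2) := L2_sqr (LX t i).
pose dis (t : 'I_n) i (w : T * T) := X t i w.1 - \sum_j ecoef i j * qval (U w (t, j)).
have Ldis t i : L2 PP (dis t i) by case: (quB t i).
have disE w : block_dist w.1 (Ubl w) = \sum_i \sum_(t < n) dis t i w ^+ 2.
  apply: eq_bigr => i _; apply: eq_bigr => t _; rewrite /dis; congr ((_ - _) ^+ 2).
  by apply: eq_bigr => j _; rewrite !ffunE.
have Ice : ig PP (fun w => ce w * fm w.1) by apply: (ig_bndM mce ceb); exact: ig_fst.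
have Idis : ig PP (fun w => block_dist w.1 (Ubl w)).
  apply: (eq_ig (fun w => esym (disE w))).
  by apply: ig_sum => i _; apply: ig_sum => t _; exact: L2_sqr.
have IF : ig PP F by exact: igD.
have IF1 w : ig P (fun w2 => F (w, w2)).
  pose h u := block_dist w u + coding_error M kap bm tau w u * fm w.
  apply: (L2_ig (f := fun w2 => h (Ubl (w, w2)))); apply: (@L2_fin _ _ _ _ P (fun w2 => Ubl (w, w2)) _ h) => u.
  by rewrite -[X in measurable X]setTI; exact: (pair1_measurable w measurableT (mUb u)).
rewrite -(Ex_fubini IF IF1) ExD//.
pose tl (t : 'I_n) i (w : T) := X t i w ^+ 2 * ((K%:R < X t i w ^+ 2)%R)%:R.
have Itl t i : ig P (tl t i).
  apply: (ig_le _ _ (IX2 t i)); last first.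
    move=> w; rewrite /tl; have y0 := sqr_ge0 (X t i w).
    by case: (_ < _); rewrite ?mulr1 ?mulr0 ?normr0// ger0_norm.
  have mX2 := ig_mble (IX2 t i); apply: measurable_funM => //; exact: mble_lt.
have nl (x : R) : \sum_(i < l) \sum_(t < n) x = (n * l)%:R * x.
  by rewrite !sumr_const !card_ord -mulrnA mulr_natl.
pose pn : R := l%:R * (lvar FU mix_weight / (n%:R * ga ^+ 2) + expR (- (n%:R * ga))).
have Iind i : ig PP (fun w => ind w i) by apply: ig01.
have Ece : Ex PP ce <= pn.
  have Ii i : ig PP (fun w => ind w i + tau i / (M i)%:R) by apply: igD => //; exact: ig_cst.
  rewrite Ex_sum// /pn mulr_natl -[X in _ *+ X](card_ord l) -sumr_const; apply: ler_sum => i _.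
  rewrite ExD//; last exact: ig_cst.
  rewrite Ex_cst; apply: lerD; last exact: tM.
  exact: (atypical gg mqt gS gG KS0 eta01 n0 ga0 (fun t => block_llr_mean t i)).
have Ice1 : ig PP ce by apply: (@ig_bnd _ _ _ _ _ (2 * l%:R)).
have h1 : Ex PP (fun w => block_dist w.1 (Ubl w)) <= (n * l)%:R * (dl + de).
  under eq_Ex do rewrite disE.
  rewrite -nl Ex_sum => [|i _]; last by apply: ig_sum => t _; exact: L2_sqr.
  apply: ler_sum => i _; rewrite Ex_sum => [|t _]; last exact: L2_sqr.
  by apply: ler_sum => t _; case: (quB t i).
have h2 : Ex PP (fun w => ce w * fm w.1) <= (n * l)%:R * (2 * (K%:R + est_bound ^+ 2) * pn + 4 * l%:R * et).
  have It t i : ig PP (fun w => 2 * (K%:R + est_bound ^+ 2) * ce w + 4 * l%:R * tl t i w.1).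
    by apply: igD; apply: igZ => //; exact: ig_fst.
  apply: le_trans (_ : Ex PP (fun w => \sum_(i < l) \sum_(t < n)
      (2 * (K%:R + est_bound ^+ 2) * ce w + 4 * l%:R * tl t i w.1)) <= _).
    apply: Ex_le => [//||w]; first by apply: ig_sum => i _; exact: ig_sum.
    rewrite /fm mulr_sumr; apply: ler_sum => i _; rewrite mulr_sumr; apply: ler_sum => t _.
    case/andP: (ce0 w) => c0 c1.
    (* After multiplication by the error count [ce], the constant [K] meets the mean of [ce] and the
       tail meets its bound [2 * l]. *)
    have xt : X t i w.1 ^+ 2 <= K%:R + tl t i w.1.
      by rewrite /tl; case: ltP => h; rewrite ?mulr1 ?mulr0 ?addr0// lerDr.
    have t0' : 0 <= tl t i w.1 by rewrite mulr_ge0 ?sqr_ge0.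
    have a1 := ler_wpM2l c0 xt; have a2 := ler_wpM2r t0' c1.
    rewrite mulrDr in a1; rewrite mulrDr !mulrDr !mulrDl.
    move: a1 a2; set x := ce w; set y := X t i w.1 ^+ 2; set z := tl t i w.1; set k := K%:R; set b := est_bound ^+ 2.
    set L := l%:R; lra.
  rewrite -nl Ex_sum => [|i _]; last by apply: ig_sum => t _.
  apply: ler_sum => i _; rewrite Ex_sum//; apply: ler_sum => t _.
  rewrite ExD; [|exact: igZ|by apply: igZ; exact: ig_fst].
  rewrite !ExZ//; last exact: ig_fst.
  rewrite (Ex_fst P (Itl t i)); apply: lerD.
    by rewrite ler_wpM2l// mulr_ge0// addr_ge0// sqr_ge0.
  by apply: ler_wpM2l; [exact: mulr_ge0|exact: tailK].
apply: le_trans (lerD h1 h2) _; by rewrite -mulrDr -[in leRHS]addrA.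
Qed.

End Code.

Lemma achievability : achievable P X Z l (rbar l gX rX gZ rZ q) (fun=> dl).
Proof.
move=> eps eps0; have [pv0 dl0] := nonneg.
(* Rate budget: [ga] in [block_rate] and [2 * ga] in the number of messages make [eps / 2]; rounding
   that number up costs [ln 2 / n], at most [eps / 2]. *)
have eps0' := ltW eps0; pose ga := eps / 6; have ga0 : 0 < ga by rewrite divr_gt0.
pose de := Num.min (q * ga) (eps / 4).
have de0 : 0 < de by rewrite lt_min mulr_gt0//= divr_gt0.
have de_ga : de <= q * ga by rewrite ge_min lexx.
have de_eps : de <= eps / 4 by rewrite ge_min lexx orbT.
have [B hB] := quantizer_choice de0.
(* Distortion budget, four quarters of [eps]: quantization, tail ([4 * l * et]), coding errors, and
   the choice of the clocks. *)
pose et := eps / (16 * l%:R); have et0 : 0 < et by rewrite divr_gt0// mulr_gt0.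
have [K hK] := gauss_tail (ltW gX0) (source_cg psdX psdZ src (ord0 : 'I_1) (Ordinal l0)) et0.
pose FU := {ffun 'I_(2 * B.+1 * B.+1).+1 -> bool}.
(* By [exp (- x) <= 1 / x], both the Chebyshev and the exponential terms are of order [1 / n]; the
   coding errors cost at most [c0 / n]. The constant involves [B], [K] and [ga] only, so [n] can be
   taken large after them. *)
pose c0 : R := 2 * (K%:R + est_bound B ^+ 2) * (l%:R * (`|lvar FU (mix_weight ga)| / ga ^+ 2 + ga^-1)).
pose c1 : R := 2 * ln 2 / eps + 4 * c0 / eps.
pose n := (Num.truncn c1).+1.
have nR : 0 < n%:R :> R by rewrite ltr0n.
have kb0 : 0 <= 2 * (K%:R + est_bound B ^+ 2) by rewrite mulr_ge0// addr_ge0// sqr_ge0.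
have c00 : 0 <= c0.
  by rewrite mulr_ge0// mulr_ge0// addr_ge0 ?divr_ge0 ?invr_ge0 ?sqr_ge0// ltW.
have ln2 : 0 <= ln 2 :> R by rewrite ln_ge0// ler1n.
have nc : c1 <= n%:R by rewrite ltW// truncnS_gt.
have n1 : ln 2 / n%:R <= eps / 2.
  rewrite ler_pdivrMr// -ler_pdivrMl ?divr_gt0//; apply: le_trans nc.
  have -> : (eps / 2)^-1 * ln 2 = 2 * ln 2 / eps by field; rewrite gt_eqF.
  by rewrite lerDl; apply: divr_ge0 => //; apply: mulr_ge0.
have n2 : c0 / n%:R <= eps / 4.
  rewrite ler_pdivrMr// -ler_pdivrMl ?divr_gt0//; apply: le_trans nc.
  have -> : (eps / 4)^-1 * c0 = 4 * c0 / eps by field; rewrite gt_eqF.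
  by rewrite lerDr; apply: divr_ge0 => //; apply: mulr_ge0.
have [G gG] := std_gvec psdX psdZ src ('I_n * 'I_l)%type l0 gX0.
have [g' gg'] := std_gvec psdX psdZ src unit l0 gX0.
pose g w := g' w tt.
have gg : gvec P (fun w (_ : unit) => g w) KI.
  by move: gg'; congr (gvec _ _ _); apply/funext => w; apply/funext => -[].
have quB := hB n G gG.
have tailK (t : 'I_n) i : Ex P (fun w => X t i w ^+ 2 * ((K%:R < X t i w ^+ 2)%R)%:R) <= et.
  exact: (hK _ _ _ _ (source_cg psdX psdZ src t i)).
pose xr i := n%:R * (block_rate ga i + 2 * ga).
have br0 i : 0 <= block_rate ga i.
  have vq : q <= pvar i by rewrite -subr_ge0.
  rewrite /block_rate addr_ge0 ?(ltW ga0)// divr_ge0// ln_ge0// ler_pdivlMr// mul1r//.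
have xr0 i : 0 <= xr i by rewrite mulr_ge0// addr_ge0// mulr_ge0// ltW.
pose M i := (Num.truncn (expR (xr i))).+1.
have M0 i : (0 < M i)%N by [].
have Mr i : expR (xr i) <= (M i)%:R by rewrite ltW// truncnS_gt.
have lnM i : ln ((M i)%:R) <= xr i + ln 2.
  have Mle : (M i)%:R <= expR (xr i) * 2.
    rewrite /M -natr1 mulr_natr mulr2n; apply: lerD; first by rewrite truncn_le// expR_ge0.
    by rewrite -expR0 ler_expR.
  rewrite -[X in X + _]expRK -lnM ?posrE ?expR_gt0//.
  by rewrite ler_ln ?posrE ?mulr_gt0 ?expR_gt0// ltr0n.
have nle0 : 0 < (n * l)%:R * (eps / 4) by rewrite mulr_gt0 ?divr_gt0// ltr0n muln_gt0.
have [dec [ee hee]] := code_exists (isT : (0 < n)%N) gG gg ga0 de_ga quB tailK M0 Mr nle0.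
pose phi i (s : 'I_n -> R) := race_encode M0 (@bk n B g s) (ee i).
exists n, M, phi; split => //.
- move=> i c; have mc (b : {ffun 'I_n -> FU}) : mble (fun s : vec R 'I_n => @bk n B g s b).
    by apply: (mble_bkern gg (@measurable_quant R B)) => t; exact: measurable_coord.
  exact: (measurable_race_encode M0 (ee i) c mc).
- move=> A cA; have -> : A = [set: 'I_l]%SET.
    by apply/eqP; rewrite eqEcard finset.subsetT cardsT card_ord cA/=.
  apply: le_trans (_ : ((l * n)%:R)^-1 * \sum_(i < l) (xr i + ln 2) <= _).
    rewrite ler_wpM2l ?invr_ge0//; under eq_bigl do rewrite inE.
    by apply: ler_sum => i _.
  have -> : \sum_(i < l) (xr i + ln 2) = n%:R * (l%:R * rbar l gX rX gZ rZ q + l%:R * (3 * ga)) + l%:R * ln 2.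
    rewrite big_split/= -(sum_ln_pred_var l2 gX0 q0 psdX psdZ) /xr -mulr_sumr /block_rate !big_split/=.
    by rewrite !sumr_const !card_ord -[ga *+ l]mulr_natl -[(2 * ga) *+ l]mulr_natl -[ln 2 *+ l]mulr_natl; ring.
  have -> : ((l * n)%:R)^-1 * (n%:R * (l%:R * rbar l gX rX gZ rZ q + l%:R * (3 * ga)) + l%:R * ln 2) =
      rbar l gX rX gZ rZ q + eps / 2 + ln 2 / n%:R.
    by rewrite /ga natrM; field; rewrite !gt_eqF.
  by rewrite -addrA lerD2l; lra.
move=> A cA; have -> : A = [set: 'I_l]%SET.
  by apply/eqP; rewrite eqEcard finset.subsetT cardsT card_ord cA.
pose z w : cells M := finfun (fun i => phi i (Sblock X Z i w)).
have mz c : measurable [set w | z w = c].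
  apply: measurable_finfun => i x; apply: measurable_race_encode => b.
  apply: (mble_bkern gg (@measurable_quant R B)) => t.
  by have [KS gS _] := srcS_gvec psdX psdZ src n; exact: L2_mble (gvec_L2 gS (t, i)).
have LX (t : 'I_n) i : L2 P (X t i).
  have cg := source_cg psdX psdZ src t i; split; first exact: (cg_mble cg).
  by have [] := cg_moments cg (ltW gX0).
pose f (t : 'I_n) (i : 'I_l) c := \sum_j @est_coef R l gX rX gZ rZ q i j * qval (dec c j t).
have mb t i := mse_best (f t i) mz (LX t i).
have cnt : #|[set: 'I_l]%SET| = l by rewrite cardsT card_ord.
rewrite cnt.
apply: le_trans (_ : (((l * n)%:R^-1)%:E * (\sum_(i < l) \sum_(t < n)
    Ex P (fun w => (X t i w - f t i (z w)) ^+ 2))%:E <= _)%E).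
  apply: lee_wpmul2l; first by rewrite lee_fin invr_ge0.
  rewrite [X in (X <= _)%E](_ : _ = \sum_(i < l) \sum_(t < n) mse P phi X Z [set: 'I_l]%SET t i)%E; last first.
    by apply: eq_bigl => i; rewrite inE.
  rewrite -sumEFin; apply: lee_sum => i _; rewrite -sumEFin; apply: lee_sum => t _; exact: mb.
rewrite -EFinM lee_fin mulrC ler_pdivrMr; last by rewrite ltr0n muln_gt0 l0.
have Lf (t : 'I_n) (i : 'I_l) : L2 P (fun w => X t i w - f t i (z w)).
  by apply: L2B => //; exact: (L2_fin P mz (f t i)).
have -> : \sum_(i < l) \sum_(t < n) Ex P (fun w => (X t i w - f t i (z w)) ^+ 2) =
    Ex P (fun w => block_dist w (dec (z w))).
  rewrite Ex_sum => [|i _]; last by apply: ig_sum => t _; exact: L2_sqr.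
  by apply: eq_bigr => i _; rewrite Ex_sum// => t _; exact: L2_sqr.
apply: (le_trans hee).
set D := _ + 4 * l%:R * et.
suff : D <= dl + eps / 4 + eps / 4 + eps / 4.
  move=> hD; have := ler_wpM2l (ler0n R (n * l)) hD; rewrite mulnC [in leRHS]mulrC !mulrDr.
  by move=> h; lra.
have e4 : 4 * l%:R * et = eps / 4 by rewrite /et; field; rewrite gt_eqF.
rewrite /D e4 lerD2r; apply: lerD; first by rewrite lerD2l.
apply: le_trans n2; rewrite /c0 -[leRHS]mulrA; apply: ler_wpM2l => //.
rewrite -[leRHS]mulrA; apply: ler_wpM2l; first exact: ltW.
rewrite [leRHS]mulrDl; apply: lerD.
  rewrite [n%:R * _]mulrC invfM mulrA; apply: ler_wpM2r; first by rewrite invr_ge0.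
  by apply: ler_wpM2r; [rewrite invr_ge0 sqr_ge0|exact: ler_norm].
rewrite -invfM expRN lef_pV2 ?posrE ?expR_gt0 ?mulr_gt0//.
by rewrite mulrC; apply: le_trans (expR_ge1Dx _); rewrite lerDr.
Qed.

End Achievability.

Theorem theorem1 (R : realType) (l : nat) (gX rX gZ rZ : R)
  (d : measure_display) (T : measurableType d) (P : probability T R)
  (X Z : nat -> 'I_l -> T -> R) (dl q : R) :
  (2 <= l)%N ->
  psd_eqcov l gX rX -> psd_eqcov l gZ rZ ->
  psd_eqcov l (gammaS gX gZ) (rhoS gX rX gZ rZ) ->
  0 < gX ->
  gauss_source P X Z gX rX gZ rZ ->
  dmin l gX rX gZ rZ < dl -> dl < gX ->
  0 < q -> distQ l gX rX gZ rZ q = dl ->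
  (let gS := gammaS gX gZ in let rS := rhoS gX rX gZ rZ in
   let lX1 := lam1 l gX rX in let lX2 := lam2 gX rX in
   let lS1 := lam1 l gS rS in let lS2 := lam2 gS rS in
   let mu := (lS2 - lS2 * (lS2 + q)^-1 * lS2) / (lS1 - lS1 * (lS1 + q)^-1 * lS1) in
   let nu := (lS1 - lS1 * (lS1 + q)^-1 * lS1) / (lS2 - lS2 * (lS2 + q)^-1 * lS2) in
   (0 <= rS /\
      0 <= (l.-1)%:R * lX2 ^+ 2 * lS1 ^+ 2 * mu * (mu - 1) + l%:R * lX1 ^+ 2 * lS2 ^+ 2)
   \/
   (rS <= 0 /\
      0 <= lX1 ^+ 2 * lS2 ^+ 2 * nu * (nu - 1) + l%:R * lX2 ^+ 2 * lS1 ^+ 2)) ->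
  (* r^{(l)}(d_l) = rbar^{(l)}(d_l): rbar is the minimum of {r : (r, d_l) in RD_l} *)
  achievable P X Z l (rbar l gX rX gZ rZ q) (fun _ => dl) /\
  (forall r : R, achievable P X Z l r (fun _ => dl) -> rbar l gX rX gZ rZ q <= r).
Proof.
move=> l2 psdX psdZ _ gX0 src _ _ q0 dE cond; split.
  exact: (achievability l2 gX0 q0 psdX psdZ src dE).
exact: (converse l2 gX0 psdX psdZ src q0 dE cond).
Qed.
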